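(* Let $X$ be a normal projective variety of dimension $n$ over an algebraically closed field $\Bbbk$ of characteristic zero, and let $L$ be a very ample and projectively normal line bundle on $X$. Let $\Delta_\infty(\mathbb{Q})$ be the space of test configurations of $(X,L)$, endowed with the simplicial topology, and let $\mathcal{T}\subset\Delta_\infty(\mathbb{Q})$ be the subset of non almost trivial test configurations, with the induced topology. Then the normalized Donaldson–Futaki invariant $\mathrm{df}\colon\mathcal{T}\to\mathbb{R}$ is continuous.
   Context: Line bundles are written additively. Put $R_r=H^0(X,rL)$ for $r\ge1$. **Weighted flags and Tits buildings.** Let $V$ be a finite-dimensional $\Bbbk$-vector space of dimension $\ge 3$. A weighted flag on $V$ is a flag $0\subsetneq F_1\subsetneq\cdots\subsetneq F_l=V$, $l\ge2$, with real weights $w_1<\dots<w_l$ such that $\sum_i w_i\dim(F_i/F_{i-1})=0$ (where $F_0=0$). Two weighted flags are equivalent if the flags coincide and the weights differ by a common factor $c>0$. The Tits building $\Delta(V)$ is the set of equivalence classes, and $\Delta(V)(\mathbb{Q})$ is the set of classes having a representative with rational weights. Any exhaustive bounded increasing filtration of $V$ with at least two jumps gives a point of $\Delta(V)$ after subtracting a common constant from all weights. A basis of $V$ is adapted to a flag if each step of the flag is spanned by a subset of the basis. The apartment of a basis $\underline v=(v_1,\dots,v_m)$ is the set of classes of weighted flags to which $\underline v$ is adapted. Recording the weight of each $v_j$ (the least $w_i$ with $v_j\in F_i$) identifies it with the sphere $\{x\in\mathbb{R}^m\setminus\{0\}:\sum x_j=0\}/\mathbb{R}_{>0}$. Simplicial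 topology on $\Delta(V)$: $U$ is open iff its intersection with every apartment is open in that sphere. $\Delta(V)(\mathbb{Q})$ has the subspace topology. **The direct system.** Let $\Delta_r$ be the Tits building of $R_r$ (canonically the same as that of $R_r^\vee$ by duality). A point of $\Delta_r(\mathbb{Q})$, represented after rescaling and shifting the weights by a filtration $F_iR_r$ indexed by integers $i$, defines an exponent $r$ test configuration $(\mathcal{X},\mathcal{L})$: let $\chi\subset\bigoplus_k R_{rk}[t,t^{-1}]$ be the $\Bbbk[t]$-subalgebra generated by $\bigoplus_i F_iR_r\,t^i$, graded by $k$; then $\mathcal{X}=\mathrm{Proj}_{\Bbbk[t]}\chi\to\mathbb{A}^1$, $\mathcal{L}=\mathcal{O}(1)$, with $\mathbb{G}_m$-linearisation for which $s\,t^i$ has weight $-i$. Its fibre over $1$ is $(X,rL)$. Equivalently, $(\mathcal{X},\mathcal{L})$ is the flat closure of the orbit of $X\subset\mathbb{P}(R_r^\vee)$ under a one parameter subgroup inducing the flag. Points of $\Delta_r(\mathbb{Q})$ thus correspond to very ample exponent $r$ test configurations modulo base change $z\mapsto z^p$ on $\mathbb{A}^1$ and twisting the linearisation of $\mathcal{L}$ by a character. The map $\iota_{r,k}\colon\Delta_r(\mathbb{Q})\to\Delta_{rk}(\mathbb{Q})$ sends $(\mathcal{X},\mathcal{L})$ to $(\mathcal{X},k\mathcal{L})$. Concretely, it sends a weighted flag on $R_r$ to the weighted flag on $R_{rk}$ given by the image, under the surjection $\mathrm{Sym}^kR_r\to R_{rk}$, of the induced filtration on $\mathrm{Sym}^kR_r$.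 These maps form a direct system indexed by positive integers ordered by divisibility. $\Delta_\infty(\mathbb{Q})=\varinjlim_r\Delta_r(\mathbb{Q})$, and its simplicial topology is the direct limit of the simplicial topologies of the $\Delta_r(\mathbb{Q})$. **Almost triviality.** $(\mathcal{X},\mathcal{L})$ is almost trivial if its normalization is a trivial test configuration, i.e. (up to twisting the linearisation) $\mathbb{G}_m$-equivariantly isomorphic to $(X\times\mathbb{A}^1, rL\boxtimes\mathcal{O}_{\mathbb{A}^1})$ with $\mathbb{G}_m$ acting trivially on $X$. **Invariants.** For an exponent $r$ test configuration $(\mathcal{X},\mathcal{L})$ let $T_k$ be the infinitesimal generator of the $\mathbb{G}_m$-action on $H^0(\mathcal{X}_0,k\mathcal{L}_0)$, let $h(k)=\dim H^0(\mathcal{X}_0,k\mathcal{L}_0)=a_0k^n+a_1k^{n-1}+\cdots$ and $w(k)=\mathrm{Tr}(T_k)=b_0k^{n+1}+b_1k^n+\cdots$ (polynomials for $k\gg0$), and let $\underline{T}_k=T_k-\frac{\mathrm{Tr}(T_k)}{h(k)}\mathrm{Id}$. The $L^2$ norm is defined by $\|(\mathcal{X},\mathcal{L})\|_{L^2}^2=\lim_{k\to\infty}(kr)^{-n-2}\mathrm{Tr}(\underline{T}_k^2)$. As $X$ is normal, it is nonzero iff $(\mathcal{X},\mathcal{L})$ is not almost trivial (known). The normalized Donaldson–Futaki invariant is $$\mathrm{df}(\mathcal{X},\mathcal{L})=\frac{1}{\|(\mathcal{X},\mathcal{L})\|_{L^2}}\lim_{k\to\infty}\left(\frac{k b_0}{a_0}-\frac{w(k)}{h(k)}\right)=\frac{1}{\|(\mathcal{X},\mathcal{L})\|_{L^2}}\cdot\frac{a_1b_0-a_0b_1}{a_0^2}.$$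 It is invariant under base change, twisting the linearisation, and replacing $\mathcal{L}$ by $m\mathcal{L}$, so it is well defined on $\mathcal{T}$. *)

(* Defs.v *)
(* Projective geometry is set up in the language of classical varieties over
   the algebraically closed field K: a closed subset of P^N is represented by
   its punctured affine cone, i.e. the set of all homogeneous coordinate
   vectors of its points.  A very ample pair (X, L) is a closed subvariety X
   of P^N together with L = O_X(1). *)
From HB Require Import structures.
From mathcomp Require Import all_boot all_order all_algebra.
From mathcomp Require mpoly.

Set Implicit Arguments.
Unset Strict Implicit.
Unset Printing Implicit Defensive.

(* The notations of multinomials clash with those of analysis, so mpoly is
   only imported inside this module. *)
Module Form.
Import mpoly.
Local Open Scope ring_scope.

Definition poly (K : fieldType) (n : nat) : Type := {mpoly K[n]}.

Definition is_form (K : fieldType) (n d : nat) (p : poly K n) : Prop :=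
  p \is d.-homog.

Definition ev (K : fieldType) (n : nat) (p : poly K n) (v : 'rV[K]_n) : K :=
  p.@[v ord0].
End Form.

From mathcomp Require Import all_classical all_reals all_analysis.
From Stdlib Require Import Relations.

Import Order.TTheory GRing.Theory Num.Theory.
Import numFieldNormedType.Exports.

Local Open Scope quotient_scope.
Local Open Scope classical_set_scope.
Local Open Scope ring_scope.

Section ProjectiveVarieties.
Context (K : closedFieldType) (N : nat).
Implicit Types X Y : set 'rV[K]_N.+1.

Definition proj_closed X : Prop :=
  exists2 S : set (Form.poly K N.+1),
    (forall p, S p -> exists d, Form.is_form d p) &
    X = [set v | v != 0 /\ forall p, S p -> Form.ev p v = 0].

Definition irreducible X : Prop :=
  X !=set0 /\
  forall A B, proj_closed A -> proj_closed B ->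
    X `<=` A `|` B -> X `<=` A \/ X `<=` B.

Definition variety X : Prop := proj_closed X /\ irreducible X.

Definition chain_in X (m : nat) (Z : nat -> set 'rV[K]_N.+1) : Prop :=
  (forall i, (i <= m)%N -> variety (Z i) /\ Z i `<=` X) /\
  (forall i, (i < m)%N -> Z i `<` Z i.+1).

Definition has_dimension X (n : nat) : Prop :=
  (exists Z, chain_in X n Z) /\
  (forall m Z, chain_in X m Z -> (m <= n)%N).

(* Every local ring O_{X,p} is integrally closed in the function field.  The
   rational function is a/b, and its monic equation
     (a/b)^m + \sum_(j < m) (c_j/e) (a/b)^j = 0,  with e p != 0,
   is multiplied by e b^m. *)
Definition normal_variety X : Prop :=
  forall p, X p ->
  forall (d : nat) (a b : Form.poly K N.+1),
    Form.is_form d a -> Form.is_form d b ->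
    (exists2 q, X q & Form.ev b q != 0) ->
  forall (m d' : nat) (c : 'I_m -> Form.poly K N.+1) (e : Form.poly K N.+1),
    (forall j, Form.is_form d' (c j)) -> Form.is_form d' e -> Form.ev e p != 0 ->
    (forall q, X q ->
      Form.ev e q * Form.ev a q ^+ m +
      \sum_(j < m) Form.ev (c j) q * Form.ev a q ^+ j * Form.ev b q ^+ (m - j)
      = 0) ->
  exists (d0 : nat) (a0 b0 : Form.poly K N.+1),
    [/\ Form.is_form d0 a0, Form.is_form d0 b0, Form.ev b0 p != 0 &
        forall q, X q -> Form.ev a q * Form.ev b0 q = Form.ev a0 q * Form.ev b q].

(* H^0(X, dL), L = O_X(1): functions on the punctured cone which are locally
   quotients of forms whose degrees differ by d.  The product of sections is
   the pointwise product of functions. *)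
Definition H0 X (d : nat) : set (X -> K^o) :=
  [set s | forall p : X, exists (e : nat) (a b : Form.poly K N.+1),
    [/\ Form.is_form (e + d) a, Form.is_form e b, Form.ev b (val p) != 0 &
        forall q : X, Form.ev b (val q) != 0 ->
          s q = Form.ev a (val q) / Form.ev b (val q)]].

(* For d = 1 this says that X is embedded by the complete linear system |L|;
   together with this, the condition for d > 1 is the surjectivity of
   Sym^d H^0(X, L) -> H^0(X, dL). *)
Definition projectively_normal X : Prop :=
  forall d s, (0 < d)%N -> H0 d s ->
    exists2 p : Form.poly K N.+1, Form.is_form d p &
      s = (fun q : X => Form.ev p (val q)).

End ProjectiveVarieties.

Section LinearAlgebra.
Context (K : fieldType) (E : lmodType K).
Implicit Types (V W G S : set E).

Definition subspace_of V W : Prop :=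
  [/\ W `<=` V, W 0 & forall (c : K) u v, W u -> W v -> W (c *: u + v)].

Definition lspan S : set E :=
  [set s | exists (m : nat) (c : 'I_m -> K) (u : 'I_m -> E),
    (forall j, S (u j)) /\ s = \sum_j c j *: u j].

(* e induces a basis of W / G *)
Definition rel_basis W G (d : nat) (e : 'I_d -> E) : Prop :=
  (forall i, W (e i)) /\
  (forall v, W v ->
     exists! c : {ffun 'I_d -> K}, G (v - \sum_i c i *: e i)).

Definition qdim W G : nat :=
  xget 0%N [set d | exists e : 'I_d -> E, rel_basis W G e].

End LinearAlgebra.

Section TitsBuilding.
Context (R : realType) (K : fieldType) (E : lmodType K).
Implicit Type V : set E.

(* steps = (F_1, ..., F_l), wts = (w_1, ..., w_l) *)
Definition is_wflag V (steps : seq (set E)) (wts : seq R) : Prop :=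
  [/\ size wts = size steps /\ (2 <= size steps)%N,
      (forall i, (i < size steps)%N -> subspace_of V (nth set0 steps i)),
      (forall i, (i < size steps)%N ->
         nth set0 ([set 0] :: steps) i `<` nth set0 steps i) /\
      last set0 steps = V,
      sorted <%R wts &
      \sum_(i < size steps)
        wts`_i * (qdim (nth set0 steps i) (nth set0 ([set 0] :: steps) i))%:R
      = 0].

Record wflag V := WFlag {
  steps : seq (set E);
  wts : seq R;
  wflagP : is_wflag V steps wts
}.

HB.instance Definition _ V := gen_eqMixin (wflag V).
HB.instance Definition _ V := gen_choiceMixin (wflag V).

Definition wflag_equiv V (f g : wflag V) : bool :=
  `[< steps f = steps g /\
      exists2 c : R, 0 < c & wts g = [seq c * x | x <- wts f] >].

Lemma wflag_equiv_class V : equiv_class_of (@wflag_equiv V).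
Proof.
split=> [f|f g|g f h].
- apply/asboolP; split=> //; exists 1 => //.
  by rewrite -[LHS]map_id; apply: eq_map => x; rewrite mul1r.
- have sym a b : wflag_equiv a b -> wflag_equiv b a.
    move=> /asboolP[sab [c c0 wE]]; apply/asboolP; split=> //.
    exists c^-1; rewrite ?invr_gt0// wE -map_comp -[LHS]map_id.
    by apply: eq_map => x /=; rewrite mulrA mulVf ?mul1r// gt_eqF.
  by apply/idP/idP; exact: sym.
- move=> /asboolP[sfg [c c0 wg]] /asboolP[sgh [d d0 wh]].
  apply/asboolP; split; first by rewrite sfg.
  exists (d * c); first exact: mulr_gt0.
  by rewrite wh wg -map_comp; apply: eq_map => x /=; rewrite mulrA.
Qed.

Canonical wflag_equivRel V := EquivRelPack (wflag_equiv_class V).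

Definition building V : Type := {eq_quot @wflag_equiv V}.

HB.instance Definition _ V := Quotient.on (building V).
HB.instance Definition _ V := Choice.on (building V).

Definition bclass V (f : wflag V) : building V := (\pi_(building V) f)%qT.

Definition adapted V (m : nat) (v : 'I_m -> E) (f : wflag V) : Prop :=
  forall i, (i < size (steps f))%N ->
    exists J : {set 'I_m}, nth set0 (steps f) i = lspan [set v j | j in [set` J]].

Definition weight_of V (f : wflag V) (v : E) : R :=
  (wts f)`_(find (fun F : set E => `[< F v >]) (steps f)).

(* On the apartment of v the weight vectors (weight_of f (v j))_j fill the
   space {x != 0 | \sum_j x_j = 0}, whose quotient by R_{>0} is the sphere; a
   subset of the sphere is open iff its inverse image is the trace of an open
   subset O of R^m. *)
Definition simplicial_open V (U : set (building V)) : Prop :=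
  forall (m : nat) (v : 'I_m -> E), rel_basis V [set 0] v ->
    exists2 O : set 'rV[R]_m, open O &
      forall f : wflag V, adapted v f ->
        (U (bclass f) <-> O (\row_j weight_of f (v j))).

Lemma simplicial_openT V : simplicial_open [set: building V].
Proof. by move=> m v _; exists setT => //; exact: openT. Qed.

Lemma simplicial_openI V : setI_closed (@simplicial_open V).
Proof.
move=> A B oA oB m v bv.
have [W1 W1o h1] := oA m v bv; have [W2 W2o h2] := oB m v bv.
exists (W1 `&` W2); first exact: openI.
move=> f af; have := h1 f af; have := h2 f af.
by split=> -[x y]; split; intuition.
Qed.

Lemma simplicial_open_bigcup V (I : Type) (f : I -> set (building V)) :
  (forall i, simplicial_open (f i)) -> simplicial_open (\bigcup_i f i).
Proof.
move=> fo m v bv.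
have /choice[W hW] : forall i, exists W : set 'rV[R]_m, open W /\
    forall g : wflag V, adapted v g ->
      (f i (bclass g) <-> W (\row_j weight_of g (v j))).
  by move=> i; have [W Wo h] := fo i m v bv; exists W.
exists (\bigcup_i W i); first by apply: bigcup_open => i _; have [] := hW i.
move=> g ag; split=> -[i _ x]; exists i => //; have [_ /(_ g ag)] := hW i;
  tauto.
Qed.

HB.instance Definition _ V := isOpenTopological.Build (building V)
  (@simplicial_openT V) (@simplicial_openI V) (@simplicial_open_bigcup V).

Definition rational_points V : set (building V) :=
  [set c | exists2 f : wflag V, c = bclass f &
     forall x, x \in wts f -> exists q : rat, x = ratr q].

(* with the subspace topology *)
Definition rbuilding V : topologicalType := set_type (@rational_points V).

(* The increasing filtration of V attached to a weighted flag. *)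
Definition filt V (f : wflag V) (x : R) : set E :=
  [set s | s = 0 \/
    exists i, [/\ (i < size (steps f))%N, (wts f)`_i <= x &
                  nth set0 (steps f) i s]].

(* F is a representation of the class of f by a filtration indexed by
   integers, after the rescaling and shift x = a i + b of the weights. *)
Definition integral_rep V (f : wflag V) (F : int -> set E) : Prop :=
  exists a b : R, [/\ 0 < a,
    (forall x, x \in wts f -> exists z : int, x = a * z%:~R + b) &
    (forall i : int, F i = filt f (a * i%:~R + b))].

End TitsBuilding.

Section TestConfigurations.
Context (R : realType) (K : closedFieldType) (N : nat) (X : set 'rV[K]_N.+1).
Local Notation E := (X -> K^o).
Implicit Type F : int -> set E.

(* Here F is an integral filtration of H0 X r.  chi F k i is the set of the
   s in R_{rk} such that s t^i lies in the K[t]-subalgebra chi generated by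
   \bigoplus_i F_i t^i; since the generators are bihomogeneous, chi is the
   direct sum of these pieces. *)
Inductive chi F : nat -> int -> set E :=
| chi_zero k i : chi F k i 0
| chi_one : chi F 0 0 1
| chi_t : chi F 0 1 1
| chi_gen i s : F i s -> chi F 1 i s
| chi_lin k i (c : K) s s' :
    chi F k i s -> chi F k i s' -> chi F k i (c *: s + s')
| chi_mul k l i j s s' :
    chi F k i s -> chi F l j s' -> chi F (k + l)%N (i + j) (s * s').

(* The bidegree (k, i) piece of the localisation chi[1/f], f t^j in chi_1,
   as functions on {f != 0} extended by 0. *)
Definition chi_loc F (k : nat) (i j : int) (f : E) : set E :=
  [set u | (forall x, f x = 0 -> u x = 0) /\
     exists m : nat, chi F (k + m) (i + j *+ m) (f ^+ m * u)].

(* The weight -i part of H^0(X_0, k L_0), X_0 = Proj (chi / t chi), computed on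
   the invariant affine cover by the loci D_+(f t^j), for f in F_j.  As t is
   injective on the localisations of chi, the sections of k L_0 over
   D_+(f t^j) are chi[1/f]_(k,i) / chi[1/f]_(k,i-1); a section over X_0 is
   given by representatives u_(j,f) (cochains0) agreeing on overlaps modulo t,
   and vanishes iff all its representatives are divisible by t (zero0). *)
Definition cochains0 F (k : nat) (i : int) : set (int * E -> E) :=
  [set u | (forall j f, F j f -> chi_loc F k i j f (u (j, f))) /\
     (forall j f j' g, F j f -> F j' g ->
        exists2 m : nat, (0 < m)%N &
          chi F (k + m.*2) (i - 1 + (j + j') *+ m)
              ((f * g) ^+ m * (u (j, f) - u (j', g))))].

Definition zero0 F (k : nat) (i : int) : set (int * E -> E) :=
  [set u | forall j f, F j f -> chi_loc F k (i - 1) j f (u (j, f))].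

(* multiplicity of the eigenvalue -i of T_k *)
Definition mult0 F (k : nat) (i : int) : nat :=
  qdim (cochains0 F k i : set (int * E -> E : lmodType K)) (zero0 F k i).

(* Tr (phi (T_k)) *)
Definition trace_fun F (phi : R -> R) (k : nat) : R :=
  \sum_(i \in [set: int]) (mult0 F k i)%:R * phi (- i%:~R).

Definition hfun F : nat -> R := trace_fun F (fun=> 1).
Definition wfun F : nat -> R := trace_fun F id.
Definition tr_sq F (k : nat) : R :=
  trace_fun F (fun x => (x - wfun F k / hfun F k) ^+ 2) k.

Definition poly_of (u : nat -> R) : {poly R} :=
  xget 0 [set P : {poly R} | \forall k \near \oo, u k = P.[k%:R]].

Definition L2norm (n r : nat) F : R :=
  Num.sqrt (lim ((fun k => tr_sq F k / (k * r)%:R ^+ n.+2) @ \oo)).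

Definition DF_normalized (n r : nat) F : R :=
  let a0 := (poly_of (hfun F))`_n in
  let a1 := (poly_of (hfun F))`_n.-1 in
  let b0 := (poly_of (wfun F))`_n.+1 in
  let b1 := (poly_of (wfun F))`_n in
  (L2norm n r F)^-1 * ((a1 * b0 - a0 * b1) / a0 ^+ 2).

(* The bidegree (k, i) piece of the integral closure of chi in
   \bigoplus_k R_{rk}[t, 1/t] = chi[1/t].  For X normal this ring is normal, so
   that Proj of the integral closure is the normalisation of Proj chi. *)
Definition chi_normalization (r : nat) F (k : nat) (i : int) : set E :=
  [set s | H0 (r * k) s /\
     exists (m : nat) (a : 'I_m -> E),
       (forall j : 'I_m, chi F ((m - j) * k) (i *+ (m - j)) (a j)) /\
       s ^+ m + \sum_(j < m) a j * s ^+ j = 0].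

Definition trivial_piece (r k : nat) (i : int) : set E :=
  if 0 <= i then H0 (r * k) else [set 0].

(* The normalisation is the trivial test configuration, up to the twist of the
   linearisation by c.  theta is an isomorphism of bigraded K[t]-algebras
   from \bigoplus_k R_{rk}[t]; as it is K[t]-linear, it is determined by its
   restrictions theta k : s |-> theta (s t^i) t^(-i-ck), independent of i. *)
Definition almost_trivial (r : nat) F : Prop :=
  exists (c : int) (theta : nat -> E -> E),
    [/\ theta 0%N 1 = 1,
        (forall k (a : K) s s', H0 (r * k) s -> H0 (r * k) s' ->
           theta k (a *: s + s') = a *: theta k s + theta k s'),
        (forall k l s s', H0 (r * k) s -> H0 (r * l) s' ->
           theta (k + l)%N (s * s') = theta k s * theta l s') &
        forall k i, set_bij (trivial_piece r k i)
                      (chi_normalization r F k (i + c *+ k)) (theta k)].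

(* The image on R_{rk} of the filtration induced by G on Sym^k R_r. *)
Definition sym_filt (G : R -> set E) (k : nat) (x : R) : set E :=
  lspan [set s | exists (u : 'I_k -> E) (y : 'I_k -> R),
    [/\ (forall j, G (y j) (u j)), \sum_j y j <= x & s = \prod_j u j]].

(* The disjoint union of the Delta_r(Q), r >= 1 *)
Definition Delta_sum : Type :=
  {r : {r : nat | (0 < r)%N} & rbuilding R (H0 (X := X) (val r))}.

HB.instance Definition _ := Topological.on Delta_sum.

(* The graph of the maps iota_(r,k): the image filtration on R_{rk} becomes a
   weighted flag after subtracting a constant c from the weights.  If the image
   filtration has only one jump (it is then the trivial test configuration, and
   x is almost trivial) it defines no point of the building and x has no
   image. *)
Definition iota_graph (x y : Delta_sum) : Prop :=
  exists k : nat, [/\ (0 < k)%N, val (projT1 y) = (val (projT1 x) * k)%N &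
    exists (f : wflag R (H0 (X := X) (val (projT1 x))))
           (g : wflag R (H0 (X := X) (val (projT1 y)))) (c : R),
      [/\ bclass f = val (projT2 x), bclass g = val (projT2 y) &
          forall z, filt g z = sym_filt (filt f) k (z + c)]].

Definition Delta_equiv (x y : Delta_sum) : bool :=
  `[< clos_refl_sym_trans Delta_sum iota_graph x y >].

Lemma Delta_equiv_class : equiv_class_of Delta_equiv.
Proof.
split=> [x|x y|y x z].
- by apply/asboolP; exact: rst_refl.
- by apply/asboolP/asboolP; exact: rst_sym.
- by move=> /asboolP xy /asboolP yz; apply/asboolP; exact: rst_trans xy yz.
Qed.

Canonical Delta_equivRel := EquivRelPack Delta_equiv_class.

(* The direct limit, with the direct limit topology *)
Definition Delta_infty : topologicalType :=
  quotient_topology {eq_quot Delta_equiv}.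

(* A test configuration (exponent and integral filtration) representing a
   point of the direct limit. *)
Definition tc_exponent (x : Delta_infty) : nat :=
  val (projT1 (repr (x : {eq_quot Delta_equiv}))).

Definition tc_filtration (x : Delta_infty) : int -> set E :=
  xget (fun=> set0)
    (integral_rep (repr (val (projT2 (repr (x : {eq_quot Delta_equiv})))))).

Definition non_almost_trivial : set Delta_infty :=
  [set x | ~ almost_trivial (tc_exponent x) (tc_filtration x)].

Definition df (n : nat) (x : Delta_infty) : R :=
  DF_normalized n (tc_exponent x) (tc_filtration x).

End TestConfigurations.

Arguments Delta_infty R {K N} X.
Arguments non_almost_trivial R {K N} X x : rename.
Arguments df R {K N} X n x.

(* Main.v *)
(* Fix an apartment of Delta_r, i.e. a basis v_1, ..., v_m of H^0(X, rL), and
   let lam be the weight vector of a point of it.  In degree k the filtration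
   defining the test configuration is spanned by the monomials v^a with |a| = k
   and lam.a <= x, and Serre vanishing on the central fibre identifies the
   spectrum of T_k, for k large, with the values -lam.a of the monomials that are
   standard for lam.  The standard monomials form a downset D_lam of N^m with
   the Hilbert function of X; by noetherianity only finitely many downsets
   occur as lam varies, and for each of them the sums over a in D, |a| = k, of
   1, a_i and a_i a_j are polynomials in k.  Hence the invariants are given by
   finitely many continuous formulas in lam, one for each downset.  These
   formulas agree where the closures of two pieces meet, since the spectrum of
   lam0 can be computed with the standard monomials of any lam close to lam0,
   so the norm, and the Donaldson-Futaki invariant where the norm is nonzero,
   are continuous on the apartment.  Both are compatible with the maps iota.

   That points which are not almost trivial have nonzero norm is proved by
   contraposition.  Let V be the span of the v_j of least weight.  If every v_j
   is nilpotent modulo the ideal generated by V, the determinant trick makes the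
   sections integral over the algebra generated by V and the normalisation is
   trivial.  Otherwise Krull's principal ideal theorem produces a positive
   proportion of monomials of large weight, hence a positive variance. *)
Require Import Defs.
From HB Require Import structures.
From mathcomp Require Import all_boot all_order all_algebra.
From mathcomp Require Import all_classical.
From mathcomp Require mpoly.
From mathcomp Require Import ring lra zify.
Set Implicit Arguments.
Unset Strict Implicit.
Unset Printing Implicit Defensive.
Import Order.TTheory GRing.Theory Num.Theory.

(* The notations of multinomials clash with those of analysis, so mpoly is
   only imported inside this module. *)
Module Algebra.
Import mpoly.
Local Open Scope classical_set_scope.
Local Open Scope ring_scope.

(** * Linear algebra modulo a subspace *)

Section LinearAlgebra.
Context (K : fieldType) (E : lmodType K).
Implicit Types (W G S : set E).

(** One source of finiteness serves everywhere: strictly decreasing chains of downsets stop. It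
    bounds the number of formulas, proves polynomiality, and gives noetherian induction both on
    bihomogeneous ideals of the Rees algebra and on closed cones.

    The multiplicities of [T_k] are defined by cochains over all the loci [D_+(f t^j)], so
    identifying them with standard monomials needs both [H^0] and [H^1] of local cohomology to
    vanish in large degree, uniformly in the weight.

    Dimension theory has to supply only the upper bound of order [k ^ n] on the Hilbert function. If
    the coefficient of degree [n] of the Hilbert polynomial is zero, then [a0 = 0] and [df] is
    constantly zero by the convention for division; if not, that coefficient itself provides the
    lower bound that the variance estimate requires.

    To descend to the direct limit, continuity is phrased through the condition that the norm is
    nonzero and the value lies in an open set [O]. This condition depends only on spectra, up to
    positive rescaling and a shift proportional to the degree, so it is constant along [iota] and
    defines an open set of the whole limit. *)

Definition is_subspace W := W 0 /\ forall (c : K) u v, W u -> W v -> W (c *: u + v).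

Lemma subspace0 W : is_subspace W -> W 0. Proof. by case. Qed.

Lemma subspaceD W u v : is_subspace W -> W u -> W v -> W (u + v).
Proof. by case=> _ h Wu Wv; rewrite -[u]scale1r; exact: h. Qed.

Lemma subspaceZ W c u : is_subspace W -> W u -> W (c *: u).
Proof. by case=> W0 h Wu; rewrite -[X in W X]addr0; exact: h. Qed.

Lemma subspaceN W u : is_subspace W -> W u -> W (- u).
Proof. by move=> h Wu; rewrite -scaleN1r; exact: subspaceZ. Qed.

Lemma subspaceB W u v : is_subspace W -> W u -> W v -> W (u - v).
Proof. by move=> h Wu Wv; apply: subspaceD => //; exact: subspaceN. Qed.

Lemma subspace_sum W (J : Type) (s : seq J) (P : pred J) (u : J -> E) :
  is_subspace W -> (forall j, P j -> W (u j)) -> W (\sum_(j <- s | P j) u j).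
Proof.
move=> h hu; elim/big_ind: _ => //; first exact: subspace0.
by move=> x y; exact: subspaceD.
Qed.

Lemma subspace_lspan S : is_subspace (lspan S).
Proof.
split.
  by exists 0%N, (fun=> 0), (fun=> 0); split; [case | rewrite big_ord0].
move=> c u v [m [a [x [xS ->]]]] [p [b [y [yS ->]]]].
exists (m + p)%N, (fun i => match fintype.split i with inl j => c * a j | inr j => b j end),
  (fun i => match fintype.split i with inl j => x j | inr j => y j end); split.
  by move=> i; case: (fintype.split i).
rewrite big_split_ord/= scaler_sumr; congr (_ + _); apply: eq_bigr => i _.
  by rewrite (unsplitK (inl i : 'I_m + 'I_p)) scalerA.
by rewrite (unsplitK (inr i : 'I_m + 'I_p)).
Qed.

Lemma lspan_sub S W : is_subspace W -> S `<=` W -> lspan S `<=` W.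
Proof.
move=> hW hS _ [m [c [u [uS ->]]]]; apply: subspace_sum => // j _.
by apply: subspaceZ => //; exact: hS.
Qed.

Lemma sub_lspan S : S `<=` lspan S.
Proof.
move=> s Ss; exists 1%N, (fun=> 1), (fun=> s); split => //.
by rewrite big_ord1 scale1r.
Qed.

Lemma lspan_mono S S' : S `<=` S' -> lspan S `<=` lspan S'.
Proof.
move=> h; apply: lspan_sub; first exact: subspace_lspan.
by move=> s /h; exact: sub_lspan.
Qed.

Lemma subspace_set0 : is_subspace [set 0 : E].
Proof. by split => // c u v -> ->; rewrite scaler0 addr0. Qed.

Definition sumset W G : set E := [set s | exists2 u, W u & G (s - u)].

Lemma subspace_sumset W G : is_subspace W -> is_subspace G ->
  is_subspace (sumset W G).
Proof.
move=> hW hG; split; first by exists 0; [exact: subspace0|rewrite subrr; exact: subspace0].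
move=> c u v [u' Wu Gu] [v' Wv Gv]; exists (c *: u' + v'); first by case: hW => _; apply.
by rewrite opprD addrACA -scalerBr; case: hG => _; apply.
Qed.

Lemma sumset_l W G : is_subspace G -> W `<=` sumset W G.
Proof. by move=> hG u Wu; exists u => //; rewrite subrr; exact: subspace0. Qed.

Lemma sumset_r W G : is_subspace W -> G `<=` sumset W G.
Proof. by move=> hW u Gu; exists 0; rewrite ?subr0//; exact: subspace0. Qed.

Lemma kernel_row (N M : nat) (C : 'M[K]_(N, M)) : (M < N)%N ->
  exists2 c : 'I_N -> K, (exists i, c i != 0) & forall j, \sum_i c i * C i j = 0.
Proof.
move=> MN; have : kermx C != 0.
  by rewrite kermx_eq0 /row_free; apply: contraTneq (rank_leq_col C) => ->; rewrite -ltnNge.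
move=> /rowV0Pn[r /sub_kermxP rC r0]; exists (r 0).
  by apply/existsP; apply: contra_neqT r0 => /existsPn h; apply/rowP => i; rewrite mxE; move: (h i) => /negPn/eqP.
by move=> j; move/rowP: rC => /(_ j); rewrite !mxE.
Qed.

(** Exchange principle modulo [G]: with more vectors than spanning ones, a left kernel vector of the
    coefficient matrix is a nontrivial relation. Most comparisons of dimensions below go through
    it. *)
Lemma indep_leq G (N M : nat) (u : 'I_N -> E) (w : 'I_M -> E) : is_subspace G ->
  (forall c : 'I_N -> K, G (\sum_i c i *: u i) -> forall i, c i = 0) ->
  (forall i, exists a : 'I_M -> K, G (u i - \sum_j a j *: w j)) -> (N <= M)%N.
Proof.
move=> hG indep /choice[a ha]; rewrite leqNgt; apply/negP => MN.
have [c [i ci] hc] := kernel_row (\matrix_(i, j) a i j) MN.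
suff /indep/(_ i)/eqP : G (\sum_i c i *: u i) by rewrite (negbTE ci).
have -> : \sum_i c i *: u i = \sum_i c i *: (u i - \sum_j a i j *: w j).
  under [RHS]eq_bigr do rewrite scalerBr.
  rewrite sumrB [X in _ - X](_ : _ = 0) ?subr0//.
  under eq_bigr do rewrite scaler_sumr.
  rewrite exchange_big big1//= => j _.
  under eq_bigr do rewrite scalerA.
  rewrite -scaler_suml -[RHS](scale0r (w j)); congr (_ *: _); rewrite -[RHS](hc j).
  by apply: eq_bigr => k _; rewrite mxE.
by apply: subspace_sum => // k _; exact: subspaceZ.
Qed.

Lemma rel_basis_indep W G (d : nat) (e : 'I_d -> E) : is_subspace W -> is_subspace G ->
  rel_basis W G e ->
  forall c : 'I_d -> K, G (\sum_i c i *: e i) -> forall i, c i = 0.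
Proof.
move=> hW hG [We he] c Gc i; have [c0 [_ uc]] := he _ (subspace0 hW).
have /uc h1 : G (0 - \sum_i [ffun j => c j] i *: e i).
  by rewrite sub0r; apply: subspaceN => //; under eq_bigr do rewrite ffunE.
have /uc h2 : G (0 - \sum_i [ffun=> 0 : K] i *: e i).
  rewrite sub0r big1 ?oppr0; first exact: subspace0.
  by move=> j _; rewrite ffunE scale0r.
have : [ffun j => c j] i = [ffun=> 0 : K] i by rewrite -h1 -h2.
by rewrite !ffunE.
Qed.

Lemma rel_basisP W G (d : nat) (e : 'I_d -> E) : is_subspace G ->
  (forall i, W (e i)) ->
  (forall v, W v -> exists c : 'I_d -> K, G (v - \sum_i c i *: e i)) ->
  (forall c : 'I_d -> K, G (\sum_i c i *: e i) -> forall i, c i = 0) ->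
  rel_basis W G e.
Proof.
move=> hG We span indep; split => // v /span[c Gc]; exists [ffun j => c j]; split.
  by under eq_bigr do rewrite ffunE.
move=> c' Gc'; apply/ffunP => i; rewrite ffunE; apply/eqP; rewrite -subr_eq0; apply/eqP.
apply: (indep (fun i => c i - c' i)).
under eq_bigr do rewrite scalerBl.
rewrite sumrB (_ : _ - _ = (v - \sum_i c' i *: e i) - (v - \sum_i c i *: e i)).
  exact: subspaceB.
by rewrite opprB [RHS]addrC subrKA.
Qed.

Lemma rel_basis_dim W G (d d' : nat) (e : 'I_d -> E) (e' : 'I_d' -> E) :
  is_subspace W -> is_subspace G -> rel_basis W G e -> rel_basis W G e' -> d = d'.
Proof.
move=> hW hG be be'; apply/eqP; rewrite eqn_leq; apply/andP; split.
- apply: (indep_leq (w := e') hG (rel_basis_indep hW hG be)) => i.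
  by have [We _] := be; have [_ /(_ _ (We i))[c [Gc _]]] := be'; exists c.
- apply: (indep_leq (w := e) hG (rel_basis_indep hW hG be')) => i.
  by have [We _] := be'; have [_ /(_ _ (We i))[c [Gc _]]] := be; exists c.
Qed.

Lemma qdimE W G (d : nat) (e : 'I_d -> E) :
  is_subspace W -> is_subspace G -> rel_basis W G e -> qdim W G = d.
Proof.
move=> hW hG be; rewrite /qdim; case: xgetP => [d' _ [e' be']|/(_ d)].
  exact: rel_basis_dim be' be.
by move=> h; case: h; exists e.
Qed.

End LinearAlgebra.

(** * Monomials and downsets *)

(** Beyond any index a sequence of naturals attains its minimum; jumping repeatedly to such places
    by [h] gives the subsequence. *)
Lemma nat_nondecreasing_subseq (f : nat -> nat) : exists2 g : nat -> nat,
  (forall i j, (i < j)%N -> (g i < g j)%N) &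
  (forall i j, (i <= j)%N -> (f (g i) <= f (g j))%N).
Proof.
have /choice[h hP] : forall n, exists p, (n <= p)%N /\ forall k, (n <= k -> f p <= f k)%N.
  move=> n; have ex : exists i, `[< exists2 p, (n <= p)%N & f p = i >].
    by exists (f n); apply/asboolP; exists n.
  case: (ex_minnP ex) => _ /asboolP[p np <-] hmin; exists p; split => // k nk.
  by apply: hmin; apply/asboolP; exists k.
pose g := fix g i := if i is i'.+1 then h (g i').+1 else h 0%N.
have gS i : (g i < g i.+1)%N by case: (hP (g i).+1).
have gmono : forall i j, (i < j)%N -> (g i < g j)%N.
  by move=> i j; apply: (homo_ltn (r := fun x y => (x < y)%N)) => //; exact: ltn_trans.
exists g => //.
move=> i j ij; have -> : g i = h (if i is i'.+1 then (g i').+1 else 0%N) by case: i {ij}.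
case: (hP (if i is i'.+1 then (g i').+1 else 0%N)) => _; apply.
apply: (@leq_trans (g i)); first by case: i {ij} => //= i; case: (hP (g i).+1).
by move: ij; rewrite leq_eqVlt => /predU1P[->//|/gmono/ltnW].
Qed.

Section Downsets.
Context {m : nat}.
Implicit Types (a b c : 'X_{1..m}) (D : set 'X_{1..m}).

(** Nondecreasing subsequences are extracted one coordinate after another; the first two terms of
    the last one are comparable. *)
Lemma dickson (f : nat -> 'X_{1..m}) : exists i j, (i < j)%N /\ (f i <= f j)%MM.
Proof.
have [g g1 g2] : exists2 g : nat -> nat, (forall i j, (i < j)%N -> (g i < g j)%N) &
    forall x, x \in enum 'I_m -> forall i j, (i <= j)%N -> (f (g i) x <= f (g j) x)%N.
  elim: (enum 'I_m) => [|x s [g g1 g2]]; first by exists id.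
  have [h h1 h2] := nat_nondecreasing_subseq (fun i => f (g i) x).
  exists (g \o h) => [i j /h1/g1//|y]; rewrite inE => /orP[/eqP->|ys] i j ij /=.
    exact: h2.
  by apply: g2 => //; move: ij; rewrite leq_eqVlt => /predU1P[->//|/h1/ltnW].
exists (g 0%N), (g 1%N); split; first exact: g1.
by apply/mnm_lepP => x; apply: g2 => //; rewrite mem_enum.
Qed.

Definition downset D := forall a b, D (a + b)%MM -> D a.

(** Noetherian induction: a failure yields a strictly decreasing chain [ch] with a monomial [al i]
    lost at stage [i], while Dickson's lemma finds [al i] below a later [al j], which has survived
    that stage. *)
Lemma downset_ind (P : set 'X_{1..m} -> Prop) :
  (forall D, downset D ->
     (forall D', downset D' -> D' `<=` D -> (exists2 a, D a & ~ D' a) -> P D') -> P D) ->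
  forall D, downset D -> P D.
Proof.
move=> step D0 dD0; apply: contrapT => nPD0.
pose T := {D | downset D /\ ~ P D}.
have next (D : T) : exists D' : T * 'X_{1..m},
    sval D'.1 `<=` sval D /\ (sval D D'.2 /\ ~ sval D'.1 D'.2).
  case: D => D [dD nPD]; apply: contrapT => h; apply: (nPD); apply: step => // D' dD' sD [a Da nDa].
  by apply: contrapT => nPD'; apply: h; exists (exist _ D' (conj dD' nPD'), a).
have [F hF] := choice next.
pose ch := fix ch i := if i is i'.+1 then (F (ch i')).1 else exist _ D0 (conj dD0 nPD0) : T.
pose al i := (F (ch i)).2.
have chS i j : (i <= j)%N -> sval (ch j) `<=` sval (ch i).
  elim: j => [|j ih]; first by rewrite leqn0 => /eqP->.
  rewrite leq_eqVlt => /predU1P[->//|/ih h]; apply: subset_trans h.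
  by case: (hF (ch j)).
have [i [j [ij le_ij]]] := dickson al.
have [_ [_ ni]] := hF (ch i); apply: ni.
have : sval (ch i.+1) (al j).
  by apply: (chS _ _ ij); case: (hF (ch j)) => _ [].
rewrite -(submK le_ij) addmC; have [di _] := svalP (ch i.+1).
exact: di.
Qed.

Definition mons k : seq 'X_{1..m} :=
  [seq bmnm x | x : 'X_{1..m < k.+1} <- [seq x : 'X_{1..m < k.+1} <- enum {: 'X_{1..m < k.+1}} | mdeg x == k]].

Lemma mem_mons k a : (a \in mons k) = (mdeg a == k).
Proof.
apply/mapP/eqP => [[b]|ak]; first by rewrite mem_filter => /andP[/eqP bk _] ->.
have ak' : (mdeg a < k.+1)%N by rewrite ak.
by exists (BMultinom ak') => //; rewrite mem_filter /= ak eqxx mem_enum.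
Qed.

Lemma mons_uniq k : uniq (mons k).
Proof. rewrite map_inj_uniq; last by move=> x y; exact: val_inj.
by apply: filter_uniq; exact: enum_uniq. Qed.

Lemma monsS_perm k (j : 'I_m) :
  perm_eq [seq a : 'X_{1..m} <- mons k.+1 | a j != 0%N] [seq (a + U_(j))%MM | a <- mons k].
Proof.
apply: uniq_perm; first by rewrite filter_uniq ?mons_uniq.
  by rewrite map_inj_uniq ?mons_uniq// => a b /addIm.
move=> a; rewrite mem_filter mem_mons; apply/andP/mapP => [[aj /eqP ak]|[b]].
  have Uj : (U_(j) <= a)%MM.
    by apply/mnm_lepP => i; rewrite mnm1E; case: eqP => // <-; rewrite lt0n.
  exists (a - U_(j))%MM; last by rewrite submK.
  by rewrite mem_mons -(eqn_add2r 1%N) -(mdeg1 j) -mdegD submK// ak mdeg1 addn1.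
rewrite mem_mons => /eqP <- ->; rewrite mdegD mdeg1 addn1 eqxx; split => //.
by rewrite mnmDE mnm1E eqxx addn1.
Qed.

Definition dsum (R : nmodType) D (p : 'X_{1..m} -> R) k : R :=
  \sum_(a <- mons k | `[< D a >]) p a.

Lemma dsumS (R : nmodType) D (p : 'X_{1..m} -> R) (j : 'I_m) k :
  dsum D p k.+1 = dsum [set a | D a /\ a j = 0%N] p k.+1
    + dsum [set a | D (a + U_(j))%MM] (fun a => p (a + U_(j))%MM) k.
Proof.
rewrite /dsum [LHS](bigID (fun a : 'X_{1..m} => a j == 0%N))/=; congr (_ + _).
  by apply: eq_bigl => a; rewrite asbool_and; congr (_ && _); apply/eqP/asboolP.
rewrite -(big_map (fun a => (a + U_(j))%MM) (fun a => `[< D a >]) p).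
rewrite -(perm_big _ (monsS_perm k j)) big_filter_cond.
by apply: eq_bigl => a; rewrite andbC.
Qed.

(** If one member omits an element of [C] of degree [k], counting in degree [k] forces every member
    inside [C] to omit some [c] among the finitely many elements of [C] of that degree, hence to lie
    in the smaller downset [C_ c]. *)
Lemma finite_downsets (F : set (set 'X_{1..m})) :
  (forall D, F D -> downset D) ->
  (forall D D', F D -> F D' -> forall k, dsum D (fun=> 1%N) k = dsum D' (fun=> 1%N) k) ->
  finite_set F.
Proof.
move=> dF hF; pose Fin C := finite_set [set D | F D /\ D `<=` C].
suff : Fin setT by rewrite /Fin (_ : [set _ | _] = F)//; apply/seteqP; split=> [D []|D].
apply: (downset_ind (P := Fin)) => // C dC IH; rewrite /Fin.
have [[D0 [FD0 sD0] nCD0]|h] := pselect (exists2 D0, F D0 /\ D0 `<=` C & ~ (C `<=` D0)); last first.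
  apply: (@sub_finite_set _ _ [set C]) => // D [FD sD] /=.
  by apply/seteqP; split => //; apply: contrapT => nC; apply: h; exists D.
have [b Cb nDb] : exists2 b, C b & ~ D0 b.
  by apply: contrapT => h; apply: nCD0 => b Cb; apply: contrapT => nb; apply: h; exists b.
set k := mdeg b.
pose C_ c := [set a | C a /\ ~ (c <= a)%MM].
apply: (@sub_finite_set _ _ (\bigcup_(c in [set` [seq c <- mons k | `[< C c >]]])
  [set D | F D /\ D `<=` C_ c])); last first.
  apply: bigcup_finite => // c /=; rewrite mem_filter => /andP[/asboolP Cc _].
  apply: IH.
  - move=> x y [/dC Cx nxy]; split => // cx; apply: nxy; apply: lepm_trans cx _.
    exact: lem_addr.
  - by move=> x [].
  - by exists c => // -[_]; apply; exact: lepm_refl.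
move=> D [FD sD]; have [c /= [Cc ck nDc]] : exists c, [/\ C c, c \in mons k & ~ D c].
  apply: contrapT => h; have : (dsum D (fun=> 1%N) k < dsum D (fun=> 1%N) k)%N; last by rewrite ltnn.
  rewrite [X in (X < _)%N](hF D D0)// /dsum [X in (_ < X)%N](_ : _ = dsum C (fun=> 1%N) k); last first.
    rewrite /dsum big_seq_cond [RHS]big_seq_cond; apply: eq_bigl => a.
    have [ak /=|//] := boolP (a \in mons k); apply/asboolP/asboolP => [/sD//|Ca].
    by apply: contrapT => nDa; apply: h; exists a.
  rewrite /dsum [X in (_ < X)%N](bigID (fun a => `[< D0 a >])) /=.
  rewrite [X in (_ < X + _)%N](_ : _ = \sum_(a <- mons k | `[< D0 a >]) 1%N)%N; last first.
    apply: eq_bigl => a; rewrite -asbool_and; apply: asbool_equiv_eq.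
    by split=> [[]//|D0a]; split => //; exact: sD0.
  rewrite -[X in (X < _)%N]addn0 ltn_add2l lt0n sum_nat_seq_neq0.
  by apply/hasP; exists b; rewrite ?mem_mons//= andbT; apply/andP; split; [exact/asboolP|apply/asboolPn].
exists c => //=; first by rewrite mem_filter ck andbT; apply/asboolP.
split => // a Da; split; first exact: sD.
by move=> ca; apply: nDc; apply: (dF D FD) (a - c)%MM _; rewrite addmC submK.
Qed.

End Downsets.

(** * Eventual polynomiality of sums over downsets *)

Section EventuallyPolynomial.
Context (R : numFieldType).
Implicit Types (u : nat -> R) (P Q : {poly R}).

Definition evpoly u := exists P k0, forall k, (k0 <= k)%N -> u k = P.[k%:R].

Lemma evpoly_eq u u' k0 : (forall k, (k0 <= k)%N -> u k = u' k) -> evpoly u -> evpoly u'.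
Proof.
move=> h [P [k1 hP]]; exists P, (maxn k0 k1) => k; rewrite geq_max => /andP[k0k k1k].
by rewrite -h// hP.
Qed.

Lemma evpolyD u u' : evpoly u -> evpoly u' -> evpoly (fun k => u k + u' k).
Proof.
move=> [P [k0 hP]] [Q [k1 hQ]]; exists (P + Q), (maxn k0 k1) => k.
by rewrite geq_max => /andP[k0k k1k]; rewrite hornerD hP// hQ.
Qed.

(** The polynomial [c *: (('X + 1) ^+ e.+1 - 'X ^+ e.+1)] has the leading term of [P], so
    subtracting it lowers the degree. *)
Lemma antidifference P : exists Q, Q \Po ('X + 1) - Q = P.
Proof.
have [n] := ubnP (size P); elim: n P => // n IH P; rewrite ltnS => sP.
have [->|P0] := eqVneq P 0; first by exists 0; rewrite comp_poly0 subrr.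
pose e := (size P).-1; have eP : size P = e.+1 by rewrite prednK// size_poly_gt0.
pose c := lead_coef P / e.+1%:R.
have [Q hQ] : exists Q, Q \Po ('X + 1) - Q = P - c *: (('X + 1) ^+ e.+1 - 'X ^+ e.+1).
  apply: IH; apply: leq_trans sP; rewrite eP ltnS; apply/leq_sizeP => i ei.
  rewrite coefB coefZ coefB coefXn (addrC 'X) exprDn coef_sum.
  under eq_bigr do rewrite expr1n mul1r coefMn coefXn.
  rewrite big_ord_recr/= binn mulr1n.
  rewrite addrK big_ord_recr/= binSn.
  move: ei; rewrite leq_eqVlt => /predU1P[<-|ei].
    rewrite eqxx big1; last first.
      move=> j _; rewrite (_ : (e == j) = false) ?mul0rn//.
      by apply/negbTE; rewrite neq_ltn ltn_ord orbT.
    rewrite add0r /c mulr_natr -mulr_natr divfK ?pnatr_eq0// /lead_coef.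
    by rewrite -/e subrr.
  rewrite (_ : (i == e) = false) ?mul0rn ?addr0; last first.
    by apply/negbTE; rewrite neq_ltn ei orbT.
  rewrite big1 ?mulr0 ?subr0; first by apply: nth_default; rewrite eP.
  move=> j _; rewrite (_ : (i == j) = false) ?mul0rn//.
  by apply/negbTE; rewrite neq_ltn (ltn_trans _ ei) ?orbT.
exists (Q + c *: 'X^(e.+1)); rewrite comp_polyD comp_polyZ comp_Xn_poly.
by rewrite opprD addrACA hQ -scalerBr subrK.
Qed.

Lemma evpoly_diff u : evpoly (fun k => u k.+1 - u k) -> evpoly u.
Proof.
move=> [P [k0 hP]]; have [Q hQ] := antidifference P.
exists (Q + (u k0 - Q.[k0%:R])%:P), k0 => k; rewrite hornerD hornerC.
elim: k => [|k IH]; first by rewrite leqn0 => /eqP ->; rewrite addrC subrK.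
rewrite leq_eqVlt => /predU1P[->|k0k]; first by rewrite addrC subrK.
rewrite -[LHS](subrK (u k)) hP// IH// -hQ hornerD hornerN horner_comp.
by rewrite hornerD hornerX hornerC -natr1 subrKA.
Qed.

Lemma evpoly_shift u : evpoly u -> evpoly (fun k => u k.-1).
Proof.
move=> [P [k0 hP]]; exists (P \Po ('X - 1)), k0.+1 => -[//|k] k0k /=.
by rewrite hP// horner_comp hornerD hornerX hornerN hornerC -natr1 addrK.
Qed.

Lemma evpoly_unshift u : evpoly (fun k => u k.+1) -> evpoly u.
Proof.
by move=> /evpoly_shift; apply: (@evpoly_eq _ _ 1) => -[].
Qed.

Section Downset.
Context {m : nat}.
Implicit Types (a b : 'X_{1..m}) (D : set 'X_{1..m}) (p : 'X_{1..m} -> R).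

Definition delta (j : 'I_m) p a := p (a + U_(j))%MM - p a.

(** Polynomial functions of degree below [e], described by the vanishing of all [e]-fold
    differences, since differences are what the recursion on [k] produces. *)
Fixpoint polynomial_lt (e : nat) p : Prop :=
  if e is e'.+1 then forall j, polynomial_lt e' (delta j p) else p = fun=> 0.

Lemma polynomial_ltD e p q : polynomial_lt e p -> polynomial_lt e q ->
  polynomial_lt e (fun a => p a + q a).
Proof.
elim: e p q => [|e IH] p q /=; first by move=> -> ->; apply/funext => a; rewrite addr0.
move=> hp hq j; rewrite (_ : delta _ _ = fun a => delta j p a + delta j q a); first exact: IH.
by apply/funext => a; rewrite /delta opprD addrACA.
Qed.

Lemma polynomial_ltS e p : polynomial_lt e p -> polynomial_lt e.+1 p.
Proof.
elim: e p => [|e IH] p; last by move=> hp j; apply: IH; exact: hp.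
by move=> /= -> j; apply/funext => a; rewrite /delta subrr.
Qed.

Lemma polynomial_lt_shift e p j : polynomial_lt e p ->
  polynomial_lt e (fun a => p (a + U_(j))%MM).
Proof.
move=> hp; rewrite (_ : (fun _ => _) = fun a => p a + delta j p a); last first.
  by apply/funext => a; rewrite /delta addrC subrK.
apply: polynomial_ltD => //; case: e hp => [/= -> |e hp].
  by apply/funext => a; rewrite /delta subrr.
by apply: polynomial_ltS; exact: hp.
Qed.

Lemma polynomial_lt_const c : polynomial_lt 1 (fun=> c).
Proof. by move=> j /=; apply/funext => a; rewrite /delta subrr. Qed.

Lemma polynomial_lt_coord (i : 'I_m) : polynomial_lt 2 (fun a => (a i)%:R).
Proof.
move=> j; rewrite (_ : delta _ _ = fun=> (j == i)%:R); first exact: polynomial_lt_const.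
by apply/funext => a; rewrite /delta mnmDE mnm1E natrD addrAC subrr add0r.
Qed.

Lemma polynomial_lt_coord2 (i k : 'I_m) : polynomial_lt 3 (fun a => (a i)%:R * (a k)%:R).
Proof.
have Z c l : polynomial_lt 2 (fun a => c * (a l)%:R).
  move=> j; rewrite (_ : delta _ _ = fun=> c * (j == l)%:R); first exact: polynomial_lt_const.
  by apply/funext => a; rewrite /delta mnmDE mnm1E natrD mulrDr addrAC subrr add0r.
move=> j; rewrite (_ : delta _ _ =
  fun a => ((j == i)%:R * (a k)%:R + (j == k)%:R * (a i)%:R) + (j == i)%:R * (j == k)%:R).
  by apply: polynomial_ltD; [exact: polynomial_ltD|apply: polynomial_ltS; exact: polynomial_lt_const].
by apply/funext => a; rewrite /delta !mnmDE !mnm1E !natrD; ring.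
Qed.

(* The part of [D] off the hyperplane [a_j = 0] is a translate of a downset
   [D'] contained in [D].  If [D' = D] this gives a difference equation whose
   right-hand side involves a lower-degree [p] or a smaller downset. *)
Lemma evpoly_dsum D e p : downset D -> polynomial_lt e p -> evpoly (dsum D p).
Proof.
move=> dD; move: D dD e p.
apply: (downset_ind (P := fun D => forall e p, polynomial_lt e p -> evpoly (dsum D p))).
move=> D dD IH.
have [[j [a0 Da0 a0j]]|h] := pselect (exists j, exists2 a, D a & a j <> 0%N); last first.
  move=> e p _; exists 0, 1%N => k k0; rewrite horner0 /dsum big1_seq// => a /andP[/asboolP Da].
  rewrite mem_mons => /eqP ak; exfalso; move: k0; rewrite -ak lt0n mdeg_eq0 => /eqP; apply.
  by apply/mnmP => j; rewrite mnm0E; apply: contrapT => aj; apply: h; exists j, a.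
pose D0 := [set a | D a /\ a j = 0%N].
have dD0 : downset D0.
  move=> a b [/dD Da]; rewrite mnmDE => /eqP; rewrite addn_eq0 => /andP[/eqP aj _].
  by split.
pose D1 := [set a | D (a + U_(j))%MM].
have dD1 : downset D1 by move=> a b; rewrite /D1 /= -addmA [(b + _)%MM]addmC addmA => /dD.
have sD1 : D1 `<=` D by move=> a; apply: dD.
have E0 e p : polynomial_lt e p -> evpoly (dsum D0 p).
  by apply: IH => //; [move=> a []|exists a0 => // -[]].
have [[a Da nDa]|h] := pselect (exists2 a, D a & ~ D1 a).
  move=> e p hp; apply: evpoly_unshift.
  apply: (@evpoly_eq (fun k => dsum D0 p k.+1 + dsum D1 (fun a => p (a + U_(j))%MM) k) _ 0).
    by move=> k _; rewrite [RHS](dsumS _ _ j).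
  apply: evpolyD.
    have [P [k0 hP]] := E0 _ _ hp; exists (P \Po ('X + 1)), k0 => k hk.
    by rewrite hP 1?(leq_trans hk)// horner_comp hornerD hornerX hornerC natr1.
  apply: (IH D1 dD1 sD1 _ e); first by exists a.
  exact: polynomial_lt_shift.
have D1E : D1 = D.
  apply/seteqP; split => // a Da; apply: contrapT => nDa; apply: h; by exists a.
elim=> [|e IHe] p hp.
  exists 0, 0%N => k _; rewrite horner0 /dsum; move: hp => /= ->.
  by rewrite big1.
apply: evpoly_diff.
apply: (@evpoly_eq (fun k => dsum D0 p k.+1 + dsum D (delta j p) k) _ 0).
  move=> k _; rewrite [dsum D p k.+1](dsumS _ _ j) -/D0 -/D1 D1E -addrA; congr (_ + _).
  by rewrite /dsum -sumrB.
apply: evpolyD; last exact: IHe.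
have [P [k0 hP]] := E0 _ _ hp; exists (P \Po ('X + 1)), k0 => k hk.
by rewrite hP 1?(leq_trans hk)// horner_comp hornerD hornerX hornerC natr1.
Qed.

End Downset.
End EventuallyPolynomial.

(** * Standard monomials and spectra *)

Lemma count_ltn (T : eqType) (p q : pred T) (s : seq T) (x : T) :
  (forall y, p y -> q y) -> x \in s -> q x -> ~~ p x -> (count p s < count q s)%N.
Proof.
move=> pq xs qx npx; apply: (@leq_trans (count (predU p (pred1 x)) s)).
  rewrite -[X in (_ < X)%N]addn0.
  rewrite -(_ : count (predI p (pred1 x)) s = 0%N); last first.
    rewrite -(count_pred0 s); apply: eq_count => y /=.
    by case: eqP => [->|_]; rewrite ?(negbTE npx) ?andbF.
  by rewrite count_predUI -addn1 leq_add2l -has_count has_pred1.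
by apply: sub_count => y /= /orP[/pq//|/eqP->].
Qed.

Lemma max_elt (T : eqType) (lt : rel T) (s : seq T) :
  (forall a, lt a a = false) -> (forall a b c, lt a b -> lt b c -> lt a c) ->
  (forall a b, a != b -> lt a b || lt b a) -> s != [::] ->
  exists2 a, a \in s & forall b, b \in s -> b != a -> lt b a.
Proof.
move=> irr tr tot; elim: s => // x s IH _.
have [->|/IH[a as_ ha]] := eqVneq s [::].
  by exists x => [|b]; rewrite inE ?eqxx// => /eqP->; rewrite eqxx.
have [xa|] := boolP (lt x a).
  by exists a => [|b]; rewrite inE ?as_ ?orbT// => /orP[/eqP->|/ha].
move=> nxa; have [xa|xa] := eqVneq x a.
  exists a => [|b]; rewrite inE ?as_ ?orbT// => /orP[/eqP-> |/ha//].
  by rewrite xa eqxx.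
have ax : lt a x by move: (tot _ _ xa); rewrite (negbTE nxa).
exists x => [|b]; rewrite inE ?eqxx// => /orP[/eqP->|bs]; first by rewrite eqxx.
by have [->//|/(ha b bs) ba _] := eqVneq b a; exact: tr ax.
Qed.

Section WeightedDegree.
Context (R : realDomainType) {m : nat} (lam : 'I_m -> R).
Implicit Types (a b : 'X_{1..m}).

Definition wdeg a : R := \sum_i lam i *+ a i.

Lemma wdegD a b : wdeg (a + b)%MM = wdeg a + wdeg b.
Proof. by rewrite /wdeg -big_split/=; apply: eq_bigr => i _; rewrite mnmDE mulrnDr. Qed.

Lemma wdeg0 : wdeg 0%MM = 0.
Proof. by rewrite /wdeg big1// => i _; rewrite mnm0E. Qed.

Lemma wdegU i : wdeg U_(i)%MM = lam i.
Proof.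
rewrite /wdeg (bigD1 i)//= mnm1E eqxx big1 ?addr0// => j ji.
by rewrite mnm1E eq_sym (negbTE ji).
Qed.

(** Weight first, ties broken by the monomial order. The order is total and compatible with
    products, but not a well-order in general, as weights may be negative; termination comes from
    fixing the degree. *)
Definition ltw a b := (wdeg a < wdeg b) || ((wdeg a == wdeg b) && (a < b)%O).

Lemma ltw_irr a : ltw a a = false.
Proof. by rewrite /ltw !ltxx eqxx. Qed.

Lemma ltw_trans a b c : ltw a b -> ltw b c -> ltw a c.
Proof.
rewrite /ltw => /orP[ab|/andP[/eqP ab ab']] /orP[bc|/andP[/eqP bc bc']].
- by rewrite (lt_trans ab bc).
- by rewrite -bc ab.
- by rewrite ab bc.
- by rewrite ab bc eqxx (lt_trans ab' bc') orbT.
Qed.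

Lemma ltw_total a b : a != b -> ltw a b || ltw b a.
Proof. by rewrite /ltw => ab; case: ltgtP => //= _; rewrite -neq_lt. Qed.

Lemma ltwD a b c : ltw a b -> ltw (a + c)%MM (b + c)%MM.
Proof. by rewrite /ltw !wdegD ltrD2r (inj_eq (addIr _)) ltmc_add2l. Qed.

Lemma ltw_wdeg a b : ltw a b -> wdeg a <= wdeg b.
Proof. by move=> /orP[/ltW//|/andP[/eqP-> _]]. Qed.

End WeightedDegree.

Section Monomials.
Context (K : fieldType) (T : Type) {m : nat} (v : 'I_m -> (T -> K^o)).
Local Notation E := (T -> K^o).
Implicit Types (a b c : 'X_{1..m}).

Definition mon a : E := \prod_i v i ^+ a i.

Lemma monD a b : mon (a + b)%MM = mon a * mon b.
Proof. by rewrite /mon -big_split/=; apply: eq_bigr => i _; rewrite mnmDE exprD. Qed.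

Lemma mon0 : mon 0%MM = 1.
Proof. by rewrite /mon big1// => i _; rewrite mnm0E expr0. Qed.

Lemma monU i : mon U_(i)%MM = v i.
Proof.
rewrite /mon (bigD1 i)//= mnm1E eqxx expr1 big1 ?mulr1// => j ji.
by rewrite mnm1E eq_sym (negbTE ji) expr0.
Qed.

Lemma fct_scalerAl (c : K) (f g : E) : c *: (f * g) = (c *: f) * g.
Proof. by apply/funext => x; exact: mulrA. Qed.

Lemma fct_scalerAr (c : K) (f g : E) : c *: (f * g) = f * (c *: g).
Proof. by apply/funext => x; exact: mulrCA. Qed.

Lemma lspan_mulr (S S' : set E) (f : E) : (forall s, S s -> lspan S' (s * f)) ->
  forall s, lspan S s -> lspan S' (s * f).
Proof.
move=> h _ [p [c [u [uS ->]]]]; rewrite mulr_suml; apply: subspace_sum.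
  exact: subspace_lspan.
move=> j _; rewrite -fct_scalerAl; apply: subspaceZ; first exact: subspace_lspan.
exact: h.
Qed.

Lemma lspan_mul (S S' S'' : set E) :
  (forall s s', S s -> S' s' -> lspan S'' (s * s')) ->
  forall s s', lspan S s -> lspan S' s' -> lspan S'' (s * s').
Proof.
move=> h s s' Ss Ss'; apply: lspan_mulr Ss => {}s Ss; rewrite mulrC.
by apply: lspan_mulr Ss' => {}s' Ss'; rewrite mulrC; exact: h.
Qed.

Section Standard.
Variables (lt cls : rel 'X_{1..m}) (I : 'X_{1..m} -> set E).
Hypothesis lt_irr : forall a, lt a a = false.
Hypothesis lt_tr : forall a b c, lt a b -> lt b c -> lt a c.
Hypothesis lt_tot : forall a b, a != b -> lt a b || lt b a.
Hypothesis cls_refl : forall a, cls a a.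
Hypothesis cls_sym : forall a b, cls a b -> cls b a.
Hypothesis cls_tr : forall a b c, cls a b -> cls b c -> cls a c.
Hypothesis cls_mdeg : forall a b, cls a b -> mdeg a = mdeg b.
Hypothesis I_sub : forall a, is_subspace (I a).
Hypothesis I_cls : forall a b, cls a b -> I a `<=` I b.

(** The monomials outside an initial ideal, in a form general enough for two uses: [cls] tells which
    monomials may share a relation, and [I a] is what is divided out. Below, [cls] is the degree
    with [I] zero, or the bidegree with [I] an ideal. *)
Definition lower a : set E :=
  sumset (lspan [set s | exists b, [/\ cls a b, lt b a & s = mon b]]) (I a).

Definition std a : Prop := ~ lower a (mon a).

Let size_lower a := count (lt^~ a) (mons (mdeg a)).

(** Rewriting replaces a monomial by smaller ones of the same degree; [size_lower] counts these and
    decreases. *)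
Lemma std_span a :
  sumset (lspan [set s | exists b, [/\ std b, cls a b, (b == a) || lt b a & s = mon b]]) (I a)
    (mon a).
Proof.
have [k] := ubnP (size_lower a); elim: k a => // k IH a; rewrite ltnS => ak.
set W := lspan _; have Wsub : is_subspace W by exact: subspace_lspan.
have [sa|] := pselect (std a).
  by apply: sumset_l => //; apply: sub_lspan; exists a; split => //; rewrite eqxx.
move=> /contrapT[u hu Iu].
rewrite -(subrK u (mon a)); apply: subspaceD; [exact: subspace_sumset| exact: sumset_r|].
move: u hu {Iu}; apply: lspan_sub; first exact: subspace_sumset.
move=> _ [b [ab ba ->]].
have [|u hu Iu] := IH b.
  apply: leq_trans ak; rewrite /size_lower (cls_mdeg ab).
  apply: (@count_ltn _ _ _ _ b); rewrite ?mem_mons ?lt_irr//.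
  by move=> y /= yb; exact: lt_tr ba.
exists u; last by apply: I_cls Iu; exact: cls_sym.
move: u hu {Iu}; apply: lspan_mono => _ [c [sc bc cb ->]]; exists c; split => //.
  exact: cls_tr bc.
by move: cb => /predU1P[->|cb]; rewrite ?ba ?orbT// (lt_tr cb ba) orbT.
Qed.

(** The largest monomial of a relation would be congruent to smaller ones of its class, so it could
    not be standard. *)
Lemma std_indep k (Q : pred 'X_{1..m}) (c : 'X_{1..m} -> K) a0 :
  (forall a, Q a -> std a /\ cls a0 a) ->
  I a0 (\sum_(a <- mons k | Q a) c a *: mon a) ->
  forall a, mdeg a = k -> Q a -> c a = 0.
Proof.
move=> hQ Ic a ak Qa; apply/eqP; apply: contrapT => /negP ca.
pose s := [seq a <- mons k | Q a & c a != 0].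
have [|b] := max_elt lt_irr lt_tr lt_tot (s := s).
  have : a \in s by rewrite mem_filter Qa ca mem_mons ak eqxx.
  by apply: contraTneq => ->.
rewrite mem_filter => /andP[/andP[Qb cb] bk] hb; have [sb a0b] := hQ b Qb; apply: sb.
set S := \sum_(_ <- _ | _) _ in Ic.
exists (mon b - (c b)^-1 *: S); last first.
  by rewrite opprB addrC subrK; apply: subspaceZ => //; exact: I_cls Ic.
rewrite /S big_mkcond (bigD1_seq b) ?mons_uniq//= Qb scalerDr scalerA mulVf// scale1r.
rewrite opprD addNKr -scaleNr; apply: subspaceZ; first exact: subspace_lspan.
rewrite big_seq_cond; apply: subspace_sum; first exact: subspace_lspan.
move=> d /andP[dk db]; case: ifPn => [Qd|_]; last exact: subspace0 (subspace_lspan _).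
have [->|cd] := eqVneq (c d) 0; first by rewrite scale0r; exact: subspace0 (subspace_lspan _).
apply: subspaceZ; first exact: subspace_lspan.
apply: sub_lspan; exists d; split => //.
  by apply: cls_tr (cls_sym a0b) _; case: (hQ d Qd).
by apply: hb => //; rewrite mem_filter Qd cd.
Qed.

Definition std_in a0 (Q : pred 'X_{1..m}) : seq 'X_{1..m} :=
  [seq a <- mons (mdeg a0) | [&& `[< std a >], cls a0 a & Q a]].

(** Rewriting only moves down in [lt], so it does not leave the span of an initial segment [Q]. *)
Lemma std_rel_basis a0 (Q : pred 'X_{1..m}) :
  (forall a b, cls a0 a -> cls a0 b -> Q b -> lt a b -> Q a) ->
  rel_basis (sumset (lspan [set s | exists b, [/\ cls a0 b, Q b & s = mon b]]) (I a0)) (I a0)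
    (fun i : 'I_(size (std_in a0 Q)) => mon (nth 0%MM (std_in a0 Q) i)).
Proof.
move=> hQ; set L := std_in a0 Q.
have LP a : (a \in L) = [&& `[< std a >], cls a0 a & Q a].
  rewrite mem_filter mem_mons; case: (boolP (cls a0 a)) => [/cls_mdeg->|]; rewrite ?andbF//.
  by rewrite eqxx andbT.
have sumE (c : 'X_{1..m} -> K) : \sum_(i < size L) c (nth 0%MM L i) *: mon (nth 0%MM L i) =
    \sum_(a <- mons (mdeg a0) | [&& `[< std a >], cls a0 a & Q a]) c a *: mon a.
  by rewrite -[RHS]big_filter [RHS](big_nth 0%MM) big_mkord.
apply: rel_basisP => //.
- move=> i; apply: sumset_l => //; apply: sub_lspan; exists (nth 0%MM L i).
  by have : nth 0%MM L i \in L by [exact: mem_nth]; rewrite LP => /and3P[].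
- move=> s [u hu Iu].
  pose W : set E := [set u | exists c : 'X_{1..m} -> K, I a0 (u - \sum_(a <- L) c a *: mon a)].
  suff [c hc] : W u.
    exists (fun i => c (nth 0%MM L i)).
    rewrite (sumE c) -big_filter -/(std_in a0 Q) -(subrKA u).
    exact: subspaceD.
  have Wsub : is_subspace W.
    split.
      exists (fun=> 0); rewrite big1 ?subr0//; first exact: subspace0.
      by move=> a _; rewrite scale0r.
    move=> c x y [cx hx] [cy hy]; exists (fun a => c * cx a + cy a).
    rewrite (_ : _ - _ = c *: (x - \sum_(a <- L) cx a *: mon a) + (y - \sum_(a <- L) cy a *: mon a)).
      by case: (I_sub a0) => _; apply.
    rewrite scalerBr addrACA -opprD scaler_sumr -big_split/=; congr (_ - _).
    by apply: eq_bigr => a _; rewrite scalerA scalerDl.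
  move: u hu {Iu}; apply: lspan_sub => // _ [b [a0b Qb ->]].
  have [u hu Iu] := std_span b.
  have [c hc] : W u.
    move: u hu {Iu}; apply: lspan_sub => // _ [d [sd bd db ->]].
    exists (fun a => (a == d)%:R).
    rewrite (bigD1_seq d)/= ?eqxx ?scale1r; last by rewrite filter_uniq// mons_uniq.
      rewrite big1 ?addr0 ?subrr; first exact: subspace0.
      by move=> a /negbTE ->; rewrite scale0r.
    rewrite LP; apply/and3P; split; [exact/asboolP|exact: cls_tr bd|].
    by move: db => /predU1P[->//|]; apply: hQ Qb => //; exact: cls_tr bd.
  exists c; rewrite -(subrKA u); apply: subspaceD => //.
  by apply: I_cls Iu; exact: cls_sym.
- move=> c Ic i; pose c' a := c (insubd i (index a L)).
  have Lu : uniq L by rewrite filter_uniq// mons_uniq.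
  have c'E (j : 'I_(size L)) : c' (nth 0%MM L j) = c j.
    by rewrite /c' index_uniq//; congr c; apply: val_inj; rewrite insubdK// -topredE /= ltn_ord.
  have {}Ic : I a0 (\sum_(a <- mons (mdeg a0) | [&& `[< std a >], cls a0 a & Q a]) c' a *: mon a).
    by rewrite -sumE; under eq_bigr do rewrite c'E.
  have := mem_nth 0%MM (ltn_ord i); rewrite LP => iL; rewrite -c'E.
  apply: (std_indep _ Ic) => //.
    by move=> a /and3P[/asboolP].
  by move: iL => /and3P[_ /cls_mdeg -> _].
Qed.

Hypothesis ltD : forall a b c, lt a b -> lt (a + c)%MM (b + c)%MM.
Hypothesis clsD : forall a b c, cls a b -> cls (a + c)%MM (b + c)%MM.
Hypothesis ID : forall a c s, I a s -> I (a + c)%MM (s * mon c).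

(** Multiplication by [mon c] carries a relation showing that [a] is not standard to one showing it
    for [(a + c)%MM]. *)
Lemma std_downset : downset std.
Proof.
move=> a c h [u hu Iu]; apply: h; rewrite monD; exists (u * mon c); last first.
  by rewrite -mulrBl; exact: ID.
apply: lspan_mulr hu => _ [b [ab ba ->]]; apply: sub_lspan; exists (b + c)%MM.
by rewrite monD; split => //; [exact: clsD|exact: ltD].
Qed.

End Standard.
End Monomials.

(** * Spectra of filtrations by weight *)

Section Spectrum.
Context (R : realDomainType) (K : fieldType) (E : lmodType K).
Implicit Types (S : R -> set E) (s : seq R).

Lemma count_le_perm s s' :
  (forall x, count (fun y => y <= x) s = count (fun y => y <= x) s') -> perm_eq s s'.
Proof.
move=> h; rewrite -(perm_sort <=%R s) perm_sym -(perm_sort <=%R s') perm_sym.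
have {h} : forall x, count (fun y => y <= x) (sort <=%R s) = count (fun y => y <= x) (sort <=%R s').
  by move=> x; rewrite !(permP (permEl (perm_sort _ _))).
move: (sort_le_sorted s) (sort_le_sorted s').
elim: (sort _ s) (sort _ s') => [|a t IH] [|b t'] //=.
- by move=> _ _ /(_ b)/eqP; rewrite lexx.
- by move=> _ _ /(_ a)/eqP; rewrite lexx.
have zero (c d : R) u : path <=%R d u -> c < d -> count (fun y => y <= c) u = 0%N.
  move=> pu cd; apply/eqP; rewrite -leqn0 leqNgt -has_count; apply/hasPn => y yu.
  by rewrite /= -ltNge (lt_le_trans cd)//; move/(order_path_min le_trans)/allP: pu; apply.
move=> pt pt' h; have ab : a = b.
  have [ab|ba|//] := ltgtP a b.
    by move: (h a); rewrite lexx leNgt ab (zero a b t').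
  by move: (h b); rewrite lexx leNgt ba (zero b a t).
move: h pt'; rewrite -ab => h pt'; rewrite perm_cons; apply: IH.
- exact: path_sorted pt.
- exact: path_sorted pt'.
- by move=> x; apply/eqP; rewrite -(eqn_add2l (a <= x)%R) h.
Qed.

(** The list [s] of jumps of the filtration [S], with multiplicities, characterised by dimensions so
    that it does not depend on a basis. *)
Definition is_spec S s := forall x,
  exists e : 'I_(count (fun y => y <= x) s) -> E, rel_basis (S x) [set 0] e.

Lemma spec_perm S s s' : (forall x, is_subspace (S x)) ->
  is_spec S s -> is_spec S s' -> perm_eq s s'.
Proof.
move=> hS hs hs'; apply: count_le_perm => x; have [e be] := hs x; have [e' be'] := hs' x.
exact: rel_basis_dim (hS x) (subspace_set0 E) be be'.
Qed.

End Spectrum.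

Section WeightFiltration.
Context (R : realDomainType) (K : fieldType) (T : Type) {m : nat}.
Context (v : 'I_m -> (T -> K^o)).
Local Notation E := (T -> K^o).
Implicit Types (a b c : 'X_{1..m}) (lam : 'I_m -> R).

(** The multiplicative filtration in which [v j] has weight [lam j]. For integral weights,
    [Sk lam k i] is the bidegree [(k, i)] piece of the Rees algebra. *)
Definition Sk lam k x : set E :=
  lspan [set s | exists b, [/\ mdeg b = k, wdeg lam b <= x & s = mon v b]].

Lemma subspace_Sk lam k x : is_subspace (Sk lam k x).
Proof. exact: subspace_lspan. Qed.

Lemma Sk_mon lam a x : wdeg lam a <= x -> Sk lam (mdeg a) x (mon v a).
Proof. by move=> ax; apply: sub_lspan; exists a. Qed.

Lemma Sk_le lam k x y : x <= y -> Sk lam k x `<=` Sk lam k y.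
Proof.
by move=> xy; apply: lspan_mono => s [b [bk bx ->]]; exists b; split => //; exact: le_trans xy.
Qed.

Lemma Sk_mul lam k l x y s s' :
  Sk lam k x s -> Sk lam l y s' -> Sk lam (k + l) (x + y) (s * s').
Proof.
apply: lspan_mul => _ _ [b [<- bx ->]] [c [<- cy ->]].
by rewrite -monD -mdegD; apply: Sk_mon; rewrite wdegD lerD.
Qed.

Definition stdw lam := std v (ltw lam) (fun a b => mdeg a == mdeg b) (fun=> [set 0]).

Lemma stdw_downset lam : downset (stdw lam).
Proof.
apply: std_downset.
- exact: ltwD.
- by move=> a b c /eqP ab; rewrite !mdegD ab.
- by move=> a c _ ->; rewrite mul0r.
Qed.

Lemma sumset0 (W : set E) : sumset W [set 0] = W.
Proof.
apply/seteqP; split => [s [u Wu /eqP]|s Ws]; first by rewrite subr_eq0 => /eqP->.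
by exists s => //; rewrite /= subrr.
Qed.

Lemma std_filter_basis lam (Q : pred 'X_{1..m}) k :
  (forall a b, mdeg a = k -> mdeg b = k -> Q b -> ltw lam a b -> Q a) ->
  exists e : 'I_(count (fun a => `[< stdw lam a >] && Q a) (mons k)) -> E,
    rel_basis (lspan [set s | exists b, [/\ mdeg b = k, Q b & s = mon v b]]) [set 0] e.
Proof.
move=> hQ; rewrite -size_filter.
have [monsk|[a0 a0k]] : mons k = [::] :> seq 'X_{1..m} \/ exists a0 : 'X_{1..m}, mdeg a0 = k.
  case: (mons k) (@mem_mons m k) => [|a s]; first by left.
  by move=> h; right; exists a; apply/eqP; rewrite -h inE eqxx.
  rewrite monsk /=; exists (fun i : 'I_0 => 0); split; first by case.
  move=> s hs; exists [ffun i => 0]; split => [|c _]; last by apply/ffunP => -[].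
  rewrite big_ord0 subr0; move: s hs; apply: lspan_sub; first exact: subspace_set0.
  by move=> s [b [bk _ _]]; have := @mem_mons m k b; rewrite monsk bk eqxx.
have := @std_rel_basis K T m v (ltw lam) (fun a b => mdeg a == mdeg b) (fun=> [set 0])
  (ltw_irr lam) (@ltw_trans _ _ lam) (@ltw_total _ _ lam) _ _ _ _ _ _ a0 Q _.
rewrite sumset0 /std_in a0k -/(stdw lam).
rewrite (_ : [set s | exists b, [/\ k == mdeg b, _ & _]] =
   [set s | exists b, [/\ mdeg b = k, Q b & s = mon v b]]); last first.
  by apply/seteqP; split=> s [b [bk Qb ->]]; exists b; split => //; [apply/esym/eqP|apply/eqP/esym].
set L := [seq _ <- _ | _]; set L' := [seq _ <- _ | _].
have -> : L = L'.
  apply: eq_in_filter => a; rewrite mem_mons => /eqP ->; by rewrite eqxx.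
move=> h; exists (fun i => mon v (nth 0%MM L' i)); apply: h => //.
- by move=> a b; rewrite eq_sym.
- by move=> a b c /eqP-> /eqP->.
- by move=> a b /eqP.
- by move=> a; exact: subspace_set0.
- by move=> a b _ s.
- by move=> a b /eqP/esym ka /eqP/esym kb; apply: hQ.
Qed.

Definition spectrum lam k : seq R := [seq wdeg lam a | a <- mons k & `[< stdw lam a >]].

(* A basis of weighted monomials, standard for [lam], computes the spectrum of
   any [lam0] whose strict inequalities in degree [k] persist for [lam]. *)
Lemma Sk_spec_near lam lam0 k :
  (forall a b, mdeg a = k -> mdeg b = k -> wdeg lam0 a < wdeg lam0 b ->
     wdeg lam a < wdeg lam b) ->
  is_spec (Sk lam0 k) [seq wdeg lam0 a | a <- mons k & `[< stdw lam a >]].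
Proof.
move=> h x; rewrite count_map count_filter.
have [|e be] := @std_filter_basis lam (fun a => wdeg lam0 a <= x) k.
  move=> a b ak bk bx ab; rewrite leNgt; apply/negP => /(le_lt_trans bx)/(h _ _ bk ak).
  by move/(fun h => le_lt_trans (ltw_wdeg ab) h); rewrite ltxx.
rewrite (@eq_count _ _ (fun a => `[< stdw lam a >] && (wdeg lam0 a <= x))); last first.
  by move=> a /=; rewrite andbC.
by exists e.
Qed.

Lemma spectrumP lam k : is_spec (Sk lam k) (spectrum lam k).
Proof. exact: Sk_spec_near. Qed.

Lemma spec_near_perm lam lam0 k :
  (forall a b, mdeg a = k -> mdeg b = k -> wdeg lam0 a < wdeg lam0 b ->
     wdeg lam a < wdeg lam b) ->
  perm_eq [seq wdeg lam0 a | a <- mons k & `[< stdw lam a >]] (spectrum lam0 k).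
Proof.
move=> h; apply: (@spec_perm _ _ _ (Sk lam0 k)); first by move=> x; exact: subspace_Sk.
  exact: Sk_spec_near.
exact: spectrumP.
Qed.

Definition Rk k : set E := lspan [set s | exists2 b, mdeg b = k & s = mon v b].

Lemma subspace_Rk k : is_subspace (Rk k).
Proof. exact: subspace_lspan. Qed.

Lemma Rk_mon a : Rk (mdeg a) (mon v a).
Proof. by apply: sub_lspan; exists a. Qed.

Lemma Rk_mul k l s s' : Rk k s -> Rk l s' -> Rk (k + l) (s * s').
Proof.
by apply: lspan_mul => _ _ [b <- ->] [c <- ->]; rewrite -monD -mdegD; exact: Rk_mon.
Qed.

Lemma Sk_Rk lam k x : Sk lam k x `<=` Rk k.
Proof. by apply: lspan_mono => s [b [bk _ ->]]; exists b. Qed.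

Lemma std_Rk_basis lam k :
  exists e : 'I_(size (spectrum lam k)) -> E, rel_basis (Rk k) [set 0] e.
Proof.
have [//|e be] := @std_filter_basis lam predT k.
rewrite size_map size_filter (@eq_count _ _ (fun a => `[< stdw lam a >] && true)); last first.
  by move=> a; rewrite andbT.
exists e; move: be; rewrite (_ : [set s | _] = [set s | exists2 b, mdeg b = k & s = mon v b])//.
by apply/seteqP; split => s; [move=> [b [bk _ ->]]; exists b|move=> [b bk ->]; exists b].
Qed.

Lemma size_spectrum lam lam' k : size (spectrum lam k) = size (spectrum lam' k).
Proof.
have [e be] := std_Rk_basis lam k; have [e' be'] := std_Rk_basis lam' k.
exact: rel_basis_dim (subspace_Rk k) (subspace_set0 _) be be'.
Qed.

Lemma dsum1_spectrum lam k : dsum (stdw lam) (fun=> 1%N) k = size (spectrum lam k).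
Proof. by rewrite /dsum sum1_count size_map size_filter. Qed.

(** For every [lam] the standard monomials of degree [k] number [dim (Rk k)], so all these downsets
    share one Hilbert function. *)
Lemma finite_stdw : finite_set [set stdw lam | lam in [set: 'I_m -> R]].
Proof.
apply: finite_downsets => [_ [lam _ <-]|_ _ [lam _ <-] [lam' _ <-] k].
  exact: stdw_downset.
by rewrite !dsum1_spectrum; exact: size_spectrum.
Qed.

End WeightFiltration.

(** * Sections on the central fibre *)

Section LocalCohomology.
Context (K : fieldType) (T : Type) {m : nat}.
Context (v : 'I_m -> (T -> K^o)) (w : 'I_m -> int).
Local Notation E := (T -> K^o).
Local Notation chi := (Sk v w).
Implicit Types (a b c : 'X_{1..m}) (I : nat -> int -> set E).

(* A bihomogeneous ideal of the Rees algebra [\bigoplus chi k i t^i]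
   containing [t]. *)
Record bideal I : Prop := BIdeal {
  bideal_sub : forall k i, is_subspace (I k i);
  bideal_t : forall k i, chi k (i - 1) `<=` I k i;
  bideal_chi : forall k i, I k i `<=` chi k i;
  bideal_mul : forall k i l j s s', I k i s -> chi l j s' -> I (k + l)%N (i + j) (s * s')
}.

Definition bicls a b := (mdeg a == mdeg b) && (wdeg w a == wdeg w b).

Definition bilower I a : set E := I (mdeg a) (wdeg w a).

Definition bistd I := std v (ltw w) bicls (bilower I).

Lemma bicls_refl a : bicls a a. Proof. by rewrite /bicls !eqxx. Qed.

Lemma bicls_sym a b : bicls a b -> bicls b a.
Proof. by rewrite /bicls eq_sym [wdeg w a == _]eq_sym. Qed.

Lemma bicls_tr a b c : bicls a b -> bicls b c -> bicls a c.
Proof. by rewrite /bicls => /andP[/eqP-> /eqP->]. Qed.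

Lemma bicls_mdeg a b : bicls a b -> mdeg a = mdeg b.
Proof. by move=> /andP[/eqP]. Qed.

Lemma bilower_cls I a b : bicls a b -> bilower I a `<=` bilower I b.
Proof. by rewrite /bilower => /andP[/eqP-> /eqP->]. Qed.

Lemma bistd_downset I : bideal I -> downset (bistd I).
Proof.
move=> hI; apply: std_downset => [a b c|a b c|a c s].
- exact: ltwD.
- by rewrite /bicls !mdegD !wdegD eqn_add2r (inj_eq (addIr _)).
- by rewrite /bilower mdegD wdegD => Is; apply: (bideal_mul hI) => //; exact: Sk_mon.
Qed.

Lemma bideal_lt I k i j : bideal I -> i < j -> chi k i `<=` I k j.
Proof. by move=> hI ij s hs; apply: (bideal_t hI); apply: Sk_le hs; lia. Qed.

Lemma bideal_basis I a0 : bideal I ->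
  rel_basis (chi (mdeg a0) (wdeg w a0)) (bilower I a0)
    (fun i : 'I_(size (std_in v (ltw w) bicls (bilower I) a0 predT)) =>
       mon v (nth 0%MM (std_in v (ltw w) bicls (bilower I) a0 predT) i)).
Proof.
move=> hI; have := @std_rel_basis K T m v (ltw w) bicls (bilower I) (ltw_irr w)
  (@ltw_trans _ _ w) (@ltw_total _ _ w) bicls_refl bicls_sym bicls_tr bicls_mdeg
  (fun a => bideal_sub hI _ _) (@bilower_cls I) a0 predT (fun _ _ _ _ _ _ => isT).
rewrite (_ : sumset _ _ = chi (mdeg a0) (wdeg w a0))//.
apply/seteqP; split.
  move=> s [u hu Iu]; rewrite -(subrK u s); apply: subspaceD; first exact: subspace_Sk.
    exact: (bideal_chi hI) Iu.
  move: u hu {Iu}; apply: lspan_sub; first exact: subspace_Sk.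
  by move=> _ [b [/andP[/eqP -> /eqP ->] _ ->]]; exact: Sk_mon.
apply: lspan_sub.
  by apply: subspace_sumset; [exact: subspace_lspan|exact: (bideal_sub hI)].
move=> _ [b [bk + ->]]; rewrite le_eqVlt => /predU1P[bi|bi].
  apply: sumset_l; first exact: (bideal_sub hI).
  by apply: sub_lspan; exists b; rewrite /bicls bk bi !eqxx.
apply: sumset_r; first exact: subspace_lspan.
by rewrite /bilower -bk; apply: (bideal_lt hI bi); exact: Sk_mon.
Qed.

Lemma bistd_mono I I' : (forall k i, I k i `<=` I' k i) -> bistd I' `<=` bistd I.
Proof.
move=> sI a h; apply: contra_not h => -[u hu Iu]; exists u => //; exact: sI.
Qed.

(** If the standard monomials were the same, a basis of [chi] modulo [I] would stay free modulo
    [I'], leaving no room for an element of [I'] outside [I]. *)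
Lemma bistd_strict I I' k i s : bideal I -> bideal I' -> (forall k i, I k i `<=` I' k i) ->
  I' k i s -> ~ I k i s -> exists2 a, bistd I a & ~ bistd I' a.
Proof.
move=> hI hI' sI I's nIs; apply: contrapT => h; apply: nIs.
have stdE : bistd I' = bistd I.
  apply/seteqP; split; first exact: bistd_mono.
  by move=> a Ia; apply: contrapT => nI'a; apply: h; exists a.
have [[a0 [a0k a0i]]|none] := pselect (exists a0 : 'X_{1..m}, mdeg a0 = k /\ wdeg w a0 = i); last first.
  apply: (bideal_t hI); move: s I's => s /(bideal_chi hI').
  apply: lspan_sub => {s}; first exact: subspace_Sk.
  move=> _ [b [bk + ->]]; rewrite le_eqVlt => /predU1P[bi|bi].
    by exfalso; apply: none; exists b.
  by rewrite -bk; apply: Sk_mon; lia.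
have LE : std_in v (ltw w) bicls (bilower I') a0 predT = std_in v (ltw w) bicls (bilower I) a0 predT.
  by apply: eq_filter => a; rewrite -/(bistd I) -/(bistd I') stdE.
have B := bideal_basis a0 hI; have B' := bideal_basis a0 hI'.
have /= := rel_basis_indep (subspace_Sk v w _ _) (bideal_sub hI' _ _) B'.
rewrite LE => indep.
have [_ /(_ s)] := B; rewrite a0k a0i => /(_ (bideal_chi hI' I's))[c [Ic _]].
suff c0 j : c j = 0.
  move: Ic; rewrite big1 ?subr0; first by rewrite /bilower a0k a0i.
  by move=> j _; rewrite c0 scale0r.
apply: indep; set S := \sum_(i < _) _ in Ic *.
have -> : S = s - (s - S) by rewrite subKr.
rewrite a0k a0i; apply: subspaceB => //; first exact: (bideal_sub hI').
by move: Ic; rewrite /bilower a0k a0i; exact: sI.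
Qed.

Lemma bideal_ind (P : (nat -> int -> set E) -> Prop) :
  (forall I, bideal I ->
    (forall I', bideal I' -> (forall k i, I k i `<=` I' k i) ->
       (exists k i s, I' k i s /\ ~ I k i s) -> P I') -> P I) ->
  forall I, bideal I -> P I.
Proof.
move=> step I hI; move: (bistd_downset hI); move DE : (bistd I) => D dD.
move: D dD I hI DE; apply: (downset_ind (P := fun D => forall I, bideal I -> bistd I = D -> P I)).
move=> D dD IH I hI DE; apply: step => // I' hI' sI [k [i [s [I's nIs]]]].
apply: (IH (bistd I')) => //.
- exact: bistd_downset.
- by rewrite -DE; exact: bistd_mono.
- by rewrite -DE; exact: bistd_strict I's nIs.
Qed.

Lemma vchi j : chi 1 (w j) (v j).
Proof. by have := @Sk_mon _ _ _ _ v w U_(j)%MM (w j); rewrite mdeg1 wdegU monU; apply. Qed.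

Lemma vXchi j e : chi e (w j *+ e) (v j ^+ e).
Proof.
have := @Sk_mon _ _ _ _ v w (U_(j) *+ e)%MM (w j *+ e).
rewrite mdegMn mdeg1 mul1n; have -> : wdeg w (U_(j) *+ e)%MM = w j *+ e.
  by elim: e => [|e IH]; rewrite ?mulm0n ?wdeg0// mulmS wdegD IH wdegU mulrS.
have -> : mon v (U_(j) *+ e)%MM = v j ^+ e.
  by elim: e => [|e IH]; rewrite ?mulm0n ?mon0// mulmS monD IH monU exprS.
by apply.
Qed.

(** Bidegrees of products agree only up to [lia] and [ring]; this moves membership along such
    equalities. *)
Lemma set_cast (J : nat -> int -> set E) k k' i i' s s' :
  J k i s -> k = k' -> i = i' -> s = s' -> J k' i' s'.
Proof. by move=> + <- <- <-. Qed.

Definition colon I d l (f : E) k i : set E :=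
  [set s | chi k i s /\ I (k + d)%N (i + l) (s * f)].

Lemma bideal_colon I d l f : bideal I -> chi d l f -> bideal (colon I d l f).
Proof.
move=> hI hf; split.
- move=> k i; split.
    split; first exact: (subspace0 (subspace_Sk _ _ _ _)).
    by rewrite mul0r; exact: (subspace0 (bideal_sub hI _ _)).
  move=> c x y [hx Ix] [hy Iy]; split; first by case: (subspace_Sk v w k i) => _; apply.
  by rewrite mulrDl -fct_scalerAl; case: (bideal_sub hI (k + d)%N (i + l)) => _; apply.
- move=> k i s hs; split; first by apply: Sk_le hs; lia.
  by apply: (set_cast (bideal_mul hI (bideal_t hI (i := i) hs) hf)).
- by move=> k i s [].
- move=> k i l' j s s' [hs Is] hs'; split; first exact: Sk_mul.
  by apply: (set_cast (bideal_mul hI Is hs')); [lia|ring|rewrite mulrAC].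
Qed.

Lemma sub_colon I d l f : bideal I -> chi d l f -> forall k i, I k i `<=` colon I d l f k i.
Proof.
by move=> hI hf k i s Is; split; [exact: (bideal_chi hI)|exact: (bideal_mul hI)].
Qed.

Definition principal d l (f : E) k i : set E :=
  [set s | exists2 c, (if (d <= k)%N then chi (k - d)%N (i - l) else [set 0]) c & s = c * f].

Definition adjoin I d l (f : E) k i : set E := sumset (principal d l f k i) (I k i).

Lemma bideal_adjoin I d l f : bideal I -> chi d l f -> bideal (adjoin I d l f).
Proof.
move=> hI hf.
have Ps k i : is_subspace (principal d l f k i).
  have hs : is_subspace (if (d <= k)%N then chi (k - d)%N (i - l) else [set 0]).
    by case: ifP => _; [exact: subspace_Sk|exact: subspace_set0].
  split; first by exists 0; [exact: subspace0|rewrite mul0r].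
  move=> c _ _ [x hx ->] [y hy ->]; exists (c *: x + y); first by case: hs => _; apply.
  by rewrite mulrDl -fct_scalerAl.
split.
- by move=> k i; apply: subspace_sumset => //; exact: (bideal_sub hI).
- by move=> k i s hs; apply: sumset_r => //; exact: (bideal_t hI).
- move=> k i s [_ [c hc ->]] /(bideal_chi hI) h; rewrite -(subrK (c * f) s).
  apply: subspaceD h _; first exact: subspace_Sk.
  move: hc; case: ifP => [dk hc|_ ->]; last by rewrite mul0r; exact: subspace0 (subspace_Sk _ _ _ _).
  by apply: (set_cast (Sk_mul hc hf)) => //; [lia|ring].
- move=> k i l' j s s' [_ [c hc ->] Is] hs'; exists (c * f * s'); last first.
    by rewrite -mulrBl; exact: (bideal_mul hI).
  exists (c * s'); last by rewrite mulrAC.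
  move: hc; case: ifP => [dk hc|_ ->].
    by rewrite (leq_trans dk) ?leq_addr//; apply: (set_cast (Sk_mul hc hs')) => //; [lia|ring].
  by rewrite mul0r; case: ifP => _ //; exact: subspace0 (subspace_Sk _ _ _ _).
Qed.

Lemma sub_adjoin I d l f : forall k i, I k i `<=` adjoin I d l f k i.
Proof.
move=> k i; apply: sumset_r; have hs : is_subspace (if (d <= k)%N then chi (k - d)%N (i - l) else [set 0]).
  by case: ifP => _; [exact: subspace_Sk|exact: subspace_set0].
split; first by exists 0; [exact: subspace0|rewrite mul0r].
move=> c _ _ [x hx ->] [y hy ->]; exists (c *: x + y); first by case: hs => _; apply.
by rewrite mulrDl -fct_scalerAl.
Qed.

Lemma adjoin_gen I d l f k i g : bideal I -> chi k i g ->
  adjoin I d l f (k + d)%N (i + l) (g * f).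
Proof.
move=> hI hc; apply: sumset_l; first exact: (bideal_sub hI).
by exists g => //; rewrite leq_addl addnK addrK.
Qed.

Definition prime I := forall d l f k i g, chi d l f -> ~ I d l f -> chi k i g ->
  I (k + d)%N (i + l) (g * f) -> I k i g.

(** If [I] is not prime, some [f] outside [I] makes both [colon I d l f] and [adjoin I d l f]
    strictly larger than [I]. The exact sequence linking the quotients by these three ideals then
    reduces a property of [I] to larger ideals. *)
Lemma bideal_dichotomy I : bideal I ->
  prime I \/ exists d l f, [/\ chi d l f, ~ I d l f &
    exists k i g, colon I d l f k i g /\ ~ I k i g].
Proof.
move=> hI.
have [h|h] := pselect (prime I); [by left|right].
apply: contrapT => h'; apply: (h) => d l f k i g hf nIf hg Ifg.
by apply: contrapT => nIg; apply: h'; exists d, l, f; split => //; exists k, i, g.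
Qed.

Lemma bideal_all_v I : bideal I -> (forall j, I 1%N (w j) (v j)) ->
  forall k i, (0 < k)%N -> chi k i `<=` I k i.
Proof.
move=> hI hv k i k0; apply: lspan_sub; first exact: (bideal_sub hI).
move=> _ [b [bk bi ->]]; move: bi; rewrite le_eqVlt => /predU1P[bi|bi]; last first.
  by apply: (bideal_lt hI bi); rewrite -bk; exact: Sk_mon.
have [j bj] : exists j, b j != 0%N.
  apply/existsP; apply: contraTT k0 => /existsPn h; rewrite -bk mdegE big1// => j _.
  by apply/eqP; move: (h j); rewrite negbK.
have Uj : (U_(j) <= b)%MM.
  by apply/mnm_lepP => x; rewrite mnm1E; case: eqP => // <-; rewrite lt0n.
have := bideal_mul hI (hv j) (Sk_mon v (lexx (wdeg w (b - U_(j))%MM))).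
rewrite -monU -monD -(mdeg1 j) -mdegD -[X in I _ (X + _)](wdegU w j) -wdegD.
by rewrite addmC submK// bk bi.
Qed.

(** Vanishing of the local cohomology [H^0] of [chi / I] at the irrelevant ideal, in degrees at
    least [k0] and in all weights at once. *)
Definition H0_vanishes I := exists k0, forall k i s, (k0 <= k)%N -> chi k i s ->
  (exists e, forall j, I (k + e)%N (i + w j *+ e) (s * v j ^+ e)) -> I k i s.

Lemma H0_vanishing I : bideal I -> H0_vanishes I.
Proof.
move: I; apply: bideal_ind => I hI IH.
have [pI|[d [l [f [hf nIf hcolon]]]]] := bideal_dichotomy hI; last first.
  have hI1 := bideal_colon hI hf; have hI2 := bideal_adjoin hI hf.
  have [k1 h1] : H0_vanishes (colon I d l f).
    by apply: IH => //; exact: sub_colon.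
  have [k2 h2] : H0_vanishes (adjoin I d l f).
    apply: IH => //; first exact: sub_adjoin.
    exists d, l, f; split=> //; have := @adjoin_gen I d l f 0%N 0 1 hI.
    rewrite add0n add0r mul1r; apply.
    by have := Sk_mon v (lexx (wdeg w (0%MM : 'X_{1..m}))); rewrite mdeg0 wdeg0 mon0.
  (* The cofactor of [f] has degree [k - d], whence the shift of [k1]. *)
  exists (maxn (k1 + d) k2) => k i s; rewrite geq_max => /andP[k1k k2k] hs [e he].
  have [|_ [c hc ->] Ic] := h2 k i s k2k hs.
    by exists e => j; exact: sub_adjoin.
  move: hc; rewrite (leq_trans _ k1k) ?leq_addl// => hc.
  rewrite -(subrK (c * f) s); apply: (subspaceD (bideal_sub hI _ _) Ic).
  have k1kd : (k1 <= k - d)%N by lia.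
  have [|_] := h1 (k - d)%N (i - l) c k1kd hc.
    exists e => j; split; first exact: Sk_mul (vXchi _ _).
    have -> : c * v j ^+ e * f = s * v j ^+ e - (s - c * f) * v j ^+ e by ring.
    apply: subspaceB; first exact: (bideal_sub hI).
      by apply: (set_cast (he j)) => //; [lia|ring].
    by apply: (set_cast (bideal_mul hI Ic (vXchi j e))) => //; [lia|ring].
  by move=> h; apply: (set_cast h) => //; [lia|ring].
(* For [I] prime, either powers of some [v j] cancel modulo [I], or all positive degrees lie in
   [I]. *)
have [[j nIj]|hv] := pselect (exists j, ~ I 1%N (w j) (v j)); last first.
  exists 1%N => k i s k0 hs _; apply: bideal_all_v => // j.
  by apply: contrapT => nIj; apply: hv; exists j.
exists 0%N => k i s _ hs [e /(_ j)]; elim: e => [|e IHe].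
  by move=> h; apply: (set_cast h); rewrite ?addn0 ?mulr0n ?addr0 ?expr0 ?mulr1.
move=> h; apply: IHe; apply: (pI _ _ _ _ _ _ (vchi j) nIj).
  exact: Sk_mul (vXchi _ _).
by apply: (set_cast h); [lia|ring|rewrite exprSr mulrA].
Qed.

(** The fractions [a j / v j ^+ e] agree on overlaps modulo [I], and the conclusion glues them to an
    [s] of degree [k]. With [H0_vanishes], this says that in large degree the sections of the sheaf
    of [chi / I] are the elements of [chi / I]. *)
Definition H1_vanishes I := exists k0, forall k i e (a : 'I_m -> E), (k0 <= k)%N ->
  (forall j, chi (k + e)%N (i + w j *+ e) (a j)) ->
  (forall j l, I (k + e + e)%N (i + w j *+ e + w l *+ e) (a j * v l ^+ e - a l * v j ^+ e)) ->
  exists s e', chi k i s /\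
    forall j, I (k + e + e')%N (i + w j *+ e + w j *+ e') ((a j - s * v j ^+ e) * v j ^+ e').

Lemma H1_vanishing I : bideal I -> H1_vanishes I.
Proof.
move: I; apply: bideal_ind => I hI IH.
have [pI|[d [l [f [hf nIf hcolon]]]]] := bideal_dichotomy hI; last first.
  have hI1 := bideal_colon hI hf; have hI2 := bideal_adjoin hI hf.
  have [k1 h1] : H1_vanishes (colon I d l f).
    by apply: IH => //; exact: sub_colon.
  have [k2 h2] : H1_vanishes (adjoin I d l f).
    apply: IH => //; first exact: sub_adjoin.
    exists d, l, f; split=> //; have := @adjoin_gen I d l f 0%N 0 1 hI.
    rewrite add0n add0r mul1r; apply.
    by have := Sk_mon v (lexx (wdeg w (0%MM : 'X_{1..m}))); rewrite mdeg0 wdeg0 mon0.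
  exists (maxn (k1 + d) k2) => k i e a; rewrite geq_max => /andP[k1k k2k] ha hcoc.
  have dk : (d <= k)%N by apply: leq_trans k1k; exact: leq_addl.
  have [|s [e' [hs hse]]] := h2 k i e a k2k ha.
    by move=> j j'; exact: sub_adjoin.
  (* Once glued modulo [adjoin], the family differs from [s] by [f] times a family [b]. This [b] is
     a cocycle for the colon ideal, and its gluing [s1] corrects [s] to [s + s1 * f]. *)
  pose a' j := (a j - s * v j ^+ e) * v j ^+ e'.
  have /choice[b hb] : forall j, exists b : E,
      chi (k - d + (e + e'))%N (i - l + w j *+ (e + e')) b /\
      I (k + e + e')%N (i + w j *+ e + w j *+ e') (a' j - b * f).
    move=> j; have [_ [b hb ->] Ib] := hse j; exists b; split => //; move: hb.
    rewrite (_ : (d <= k + e + e')%N); last by rewrite -addnA (leq_trans dk)// leq_addr.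
    by move=> hb; apply: (set_cast hb) => //; [lia|ring].
  have k1kd : (k1 <= k - d)%N by lia.
  have [||s1 [e1 [hs1 hse1]]] := h1 (k - d)%N (i - l) (e + e')%N b k1kd.
  - by move=> j; case: (hb j).
  - move=> j j'; have [bj Ij] := hb j; have [bj' Ij'] := hb j'; split.
      apply: subspaceB; first exact: subspace_Sk.
        exact: Sk_mul (vXchi _ _).
      apply: (set_cast (Sk_mul bj' (vXchi j (e + e')))) => //; ring.
    have -> : (b j * v j' ^+ (e + e') - b j' * v j ^+ (e + e')) * f =
        (a j * v j' ^+ e - a j' * v j ^+ e) * (v j ^+ e' * v j' ^+ e')
        - ((a' j - b j * f) * v j' ^+ (e + e') - (a' j' - b j' * f) * v j ^+ (e + e')).
      by rewrite /a' !exprD; ring.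
    apply: subspaceB; first exact: (bideal_sub hI).
      apply: (set_cast (bideal_mul hI (hcoc j j') (Sk_mul (vXchi j e') (vXchi j' e')))) => //; [lia|ring].
    apply: subspaceB; first exact: (bideal_sub hI).
      by apply: (set_cast (bideal_mul hI Ij (vXchi j' (e + e')))) => //; [lia|ring].
    by apply: (set_cast (bideal_mul hI Ij' (vXchi j (e + e')))) => //; [lia|ring].
  exists (s + s1 * f), (e' + e1)%N; split.
    apply: subspaceD => //; first exact: subspace_Sk.
    by apply: (set_cast (Sk_mul hs1 hf)) => //; [lia|ring].
  move=> j; have [bj Ij] := hb j.
  have -> : (a j - (s + s1 * f) * v j ^+ e) * v j ^+ (e' + e1) =
     (a' j - b j * f) * v j ^+ e1 + (b j - s1 * v j ^+ (e + e')) * v j ^+ e1 * f.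
    by rewrite /a' !exprD; ring.
  apply: subspaceD; first exact: (bideal_sub hI).
    by apply: (set_cast (bideal_mul hI Ij (vXchi j e1))) => //; [lia|ring].
  have [_ h] := hse1 j.
  by apply: (set_cast h) => //; [lia|ring].
have [[j0 nIj]|hv] := pselect (exists j, ~ I 1%N (w j) (v j)); last first.
  exists 1%N => k i e a k0 ha _; exists 0, 0%N; split; first exact: subspace0 (subspace_Sk _ _ _ _).
  move=> j; apply: bideal_all_v => // [j'||].
  - by apply: contrapT => nIj'; apply: hv; exists j'.
  - by rewrite addn0 (leq_trans k0)// leq_addr.
  - by apply: (set_cast (ha j)); [lia|ring|ring].
set f := v j0.
have [k2 h2] := H0_vanishing (bideal_adjoin hI (vchi j0)).
exists k2 => k i e a k2k ha hcoc.
(* [P r] says that the family multiplied by [f ^+ r] glues. The cocycle condition gives [P e] with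
   [s = a j0]. In the descent from [r.+1], the glued section vanishes locally modulo [f], so
   [H0_vanishing] for [adjoin] makes it a multiple of [f], and primality cancels this factor. *)
pose P r := exists s e', chi (k + r)%N (i + w j0 *+ r) s /\
    forall j, I (k + r + e + e')%N (i + w j0 *+ r + w j *+ e + w j *+ e')
      ((a j * f ^+ r - s * v j ^+ e) * v j ^+ e').
have Pe : P e.
  exists (a j0), 0%N; split => // j; rewrite expr0 mulr1.
  by apply: (set_cast (hcoc j j0)) => //; [lia|ring].
suff descent r : P r -> P 0%N.
  have [s [e' [hs hse]]] := descent e Pe.
  exists s, e'; split; first by apply: (set_cast hs); rewrite ?addn0 ?mulr0n ?addr0.
  by move=> j; apply: (set_cast (hse j)); rewrite ?addn0 ?mulr0n ?addr0 ?expr0 ?mulr1.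
elim: r => // r IHr [s [e' [hs hse]]]; apply: IHr.
have hse' j : I (k + r.+1 + (e + e'))%N (i + w j0 *+ r.+1 + w j *+ (e + e'))
    (a j * f ^+ r.+1 * v j ^+ e' - s * v j ^+ (e + e')).
  apply: (set_cast (hse j)); [lia|ring|by rewrite exprD; ring].
have [||_ [c hc ->] Ic] := h2 (k + r.+1)%N (i + w j0 *+ r.+1) s _ hs.
- by rewrite (leq_trans k2k)// leq_addr.
- exists (e + e')%N => j.
  have -> : s * v j ^+ (e + e') = a j * f ^+ r.+1 * v j ^+ e'
      - (a j * f ^+ r.+1 * v j ^+ e' - s * v j ^+ (e + e')) by ring.
  apply: subspaceB; first exact: (bideal_sub (bideal_adjoin hI (vchi j0))).
    have hg : chi (k + r + (e + e'))%N (i + w j0 *+ r + w j *+ (e + e')) (a j * f ^+ r * v j ^+ e').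
      by apply: (set_cast (Sk_mul (Sk_mul (ha j) (vXchi j0 r)) (vXchi j e'))) => //; [lia|ring].
    by apply: (set_cast (@adjoin_gen I 1 (w j0) f _ _ _ hI hg)); [lia|ring|rewrite exprSr; ring].
  exact: sub_adjoin.
have {}hc : chi (k + r)%N (i + w j0 *+ r) c.
  by move: hc; rewrite (_ : (0 < k + r.+1)%N)// ?addnS// => hc; apply: (set_cast hc) => //; [lia|ring].
exists c, e'; split => // j.
apply: (pI _ _ _ _ _ _ (vchi j0) nIj).
  apply: Sk_mul (vXchi _ _); apply: subspaceB; first exact: subspace_Sk.
    by apply: (set_cast (Sk_mul (ha j) (vXchi j0 r))) => //; [lia|ring].
  exact: Sk_mul (vXchi _ _).
have -> : (a j * f ^+ r - c * v j ^+ e) * v j ^+ e' * v j0 =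
    (a j * f ^+ r.+1 * v j ^+ e' - s * v j ^+ (e + e')) + (s - c * f) * v j ^+ (e + e').
  by rewrite exprSr exprD /f; ring.
apply: subspaceD; first exact: (bideal_sub hI).
  by apply: (set_cast (hse' j)) => //; [lia|ring].
by apply: (set_cast (bideal_mul hI Ic (vXchi j (e + e')))) => //; [lia|ring].
Qed.

End LocalCohomology.

(** * Comparison of cochains with the Rees algebra modulo [t] *)

Section CentralFibre.
Context (K : closedFieldType) (N : nat) (X : set 'rV[K]_N.+1) {m : nat}.
Local Notation E := (X -> K^o).
Variables (F : int -> set E) (v : 'I_m -> E) (w : 'I_m -> int).
Hypothesis m_gt0 : (0 < m)%N.
Hypothesis FE : forall i, F i = lspan [set s | exists2 j, w j <= i & s = v j].
Implicit Types (f g s : E).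

Lemma chi_sum k i (J : Type) (r : seq J) (P : pred J) (u : J -> E) :
  (forall j, P j -> chi F k i (u j)) -> chi F k i (\sum_(j <- r | P j) u j).
Proof.
move=> h; elim/big_ind: _ => //; first exact: chi_zero.
by move=> x y hx hy; rewrite -[x]scale1r; exact: chi_lin.
Qed.

Lemma chi_raise k i j s : i <= j -> chi F k i s -> chi F k j s.
Proof.
move=> ij hs; have -> : j = i + `|j - i|%N%:Z by lia.
elim: `|_|%N => [|n IH]; first by rewrite addr0.
rewrite -addn1 PoszD addrA -[s]mulr1 -(addn0 k).
by apply: chi_mul => //; exact: chi_t.
Qed.

Lemma chiE : chi F = Sk v w.
Proof.
apply/funext => k; apply/funext => i; apply/seteqP; split.
  move=> s; elim => {k i s}.
  - by move=> k i; exact: subspace0 (subspace_Sk _ _ _ _).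
  - by have := Sk_mon v (lexx (wdeg w (0%MM : 'X_{1..m}))); rewrite mdeg0 wdeg0 mon0.
  - have := @Sk_mon _ _ _ _ v w (0%MM : 'X_{1..m}) 1.
    by rewrite mdeg0 wdeg0 mon0; apply.
  - move=> i s; rewrite FE; apply: lspan_sub; first exact: subspace_Sk.
    by move=> _ [j ji ->]; apply: Sk_le ji _ _; exact: vchi.
  - by move=> k i c s s' _ h _ h'; case: (subspace_Sk v w k i) => _; apply.
  - by move=> k l i j s s' _ h _ h'; exact: Sk_mul.
move=> _ [p [c [u [uS ->]]]]; apply: chi_sum => j _.
rewrite -[_ *: _]addr0; apply: chi_lin; last exact: chi_zero.
have [b [<- bi ->]] := uS j; apply: chi_raise bi _.
rewrite [b]multinomUE_id; elim/big_rec: _.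
  by rewrite mdeg0 wdeg0 mon0; exact: chi_one.
move=> l a _ ha; rewrite mdegD wdegD monD; apply: chi_mul => //.
elim: (b l) => [|n IH]; first by rewrite mulm0n mdeg0 wdeg0 mon0; exact: chi_one.
rewrite mulmS mdegD wdegD monD; apply: chi_mul => //.
rewrite mdeg1 wdegU monU; apply: chi_gen; rewrite FE.
by apply: sub_lspan; exists l.
Qed.

Local Notation chi' := (Sk v w).

(** The ideal [t chi]: multiplication by [t] leaves the function unchanged and raises its weight by
    one. *)
Definition fibre_ideal k i : set E := chi' k (i - 1).

Lemma bideal_fibre : bideal v w fibre_ideal.
Proof.
split.
- by move=> k i; exact: subspace_Sk.
- by move=> k i s.
- by move=> k i; apply: Sk_le; lia.
- by move=> k i l j s s' hs hs'; apply: (set_cast (Sk_mul hs hs')) => //; ring.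
Qed.

(** Monomials of the same degree and strictly smaller weight already lie in [t chi], so working in a
    bidegree modulo [t chi] amounts to working in a degree. *)
Lemma bistd_fibre : bistd v w fibre_ideal = stdw v w.
Proof.
suff lowE a : lower v (ltw w) (bicls w) (bilower w fibre_ideal) a =
    lower v (ltw w) (fun a b => mdeg a == mdeg b) (fun=> [set 0]) a.
  by apply/funext => a; rewrite /bistd /stdw /std lowE.
rewrite /lower sumset0; apply/seteqP; split.
  move=> s [u hu hs]; rewrite -(subrK u s); apply: subspaceD; first exact: subspace_lspan.
    move: hs; apply: lspan_mono => _ [b [bk bi ->]]; exists b; split; rewrite ?bk//.
    by apply/orP; left; lia.
  move: u hu {hs}; apply: lspan_mono => _ [b [/andP[/eqP ab _] ba ->]].
  by exists b; rewrite ab eqxx.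
apply: lspan_sub; first by apply: subspace_sumset; [exact: subspace_lspan|exact: subspace_Sk].
move=> _ [b [/eqP ab ba ->]]; move: (ba) => /orP[lt_ba|/andP[/eqP eq_ba _]].
  apply: sumset_r; first exact: subspace_lspan.
  by apply: sub_lspan; exists b; split => //; lia.
apply: sumset_l; first exact: subspace_Sk.
by apply: sub_lspan; exists b; split; rewrite // /bicls ab eq_ba !eqxx.
Qed.

Lemma F_chi j f : F j f -> chi' 1 j f.
Proof.
rewrite FE; apply: lspan_sub; first exact: subspace_Sk.
by move=> _ [l lj ->]; apply: Sk_le lj _ _; exact: vchi.
Qed.

Lemma F_v j : F (w j) (v j).
Proof. by rewrite FE; apply: sub_lspan; exists j. Qed.

Lemma FX_chi j f e : F j f -> chi' e (j *+ e) (f ^+ e).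
Proof.
move=> /F_chi hf; elim: e => [|e IH].
  by have := Sk_mon v (lexx (wdeg w (0%MM : 'X_{1..m}))); rewrite mdeg0 wdeg0 mon0.
by rewrite exprS; apply: (set_cast (Sk_mul hf IH)) => //; ring.
Qed.

Lemma loc_raise k i j f (u : E) n n' : F j f -> (n <= n')%N ->
  chi' (k + n)%N (i + j *+ n) (f ^+ n * u) -> chi' (k + n')%N (i + j *+ n') (f ^+ n' * u).
Proof.
move=> hf nn' h; rewrite -(subnKC nn').
by apply: (set_cast (Sk_mul h (FX_chi (n' - n) hf))); [lia|ring|rewrite exprD; ring].
Qed.

Lemma overlap_raise k i j j' f g (u : E) n n' : F j f -> F j' g -> (n <= n')%N ->
  chi' (k + n.*2)%N (i + (j + j') *+ n) ((f * g) ^+ n * u) ->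
  chi' (k + n'.*2)%N (i + (j + j') *+ n') ((f * g) ^+ n' * u).
Proof.
move=> hf hg nn' h; rewrite -(subnKC nn').
apply: (set_cast (Sk_mul h (Sk_mul (FX_chi (n' - n) hf) (FX_chi (n' - n) hg)))); [lia|ring|].
by rewrite exprD [in RHS]exprMn_comm ?exprMn_comm; [ring|exact: mulrC..].
Qed.

Lemma subspace_chi_loc k i j f : F j f -> is_subspace (chi_loc F k i j f).
Proof.
move=> hf; split.
  by split=> //; exists 0%N; rewrite mulr0; exact: chi_zero.
move=> c u u' [u0 [n hu]] [u0' [n' hu']]; split.
  by move=> x fx; change (c * u x + u' x = 0); rewrite u0// u0'// mulr0 addr0.
exists (maxn n n'); rewrite chiE in hu hu' *; rewrite mulrDr -fct_scalerAr.
case: (subspace_Sk v w (k + maxn n n')%N (i + j *+ maxn n n')) => _; apply.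
  by apply: loc_raise hu => //; exact: leq_maxl.
by apply: loc_raise hu' => //; exact: leq_maxr.
Qed.

Lemma subspace_zero0 k i : is_subspace (zero0 F k i : set (int * E -> E : lmodType K)).
Proof.
split=> [j f hf|c u u' hu hu' j f hf]; first exact: subspace0 (subspace_chi_loc _ _ hf).
by case: (subspace_chi_loc k (i - 1) hf) => _; apply; [exact: hu|exact: hu'].
Qed.

Lemma subspace_cochains0 k i : is_subspace (cochains0 F k i : set (int * E -> E : lmodType K)).
Proof.
split.
  split=> [j f hf|j f j' g hf hg]; first exact: subspace0 (subspace_chi_loc _ _ hf).
  by exists 1%N => //; rewrite subrr mulr0; exact: chi_zero.
move=> c u u' [hu hu2] [hu' hu2']; split=> [j f hf|j f j' g hf hg].
  by case: (subspace_chi_loc k i hf) => _; apply; [exact: hu|exact: hu'].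
have [n n0 h] := hu2 _ _ _ _ hf hg; have [n' n0' h'] := hu2' _ _ _ _ hf hg.
exists (maxn n n'); first by rewrite leq_max n0.
rewrite chiE in h h' *.
have -> : (f * g) ^+ maxn n n' * ((c *: u + u') (j, f) - (c *: u + u') (j', g)) =
    c *: ((f * g) ^+ maxn n n' * (u (j, f) - u (j', g)))
    + (f * g) ^+ maxn n n' * (u' (j, f) - u' (j', g)).
  rewrite fct_scalerAr -mulrDr; congr (_ * _).
  by rewrite scalerBr opprD addrACA.
case: (subspace_Sk v w (k + (maxn n n').*2)%N (i - 1 + (j + j') *+ maxn n n')) => _; apply.
  by apply: overlap_raise h => //; exact: leq_maxl.
by apply: overlap_raise h' => //; exact: leq_maxr.
Qed.

(** A global section as a cochain; the indicator of [f != 0] realises the convention that functions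
    on this locus are extended by zero. *)
Definition restrict s : int * E -> E := fun p x => s x * (p.2 x != 0)%:R.

Lemma restrict_mul s j f n : (0 < n)%N -> f ^+ n * restrict s (j, f) = f ^+ n * s.
Proof.
case: n => // n _; rewrite exprS; apply/funext => x.
change (f x * (f ^+ n) x * (s x * (f x != 0)%:R) = f x * (f ^+ n) x * s x).
by case: eqP => [->|_]; rewrite ?mul0r ?mulr1.
Qed.

Lemma restrict_sum (d : nat) (c : 'I_d -> K) (u : 'I_d -> E) :
  restrict (\sum_j c j *: u j) = \sum_j c j *: restrict (u j) :> (int * E -> E).
Proof.
have h (c0 : K) (a b : E) : restrict (c0 *: a + b) = c0 *: restrict a + restrict b :> (int * E -> E).
  by apply/funext => p; apply/funext => x; rewrite /restrict /= mulrDl -mulrA.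
elim: d c u => [|d IH] c u.
  rewrite !big_ord0; apply/funext => p; apply/funext => x; exact: mul0r.
by rewrite !big_ord_recl h IH.
Qed.

Lemma restrict_loc k i j f s : F j f -> chi' k i s -> chi_loc F k i j f (restrict s (j, f)).
Proof.
move=> hf hs; split; first by move=> x fx; rewrite /restrict /= fx eqxx mulr0.
exists 1%N; rewrite restrict_mul// chiE mulrC.
exact: Sk_mul (FX_chi _ hf).
Qed.

Lemma restrict_cochain k i s : chi' k i s -> cochains0 F k i (restrict s).
Proof.
move=> hs; split => [j f hf|j f j' g hf hg]; first exact: restrict_loc.
exists 1%N => //; rewrite [X in chi _ _ _ X](_ : _ = 0); first exact: chi_zero.
rewrite expr1; apply/funext => x.
change (f x * g x * (s x * (f x != 0)%:R - s x * (g x != 0)%:R) = 0).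
by case: eqP => [->|_]; [|case: eqP => [->|_]]; rewrite ?mulr0 ?mul0r ?subrr ?mulr0.
Qed.

Lemma common_bound (P : 'I_m -> nat -> Prop) :
  (forall j n n', (n <= n')%N -> P j n -> P j n') -> (forall j, exists n, P j n) ->
  exists n, forall j, P j n.
Proof.
move=> mono /choice[n hn]; exists (\max_j n j) => j.
by apply: mono (hn j); exact: leq_bigmax.
Qed.

(** It makes every monomial of degree [m * q] divisible by some [v l ^+ q], so that estimates on the
    loci of the [v l] reach the locus of an arbitrary [f]. *)
Lemma bideg_pigeonhole (b : 'X_{1..m}) q : (0 < q)%N -> mdeg b = (m * q)%N -> exists l, (q <= b l)%N.
Proof.
move=> q0 hb; apply: contrapT => h; have : (mdeg b <= \sum_(l < m) q.-1)%N.
  rewrite mdegE; apply: leq_sum => l _; rewrite -ltnS prednK// ltnNge; apply/negP => ql.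
  by apply: h; exists l.
rewrite sum_nat_const card_ord hb leq_mul2l; case: (m) m_gt0 => //= _ _.
by case: q q0 {hb h} => // q _; rewrite ltnn.
Qed.

(* Serre's theorem for the central fibre, in large degrees: its sections are
   those of the homogeneous coordinate ring [chi / t chi]. *)
Lemma mult0_large : exists k0, forall k i, (k0 <= k)%N ->
  mult0 F k i = count (fun a => `[< stdw v w a >] && (wdeg w a == i)) (mons k).
Proof.
have [k1 h0] := H0_vanishing bideal_fibre.
have [k2 h1] := H1_vanishing bideal_fibre.
exists (maxn k1 k2) => k i; rewrite geq_max => /andP[k1k k2k].
have sur u : cochains0 F k i u -> exists2 s, chi' k i s & zero0 F k i (u - restrict s).
  move=> [hloc hov].
  have /common_bound[|M hM] : forall l, exists n,
      chi' (k + n)%N (i + w l *+ n) (v l ^+ n * u (w l, v l)).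
    by move=> l; have [_ [n hn]] := hloc _ _ (F_v l); exists n; rewrite -chiE.
  - by move=> l n n' nn'; apply: loc_raise => //; exact: F_v.
  have /common_bound[|M' hM'] : forall l, exists n, forall l',
      chi' (k + n.*2)%N (i - 1 + (w l + w l') *+ n)
         ((v l * v l') ^+ n * (u (w l, v l) - u (w l', v l'))).
    move=> l; apply: common_bound.
      by move=> l' n n' nn'; apply: overlap_raise => //; exact: F_v.
    by move=> l'; have [n _ hn] := hov _ _ _ _ (F_v l) (F_v l'); exists n; rewrite -chiE.
  - by move=> l n n' nn' h l'; apply: overlap_raise (h l') => //; exact: F_v.
  (* One exponent clears the denominators on the finite cover by the [v l] and on its overlaps. *)
  pose e := maxn M M'; pose a l := v l ^+ e * u (w l, v l).
  have [||s [e' [hs hse]]] := h1 k i e a k2k.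
  - by move=> l; apply: loc_raise (hM l); [exact: F_v|exact: leq_maxl].
  - move=> l l'; have h : (M' <= e)%N by exact: leq_maxr.
    have := overlap_raise (F_v l) (F_v l') h (hM' l l').
    move/set_cast; apply; [by lia|by ring|].
    by rewrite /a exprMn_comm; [ring|exact: mulrC].
  exists s => // j f hf; split.
    move=> x fx; have [u0 _] := hloc _ _ hf.
    change (u (j, f) x - s x * (f x != 0)%:R = 0).
    by rewrite u0// fx eqxx mulr0 subrr.
  have /common_bound[|M1 hM1] : forall l, exists n,
      chi' (k + n.*2)%N (i - 1 + (j + w l) *+ n) ((f * v l) ^+ n * (u (j, f) - u (w l, v l))).
    by move=> l; have [n _ hn] := hov _ _ _ _ hf (F_v l); exists n; rewrite -chiE.
  - by move=> l n n' nn'; apply: overlap_raise => //; exact: F_v.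
  (* Large enough for the overlaps of [f] with all [v l] and for the gluing; the successor makes it
     positive, as the pigeonhole and [restrict_mul] require. *)
  pose q := (maxn M1 (e + e')).+1; pose y := u (j, f) - s.
  have hq l : chi' (k + q.*2)%N (i - 1 + (j + w l) *+ q) (f ^+ q * v l ^+ q * y).
    have q1 : (M1 <= q)%N by rewrite leqW// leq_maxl.
    have q2 : (e + e' <= q)%N by rewrite leqW// leq_maxr.
    have -> : f ^+ q * v l ^+ q * y = (f * v l) ^+ q * (u (j, f) - u (w l, v l))
        + v l ^+ q * (u (w l, v l) - s) * f ^+ q.
      by rewrite exprMn_comm; [rewrite /y; ring|exact: mulrC].
    apply: subspaceD; [exact: subspace_Sk|exact: overlap_raise hf (F_v l) q1 (hM1 l)|].
    have h3 : chi' (k + (e + e'))%N (i - 1 + w l *+ (e + e')) (v l ^+ (e + e') * (u (w l, v l) - s)).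
      have h := hse l; rewrite /fibre_ideal in h.
      by apply: (set_cast h); [lia|ring|rewrite /a exprD; ring].
    by apply: (set_cast (Sk_mul (loc_raise (F_v l) q2 h3) (FX_chi q hf))) => //; [lia|ring].
  (* The power [f ^+ (m * q)] is a combination of monomials each divisible by some [v l ^+ q]; the
     other [f ^+ q] is the factor present in [hq]. *)
  exists (q + m * q)%N; rewrite chiE.
  change ((u - restrict s) (j, f)) with (u (j, f) - restrict s (j, f)).
  have -> : f ^+ (q + m * q) * (u (j, f) - restrict s (j, f)) = f ^+ q * f ^+ (m * q) * y.
    by rewrite mulrBr restrict_mul// -mulrBr exprD.
  suff : forall g, chi' (m * q)%N (j *+ (m * q)) g ->
      chi' (k + (q + m * q))%N (i - 1 + j *+ (q + m * q)) (f ^+ q * g * y).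
    by apply; exact: FX_chi.
  pose W : set E := [set g | chi' (k + (q + m * q))%N (i - 1 + j *+ (q + m * q)) (f ^+ q * g * y)].
  apply: (@lspan_sub K E _ W).
    split; first by rewrite /W /= mulr0 mul0r; exact: subspace0 (subspace_Sk _ _ _ _).
    move=> c g g' hg hg'; rewrite /W /=.
    have -> : f ^+ q * (c *: g + g') * y = c *: (f ^+ q * g * y) + f ^+ q * g' * y.
      by rewrite [f ^+ q * (_ + _)]mulrDr [LHS]mulrDl -fct_scalerAr -fct_scalerAl.
    by case: (subspace_Sk v w (k + (q + m * q))%N (i - 1 + j *+ (q + m * q))) => _; apply.
  move=> _ [b [bq bj ->]]; have [l ql] := bideg_pigeonhole (ltn0Sn _) bq.
  have Ub : (U_(l) *+ q <= b)%MM.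
    by apply/mnm_lepP => x; rewrite mulmnE mnm1E; case: eqP => [<-|]; rewrite ?mul1n.
  have vE : mon v (U_(l) *+ q)%MM = v l ^+ q.
    by elim: (q) => [|n IH]; rewrite ?mulm0n ?mon0// mulmS monD IH monU exprS.
  have wE : wdeg w (U_(l) *+ q)%MM = w l *+ q.
    by elim: (q) => [|n IH]; rewrite ?mulm0n ?wdeg0// mulmS wdegD IH wdegU mulrS.
  move: bq bj; rewrite /W /= -(submK Ub) addmC; set b' := (b - _)%MM.
  rewrite mdegD mdegMn mdeg1 mul1n wdegD wE monD vE => bq bj.
  apply: (@Sk_le _ _ _ _ v w _ (i - 1 + (j + w l) *+ q + wdeg w b')).
    rewrite mulrnDr mulrnDl -!addrA lerD2l lerD2l; lia.
  by apply: (set_cast (Sk_mul (hq l) (Sk_mon v (lexx (wdeg w b'))))) => //; [lia|ring].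
pose Q a := wdeg w a == i.
pose L := [seq a <- mons k | `[< stdw v w a >] && Q a].
rewrite /mult0 -size_filter -/L.
have [e [he1 he2 he3]] : exists e : 'I_(size L) -> E, [/\ forall l, chi' k i (e l),
    forall s, chi' k i s -> exists c : 'I_(size L) -> K, chi' k (i - 1) (s - \sum_l c l *: e l) &
    forall c : 'I_(size L) -> K, chi' k (i - 1) (\sum_l c l *: e l) -> forall l, c l = 0].
  have [[a0 [a0k a0i]]|none] := pselect (exists a0 : 'X_{1..m}, mdeg a0 = k /\ wdeg w a0 = i).
    have B := bideal_basis a0 bideal_fibre.
    have B' := rel_basis_indep (subspace_Sk v w _ _) (subspace_Sk v w _ _) B.
    have LE : std_in v (ltw w) (bicls w) (bilower w fibre_ideal) a0 predT = L.
      rewrite /std_in a0k; apply: eq_in_filter => a; rewrite mem_mons => /eqP ak.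
      by rewrite -/(bistd _ _ _) bistd_fibre /bicls /Q ak a0k a0i eqxx andbT eq_sym.
    move: B B'; rewrite LE /bilower /fibre_ideal a0k a0i.
    move=> [B1 B2] B3; exists (fun l => mon v (nth 0%MM L l)); split => // s /B2[c [hc _]].
    by exists c.
  have L0 : L = [::].
    rewrite /L (@eq_in_filter _ _ pred0) ?filter_pred0// => a; rewrite mem_mons => /eqP ak.
    by apply/negbTE/negP => /andP[_ /eqP ai]; apply: none; exists a.
  rewrite L0; exists (fun=> 0); split; [by case| |by move=> c _ []].
  move=> s hs; exists (fun=> 0); rewrite big_ord0 subr0.
  move: s hs; apply: lspan_sub; first exact: subspace_Sk.
  move=> _ [b [bk + ->]]; rewrite le_eqVlt => /predU1P[bi|bi].
    by exfalso; apply: none; exists b.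
  by rewrite -bk; apply: Sk_mon; lia.
have zres s : chi' k (i - 1) s -> zero0 F k i (restrict s).
  by move=> hs j f hf; exact: restrict_loc.
apply: (@qdimE _ _ _ _ _ (fun l => restrict (e l))).
- exact: subspace_cochains0.
- exact: subspace_zero0.
apply: rel_basisP; first exact: subspace_zero0.
- by move=> l; exact: restrict_cochain.
- move=> u /sur[s hs zs]; have [c hc] := he2 s hs; exists c.
  rewrite -restrict_sum -(subrKA (restrict s)); apply: (subspaceD (subspace_zero0 k i) zs).
  have -> : restrict s - restrict (\sum_l c l *: e l) = restrict (s - \sum_l c l *: e l).
    by apply/funext => p; apply/funext => x; rewrite /restrict /= -mulrBl.
  exact: zres.
- move=> c; rewrite -restrict_sum => hz; apply: he3.
  set s := \sum_l _ in hz *.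
  have hs : chi' k i s.
    by apply: subspace_sum => [|l _]; [exact: subspace_Sk|apply: subspaceZ => //; exact: subspace_Sk].
  apply: (h0 k i s k1k hs).
  have /common_bound[|n hn] : forall l, exists n, chi' (k + n)%N (i - 1 + w l *+ n) (v l ^+ n * s).
    move=> l; have [_ [n hn]] := hz _ _ (F_v l); exists n.+1.
    rewrite -(@restrict_mul s (w l))//; apply: (loc_raise (F_v l) (leqnSn n)).
    by rewrite -chiE.
  - by move=> l n n' nn'; apply: loc_raise => //; exact: F_v.
  exists n => l; apply: (set_cast (hn l)) => //; [by ring|exact: mulrC].
Qed.

End CentralFibre.

(** * Noether normalisation and the principal ideal theorem *)

Lemma digits_inj n (B : nat) (a b : 'I_n -> nat) :
  (forall i, (a i < B)%N) -> (forall i, (b i < B)%N) ->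
  (\sum_i a i * B ^ i = \sum_i b i * B ^ i)%N -> a =1 b.
Proof.
elim: n a b => [|n IH] a b ha hb; first by move=> _ [].
have B0 : (0 < B)%N by apply: leq_ltn_trans (ha ord0).
rewrite !big_ord_recl /= !expn0 !muln1.
have shift (c : 'I_n.+1 -> nat) : (\sum_(i < n) c (lift ord0 i) * B ^ bump 0 i =
    (\sum_(i < n) c (lift ord0 i) * B ^ i) * B)%N.
  by rewrite big_distrl; apply: eq_bigr => i _; rewrite /bump /= add1n expnSr mulnA.
rewrite !shift => h.
have h0 : a ord0 = b ord0.
  have := congr1 (modn^~ B) h; rewrite /= ![(_ + _ * B)%N]addnC !modnMDl.
  by rewrite !modn_small.
move: h; rewrite h0 => /addnI/eqP; rewrite eqn_pmul2r// => /eqP h i.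
have [j ->|->//] := unliftP ord0 i.
exact: (IH (fun j => a (lift ord0 j)) (fun j => b (lift ord0 j))).
Qed.

(** Kronecker substitution: with [B] above all exponents, putting [t ^+ (B ^ i)] for the variables
    sends distinct monomials to distinct powers of [t], which reduces the claim to one variable. *)
Lemma mpoly_nonroot (K : closedFieldType) n (p : {mpoly K[n]}) :
  p != 0 -> exists a : 'I_n -> K, p.@[a] != 0.
Proof.
move=> p0; pose B := msize p.
have expo (m : 'X_{1..n}) : m \in msupp p -> forall i, (m i < B)%N.
  move=> /msize_mdeg_lt; rewrite -/B => mB i; apply: leq_ltn_trans mB.
  by rewrite mdegE (bigD1 i)//= leq_addr.
pose N (m : 'X_{1..n}) := (\sum_(i < n) m i * B ^ i)%N.
pose P : {poly K} := \sum_(m <- msupp p) p@_m *: 'X^(N m).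
have P0 : P != 0.
  apply/eqP => /(congr1 (fun q : {poly K} => q`_(N (mlead p)))).
  rewrite coef0 coef_sum (bigD1_seq (mlead p)) ?msupp_uniq ?mlead_supp//=.
  rewrite coefZ coefXn eqxx mulr1 big_seq_cond big1 ?addr0.
    by move/eqP; rewrite mleadc_eq0 (negbTE p0).
  move=> m /andP[mp mN]; rewrite coefZ coefXn; case: eqP => [h|_]; last exact: mulr0.
  case/eqP: mN; apply/mnmP => i.
  by apply/esym; apply: (digits_inj _ _ h); apply: expo => //; exact: mlead_supp.
have /closed_nonrootP[t] := P0; rewrite /root => Pt.
exists (fun i => t ^+ (B ^ i)); apply: contraNneq Pt => <-.
rewrite mevalE /P horner_sum; apply/eqP; apply: eq_bigr => m _.
rewrite hornerZ hornerXn /N -prodrXr; congr (_ * _); apply: eq_bigr => i _.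
by rewrite mulnC exprM.
Qed.

Section Substitution.
Context (K S : comNzRingType) (kappa : {rmorphism K -> S}) (r : nat).
Implicit Types (f : {mpoly K[r]}) (b : 'I_r -> K) (c : 'I_r -> S).

Definition top_form f : {mpoly K[r]} :=
  \sum_(m <- msupp f | mdeg m == (msize f).-1) f@_m *: 'X_[m].

(** Restriction to a line of direction [b] whose base point [c] lies in the extension [S]; its top
    coefficient is then a constant, whatever [c] is. *)
Definition line_subst b c : {mpoly K[r]} -> {poly S} :=
  mmap (polyC \o kappa) (fun i => (c i)%:P + kappa (b i) *: 'X).

HB.instance Definition _ b c := GRing.RMorphism.on (line_subst b c).

Definition deg_coef (p : {poly S}) k a := (size p <= k.+1)%N /\ p`_k = a.

Lemma deg_coefM p q k l a a' : deg_coef p k a -> deg_coef q l a' ->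
  deg_coef (p * q) (k + l) (a * a').
Proof.
move=> [sp pa] [sq qa]; split.
  by apply: leq_trans (size_polyMleq _ _) _; lia.
have pk i : (k < i)%N -> p`_i = 0 by move=> ki; apply: nth_default; exact: leq_trans sp _.
have ql i : (l < i)%N -> q`_i = 0 by move=> li; apply: nth_default; exact: leq_trans sq _.
have hk : (k < (k + l).+1)%N by lia.
rewrite coefM (bigD1 (Ordinal hk))//= pa addKn qa big1 ?addr0// => i /eqP ik.
have [ki|ik'] := ltnP k i; first by rewrite pk ?mul0r.
rewrite ql ?mulr0//; have ik2 : (i != k :> nat) by apply/eqP => h; apply: ik; apply: val_inj.
by move/eqP: ik2; lia.
Qed.

Lemma line_subst_top b c f :
  deg_coef (line_subst b c f) (msize f).-1 (kappa (top_form f).@[b]).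
Proof.
pose h i : {poly S} := (c i)%:P + kappa (b i) *: 'X.
have mono (m : 'X_{1..r}) : deg_coef (mmap1 h m) (mdeg m) (kappa (\prod_i b i ^+ m i)).
  rewrite /mmap1 mdegE rmorph_prod /=.
  apply: (big_ind3 deg_coef).
  - by split; rewrite ?size_polyC ?oner_eq0// coef1.
  - by move=> p k a q l a' hp hq; exact: deg_coefM.
  - move=> i _; rewrite rmorphXn; elim: (m i) => [|k IH].
      by split; rewrite ?size_polyC ?oner_eq0// coef1.
    rewrite !exprS -add1n; apply: deg_coefM IH; split.
      apply: leq_trans (size_polyD _ _) _; rewrite geq_max; apply/andP; split.
        by apply: leq_trans (size_polyC_leq1 _) _.
      by apply: leq_trans (size_scale_leq _ _) _; rewrite size_polyX.
    by rewrite coefD coefC coefZ coefX add0r mulr1.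
have msz (m : 'X_{1..r}) : m \in msupp f -> (mdeg m <= (msize f).-1)%N.
  by move=> /msize_mdeg_lt; lia.
rewrite /line_subst /mmap; split.
  apply: leq_trans (size_sum _ _ _) _.
  rewrite big_seq; elim/big_ind: _ => // [x y|m mf]; first by rewrite geq_max => -> ->.
  have [sm _] := mono m; rewrite /= mul_polyC; apply: leq_trans (size_scale_leq _ _) _.
  by apply: leq_trans sm _; rewrite ltnS msz.
rewrite coef_sum /top_form (raddf_sum (meval b))/= (rmorph_sum kappa)/= [RHS]big_mkcond.
rewrite big_seq [RHS]big_seq; apply: eq_bigr => m mf; have [sm cm] := mono m.
rewrite coefCM; case: ifPn => [/eqP <-|me].
  by rewrite cm mevalZ mevalX rmorphM.
rewrite nth_default ?mulr0//; apply: leq_trans sm _.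
by rewrite ltn_neqAle me msz.
Qed.

End Substitution.

Lemma top_form_neq0 (K : comNzRingType) r (f : {mpoly K[r]}) : f != 0 -> top_form f != 0.
Proof.
move=> f0; apply/eqP => /(congr1 (mcoeff (mlead f))); rewrite mcoeff0 /top_form raddf_sum /=.
rewrite -big_filter (bigD1_seq (mlead f)) ?filter_uniq ?msupp_uniq//=; last first.
  by rewrite mem_filter mlead_supp// -mlead_deg// eqxx.
rewrite mcoeffZ mcoeffX eqxx mulr1 big1 ?addr0.
  by move/eqP; rewrite mleadc_eq0 (negbTE f0).
by move=> m /negbTE mf; rewrite mcoeffZ mcoeffX mf mulr0.
Qed.

(* A direction [b] along which [f] has degree [deg f], normalised so that some
   coordinate of [b] is 1. *)
Lemma monic_direction (K : closedFieldType) r (f : {mpoly K[r]}) : (1 < msize f)%N ->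
  exists (b : 'I_r -> K) (i : 'I_r), b i = 1 /\ (top_form f).@[b] != 0.
Proof.
move=> fs; have f0 : f != 0 by apply: contraTneq fs => ->; rewrite msize0.
have [a ha] := mpoly_nonroot (top_form_neq0 f0).
have topE (b : 'I_r -> K) (t : K) : (top_form f).@[fun i => t * b i] = t ^+ (msize f).-1 * (top_form f).@[b].
  rewrite /top_form !(raddf_sum (meval _)) /= mulr_sumr; apply: eq_bigr => m /eqP <-.
  rewrite !mevalZ !mevalX mulrCA; congr (_ * _); rewrite mdegE -prodrXr -big_split/=.
  by apply: eq_bigr => i _; rewrite exprMn.
have [i ai] : exists i, a i != 0.
  apply/existsP; apply: contraNT ha => /existsPn h.
  have -> : (top_form f).@[a] = (top_form f).@[fun i => 0 * a i].
    by apply: meval_eq => i; move: (h i); rewrite negbK mul0r => /eqP.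
  by rewrite topE expr0n; case: (msize f) fs => [|[|n]] // _; rewrite mul0r.
exists (fun j => (a i)^-1 * a j), i; split; first by rewrite mulVf.
by rewrite topE mulf_neq0// expf_neq0// invr_eq0.
Qed.

Section NoetherNormalization.
Context (K : closedFieldType) (D : comNzRingType) (iota : {rmorphism K -> D}).

Definition alg_indep d (x : 'I_d -> D) := forall p : {mpoly K[d]}, mmap iota x p = 0 -> p = 0.

Definition in_lspan r (g : 'I_r -> D) (y : D) := exists c : 'I_r -> K, y = \sum_i iota (c i) * g i.

Definition integral_gen d (x : 'I_d -> D) := integralOver (mmap iota x : {mpoly K[d]} -> D).

Section IntegralGen.
Context (d : nat) (x : 'I_d -> D).
Let phi : {rmorphism {mpoly K[d]} -> D} := mmap iota x.

Lemma integral_gen_id p : integral_gen x (mmap iota x p).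
Proof. exact: (integral_id phi). Qed.

Lemma integral_gen_const c : integral_gen x (iota c).
Proof. by rewrite -(mmapC x); exact: integral_gen_id. Qed.

Lemma integral_gen_nat n : integral_gen x n%:R.
Proof. by rewrite -(rmorph_nat iota); exact: integral_gen_const. Qed.

Lemma integral_genD u v : integral_gen x u -> integral_gen x v -> integral_gen x (u + v).
Proof. exact: (@integral_add _ _ phi). Qed.

Lemma integral_genM u v : integral_gen x u -> integral_gen x v -> integral_gen x (u * v).
Proof. exact: (@integral_mul _ _ phi). Qed.

Lemma integral_gen_root u p : p \is monic -> root p u -> (forall k, integral_gen x p`_k) ->
  integral_gen x u.
Proof. by move=> mp pu h; apply: (@integral_root_monic _ _ phi _ _ mp pu); apply/integral_poly. Qed.

End IntegralGen.

Lemma in_lspan_sum r s (g : 'I_r -> D) (h : 'I_s -> D) y :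
  (forall i, in_lspan g (h i)) -> in_lspan h y -> in_lspan g y.
Proof.
move=> /choice[c hc] [a ->]; exists (fun i => \sum_j a j * c j i).
under eq_bigr do rewrite hc mulr_sumr.
rewrite exchange_big; apply: eq_bigr => i _; rewrite rmorph_sum mulr_suml.
by apply: eq_bigr => j _; rewrite rmorphM mulrA.
Qed.

Lemma integral_mmap d (x : 'I_d -> D) r (g : 'I_r -> D) (p : {mpoly K[r]}) :
  (forall i, integral_gen x (g i)) -> integral_gen x (mmap iota g p).
Proof.
move=> hg; rewrite /mmap; elim/big_ind: _ => [|a b|m _].
- exact: (integral_gen_nat _ 0).
- exact: integral_genD.
apply: integral_genM; first exact: integral_gen_const.
rewrite /mmap1; elim/big_ind: _ => [|a b|i _]; [exact: (integral_gen_nat _ 1)|exact: integral_genM|].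
elim: (m i) => [|k IH]; first exact: (integral_gen_nat _ 1).
by rewrite exprS; exact: integral_genM.
Qed.

(** The parameters are kept linear in the [g i], so that on a cone they come from linear forms. A
    relation [f] among the generators becomes monic in [g i0], up to a constant, once the others are
    sheared along a direction where the top form does not vanish. *)
Lemma noether_normalization r (g : 'I_r -> D) : exists d (x : 'I_d -> D),
  [/\ forall j, in_lspan g (x j), alg_indep x & forall i, integral_gen x (g i)].
Proof.
elim: r g => [|r IH] g.
  exists 0%N, g; split=> [[]//|p|[]//].
  have -> : p = (p@_0%MM)%:MP.
    by apply/mpolyP => m; rewrite mcoeffC (_ : 0%MM = m) ?eqxx ?mulr1//; apply/mnmP => -[].
  by rewrite mmapC => /eqP; rewrite fmorph_eq0 => /eqP ->.
have [ind|] := pselect (alg_indep g).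
  exists r.+1, g; split => // j.
    exists (fun i => (i == j)%:R); rewrite (bigD1 j)//= eqxx rmorph1 mul1r big1 ?addr0//.
    by move=> i /negbTE ->; rewrite rmorph0 mul0r.
  suff -> : g j = mmap iota g 'X_j by exact: integral_gen_id.
  by rewrite mmapX mmap1U.
move=> /existsNP[f /not_implyP[fg0 /eqP f0]].
have fs : (1 < msize f)%N.
  have : msize f != 0%N by rewrite msize_poly_eq0.
  case: ltngtP => // [|fs _]; first by case: (msize f).
  have /msize_poly1P[c c0 fc] : msize f == 1%N by rewrite fs.
  by move: fg0 c0; rewrite fc mmapC => /eqP; rewrite fmorph_eq0 => /eqP->; rewrite eqxx.
have [b [i0 [bi0 hb]]] := monic_direction fs.
(* As [b i0 = 1], the shear sends [g i0] to zero, so [r] generators remain for the induction. *)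
pose x i := g i - iota (b i) * g i0.
have x_i0 : x i0 = 0 by rewrite /x bi0 rmorph1 mul1r subrr.
pose x' (j : 'I_r) := x (lift i0 j).
have [d [y [y_span y_ind y_int]]] := IH x'.
have x_int i : integral_gen y (x i).
  by have [j ->|->] := unliftP i0 i; [exact: y_int|rewrite x_i0; exact: (integral_gen_nat _ 0)].
have P_int k : integral_gen y (line_subst iota b x f)`_k.
  have [hx hXn] : (forall i k, integral_gen y ((x i)%:P + iota (b i) *: 'X : {poly D})`_k) /\
      forall (p q : {poly D}), (forall k, integral_gen y p`_k) -> (forall k, integral_gen y q`_k) ->
        forall k, integral_gen y (p * q)`_k.
    split=> [i k'|p q hp hq k'].
      rewrite coefD coefC coefZ coefX; apply: integral_genD.
        by case: eqP => _; [exact: x_int|exact: (integral_gen_nat _ 0)].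
      apply: integral_genM; last exact: integral_gen_nat.
      exact: integral_gen_const.
    rewrite coefM; elim/big_ind: _ => [|u v|i _]; [exact: (integral_gen_nat _ 0)|exact: integral_genD|].
    exact: integral_genM.
  have int1 k' : integral_gen y (1 : {poly D})`_k' by rewrite coef1; exact: integral_gen_nat.
  rewrite /line_subst /mmap coef_sum; elim/big_ind: _ => [|u v|m _].
  - exact: (integral_gen_nat _ 0).
  - exact: integral_genD.
  rewrite coefCM; apply: integral_genM; first exact: integral_gen_const.
  rewrite /mmap1; move: k; elim/big_ind: _ => // i _.
  by elim: (m i) => [|n IHn] k; [rewrite expr0|rewrite exprS; exact: hXn].
set P := line_subst iota b x f in P_int.
set c := (top_form f).@[b] in hb; have [sP lP] := line_subst_top iota b x f.
have cV : iota c^-1 * iota c = 1 by rewrite -rmorphM mulVf// rmorph1.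
have sP' : size P = (msize f).-1.+1.
  apply/eqP; rewrite eqn_leq sP ltnNge; apply/negP => /leq_sizeP/(_ _ (leqnn _)) h.
  by have := cV; rewrite -lP h mulr0 => /esym/eqP; rewrite oner_eq0.
have gi0_int : integral_gen y (g i0).
  apply: (@integral_gen_root _ _ _ (iota c^-1 *: P)).
  - have sQ : size (iota c^-1 *: P) = (msize f).-1.+1.
      apply/eqP; rewrite eqn_leq (leq_trans (size_scale_leq _ _))//= ltnNge.
      apply/negP => /leq_sizeP/(_ _ (leqnn _)) /eqP.
      by rewrite coefZ lP cV oner_eq0.
    by rewrite monicE lead_coefE sQ /= coefZ lP cV.
  - rewrite rootE hornerZ; suff -> : P.[g i0] = mmap iota g f by rewrite fg0 mulr0.
    rewrite /P /line_subst /mmap horner_sum; apply: eq_bigr => m _.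
    rewrite hornerM hornerC; congr (_ * _); rewrite /mmap1 horner_prod; apply: eq_bigr => i _.
    by rewrite horner_exp hornerD hornerC hornerZ hornerX subrK.
  - move=> k; rewrite coefZ; apply: integral_genM; last exact: P_int.
    exact: integral_gen_const.
exists d, y; split => //.
  move=> j; apply: in_lspan_sum (y_span j) => k.
  exists (fun i => (i == lift i0 k)%:R - (i == i0)%:R * b (lift i0 k)).
  under eq_bigr do rewrite rmorphB mulrBl rmorphM -mulrA.
  rewrite sumrB (bigD1 (lift i0 k))//= eqxx rmorph1 mul1r big1 ?addr0; last first.
    by move=> i /negbTE ->; rewrite rmorph0 mul0r.
  rewrite (bigD1 i0)//= eqxx rmorph1 mul1r big1 ?addr0// => i /negbTE ->.
  by rewrite rmorph0 mul0r.
move=> i; rewrite -(subrK (iota (b i) * g i0) (g i)); apply: integral_genD; first exact: x_int.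
by apply: integral_genM => //; rewrite -(mmapC y); exact: integral_gen_id.
Qed.

End NoetherNormalization.

(** * Finite modules and lying over *)

Section ModuleFinite.
Context (K : closedFieldType) (D : comNzRingType) (iota : {rmorphism K -> D}).
Context (d r : nat) (x : 'I_d -> D) (g : 'I_r -> D).
Local Notation phi := (mmap iota x).

Lemma common_monic : (forall i, integral_gen iota x (g i)) ->
  exists B, forall i, exists q : 'I_B.+1 -> {mpoly K[d]},
    g i ^+ B.+1 = \sum_k phi (q k) * g i ^+ k.
Proof.
move=> h.
have /choice[n hn] : forall i, exists n, forall B, (n <= B)%N ->
    exists q : 'I_B -> {mpoly K[d]}, g i ^+ B = \sum_k phi (q k) * g i ^+ k.
  move=> i; case: (h i) => {}p mp /rootP; rewrite horner_coef.
  have sp : size (map_poly phi p) = size p by rewrite size_map_poly_id0// (monicP mp) rmorph1 oner_neq0.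
  rewrite sp; have sp0 : (0 < size p)%N by rewrite size_poly_gt0 monic_neq0.
  rewrite -(prednK sp0) big_ord_recr /= coef_map /= -/(lead_coef p) (monicP mp) rmorph1 mul1r.
  set n := (size p).-1 => /eqP; rewrite addr_eq0 => /eqP hn.
  exists n => B nB; exists (fun k : 'I_B => if (k < B - n)%N then 0 else - p`_(k - (B - n))).
  rewrite -{1}(subnKC nB) exprD -[g i ^+ n]opprK -hn mulNr mulr_suml.
  rewrite -(big_mkord xpredT (fun k => phi (if (k < B - n)%N then 0 else - p`_(k - (B - n))) * g i ^+ k)).
  rewrite (big_cat_nat (n := (B - n)))//=; last by rewrite leq_subr.
  rewrite [X in _ = X + _]big1_seq ?add0r; last first.
    by move=> k /andP[_]; rewrite mem_index_iota => /andP[_ ->]; rewrite rmorph0 mul0r.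
  rewrite -[X in \sum_(X <= _ < _) _]add0n big_addn subKn// big_mkord -sumrN.
  apply: eq_bigr => k _; rewrite ltnNge leq_addl /= addnK rmorphN coef_map /=.
  by rewrite mulNr exprD mulrA.
exists (\max_i n i) => i; apply: hn; apply: leqW; exact: leq_bigmax.
Qed.

(* Degrees are controlled: monomials of degree [q] in [g] have coordinates of
   degree [O(q)] in [x]. *)
Lemma module_finite : (forall i, integral_gen iota x (g i)) ->
  exists (M : nat) (e : 'I_M -> D) (c : nat), forall a : 'X_{1..r},
    exists2 P : 'I_M -> {mpoly K[d]}, (forall b, (msize (P b) <= c * (mdeg a).+1)%N) &
      mmap1 g a = \sum_b phi (P b) * e b.
Proof.
move=> /common_monic[B hB].
pose J := {ffun 'I_r -> 'I_B.+1}.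
pose e (b : J) : D := \prod_i g i ^+ b i.
pose insp y := exists P : J -> {mpoly K[d]}, y = \sum_b phi (P b) * e b.
have inspD y z : insp y -> insp z -> insp (y + z).
  move=> [P ->] [Q ->]; exists (fun b => P b + Q b); rewrite -big_split /=.
  by apply: eq_bigr => b _; rewrite rmorphD mulrDl.
have inspM p y : insp y -> insp (phi p * y).
  move=> [P ->]; exists (fun b => p * P b); rewrite mulr_sumr.
  by apply: eq_bigr => b _; rewrite rmorphM mulrA.
have insp0 : insp 0 by exists (fun=> 0); rewrite big1// => b _; rewrite rmorph0 mul0r.
have inspe b : insp (e b).
  exists (fun b' => (b' == b)%:R); rewrite (bigD1 b)//= eqxx rmorph1 mul1r big1 ?addr0//.
  by move=> b' /negbTE ->; rewrite rmorph0 mul0r.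
pose upd (b : J) i (k : 'I_B.+1) : J := [ffun j => if j == i then k else b j].
have eU b i k : e (upd b i k) = g i ^+ k * \prod_(j | j != i) g j ^+ b j.
  rewrite /e (bigD1 i)//= ffunE eqxx; congr (_ * _); apply: eq_bigr => j /negbTE ji.
  by rewrite ffunE ji.
have inspg i b : insp (g i * e b).
  have -> : e b = g i ^+ b i * \prod_(j | j != i) g j ^+ b j by rewrite /e (bigD1 i).
  rewrite mulrA -exprS; have [bi|] := ltnP (b i) B.
    have bi' : ((b i).+1 < B.+1)%N by [].
    by rewrite -(eU b i (Ordinal bi')).
  move=> Bb; have -> : (b i : nat) = B by apply/eqP; rewrite eqn_leq Bb -ltnS ltn_ord.
  have [q ->] := hB i; rewrite mulr_suml -/(insp _); apply: (big_ind insp) => // k _.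
  by rewrite -mulrA -eU; exact: inspM.
have /choice[Q0 hQ0] : forall t : unit, exists P : J -> {mpoly K[d]}, 1 = \sum_b phi (P b) * e b.
  move=> _; suff -> : 1 = e [ffun=> ord0] by exact: inspe.
  by rewrite /e big1// => i _; rewrite ffunE.
have /choice[Q hQ] : forall ib : 'I_r * J, exists P : J -> {mpoly K[d]},
  g ib.1 * e ib.2 = \sum_b phi (P b) * e b by move=> [i b]; exact: inspg.
pose c := (maxn (\max_b msize (Q0 tt b)) (\max_ib \max_b msize (Q ib b))).+1.
suff h (a : 'X_{1..r}) : exists2 P : J -> {mpoly K[d]},
    (forall b, (msize (P b) <= c * (mdeg a).+1)%N) & mmap1 g a = \sum_b phi (P b) * e b.
  exists #|{: J}|, (fun i => e (enum_val i)), c => a; have [P hP ->] := h a.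
  exists (fun i => P (enum_val i)) => [b|]; first exact: hP.
  by rewrite (reindex (@enum_val _ {: J}))//=; exact/onW_bij/enum_val_bij.
have [n] := ubnP (mdeg a); elim: n a => // n IH a; rewrite ltnS => an.
have [->|a0] := eqVneq a 0%MM.
  exists (Q0 tt); last by rewrite mmap11 (hQ0 tt).
  move=> b; rewrite mdeg0 muln1 /c ltnW// ltnS leq_max; apply/orP; left.
  exact: (leq_bigmax (F := fun b => msize (Q0 tt b))).
have [i ai] : exists i, a i != 0%N.
  by apply/existsP; apply: contraNT a0 => /existsPn h; apply/eqP/mnmP => i; rewrite mnm0E; apply/eqP; move: (h i); rewrite negbK.
have Ua : (U_(i) <= a)%MM.
  by apply/mnm_lepP => j; rewrite mnm1E; case: eqP => // <-; rewrite lt0n.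
rewrite -(submK Ua); set a' := (a - U_(i))%MM; have am : mdeg a = (mdeg a').+1.
  by rewrite -{1}(submK Ua) mdegD mdeg1 addn1.
have [|P hP aE] := IH a'; first by rewrite -ltnS -am.
exists (fun b' => \sum_b P b * Q (i, b) b').
  move=> b'; apply: leq_trans (msize_sum _ _ _) _; apply/bigmax_leqP => b _.
  apply: leq_trans (msizeM_le _ _) _; rewrite submK// am [(c * _)%N]mulnS -addnS [X in (X <= _)%N]addnC.
  apply: leq_add; last exact: hP.
  rewrite ltnS leq_max; apply/orP; right.
  apply: (@leq_trans (\max_b' msize (Q (i, b) b'))).
    exact: (leq_bigmax (F := fun b' => msize (Q (i, b) b'))).
  exact: (leq_bigmax (F := fun ib => \max_b' msize (Q ib b'))).
have -> : mmap1 g (a' + U_(i)) = g i * mmap1 g a'.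
  rewrite commr_mmap1_M; last by move=> *; exact: mulrC.
  by rewrite mmap1U mulrC.
rewrite aE mulr_sumr; under eq_bigr do rewrite mulrCA (hQ (i, _)) mulr_sumr.
rewrite exchange_big /=; apply: eq_bigr => b' _; rewrite rmorph_sum mulr_suml.
by apply: eq_bigr => b _; rewrite rmorphM mulrA.
Qed.

End ModuleFinite.

Section LyingOver.
Context (K : closedFieldType) (D : comNzRingType) (iota : {rmorphism K -> D}).
Implicit Types (I : set D).

Definition is_ideal I := I 0 /\ forall a u v, I u -> I v -> I (a * u + v).

Lemma idealD I u v : is_ideal I -> I u -> I v -> I (u + v).
Proof. by move=> [_ h] Iu Iv; rewrite -[u]mul1r; exact: h. Qed.

Lemma idealM I a u : is_ideal I -> I u -> I (a * u).
Proof. by move=> [I0 h] Iu; rewrite -[_ * _]addr0; exact: h. Qed.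

Lemma mmap_mod_ideal I r (g : 'I_r -> D) (c : 'I_r -> K) (p : {mpoly K[r]}) : is_ideal I ->
  (forall i, I (g i - iota (c i))) -> I (mmap iota g p - iota p.@[c]).
Proof.
move=> hI h; have I0 := hI.1.
have mon (a : 'X_{1..r}) : I (mmap1 g a - iota (\prod_i c i ^+ a i)).
  rewrite rmorph_prod; apply: (big_ind2 (fun u v => I (u - v))).
  - by rewrite subrr.
  - move=> u u' v v' hu hv; rewrite (_ : _ - _ = v * (u - u') + u' * (v - v')); last by ring.
    by apply: idealD => //; exact: idealM.
  - move=> i _; rewrite rmorphXn; elim: (a i) => [|k IH]; first by rewrite !expr0 subrr.
    rewrite !exprS (_ : _ - _ = g i * (g i ^+ k - iota (c i) ^+ k) + iota (c i) ^+ k * (g i - iota (c i))); last by ring.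
    by apply: idealD => //; exact: idealM.
rewrite /mmap mevalE rmorph_sum -sumrB; apply: big_ind => // [u v|a _]; first exact: idealD.
by rewrite rmorphM -mulrBr; exact: idealM.
Qed.

(** If [I] together with [y - iota z] generates 1, the factor [y - iota z] may be dropped from the
    product modulo [I]; dropping all of them would put 1 in [I]. *)
Lemma adjoin_root I y (s : seq K) : is_ideal I -> ~ I 1 ->
  I (\prod_(z <- s) (y - iota z)) ->
  exists z J, [/\ is_ideal J, I `<=` J, ~ J 1 & J (y - iota z)].
Proof.
move=> hI nI1; elim: s => [|z s IH]; first by rewrite big_nil.
rewrite big_cons => hz.
pose J := [set u | exists i h, I i /\ u = i + h * (y - iota z)].
have hJ : is_ideal J.
  split; first by exists 0, 0; split; [exact: hI.1|rewrite mul0r addr0].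
  move=> a _ _ [i [h [Ii ->]]] [i' [h' [Ii' ->]]].
  by exists (a * i + i'), (a * h + h'); split; [exact: hI.2|ring].
have IJ : I `<=` J by move=> u Iu; exists u, 0; rewrite mul0r addr0.
have [J1|nJ1] := pselect (J 1); last first.
  exists z, J; split => //; exists 0, 1; split; [exact: hI.1|by rewrite mul1r add0r].
apply: IH; case: J1 => i [h [Ii e1]]; set P := \prod_(_ <- s) _ in hz *.
rewrite -[P]mul1r e1 mulrDl; apply: idealD => //; first by rewrite mulrC; exact: idealM.
by rewrite -mulrA; exact: idealM.
Qed.

(** The ideal [I0] of the point [c] stays proper in [D] by Nakayama's determinant argument. The
    generators are then specialised one at a time, each being a root of a monic polynomial that
    splits over [K]. *)
Lemma lying_over d r (x : 'I_d -> D) (g : 'I_r -> D) (q : 'I_d -> {mpoly K[r]}) (c : 'I_d -> K) :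
  (forall y : D, exists p : {mpoly K[r]}, y = mmap iota g p) ->
  alg_indep iota x -> (forall i, integral_gen iota x (g i)) ->
  (forall j, x j = mmap iota g (q j)) ->
  exists xi : 'I_r -> K, (forall p : {mpoly K[r]}, mmap iota g p = 0 -> p.@[xi] = 0) /\
    forall j, (q j).@[xi] = c j.
Proof.
move=> surj ind int xq.
pose I0 : set D := [set u | exists h : 'I_d -> D, u = \sum_j h j * (x j - iota (c j))].
have hI0 : is_ideal I0.
  split; first by exists (fun=> 0); rewrite big1// => j _; rewrite mul0r.
  move=> a _ _ [h ->] [h' ->]; exists (fun j => a * h j + h' j).
  by rewrite mulr_sumr -big_split; apply: eq_bigr => j _ /=; ring.
have I0x j : I0 (x j - iota (c j)).
  exists (fun k => (k == j)%:R); rewrite (bigD1 j)//= eqxx mul1r big1 ?addr0//.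
  by move=> k /negbTE ->; rewrite mul0r.
have nI01 : ~ I0 1.
  move=> [h h1]; have [M [e [deg he]]] := module_finite int.
  have span (y : D) : exists P : 'I_M -> {mpoly K[d]}, y = \sum_b mmap iota x (P b) * e b.
    have [p ->] := surj y; rewrite {1}/mmap.
    have /choice[Q hQ] : forall a, exists P : 'I_M -> {mpoly K[d]}, mmap1 g a = \sum_b mmap iota x (P b) * e b.
      by move=> a; have [P _ aE] := he a; exists P.
    exists (fun b => \sum_(a <- msupp p) p@_a *: Q a b).
    under [RHS]eq_bigr do rewrite rmorph_sum mulr_suml.
    rewrite exchange_big /=; apply: eq_bigr => a _; rewrite hQ.
    by rewrite mulr_sumr; apply: eq_bigr => b _; rewrite mmapZ mulrA.
  have /choice[P hP] : forall jb : 'I_d * 'I_M, exists P : 'I_M -> {mpoly K[d]},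
    h jb.1 * e jb.2 = \sum_b mmap iota x (P b) * e b by move=> jb; exact: span.
  (* The entries of [A] vanish at [c], so [\det (1%:M - A)] is 1 there; but it annihilates the
     module generators, hence is zero by independence of the [x j]. *)
  pose A : 'M[{mpoly K[d]}]_M := \matrix_(a, b) \sum_j P (j, a) b * ('X_j - (c j)%:MP).
  pose phi := mmap iota x.
  have Ae : map_mx phi (1%:M - A) *m (\col_b e b) = 0.
    rewrite map_mxB map_scalar_mx rmorph1 mulmxBl mul1mx; apply/eqP; rewrite subr_eq0; apply/eqP.
    apply/colP => a; rewrite !mxE -[LHS]mul1r [X in X * _]h1 mulr_suml.
    under eq_bigr do rewrite mulrAC (hP (_, a)) mulr_suml.
    rewrite exchange_big; apply: eq_bigr => b _ /=; rewrite !mxE rmorph_sum mulr_suml.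
    apply: eq_bigr => j _; rewrite /phi rmorphM /= mmapB mmapX mmap1U mmapC; ring.
  have det0 : mmap iota x (\det (1%:M - A)) = 0.
    have [P1 e1] := span 1.
    have : (\det (map_mx phi (1%:M - A)))%:M *m (\col_b e b) = 0.
      by rewrite -mul_adj_mx -mulmxA Ae mulmx0.
    rewrite mul_scalar_mx => dete; rewrite -[LHS]mulr1 [X in _ * X]e1 mulr_sumr big1// => b _.
    have /colP/(_ b) := dete; rewrite !mxE det_map_mx /phi => db.
    by rewrite mulrCA db mulr0.
  have := ind _ det0 => /(congr1 (meval c)); rewrite rmorph0 -det_map_mx map_mxB map_scalar_mx rmorph1.
  rewrite (_ : map_mx (meval c) A = 0) ?subr0 ?det1 => [/eqP|]; first by rewrite oner_eq0.
  apply/matrixP => a b; rewrite !mxE rmorph_sum big1// => j _.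
  by rewrite rmorphM rmorphB /= mevalXU mevalC subrr mulr0.
have [xi [I [hI I0I nI1 hxi]]] : exists (xi : 'I_r -> K) I, [/\ is_ideal I, I0 `<=` I, ~ I 1 &
    forall i, i \in enum 'I_r -> I (g i - iota (xi i))].
  elim: (enum 'I_r) => [|i s [xi [I [hI I0I nI1 hxi]]]]; first by exists (fun=> 0), I0; split.
  have [z [J [hJ IJ nJ1 Jz]]] : exists z J, [/\ is_ideal J, I `<=` J, ~ J 1 & J (g i - iota z)].
    have [p mp /rootP] := int i; rewrite horner_coef => pg.
    have sp : size (map_poly (mmap iota x) p) = size p.
      by rewrite size_map_poly_id0// (monicP mp) rmorph1 oner_neq0.
    pose p1 : {poly K} := map_poly (meval c) p.
    have [s' p1E] := closed_field_poly_normal p1.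
    apply: (@adjoin_root I (g i) s') => //.
    have lp1 : lead_coef p1 = 1.
      have m1 := meval1 c : (meval c : {additive _ -> _}) 1 = 1.
      by rewrite lead_coef_map_eq (monicP mp) m1 ?oner_neq0.
    suff : I (map_poly iota p1).[g i].
      rewrite p1E lp1 scale1r rmorph_prod horner_prod.
      by under eq_bigr do rewrite rmorphB /= map_polyX map_polyC hornerXsubC.
    rewrite (@horner_coef_wide _ (size p)); last first.
      by apply: leq_trans (size_poly _ _) _; exact: leq_trans (size_poly _ _) _.
    rewrite -[X in I X]subr0 -[X in _ - X]pg sp -sumrB.
    apply: big_ind => [|u v|k _]; [exact: hI.1|exact: idealD|].
    rewrite !coef_map /= -mulrBl -opprB mulNr -mulrN mulrC; apply: idealM => //.
    by apply: I0I; apply: mmap_mod_ideal.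
  exists (fun j => if j == i then z else xi j), J; split => //; first exact: subset_trans IJ.
  move=> j; rewrite inE; case: eqP => [-> _|_ /= js]; first by [].
  by apply: IJ; exact: hxi.
have {}hxi i : I (g i - iota (xi i)) by apply: hxi; rewrite mem_enum.
have inI (t : K) : I (iota t) -> t = 0.
  move=> It; apply: contrapT => /eqP t0; apply: nI1.
  by rewrite -(rmorph1 iota) -(mulVf t0) rmorphM; exact: idealM.
exists xi; split => [p p0|j].
  apply: inI; have := mmap_mod_ideal p hI hxi; rewrite p0 sub0r => h.
  by rewrite -[iota _]opprK -mulN1r; exact: idealM.
apply/eqP; rewrite -subr_eq0; apply/eqP; apply: inI; rewrite rmorphB.
rewrite (_ : _ - _ = (x j - iota (c j)) + -1 * (mmap iota g (q j) - iota (q j).@[xi])).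
  by apply: idealD => //; [exact: I0I|apply: idealM => //; exact: mmap_mod_ideal].
by rewrite xq; ring.
Qed.

End LyingOver.

(* Polynomial rings are completely integrally closed: subtracting from the
   fraction [f / g] the quotient of the leading terms lowers [mlead f]. *)
Lemma mpoly_almost_integral (K : fieldType) d (f g s : {mpoly K[d]}) : g != 0 -> s != 0 ->
  (forall k, exists h, s * f ^+ k = h * g ^+ k) -> exists q, f = q * g.
Proof.
move=> g0 s0; move Em : (mlead f) => m; elim/(@ltmwf d): m f Em => m IH f fm hf.
have [->|f0] := eqVneq f 0; first by exists 0; rewrite mul0r.
have le_gf : (mlead g <= mlead f)%MM.
  apply/mnm_lepP => i; rewrite leqNgt; apply/negP => lt_fg.
  set n := (mlead s i).+1; have [h sh] := hf n.
  have h0 : h != 0.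
    by apply/eqP => h0; move/eqP: sh; rewrite h0 mul0r mulf_eq0 (negbTE s0) expf_eq0 (negbTE f0) andbF.
  have e1 : mlead (s * f ^+ n) = (mlead s + mlead f *+ n)%MM.
    by rewrite (mleadM s0 (expf_neq0 n f0)) mleadX.
  have e2 : mlead (h * g ^+ n) = (mlead h + mlead g *+ n)%MM.
    by rewrite (mleadM h0 (expf_neq0 n g0)) mleadX.
  have : ((mlead f i).+1 * n <= mlead g i * n)%N by rewrite leq_mul2r lt_fg orbT.
  move: e2; rewrite -sh e1 => /mnmP/(_ i); rewrite !mnmDE !mulmnE /n.
  move: (mlead f i) (mlead g i) (mlead s i) (mlead h i) => a b e t; lia.
pose c := mleadc f / mleadc g.
pose q1 : {mpoly K[d]} := c *: 'X_[(mlead f - mlead g)%MM].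
have c0 : c != 0 by rewrite mulf_neq0// ?invr_eq0 mleadc_eq0.
pose f1 := f - q1 * g.
have hf1 k : exists h, s * f1 ^+ k = h * g ^+ k.
  have /choice[h hh] := hf.
  exists (\sum_(i < k.+1) (h (k - i)%N * (- q1) ^+ i) *+ 'C(k, i)).
  rewrite /f1 exprDn mulr_sumr mulr_suml; apply: eq_bigr => i _.
  rewrite mulrnAr mulrnAl -mulNr; congr (_ *+ _).
  have -> : (- q1 * g) ^+ i = (- q1) ^+ i * g ^+ i by rewrite exprMn_comm//; exact: mulrC.
  have ik : (i <= k)%N by rewrite -ltnS.
  have gk : g ^+ k = g ^+ (k - i) * g ^+ i by rewrite -exprD subnK.
  by rewrite mulrA hh gk; ring.
have f1lt : f1 != 0 -> (mlead f1 < mlead f)%O.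
  move=> f10; have q1g0 : q1 * g != 0.
    rewrite mulf_neq0// scaler_eq0 (negbTE c0)/=.
    by apply/eqP => /(congr1 (mcoeff (mlead f - mlead g)%MM)); rewrite mcoeffX eqxx mcoeff0 => /eqP; rewrite oner_eq0.
  have lq : mlead (q1 * g) = mlead f.
    rewrite mleadM//; last by move: q1g0; rewrite mulf_eq0 negb_or => /andP[].
    by rewrite mleadZ// mleadXm submK.
  rewrite lt_neqAle; apply/andP; split; last first.
    by apply: le_trans (mleadB_le _ _) _; rewrite lq joinxx.
  apply: contra_neq f10 => h; apply/eqP; rewrite -mleadc_eq0 h /f1 mcoeffB.
  have -> : (q1 * g)@_(mlead f) = mleadc f.
    have lq1 : mlead q1 = (mlead f - mlead g)%MM by rewrite mleadZ// mleadXm.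
    have := mleadcM q1 g; rewrite lq1 submK// => ->.
    by rewrite mcoeffZ mcoeffX eqxx mulr1 /c divfK// mleadc_eq0.
  by rewrite subrr.
have [f10|f10] := eqVneq f1 0; first by exists q1; apply/eqP; rewrite -subr_eq0 -/f1 f10.
have [q hq] : exists q, f1 = q * g by apply: (IH (mlead f1)) => //; rewrite -fm; exact: f1lt.
by exists (q + q1); rewrite mulrDl -hq /f1 subrK.
Qed.

(** * Fractions over a polynomial ring, norms, and the principal ideal theorem *)

Section PrincipalQuotient.
Context (K : closedFieldType) (L : fieldType) (iota : {rmorphism K -> L}).

Section Fractions.
Context (d : nat) (x : 'I_d -> L).
Hypothesis x_ind : alg_indep iota x.
Let phi : {rmorphism {mpoly K[d]} -> L} := mmap iota x.

Definition poly_elt (y : L) := exists p, y = phi p.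
Definition frac_elt (y : L) := exists p q, q != 0 /\ y = phi p / phi q.

Lemma phi_eq0 p : (phi p == 0) = (p == 0).
Proof. by apply/eqP/eqP => [/x_ind//|->]; rewrite rmorph0. Qed.

Lemma poly_frac y : poly_elt y -> frac_elt y.
Proof. by move=> [p ->]; exists p, 1; rewrite oner_neq0 rmorph1 divr1. Qed.

Lemma poly_eltD y z : poly_elt y -> poly_elt z -> poly_elt (y + z).
Proof. by move=> [p ->] [q ->]; exists (p + q); rewrite rmorphD. Qed.

Lemma poly_eltM y z : poly_elt y -> poly_elt z -> poly_elt (y * z).
Proof. by move=> [p ->] [q ->]; exists (p * q); rewrite rmorphM. Qed.

Lemma poly_eltN y : poly_elt y -> poly_elt (- y).
Proof. by move=> [p ->]; exists (- p); rewrite rmorphN. Qed.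

Lemma poly_elt_const c : poly_elt (iota c).
Proof. by exists c%:MP; rewrite /phi /= mmapC. Qed.

Lemma poly_elt_nat n : poly_elt n%:R.
Proof. by rewrite -(rmorph_nat iota); exact: poly_elt_const. Qed.

Lemma poly_elt_sum (J : Type) (s : seq J) (P : pred J) (F : J -> L) :
  (forall j, P j -> poly_elt (F j)) -> poly_elt (\sum_(j <- s | P j) F j).
Proof.
by move=> h; apply: big_ind => //; [exact: (poly_elt_nat 0)|exact: poly_eltD].
Qed.

Lemma poly_elt_prod (J : Type) (s : seq J) (P : pred J) (F : J -> L) :
  (forall j, P j -> poly_elt (F j)) -> poly_elt (\prod_(j <- s | P j) F j).
Proof.
by move=> h; apply: big_ind => //; [exact: (poly_elt_nat 1)|exact: poly_eltM].
Qed.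

Lemma poly_elt_det m (M : 'M[L]_m) : (forall i j, poly_elt (M i j)) -> poly_elt (\det M).
Proof.
move=> h; apply: poly_elt_sum => s _; apply: poly_eltM; last exact: poly_elt_prod.
rewrite -signr_odd; case: odd; rewrite ?expr1 ?expr0; last exact: (poly_elt_nat 1).
by apply: poly_eltN; exact: (poly_elt_nat 1).
Qed.

Lemma frac_eltD y z : frac_elt y -> frac_elt z -> frac_elt (y + z).
Proof.
move=> [p [q [q0 ->]]] [p' [q' [q0' ->]]]; exists (p * q' + p' * q), (q * q').
by rewrite mulf_neq0// rmorphD !rmorphM addf_div// phi_eq0.
Qed.

Lemma frac_eltM y z : frac_elt y -> frac_elt z -> frac_elt (y * z).
Proof.
move=> [p [q [q0 ->]]] [p' [q' [q0' ->]]]; exists (p * p'), (q * q').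
by rewrite mulf_neq0// !rmorphM mulf_div.
Qed.

Lemma frac_eltN y : frac_elt y -> frac_elt (- y).
Proof. by move=> [p [q [q0 ->]]]; exists (- p), q; rewrite rmorphN mulNr. Qed.

Lemma frac_eltV y : frac_elt y -> frac_elt y^-1.
Proof.
move=> [p [q [q0 ->]]]; have [->|p0] := eqVneq p 0.
  by rewrite rmorph0 mul0r invr0; exact/poly_frac/(poly_elt_nat 0).
by exists q, p; rewrite invf_div.
Qed.

Lemma frac_elt_sum (J : Type) (s : seq J) (P : pred J) (F : J -> L) :
  (forall j, P j -> frac_elt (F j)) -> frac_elt (\sum_(j <- s | P j) F j).
Proof.
by move=> h; apply: big_ind => //; [exact/poly_frac/(poly_elt_nat 0)|exact: frac_eltD].
Qed.

Lemma frac_elt_prod (J : Type) (s : seq J) (P : pred J) (F : J -> L) :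
  (forall j, P j -> frac_elt (F j)) -> frac_elt (\prod_(j <- s | P j) F j).
Proof.
by move=> h; apply: big_ind => //; [exact/poly_frac/(poly_elt_nat 1)|exact: frac_eltM].
Qed.

Lemma frac_elt_det m (M : 'M[L]_m) : (forall i j, frac_elt (M i j)) -> frac_elt (\det M).
Proof.
move=> h; apply: frac_elt_sum => s _; apply: frac_eltM; last exact: frac_elt_prod.
rewrite -signr_odd; case: odd; rewrite ?expr1 ?expr0; apply: poly_frac; last exact: (poly_elt_nat 1).
by apply: poly_eltN; exact: (poly_elt_nat 1).
Qed.

Lemma common_denominator (J : finType) (F : J -> L) : (forall j, frac_elt (F j)) ->
  exists2 s, s != 0 & forall j, poly_elt (phi s * F j).
Proof.
move=> /choice[p /choice[q hq]]; exists (\prod_j q j).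
  by apply/prodf_neq0 => j _; have [] := hq j.
move=> j; have [q0 ->] := hq j; exists (p j * \prod_(k | k != j) q k).
have key (a b t : L) : a != 0 -> a * t * (b / a) = b * t by move=> a0; field.
by rewrite (bigD1 j)//= !rmorphM; apply: key; rewrite phi_eq0.
Qed.

Lemma almost_integral y s : frac_elt y -> s != 0 -> (forall k, poly_elt (phi s * y ^+ k)) ->
  poly_elt y.
Proof.
move=> [p [q [q0 ->]]] s0 h; have [|t ->] := mpoly_almost_integral q0 s0 (f := p).
  move=> k; have [t ht] := h k; exists t; apply/eqP.
  rewrite -subr_eq0 -phi_eq0 rmorphB !rmorphM !rmorphXn subr_eq0 -ht.
  by rewrite expr_div_n -mulrA divfK// expf_neq0// phi_eq0.
by exists t; rewrite rmorphM mulfK// phi_eq0.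
Qed.

(* [P(M) = 0] with [P] monic over the polynomial ring bounds the denominators
   of all powers of [M]. *)
Lemma integral_matrix_det m (M : 'M[L]_m) (P : {poly {mpoly K[d]}}) : P \is monic ->
  (forall i j, frac_elt (M i j)) ->
  \sum_(k < size P) phi P`_k *: iter k (mulmx M) 1%:M = 0 -> poly_elt (\det M).
Proof.
move=> mP hM hP; pose pw k := iter k (mulmx M) (1%:M : 'M[L]_m).
have pwS k l : pw (k + l)%N = pw k *m pw l.
  by rewrite /pw; elim: k => [|k IH]; rewrite ?mul1mx// addSn !iterS IH mulmxA.
have pw_frac k i j : frac_elt (pw k i j).
  elim: k i j => [|k IH] i j; first by rewrite mxE; exact/poly_frac/poly_elt_nat.
  by rewrite /pw iterS mxE; apply: frac_elt_sum => l _; exact: frac_eltM.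
pose n := (size P).-1; have sP : size P = n.+1 by rewrite prednK// size_poly_gt0 monic_neq0.
have [s s0 hs] : exists2 s, s != 0 & forall kij : 'I_n * ('I_m * 'I_m), poly_elt (phi s * pw kij.1 kij.2.1 kij.2.2).
  by apply: common_denominator => kij.
have hpw k i j : poly_elt (phi s * pw k i j).
  have [l] := ubnP k; elim: l k i j => // l IH k i j; rewrite ltnS => kl.
  have [kn|nk] := ltnP k n; first exact: (hs (Ordinal kn, (i, j))).
  move: hP; rewrite sP big_ord_recr /= -/(pw _) (_ : phi P`_n = 1); last first.
    by rewrite -[P`_n]lead_coefE (monicP mP) rmorph1.
  rewrite scale1r => /eqP; rewrite addr_eq0 => /eqP hn.
  have -> : pw k = - \sum_(e < n) phi P`_e *: pw (k - n + e)%N.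
    rewrite -{1}(subnK nk) pwS -[pw n]opprK -hn mulmxN mulmx_sumr; congr (- _).
    by apply: eq_bigr => e _; rewrite -scalemxAr pwS.
  rewrite mxE summxE mulrN mulr_sumr; apply: poly_eltN; apply: poly_elt_sum => e _.
  rewrite mxE mulrCA; apply: poly_eltM; first by exists P`_e.
  by apply: IH; apply: leq_trans kl; rewrite -ltn_subRL; have := ltn_ord e; lia.
have det_pw k : \det (pw k) = \det M ^+ k.
  by elim: k => [|k IH]; rewrite /pw ?det1// iterS det_mulmx IH exprS.
apply: (@almost_integral _ (s ^+ m)); first exact: frac_elt_det.
  exact: expf_neq0.
move=> k; rewrite -det_pw rmorphXn -detZ; apply: poly_elt_det => i j.
by rewrite mxE; exact: hpw.
Qed.

End Fractions.
End PrincipalQuotient.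

Lemma horner_char_poly (R : comNzRingType) n (M : 'M[R]_n) t :
  (char_poly M).[t] = \det (t%:M - M).
Proof.
rewrite /char_poly -horner_evalE -det_map_mx; congr (\det _).
by apply/matrixP => i j; rewrite !mxE raddfB raddfMn /= /horner_eval !hornerE.
Qed.

Lemma polyC_neq_mul (R : idomainType) (c : R) (f g : {poly R}) : c != 0 ->
  (1 < size g)%N -> c%:P <> f * g.
Proof.
move=> c0 sg e; have /negP := c0; apply; rewrite -polyC_eq0 e mulf_eq0.
have [//|f0] := eqVneq f 0; have g0 : g != 0 by rewrite -size_poly_gt0 (ltn_trans _ sg).
have := size_mul f0 g0; rewrite -e size_polyC c0 => h; move: f0 sg; rewrite -size_poly_gt0.
by move: (size f) (size g) h => a b /=; lia.
Qed.

Lemma closed_field_avoid (K : closedFieldType) (s : seq K) : exists t, t \notin s.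
Proof.
have : \prod_(z <- s) ('X - z%:P) != 0 :> {poly K}.
  by rewrite monic_neq0// monic_prod_XsubC.
by move=> /closed_nonrootP[t]; rewrite root_prod_XsubC; exists t.
Qed.

Section PrincipalIdealTheorem.
Context (K : closedFieldType) (L : fieldType) (iota : {rmorphism K -> L}).

(** [V] is a [K]-subspace of [L]. Division of [P - a%:P] by the linear factor at [t] gives a
    polynomial of smaller degree with values in [V] away from [t]; as [K] is infinite, a list of
    excluded points does no harm. *)
Lemma poly_interpolation (V : L -> Prop) (P : {poly L}) : V 0 ->
  (forall y z, V y -> V z -> V (y + z)) -> (forall c y, V y -> V (iota c * y)) ->
  (forall c, V P.[iota c]) -> forall k, V P`_k.
Proof.
move=> V0 VD VM VP; have {VP} : forall c, c \notin [::] -> V P.[iota c] by move=> c _.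
have [n] := ubnP (size P); elim: n P [::] => // n IH P s; rewrite ltnS => sP VP k.
have VB y z : V y -> V z -> V (y - z).
  by move=> Vy Vz; apply: VD => //; rewrite -mulN1r -(rmorph1 iota) -rmorphN; exact: VM.
have [t ts] := closed_field_avoid s.
set a := P.[iota t]; have : root (P - a%:P) (iota t) by rewrite rootE !hornerE subrr.
move=> /factor_theorem[Q PQ].
have VQ k' : V Q`_k'.
  have [->|Q0] := eqVneq Q 0; first by rewrite coef0.
  apply: (IH Q (t :: s)) => [|c].
    apply: leq_trans sP; have [sP1|sP1] := leqP (size P) 1.
      have : P - a%:P = 0.
        by rewrite /a; have [e ->] : exists e, P = e%:P by [exists P`_0; exact: size1_polyC]; rewrite hornerC subrr.
      by rewrite PQ => /eqP; rewrite mulf_eq0 (negbTE Q0) polyXsubC_eq0.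
    have := congr1 (fun q : {poly L} => size q) PQ.
    rewrite size_polyDl; last by rewrite size_polyN size_polyC (leq_ltn_trans (leq_b1 _)).
    by rewrite size_Mmonic ?monicXsubC// size_XsubC addn2 /= => ->.
  rewrite inE negb_or => /andP[ct cs].
  have ct' : iota (c - t) != 0 by rewrite fmorph_eq0 subr_eq0.
  have -> : Q.[iota c] = iota (c - t)^-1 * (P.[iota c] - a).
    have := congr1 (fun q : {poly L} => q.[iota c]) PQ.
    rewrite /= !hornerE -rmorphB => ->; rewrite fmorphV mulrCA mulVf ?mulr1//.
  by apply: VM; apply: VB; [exact: VP|exact: VP].
rewrite -(subrK a%:P P) PQ coefD coefC mulrBr coefB coefMX coefMC.
apply: VD; last by case: eqP => // _; exact: VP.
by apply: VB; [case: eqP|rewrite mulrC; exact: VM].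
Qed.

Context (r : nat) (g : 'I_r -> L).

Definition in_subalg (y : L) := exists p : {mpoly K[r]}, y = mmap iota g p.

Lemma in_subalgD y z : in_subalg y -> in_subalg z -> in_subalg (y + z).
Proof. by move=> [p ->] [q ->]; exists (p + q); rewrite rmorphD. Qed.

Lemma in_subalgM y z : in_subalg y -> in_subalg z -> in_subalg (y * z).
Proof. by move=> [p ->] [q ->]; exists (p * q); rewrite rmorphM. Qed.

Lemma in_subalg_const c : in_subalg (iota c).
Proof. by exists c%:MP; rewrite mmapC. Qed.

Lemma in_subalg_nat n : in_subalg n%:R.
Proof. by rewrite -(rmorph_nat iota); exact: in_subalg_const. Qed.

Lemma in_subalg_sum (J : Type) (s : seq J) (P : pred J) (F : J -> L) :
  (forall j, P j -> in_subalg (F j)) -> in_subalg (\sum_(j <- s | P j) F j).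
Proof. by move=> h; apply: big_ind => //; [exact: (in_subalg_nat 0)|exact: in_subalgD]. Qed.

Lemma in_subalg_prod (J : Type) (s : seq J) (P : pred J) (F : J -> L) :
  (forall j, P j -> in_subalg (F j)) -> in_subalg (\prod_(j <- s | P j) F j).
Proof. by move=> h; apply: big_ind => //; [exact: (in_subalg_nat 1)|exact: in_subalgM]. Qed.

Lemma in_subalgX y n : in_subalg y -> in_subalg (y ^+ n).
Proof.
move=> h; elim: n => [|n IH]; first exact: (in_subalg_nat 1).
by rewrite exprS; exact: in_subalgM.
Qed.

Lemma in_subalg_gen i : in_subalg (g i).
Proof. by exists 'X_i; rewrite mmapX mmap1U. Qed.

Lemma in_subalg_mmap d (x : 'I_d -> L) p : (forall j, in_lspan iota g (x j)) ->
  in_subalg (mmap iota x p).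
Proof.
move=> hx; apply: in_subalg_sum => a _; apply: in_subalgM; first exact: in_subalg_const.
apply: in_subalg_prod => j _; apply: in_subalgX; have [c ->] := hx j.
by apply: in_subalg_sum => i _; apply: in_subalgM; [exact: in_subalg_const|exact: in_subalg_gen].
Qed.

(* Krull's principal ideal theorem for a nonunit [u] of the affine domain
   [in_subalg], in the form: if the domain has dimension [d + 1], then some [d]
   elements remain algebraically independent modulo [u].  The norm of [u] to a
   Noether normalisation is a nonconstant polynomial [f], and [u b = a] forces
   [f] to divide a power of [a]. *)
Theorem principal_ideal_dim (u : L) : in_subalg u -> u != 0 -> ~ in_subalg u^-1 ->
  exists d (x : 'I_d.+1 -> L) (y : 'I_d -> L),
    [/\ alg_indep iota x, forall i, integral_gen iota x (g i),
        forall j, in_lspan iota g (y j) &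
        forall (p : {mpoly K[d]}) b, in_subalg b -> mmap iota y p = u * b -> p = 0].
Proof.
move=> Au u0 nAu; have [D [x [x_span x_ind x_int]]] := noether_normalization iota g.
have alg_int b : in_subalg b -> integral_gen iota x b by move=> [p ->]; exact: integral_mmap.
pose Fr := frac_elt iota x; pose Po := poly_elt iota x.
have Po_alg b : Po b -> in_subalg b by move=> [p ->]; exact: in_subalg_mmap.
(* The least such [m] is the degree of [u] over the fractions [Fr]; minimality makes the powers of
   [u] below [m] independent over [Fr]. *)
pose Pm m := `[< exists q : {poly L}, [/\ q \is monic, size q = m.+1, forall k, Fr q`_k & root q u] >].
have exP : exists m, Pm m.
  have [p mp pu] := alg_int u Au.
  have mq : map_poly (mmap iota x) p \is monic by exact: monic_map.
  exists (size (map_poly (mmap iota x) p)).-1; apply/asboolP.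
  exists (map_poly (mmap iota x) p); split => //.
    by rewrite prednK// size_poly_gt0 monic_neq0.
  by move=> k; rewrite coef_map; apply: poly_frac; exists p`_k.
case: (ex_minnP exP) => m /asboolP[q [mq sq Fq qu]] m_min.
have indep (a : 'I_m -> L) : (forall i, Fr (a i)) -> \sum_i a i * u ^+ i = 0 -> forall i, a i = 0.
  move=> Fa au i; pose Q : {poly L} := \poly_(k < m) (if insub k is Some j then a j else 0).
  have QE (k : 'I_m) : Q`_k = a k by rewrite coef_poly ltn_ord valK.
  suff Q0 : Q = 0 by rewrite -QE Q0 coef0.
  apply: contrapT => /eqP Q0; have sQ : (0 < size Q)%N by rewrite size_poly_gt0.
  have : (m <= (size Q).-1)%N.
    apply: m_min; apply/asboolP; exists ((lead_coef Q)^-1 *: Q).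
    have FQ k : Fr Q`_k.
      rewrite coef_poly; case: ifP => km; last exact/poly_frac/(poly_elt_nat _ _ 0).
      by rewrite insubT /=.
    split.
    - by rewrite monicE lead_coefZ mulVf// lead_coef_eq0.
    - by rewrite size_scale ?invr_eq0 ?lead_coef_eq0// prednK.
    - by move=> k; rewrite coefZ; apply: frac_eltM; [apply: frac_eltV; exact: FQ|exact: FQ].
    rewrite rootE hornerZ (horner_coef_wide _ (size_poly _ _)).
    by under eq_bigr do rewrite QE; rewrite au mulr0.
  have := size_poly m (fun k => if insub k is Some j then a j else 0).
  by rewrite -/Q; move: sQ; case: (size Q) => //= s _ sm /(leq_ltn_trans) => /(_ _ sm); rewrite ltnn.
have m0 : (0 < m)%N.
  rewrite lt0n; apply/eqP => m0; rewrite m0 in sq.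
  have [e qe] : exists e, q = e%:P by exists q`_0; apply: size1_polyC; rewrite sq.
  move: qu mq; rewrite qe rootC monicE lead_coefC => /eqP ->.
  by rewrite eq_sym oner_eq0.
pose U : 'cV[L]_m := \col_i u ^+ i.
have inj (M : 'M[L]_m) : (forall i j, Fr (M i j)) -> M *m U = 0 -> M = 0.
  move=> FM /colP MU; apply/matrixP => i j; rewrite [RHS]mxE; apply: (indep (fun j => M i j)) => //.
  transitivity ((M *m U) i 0); last by rewrite MU mxE.
  by rewrite mxE; apply: eq_bigr => k _; rewrite mxE.
(* A matrix of fractions that represents multiplication by an integral [w] on the powers of [u]
   satisfies the equation of [w]; hence its determinant, the norm of [w] when [w] lies in the field
   generated by [u], is a polynomial. *)
have detPo (w : L) (M : 'M[L]_m) : integral_gen iota x w -> (forall i j, Fr (M i j)) ->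
    w *: U = M *m U -> Po (\det M).
  move=> [p mp pw] FM wM; apply: (integral_matrix_det x_ind mp FM).
  have pwU k : iter k (mulmx M) 1%:M *m U = w ^+ k *: U.
    elim: k => [|k IH]; first by rewrite /= mul1mx scale1r.
    by rewrite iterS -mulmxA IH -scalemxAr -wM scalerA -exprSr.
  have FrI k i j : Fr (iter k (mulmx M) 1%:M i j).
    elim: k i j => [|k IH] i j; first by rewrite mxE; exact/poly_frac/poly_elt_nat.
    by rewrite iterS mxE; apply: (frac_elt_sum x_ind) => l _; apply: frac_eltM; [exact: FM|exact: IH].
  apply: inj.
    move=> i j; rewrite summxE; apply: (frac_elt_sum x_ind) => k _; rewrite mxE.
    by apply: frac_eltM; [apply: poly_frac; exists p`_k|exact: FrI].
  rewrite mulmx_suml; under eq_bigr do rewrite -scalemxAl pwU scalerA.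
  rewrite -scaler_suml; move/rootP: pw; rewrite horner_coef size_map_poly_id0.
    by under eq_bigr do rewrite coef_map; move=> ->; rewrite scale0r.
  by rewrite (monicP mp) rmorph1 oner_neq0.
have [C FC uC] : exists2 C : 'M[L]_m, (forall i j, Fr (C i j)) & u *: U = C *m U.
  exists (\matrix_(i, j) if (i.+1 < m)%N then (i.+1 == j)%:R else - q`_j).
    move=> i j; rewrite mxE; case: ifP => _; first exact/poly_frac/poly_elt_nat.
    by apply: frac_eltN; exact: Fq.
  apply/colP => i; rewrite !mxE -exprS; under eq_bigr do rewrite !mxE.
  have [im|mi] := ltnP i.+1 m.
    rewrite (bigD1 (Ordinal im))//= eqxx mul1r big1 ?addr0// => j /eqP ji.
    by case: eqP => [ij|]; rewrite ?mul0r//; case: ji; apply: val_inj.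
  have -> : i.+1 = m by apply/eqP; rewrite eqn_leq mi ltn_ord.
  move/rootP: qu; rewrite horner_coef sq big_ord_recr /=.
  have -> : q`_m = 1 by have := monicP mq; rewrite lead_coefE sq.
  rewrite mul1r => /eqP; rewrite addrC addr_eq0 => /eqP ->.
  by rewrite -sumrN; apply: eq_bigr => j _; rewrite mulNr.
pose chi := char_poly C.
have chi_u : chi.[u] = 0.
  rewrite horner_char_poly; have : \det (u%:M - C) *: U = 0.
    rewrite -mul_scalar_mx -mul_adj_mx -mulmxA mulmxBl mul_scalar_mx uC subrr mulmx0//.
  by move=> /colP/(_ (Ordinal m0)); rewrite !mxE expr0 mulr1.
(* At a constant [c], the value of [chi] is the norm of [iota c - u], hence a polynomial;
   interpolation passes to the coefficients. *)
have chi_Po k : Po chi`_k.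
  apply: (@poly_interpolation Po) => //.
  - exact: (poly_elt_nat _ _ 0).
  - by move=> y z; exact: poly_eltD.
  - by move=> c y; apply: poly_eltM; exact: poly_elt_const.
  move=> c; rewrite horner_char_poly; apply: (detPo (iota c - u)).
  - apply: integral_genD; first exact: integral_gen_const.
    by rewrite -mulN1r; apply: integral_genM; [rewrite -(rmorph1 iota) -rmorphN; exact: integral_gen_const|exact: alg_int].
  - move=> i j; rewrite !mxE; apply: (frac_eltD x_ind); last by apply: frac_eltN; exact: FC.
    by rewrite -mulr_natr; apply: frac_eltM; apply: poly_frac; [exact: poly_elt_const|exact: poly_elt_nat].
  - by rewrite scalerBl uC mulmxBl mul_scalar_mx.
have schi : size chi = m.+1 by rewrite size_char_poly.
have [f0 f0E'] := chi_Po 0%N.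
have {f0E'} f0E : chi`_0 = mmap iota x f0 := f0E'.
have chi0 : chi`_0 = (-1) ^+ m * \det C by rewrite char_poly_det.
(* A nonzero constant norm would put the inverse of [u] in the algebra; a zero norm would allow
   [chi] to be divided by the variable, against the minimality of [m]. *)
have f0s : (1 < msize f0)%N.
  rewrite ltnNge; apply/negP => /msize1_polyC f0C.
  move: f0E; rewrite f0C mmapC; set c := f0@_0%MM => f0E'.
  have {f0E'} f0E : chi`_0 = iota c := f0E'.
  have chiE : chi`_0 + u * \sum_(k < m) chi`_k.+1 * u ^+ k = 0.
    apply: etrans chi_u; rewrite horner_coef schi big_ord_recl expr0 mulr1; congr (_ + _).
    by rewrite mulr_sumr; apply: eq_bigr => k _; rewrite exprS mulrCA.
  have [c0|c0] := eqVneq c 0; last first.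
    apply: nAu.
    have -> : u^-1 = iota (- c^-1) * \sum_(k < m) chi`_k.+1 * u ^+ k.
      apply: (mulfI u0); rewrite mulfV// mulrCA rmorphN fmorphV mulNr.
      move/eqP: chiE; rewrite addrC addr_eq0 => /eqP ->.
      by rewrite f0E mulrN opprK mulVf// fmorph_eq0.
    apply: in_subalgM; first exact: in_subalg_const.
    by apply: in_subalg_sum => k _; apply: in_subalgM; [exact: Po_alg|exact: in_subalgX].
  have ic0 : iota c = 0 by rewrite c0; exact: rmorph0.
  move: chiE; rewrite f0E ic0 add0r => /eqP; rewrite mulf_eq0 (negbTE u0) /= => /eqP chiE.
  have : (m <= m.-1)%N; last by rewrite leqNgt prednK ?leqnn.
  apply: m_min; apply/asboolP; exists (\poly_(k < m) chi`_k.+1).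
  have top : (\poly_(k < m) chi`_k.+1)`_m.-1 = 1.
    rewrite coef_poly prednK// leqnn; have := char_poly_monic C.
    by rewrite -/chi monicE lead_coefE schi => /eqP.
  have sQ : size (\poly_(k < m) chi`_k.+1) = m.-1.+1.
    rewrite prednK//; apply/eqP; rewrite eqn_leq size_poly leqNgt; apply/negP => h.
    move: top; rewrite nth_default; last by rewrite -ltnS prednK.
    by move/esym/eqP; rewrite oner_eq0.
  split => //.
  - by rewrite monicE lead_coefE sQ /= top.
  - by move=> k; rewrite coef_poly; apply: poly_frac; case: ifP => _; [exact: chi_Po|exact: (poly_elt_nat _ _ 0)].
  - by rewrite rootE horner_poly chiE.
have detC0 : \det C != 0.
  apply/eqP => dC; move: chi0; rewrite dC mulr0 f0E => /x_ind f00.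
  by move: f0s; rewrite f00 msize0.
have [b [i0 [bi0 hb]]] := monic_direction f0s.
have [d Dd] : exists d, D = d.+1 by exists D.-1; rewrite prednK// (leq_ltn_trans _ (ltn_ord i0)).
subst D.
pose y (j : 'I_d) := x (lift i0 j) - iota (b (lift i0 j)) * x i0.
exists d, x, y; split => // [j|p w Aw pE].
  apply: in_lspan_sum x_span _; exists (fun i => (i == lift i0 j)%:R - (i == i0)%:R * b (lift i0 j)).
  under eq_bigr do rewrite rmorphB mulrBl rmorphM -mulrA.
  rewrite sumrB (bigD1 (lift i0 j))//= eqxx rmorph1 mul1r big1 ?addr0; last first.
    by move=> i /negbTE ->; rewrite rmorph0 mul0r.
  rewrite (bigD1 i0)//= eqxx rmorph1 mul1r big1 ?addr0// => i /negbTE ->.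
  by rewrite rmorph0 mul0r.
pose h (j : 'I_d) : {mpoly K[d.+1]} := 'X_(lift i0 j) - (b (lift i0 j))%:MP * 'X_i0.
pose P : {mpoly K[d.+1]} := mmap (@mpolyC d.+1 K) h p.
have PE : mmap iota x P = mmap iota y p.
  rewrite /P [mmap _ h p]/mmap [in RHS]/mmap rmorph_sum; apply: eq_bigr => a _.
  rewrite rmorphM /= mmapC; congr (_ * _); rewrite /mmap1 rmorph_prod; apply: eq_bigr => j _.
  by rewrite rmorphXn /= /h mmapB rmorphM /= mmapC !mmapX !mmap1U.
(* This is the matrix of multiplication by [w], the quotient of [p] at [y] by [u]. Its determinant
   being a polynomial, [P ^+ m] is divisible by the norm [f0]. *)
have [t tE'] : Po (\det ((mmap iota y p) *: invmx C)).
  have CU : C \in unitmx by rewrite unitmxE unitfE.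
  apply: (detPo w); first exact: alg_int.
    move=> i j; rewrite mxE; apply: frac_eltM.
      by rewrite -PE; apply: poly_frac; exists P.
    rewrite /invmx CU mxE; apply: frac_eltM.
      by apply: frac_eltV; exact: (frac_elt_det x_ind).
    rewrite mxE; apply: frac_eltM; last by apply: (frac_elt_det x_ind) => k l; rewrite !mxE; exact: FC.
    rewrite -signr_odd; case: odd; rewrite ?expr1 ?expr0; last exact/poly_frac/(poly_elt_nat _ _ 1).
    by apply: frac_eltN; exact/poly_frac/(poly_elt_nat _ _ 1).
  have UE : U = u *: (invmx C *m U) by rewrite scalemxAr uC mulKmx.
  by rewrite -scalemxAl {1}UE scalerA pE mulrC.
have {tE'} tE : \det ((mmap iota y p) *: invmx C) = mmap iota x t := tE'.
have Pm' : P ^+ m = (-1) ^+ m * t * f0.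
  apply/eqP; rewrite -subr_eq0; apply/eqP; apply: x_ind.
  have -> : mmap iota x (P ^+ m - (-1) ^+ m * t * f0)
    = mmap iota x P ^+ m - (-1) ^+ m * mmap iota x t * mmap iota x f0.
    by rewrite rmorphB !rmorphM /= !rmorphXn /= rmorphN1.
  rewrite PE -tE -f0E chi0 detZ det_inv.
  have e (a c : L) : c != 0 -> a ^+ m - (-1) ^+ m * (a ^+ m * c^-1) * ((-1) ^+ m * c) = 0.
    move=> c0; have -> : a ^+ m - (-1) ^+ m * (a ^+ m * c^-1) * ((-1) ^+ m * c) = a ^+ m * (1 - (-1) ^+ m * (-1) ^+ m * (c^-1 * c)) by ring.
    by rewrite mulVf// -exprMn mulrNN !mulr1 expr1n subrr mulr0.
  exact: e.
apply: contrapT => /eqP p0.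
(* In coordinates where [x i0] is the variable and the [y j] are coefficients, [P] becomes the
   constant [p], while [f0] has positive degree. *)
pose c (j : 'I_d.+1) : {mpoly K[d]} := if unlift i0 j is Some k then 'X_k else 0.
pose psi : {rmorphism {mpoly K[d.+1]} -> {poly {mpoly K[d]}}} := line_subst (@mpolyC d K) b c.
have psiP : psi P = p%:P.
  rewrite /P {2}[p]mpolyE [mmap _ h p]/mmap !rmorph_sum; apply: eq_bigr => a _.
  rewrite rmorphM /= -mul_mpolyC rmorphM /=; congr (_ * _); first by rewrite /psi /= /line_subst mmapC.
  rewrite mpolyXE_id /mmap1 !rmorph_prod; apply: eq_bigr => j _.
  rewrite !rmorphXn /=; congr (_ ^+ _).
  rewrite /h rmorphB rmorphM /= /psi /= /line_subst mmapC !mmapX !mmap1U /c liftK unlift_none /= bi0.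
  rewrite rmorph1 scale1r add0r mul_polyC addrK//.
have := congr1 psi Pm'; rewrite rmorphXn psiP rmorphM => e.
have [sle cE] := line_subst_top (@mpolyC d K) b c f0.
have sf : size (psi f0) = msize f0.
  have m0f : msize f0 = (msize f0).-1.+1 by rewrite prednK// (ltn_trans _ f0s).
  apply/eqP; rewrite m0f eqn_leq sle ltnNge; apply/negP => hs.
  by move/eqP: cE; rewrite nth_default// eq_sym mpolyC_eq0 (negbTE hb).
have p0m : p ^+ m != 0 by rewrite expf_neq0.
apply: (polyC_neq_mul p0m (g := psi f0) (f := psi ((-1) ^+ m * t))); first by rewrite sf.
by rewrite -e rmorphXn.
Qed.

End PrincipalIdealTheorem.

(** * Cones and their dimension *)

Section QuotientRings.
Local Open Scope quotient_scope.
Local Open Scope ring_scope.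

Section QuotientByIdeal.
Context (R : comNzRingType) (I : set R) (hI : is_ideal I) (I1 : ~ I 1).

(** The phantom argument keeps the proof that [I] is a proper ideal within reach of the structure
    declared on the predicate. *)
Definition ideal_pred (_ : is_ideal I /\ ~ I 1) : R -> bool := fun u => `[< I u >].
Local Notation P := (ideal_pred (conj hI I1)).

Lemma ideal_pred_closed : idealr_closed (P : {pred R}).
Proof.
split; first exact/asboolP/hI.1.
  by apply/negP => /asboolP.
by move=> a u v /asboolP Iu /asboolP Iv; apply/asboolP/hI.2.
Qed.

HB.instance Definition _ := isIdealr.Build R P ideal_pred_closed.

Lemma quotient_ring : exists (D : comNzRingType) (pi : {rmorphism R -> D}),
  (forall y, exists u, y = pi u) /\ forall u, pi u = 0 <-> I u.
Proof.
pose J : idealr R := P.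
exists ({ideal_quot J} : comNzRingType), (\pi_({ideal_quot J}) : {rmorphism R -> {ideal_quot J}}).
split=> [y|u]; first by exists (repr y); rewrite /= reprK.
have pi0 : (\pi_({ideal_quot J}) u == 0) = (u \in (J : {pred R})).
  by rewrite -[u in RHS]subr0 Quotient.idealrBE -(rmorph0 (\pi_({ideal_quot J}) : {rmorphism _ -> _})).
split => [/eqP|Iu]; first by rewrite pi0 => /asboolP.
by apply/eqP; rewrite pi0; apply/asboolP.
Qed.

End QuotientByIdeal.

Section ClassicalFractions.
Context (D : comNzRingType).

(** A copy of [D] tagged with the absence of zero divisors, on which an integral domain structure is
    built with inverses obtained by choice. *)
Definition classical_domain (_ : forall x y : D, x * y = 0 -> x = 0 \/ y = 0) : Type := D.

Context (hD : forall x y : D, x * y = 0 -> x = 0 \/ y = 0).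
Local Notation A := (classical_domain hD).

HB.instance Definition _ := GRing.ComNzRing.on A.

Let unit : {pred A} := fun x => `[< exists y : A, y * x = 1 >].
Let inv (x : A) : A := xget x [set y | y * x = 1].

Let mulVx : {in unit, left_inverse 1 inv *%R}.
Proof. by move=> x /asboolP[y yx]; exact: (@xgetPex _ x [set y | y * x = 1] (ex_intro _ y yx)). Qed.

Let unitPl (x y : A) : y * x = 1 -> unit x.
Proof. by move=> yx; apply/asboolP; exists y. Qed.

Let invr_out : {in [predC unit], inv =1 id}.
Proof.
by move=> x /= /asboolP nx; rewrite /inv; case: xgetP => // y _ yx; case: nx; exists y.
Qed.

HB.instance Definition _ := GRing.ComNzRing_hasMulInverse.Build A mulVx unitPl invr_out.

Let mul_eq0 (x y : A) : x * y = 0 -> (x == 0) || (y == 0).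
Proof. by move=> /hD[->|->]; rewrite eqxx ?orbT. Qed.

HB.instance Definition _ := GRing.ComUnitRing_isIntegral.Build A mul_eq0.

Lemma fraction_field : exists (L : fieldType) (j : {rmorphism D -> L}), injective j.
Proof.
exists {fraction A}, (@tofrac A : {rmorphism A -> _}).
by move=> x y /eqP; rewrite tofrac_eq => /eqP.
Qed.

End ClassicalFractions.

End QuotientRings.

Lemma poly_vanish_neq0 (K : closedFieldType) (P : {poly K}) :
  (forall t, t != 0 -> P.[t] = 0) -> P = 0.
Proof.
move=> h; apply: contrapT => /eqP P0.
have : P * 'X != 0 by rewrite mulf_neq0// polyX_eq0.
move=> /closed_nonrootP[t]; rewrite rootE hornerM hornerX mulf_eq0 negb_or => /andP[Pt t0].
by rewrite h// eqxx in Pt.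
Qed.

Section Lines.
Context (K : fieldType) (n : nat) (u : 'I_n -> K).
Implicit Types (p : {mpoly K[n]}).

(** Restriction to the line through the origin and [u]. Its coefficients are the values at [u] of
    the homogeneous components, which is how cones separate degrees. *)
Definition line_poly : {mpoly K[n]} -> {poly K} := mmap (@polyC K) (fun i => u i *: 'X).

HB.instance Definition _ := GRing.RMorphism.on line_poly.

Lemma coef_line_poly p d : (line_poly p)`_d = (pihomog mdeg d p).@[u].
Proof.
rewrite /line_poly /mmap coef_sum pihomogE (raddf_sum (meval _)) /= [RHS]big_mkcond.
apply: eq_bigr => a _; rewrite coefCM.
have -> : mmap1 (fun i => u i *: 'X) a = (\prod_i u i ^+ a i) *: 'X^(mdeg a).
  rewrite /mmap1 (eq_bigr (fun i => u i ^+ a i *: 'X^(a i))) => [|i _]; last exact: exprZn.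
  by rewrite scaler_prod prodrXr mdegE.
rewrite coefZ coefXn eq_sym; case: eqP => _; last by rewrite !mulr0.
by rewrite mulr1 mevalZ mevalX.
Qed.

Lemma horner_line_poly p t : (line_poly p).[t] = p.@[fun i => t * u i].
Proof.
rewrite /line_poly /mmap horner_sum mevalE; apply: eq_bigr => a _.
rewrite hornerM hornerC horner_prod; congr (_ * _); apply: eq_bigr => i _.
by rewrite horner_exp hornerZ hornerX mulrC.
Qed.

Lemma line_poly_form d p : p \is d.-homog -> p.@[u] = 0 -> line_poly p = 0.
Proof.
move=> hp pv; apply/polyP => e; rewrite coef_line_poly coef0.
have [<-|ed] := eqVneq d e; first by rewrite pihomog_dE.
by rewrite (pihomog_ne0 ed)// meval0.
Qed.

Lemma line_poly0 p : line_poly p = 0 -> p.@[u] = 0.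
Proof.
move=> h; have := horner_line_poly p 1; rewrite h horner0 => ->.
by apply: meval_eq => i; rewrite mul1r.
Qed.

End Lines.

Section Cones.
Context (K : closedFieldType) (N : nat).
Implicit Types (X Z A B : set 'rV[K]_N.+1) (v : 'rV[K]_N.+1) (p q : {mpoly K[N.+1]}).

Definition vanish Z : set {mpoly K[N.+1]} := [set p | forall v, Z v -> p.@[v ord0] = 0].

Lemma vanish_ideal Z : is_ideal (vanish Z).
Proof.
split=> [v _|a p q hp hq v Zv]; first by rewrite meval0.
by rewrite mevalD mevalM hp// hq// mulr0 addr0.
Qed.

Lemma vanish_le Z A : Z `<=` A -> vanish A `<=` vanish Z.
Proof. by move=> ZA p hp v /ZA; exact: hp. Qed.

Lemma vanish1 Z : Z !=set0 -> ~ vanish Z 1.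
Proof. by move=> [v Zv] /(_ v Zv) /eqP; rewrite meval1 oner_eq0. Qed.

Lemma horner_line_rV v p t : (line_poly (v ord0) p).[t] = p.@[(t *: v) ord0].
Proof. by rewrite horner_line_poly; apply: meval_eq => i; rewrite mxE. Qed.

Lemma proj_closed_scale Z v t : proj_closed Z -> t != 0 -> Z v -> Z (t *: v).
Proof.
move=> [S hS ->] t0 [v0 hv]; split; first by rewrite scaler_eq0 negb_or t0.
move=> p Sp; have [d pd] := hS p Sp.
by rewrite /Form.ev -horner_line_rV (line_poly_form pd (hv p Sp)) horner0.
Qed.

Lemma proj_closed_neq0 Z v : proj_closed Z -> Z v -> v != 0.
Proof. by move=> [S _ ->] []. Qed.

Lemma proj_closed_mem Z v : proj_closed Z -> v != 0 ->
  (forall p, vanish Z p -> p.@[v ord0] = 0) -> Z v.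
Proof. by move=> [S hS ->] v0 h; split=> // p Sp; apply: h => u [_]; exact. Qed.

Lemma vanish_line_poly Z v p : proj_closed Z -> vanish Z p -> Z v -> line_poly (v ord0) p = 0.
Proof.
move=> cZ hp Zv; apply: poly_vanish_neq0 => t t0; rewrite horner_line_rV.
by apply: hp; exact: proj_closed_scale.
Qed.

Lemma proj_closedI A B : proj_closed A -> proj_closed B -> proj_closed (A `&` B).
Proof.
move=> [S hS ->] [T hT ->]; exists (S `|` T); first by move=> p [/hS|/hT].
apply/seteqP; split=> [v [[v0 hv] [_ hv']]|v [v0 hv]].
  by split=> // p [/hv|/hv'].
by split; split=> // p hp; apply: hv; [left|right].
Qed.

(** The common zeros of all homogeneous components of [p], a closed cone even when [p] is not a
    form. *)
Definition line_locus p := [set v : 'rV[K]_N.+1 | v != 0 /\ line_poly (v ord0) p = 0].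

Lemma proj_closed_line_locus p : proj_closed (line_locus p).
Proof.
exists (range (fun d => pihomog mdeg d p)) => [_ [d _ <-]|].
  by exists d; exact: pihomogP.
apply/seteqP; split=> v [v0 hv]; split => //.
  by move=> _ [d _ <-]; rewrite /Form.ev -coef_line_poly hv coef0.
by apply/polyP => d; rewrite coef_line_poly coef0; apply: hv; exists d.
Qed.

(** On each line through the origin the product lives in a polynomial ring in one variable, where
    one factor must vanish; this covers [Z] by two closed cones. *)
Lemma vanish_prime Z p q : variety Z -> vanish Z (p * q) -> vanish Z p \/ vanish Z q.
Proof.
move=> [cZ [_ irr]] hpq.
have [] := irr _ _ (proj_closed_line_locus p) (proj_closed_line_locus q).
- move=> v Zv; have v0 := proj_closed_neq0 cZ Zv.
  have := vanish_line_poly cZ hpq Zv; rewrite rmorphM => /eqP; rewrite mulf_eq0.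
  by move=> /orP[] /eqP h; [left|right]; split.
- by move=> h; left => v /h[_ /line_poly0].
- by move=> h; right => v /h[_ /line_poly0].
Qed.

Lemma coordinate_ring Z : Z !=set0 ->
  exists (D : comNzRingType) (iota : {rmorphism K -> D}) (g : 'I_N.+1 -> D),
    (forall p, mmap iota g p = 0 <-> vanish Z p) /\ forall y, exists p, y = mmap iota g p.
Proof.
move=> Z0; have [D [pi [pis pi0]]] := quotient_ring (vanish_ideal Z) (vanish1 Z0).
pose iota : {rmorphism K -> D} := pi \o @mpolyC N.+1 K.
have E p : mmap iota (fun i => pi 'X_i) p = pi p.
  rewrite {2}[p]mpolyE rmorph_sum /mmap; apply: eq_bigr => a _.
  rewrite -mul_mpolyC rmorphM /=; congr (_ * _).
  by rewrite mpolyXE_id rmorph_prod; apply: eq_bigr => i _; rewrite rmorphXn.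
exists D, iota, (fun i => pi 'X_i); split=> [p|y]; first by rewrite E.
by have [p ->] := pis y; exists p; rewrite E.
Qed.

Lemma coordinate_field Z : variety Z ->
  exists (L : fieldType) (iota : {rmorphism K -> L}) (g : 'I_N.+1 -> L),
    forall p, mmap iota g p = 0 <-> vanish Z p.
Proof.
move=> vZ; have [D [iota [g [hk surj]]]] := coordinate_ring vZ.2.1.
have dom (x y : D) : x * y = 0 -> x = 0 \/ y = 0.
  have [p ->] := surj x; have [q ->] := surj y.
  by rewrite -rmorphM => /hk /(vanish_prime vZ)[] /hk; [left|right].
have [L [j j_inj]] := fraction_field dom.
exists L, (j \o iota : {rmorphism K -> L}), (j \o g) => p.
have -> : mmap (j \o iota) (j \o g) p = j (mmap iota g p).
  rewrite /mmap rmorph_sum; apply: eq_bigr => a _; rewrite rmorphM /=; congr (_ * _).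
  by rewrite /mmap1 rmorph_prod; apply: eq_bigr => i _; rewrite rmorphXn.
by rewrite -hk; split=> [|->]; [rewrite -(rmorph0 j) => /j_inj|rewrite rmorph0].
Qed.

Lemma ideal_mlead_eq (I J : set {mpoly K[N.+1]}) : is_ideal I -> is_ideal J -> I `<=` J ->
  (forall p, J p -> p != 0 -> exists q, [/\ I q, q != 0 & mlead q = mlead p]) -> J `<=` I.
Proof.
move=> hI hJ IJ h p; move Em : (mlead p) => m; elim/(@ltmwf N.+1): m p Em => m IH p pm Jp.
have [->|p0] := eqVneq p 0; first exact: hI.1.
have [q [Iq q0 qp]] := h p Jp p0.
have qm : q@_(mlead p) != 0 by rewrite -qp mleadc_eq0.
pose c := p@_(mlead p) / q@_(mlead p).
have -> : p = c%:MP * q + (p - c%:MP * q) by rewrite addrC subrK.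
apply: hI.2 => //; set p' := p - _.
have [->|p'0] := eqVneq p' 0; first exact: hI.1.
apply: (IH (mlead p')) => //; last first.
  rewrite /p' addrC -mulNr -rmorphN; apply: hJ.2 => //; exact: IJ.
rewrite -pm lt_neqAle; apply/andP; split; last first.
  apply: le_trans (mleadB_le _ _) _; rewrite leUx lexx /= -qp mul_mpolyC.
  exact: mleadZ_le.
apply: contra_neq p'0 => e; apply/eqP; rewrite -mleadc_eq0 e /p' mcoeffB mul_mpolyC mcoeffZ.
by rewrite /c divfK// subrr.
Qed.

(* Hilbert's basis theorem, through the monomials which are not initial terms. *)
Lemma minimal_closed (Q : set 'rV[K]_N.+1 -> Prop) Z : proj_closed Z -> Q Z ->
  exists A, [/\ proj_closed A, A `<=` Z, Q A &
    forall B, proj_closed B -> B `<=` A -> Q B -> B = A].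
Proof.
pose D A : set 'X_{1..N.+1} := [set a | ~ exists p, [/\ vanish A p, p != 0 & mlead p = a]].
have dD A : downset (D A).
  move=> a b nab [p [hp p0 pa]]; apply: nab; exists ('X_[b] * p).
  have X0 : 'X_[b] != 0 :> {mpoly K[N.+1]} by rewrite -mleadc_eq0 mleadXm mcoeffX eqxx oner_eq0.
  split; [|exact: mulf_neq0|by rewrite mleadM// mleadXm pa addmC].
  exact: idealM (vanish_ideal A) hp.
suff main C : downset C -> forall Z, D Z = C -> proj_closed Z -> Q Z ->
  exists A, [/\ proj_closed A, A `<=` Z, Q A & forall B, proj_closed B -> B `<=` A -> Q B -> B = A].
  by move=> cZ QZ; exact: (main (D Z) (dD Z)).
move: C; apply: downset_ind => {Z} C dC IH Z DZ cZ QZ.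
have [hmin|] := pselect (forall B, proj_closed B -> B `<=` Z -> Q B -> B = Z).
  by exists Z; split.
move=> /existsNP[B /not_implyP[cB /not_implyP[BZ /not_implyP[QB BnZ]]]].
have DBZ : D B `<=` D Z by move=> a na [p [hp p0 pa]]; apply: na; exists p; split => //; exact: vanish_le hp.
have [||A [cA AB QA Amin]] := IH (D B) (dD B) _ _ B erefl cB QB.
- by rewrite -DZ.
- apply: contrapT => h; apply: BnZ; apply/seteqP; split=> // v Zv.
  apply: proj_closed_mem cB (proj_closed_neq0 cZ Zv) _ => p hp.
  suff : vanish Z p by apply.
  apply: (ideal_mlead_eq (vanish_ideal Z) (vanish_ideal B) (vanish_le BZ)) hp => q hq q0.
  apply: contrapT => hn; apply: h; exists (mlead q); rewrite -?DZ => //.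
  by apply; exists q.
- by exists A; split=> //; exact: subset_trans BZ.
Qed.

End Cones.

Lemma mmap_mmap (K : fieldType) (D : comNzRingType) (iota : {rmorphism K -> D}) r d
    (g : 'I_r -> D) (h : 'I_d -> {mpoly K[r]}) p :
  mmap iota g (mmap (@mpolyC r K) h p) = mmap iota (fun j => mmap iota g (h j)) p.
Proof.
rewrite [mmap _ h p]/mmap [in RHS]/mmap rmorph_sum; apply: eq_bigr => a _.
rewrite rmorphM /= mmapC; congr (_ * _); rewrite /mmap1 rmorph_prod; apply: eq_bigr => j _.
by rewrite rmorphXn.
Qed.

Lemma meval_mmap (K : fieldType) r d (c : 'I_r -> K) (h : 'I_d -> {mpoly K[r]}) p :
  (mmap (@mpolyC r K) h p).@[c] = p.@[fun j => (h j).@[c]].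
Proof.
rewrite [mmap _ h p]/mmap [RHS]mevalE (raddf_sum (meval c)); apply: eq_bigr => a _.
rewrite /= mevalM mevalC; congr (_ * _); rewrite /mmap1 (rmorph_prod (meval c)); apply: eq_bigr => j _.
by rewrite rmorphXn.
Qed.

(** * Dimension through chains of subvarieties *)

Section Chains.
Context (K : closedFieldType) (N : nat).
Implicit Types (X Z A B : set 'rV[K]_N.+1) (v : 'rV[K]_N.+1) (l : nat -> {mpoly K[N.+1]}).

Definition values l d v : 'I_d -> K := fun j => (l j).@[v ord0].
Arguments values : clear implicits.

(* [l 0, ..., l (d - 1)] are the coordinates of a finite dominant map from the
   cone of [Z] to affine [d]-space. *)
Definition parameters Z l d :=
  (forall p : {mpoly K[d]}, (forall v, Z v -> p.@[values l d v] = 0) -> p = 0) /\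
  forall i, exists2 q : {poly {mpoly K[d]}}, q \is monic &
    forall v, Z v -> (map_poly (meval (values l d v)) q).[v ord0 i] = 0.

Let sub l d : {mpoly K[d]} -> {mpoly K[N.+1]} := mmap (@mpolyC N.+1 K) (fun j : 'I_d => l j).

Arguments sub : clear implicits.

Let meval_sub l d v (q : {poly {mpoly K[d]}}) i :
  ((map_poly (sub l d) q).['X_i]).@[v ord0] = (map_poly (meval (values l d v)) q).[v ord0 i].
Proof.
rewrite !(horner_coef_wide _ (size_poly _ _)) rmorph_sum; apply: eq_bigr => k _.
by rewrite rmorphM rmorphXn /= mevalXU !coef_map /= meval_mmap.
Qed.

Let mmap_sub (D : comNzRingType) (iota : {rmorphism K -> D}) g l d (q : {poly {mpoly K[d]}}) i :
  mmap iota g ((map_poly (sub l d) q).['X_i]) =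
  (map_poly (mmap iota (fun j : 'I_d => mmap iota g (l j))) q).[g i].
Proof.
rewrite !(horner_coef_wide _ (size_poly _ _)) rmorph_sum; apply: eq_bigr => k _.
by rewrite rmorphM rmorphXn /= mmapX mmap1U !coef_map /= mmap_mmap.
Qed.

Lemma parametersP Z l d (D : comNzRingType) (iota : {rmorphism K -> D}) g :
  (forall p, mmap iota g p = 0 <-> vanish Z p) ->
  parameters Z l d <-> alg_indep iota (fun j : 'I_d => mmap iota g (l j)) /\
    forall i, integral_gen iota (fun j : 'I_d => mmap iota g (l j)) (g i).
Proof.
move=> hk; split=> -[h1 h2]; split.
- move=> p; rewrite -mmap_mmap => /hk hp; apply: h1 => v /hp; by rewrite meval_mmap.
- move=> i; have [q mq hq] := h2 i; exists q => //.
  by apply/rootP; rewrite -mmap_sub; apply/hk => v Zv; rewrite meval_sub; exact: hq.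
- move=> p hp; apply: h1; rewrite -mmap_mmap; apply/hk => v Zv.
  by rewrite meval_mmap; exact: hp.
- move=> i; have [q mq /rootP] := h2 i; rewrite -mmap_sub => /hk hq; exists q => // v /hq.
  by rewrite meval_sub.
Qed.

(** The lifted point may be the vertex of the cone, which [Z] excludes; hence the vanishing of the
    ideal in place of membership. *)
Lemma parameters_surj Z l d (c : 'I_d -> K) : Z !=set0 -> parameters Z l d ->
  exists v, (forall p, vanish Z p -> p.@[v ord0] = 0) /\ forall j : 'I_d, (l j).@[v ord0] = c j.
Proof.
move=> Z0; have [D [iota [g [hk surj]]]] := coordinate_ring Z0.
move=> /(parametersP l d hk)[ind int].
have [xi [h1 h2]] := lying_over (q := fun j : 'I_d => l j) c surj ind int (fun=> erefl).
exists (\row_i xi i).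
have E (p : {mpoly K[N.+1]}) : p.@[(\row_i xi i) ord0] = p.@[xi].
  by apply: meval_eq => i; rewrite mxE.
by split=> [p /hk /h1|j]; rewrite E.
Qed.

Lemma form_eval0 d (p : {mpoly K[N.+1]}) : Form.is_form d.+1 p ->
  p.@[(0 : 'rV[K]_N.+1) ord0] = 0.
Proof.
move=> hp; rewrite -(scale0r 0) -horner_line_rV horner_coef0 coef_line_poly.
by rewrite (@pihomog_ne0 _ _ _ d.+1)// meval0.
Qed.

(** A hyperplane section loses one parameter but still dominates the smaller affine space. A closed
    subset minimal with this property is irreducible: if neither of two closed pieces contained it,
    polynomials killing the pieces would have a product killing the whole. *)
Lemma parameters_section Z l d : variety Z -> (forall j, Form.is_form 1 (l j)) ->
  parameters Z l d.+2 -> exists A, [/\ variety A, A `<=` Z, A != Z & parameters A l d.+1].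
Proof.
move=> vZ lf hp; have [cZ [Z0 _]] := vZ.
pose inj A := forall p : {mpoly K[d.+1]}, (forall v, A v -> p.@[values l d.+1 v] = 0) -> p = 0.
pose W := Z `&` line_locus (l d.+1).
have cW : proj_closed W by apply: proj_closedI => //; exact: proj_closed_line_locus.
have lW v : W v -> (l d.+1).@[v ord0] = 0 by move=> [_ [_ /line_poly0]].
have injW : inj W.
  move=> p hpW; apply: contrapT => /eqP p0.
  (* The extra variable gives the lifted point a nonzero parameter, so it is not the vertex. *)
  have pX0 : p * 'X_ord0 != 0.
    by rewrite mulf_neq0// -mleadc_eq0 mleadXm mcoeffX eqxx oner_eq0.
  have [c hc] := mpoly_nonroot pX0.
  have [v [vZp vc]] := parameters_surj (fun j : 'I_d.+2 => if insub (val j) is Some k then c k else 0) Z0 hp.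
  have vl (j : 'I_d.+1) : (l j).@[v ord0] = c j.
    by have := vc (widen_ord (leqnSn _) j); rewrite /= valK.
  have ld : (l d.+1).@[v ord0] = 0 by have := vc ord_max; rewrite /= insubF//= ltnn.
  have pc : p.@[values l d.+1 v] = p.@[c] by apply: meval_eq.
  move: hc; rewrite mevalM mevalXU mulf_eq0 negb_or => /andP[pc0 c0].
  have [v0|v0] := eqVneq v 0; last first.
    move/eqP: pc0; apply; rewrite -pc; apply: hpW; split; first exact: proj_closed_mem.
    by split=> //; exact: line_poly_form (lf _) _.
  by move/eqP: c0; apply; rewrite -vl v0; exact: form_eval0 (lf _).
have [A [cA AW injA minA]] := minimal_closed cW injW.
have AZ : A `<=` Z by move=> v /AW[].
have irrA : irreducible A.
  split; first apply: contrapT => /set0P/negP/negPn/eqP A0.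
    by have /eqP := injA 1 (fun v Av => ltac:(by rewrite A0 in Av)); rewrite oner_eq0.
  move=> B C cB cC ABC.
  have half D : proj_closed D -> A `<=` D \/
      exists2 p : {mpoly K[d.+1]}, p != 0 & forall v, A v -> D v -> p.@[values l d.+1 v] = 0.
    move=> cD; have [injD|] := pselect (inj (A `&` D)).
      by left; rewrite -(minA (A `&` D) (proj_closedI cA cD) (@subIsetl _ A D) injD); exact: subIsetr.
    move=> /existsNP[p /not_implyP[hpD /eqP p0]]; right; exists p => // v Av Dv.
    by apply: hpD.
  have [|[p p0 hpB]] := half B cB; first by left.
  have [|[q q0 hqC]] := half C cC; first by right.
  have : p * q != 0 by rewrite mulf_neq0.
  move=> /eqP[]; apply: injA => v Av; rewrite mevalM.
  by have [/(hpB v Av)->|/(hqC v Av)->] := ABC v Av; rewrite ?mul0r ?mulr0.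
exists A; split => //.
  apply/eqP => AZE; have [h _] := hp.
  have : 'X_ord_max != 0 :> {mpoly K[d.+2]}.
    by rewrite -mleadc_eq0 mleadXm mcoeffX eqxx oner_eq0.
  move=> /eqP[]; apply: h => v Zv; rewrite mevalXU; apply: lW; apply: AW.
  by rewrite AZE.
split; first exact: injA.
move=> i; have [q mq hq] := hp.2 i.
pose sigma : {rmorphism {mpoly K[d.+2]} -> {mpoly K[d.+1]}} :=
  mmap (@mpolyC d.+1 K) (fun j : 'I_d.+2 => if insub (val j) is Some k then 'X_k else 0).
exists (map_poly sigma q); first exact: monic_map.
move=> v Av; rewrite -(hq v (AZ v Av)) -map_poly_comp; congr (_.[_]).
apply: eq_map_poly => a /=; rewrite /sigma /= meval_mmap; apply: meval_eq => j.
rewrite /values; case: insubP => [k _ kj|]; first by rewrite mevalXU kj.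
rewrite -leqNgt meval0 => jd; have -> : (j : nat) = d.+1.
  by apply/eqP; rewrite eqn_leq jd -ltnS ltn_ord.
by rewrite lW//; exact: AW.
Qed.

Lemma parameters_dim X n l d : variety X -> has_dimension X n ->
  (forall j, Form.is_form 1 (l j)) -> parameters X l d -> (d <= n.+1)%N.
Proof.
move=> vX [_ hX] lf; case: d => // d hp; rewrite ltnS.
suff [Z [hZ ZE]] : exists Z : nat -> set 'rV[K]_N.+1, chain_in X d Z /\ Z d = X.
  exact: hX hZ.
elim: d X vX {hX} hp => [|d IH] X vX hp.
  by exists (fun=> X); split=> //; split=> // i; split.
have [A [vA AX AnX pA]] := parameters_section vX lf hp.
have [Z [[hZ1 hZ2] Zd]] := IH A vA pA.
exists (fun i => if (i <= d)%N then Z i else X); rewrite ltnn; split=> //; split=> i hi.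
  by case: ifP => id; [have [vZ ZA] := hZ1 i id; split=> //; exact: subset_trans AX|split].
rewrite -ltnS hi; case: ifP => id; first by exact: hZ2.
have -> : i = d by move: hi id; lia.
by rewrite Zd properEneq.
Qed.

(** The affine cone has one dimension more than [X]. Linear parameters come from linear forms, whose
    successive sections build a chain of subvarieties. *)
Theorem noether_dim X n (L : comNzRingType) (iota : {rmorphism K -> L}) g d (x : 'I_d -> L) :
  variety X -> has_dimension X n ->
  (forall p : {mpoly K[N.+1]}, mmap iota g p = 0 <-> vanish X p) ->
  (forall j, in_lspan iota g (x j)) -> alg_indep iota x -> (forall i, integral_gen iota x (g i)) ->
  (d <= n.+1)%N.
Proof.
move=> vX dX hk /choice[c xE] ind int.
pose l j : {mpoly K[N.+1]} := if insub j is Some k then \sum_i c k i *: 'X_i else 0.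
have lx : (fun j : 'I_d => mmap iota g (l j)) = x.
  apply/funext => j; rewrite /l valK rmorph_sum xE; apply: eq_bigr => i _.
  by rewrite /= mmapZ mmapX mmap1U.
apply: (parameters_dim (l := l) vX dX).
  move=> j; rewrite /l; case: insub => [k|]; last exact: dhomog0.
  by apply: rpred_sum => i _; apply: rpredZ; rewrite dhomogX; apply/eqP; exact: mdeg1.
by apply/(parametersP l d hk); rewrite lx.
Qed.

End Chains.

(** * Growth of Hilbert functions *)

Lemma card_bmultinom d B : (#|{: 'X_{1..d < B}}| <= B ^ d)%N.
Proof.
case: B => [|B].
  by rewrite (eq_card0 (A := {: 'X_{1..d < 0}})) // => a; have := bmdeg a; rewrite ltn0.
have -> : (B.+1 ^ d = #|{ffun 'I_d -> 'I_B.+1}|)%N by rewrite card_ffun !card_ord.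
apply: (@leq_card _ _ (fun a : 'X_{1..d < B.+1} => [ffun i => inord ((a : 'X_{1..d}) i) : 'I_B.+1])).
move=> a b /ffunP ab; apply: val_inj; apply/mnmP => i.
have lt (c : 'X_{1..d < B.+1}) : ((c : 'X_{1..d}) i < B.+1)%N.
  apply: leq_ltn_trans (bmdeg c); by rewrite mdegE (bigD1 i)//= leq_addr.
by have := ab i; rewrite !ffunE => /(congr1 val); rewrite /= !inordK.
Qed.

Lemma mmap_bounded (K : fieldType) (D : comNzRingType) (iota : {rmorphism K -> D}) d
    (x : 'I_d -> D) (p : {mpoly K[d]}) B : (msize p <= B)%N ->
  mmap iota x p = \sum_(a : 'X_{1..d < B}) iota p@_a * mmap1 x a.
Proof.
move=> pB; rewrite {1}(mpolywE pB) rmorph_sum; apply: eq_bigr => a _.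
by rewrite /= mmapZ mmapX.
Qed.

(** Over the polynomial ring in [d] variables, elements of degree at most [q] have coordinates of
    size linear in [q], and the monomials of that size number [O(q ^ d)]. *)
Lemma count_bound (K : closedFieldType) (D : comNzRingType) (iota : {rmorphism K -> D})
    d r (x : 'I_d -> D) (g : 'I_r -> D) : (forall i, integral_gen iota x (g i)) ->
  exists C, forall q (J : finType) (y : J -> D),
    (forall c : J -> K, \sum_j iota (c j) * y j = 0 -> forall j, c j = 0) ->
    (forall j, exists2 p : {mpoly K[r]}, (msize p <= q.+1)%N & y j = mmap iota g p) ->
    (#|J| <= C * q.+1 ^ d)%N.
Proof.
move=> /module_finite[M [e [c he]]]; exists (M * c ^ d)%N => q J y ind span.
pose B := (c * q.+1)%N.
have /choice[P hP] : forall jb : J, exists P : 'I_M -> {mpoly K[d]},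
    (forall b, (msize (P b) <= B)%N) /\ y jb = \sum_b mmap iota x (P b) * e b.
  move=> j; have [p sp ->] := span j.
  have /choice[Q hQ] : forall a : 'X_{1..r}, exists P : 'I_M -> {mpoly K[d]},
      (forall b, (msize (P b) <= c * (mdeg a).+1)%N) /\ mmap1 g a = \sum_b mmap iota x (P b) * e b.
    by move=> a; have [P P1 P2] := he a; exists P.
  exists (fun b => \sum_(a <- msupp p) p@_a *: Q a b); split=> [b|].
    rewrite big_seq; apply: (big_ind (fun t => (msize t <= B)%N)) => [|s t hs ht|a ap].
    - by rewrite msize0.
    - by apply: leq_trans (msizeD_le _ _) _; rewrite geq_max hs.
    - apply: leq_trans (msizeZ_le _ _) _; apply: leq_trans ((hQ a).1 b) _.
      by rewrite leq_mul2l (leq_trans (msize_mdeg_lt ap) sp) orbT.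
  under [RHS]eq_bigr do rewrite rmorph_sum mulr_suml.
  rewrite exchange_big /=; apply: eq_bigr => a _; rewrite (hQ a).2 mulr_sumr.
  by apply: eq_bigr => b _; rewrite mmapZ mulrA.
pose T : finType := ('I_M * 'X_{1..d < B})%type.
have cT : (#|T| <= M * c ^ d * q.+1 ^ d)%N.
  by rewrite card_prod card_ord -mulnA -expnMn leq_mul2l card_bmultinom orbT.
apply: leq_trans cT; rewrite leqNgt; apply/negP => lt.
have [s [i si] hs] := @kernel_row K #|J| #|T| (\matrix_(i, t)
    (let u : 'I_M * 'X_{1..d < B} := @enum_val T T t in (P (@enum_val J J i) u.1)@_u.2)) lt.
have si' : s (enum_rank (enum_val i)) != 0 by rewrite enum_valK.
move/eqP: si'; apply; apply: (ind (fun j => s (enum_rank j))).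
under eq_bigr => j _.
  rewrite (hP j).2; under eq_bigr do rewrite (mmap_bounded _ _ ((hP j).1 _)) mulr_suml.
  rewrite pair_bigA mulr_sumr; over.
rewrite exchange_big big1//= => t _.
have := hs (enum_rank t) => /(congr1 iota); rewrite rmorph0 rmorph_sum => ht.
transitivity ((\sum_j iota (s (enum_rank j)) * iota (P j t.1)@_t.2) * (mmap1 x t.2 * e t.1)).
  by rewrite mulr_suml; apply: eq_bigr => j _; rewrite !mulrA.
rewrite (reindex_onto (@enum_val J _) enum_rank) => [|j _]; last exact: enum_rankK.
rewrite (_ : \sum_(_ | _) _ = 0) ?mul0r// -[RHS]ht; apply: eq_big => [j|j _].
  by rewrite enum_valK eqxx.
by rewrite !mxE enum_rankK enum_valK rmorphM.
Qed.

Section Evaluation.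
Context (K : fieldType) (T : Type) {m : nat} (v : 'I_m -> (T -> K^o)).
Local Notation E := (T -> K^o).

Definition evf (P : {mpoly K[m]}) : E := fun x => P.@[fun j => v j x].

Lemma fct_sumE (J : Type) (s : seq J) (Q : pred J) (f : J -> E) x :
  (\sum_(j <- s | Q j) f j) x = \sum_(j <- s | Q j) f j x.
Proof. by elim/big_rec2: _ => // j y1 y2 _ <-. Qed.

Lemma fct_prodE (J : Type) (s : seq J) (Q : pred J) (f : J -> E) x :
  (\prod_(j <- s | Q j) f j) x = \prod_(j <- s | Q j) (f j x : K).
Proof. by elim/big_rec2: _ => // j y1 y2 _ <-. Qed.

Lemma fct_expE (f : E) k x : (f ^+ k) x = (f x : K) ^+ k.
Proof. by elim: k => [|k IH]//; rewrite !exprS -IH. Qed.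

Lemma monE a x : mon v a x = \prod_j (v j x : K) ^+ a j.
Proof. by rewrite /mon fct_prodE; apply: eq_bigr => j _; rewrite fct_expE. Qed.

Lemma evfX a : evf 'X_[a] = mon v a.
Proof. by apply/funext => x; rewrite /evf mevalX monE. Qed.

Lemma evfD P Q : evf (P + Q) = evf P + evf Q.
Proof. by apply/funext => x; exact: mevalD. Qed.

Lemma evfM P Q : evf (P * Q) = evf P * evf Q.
Proof. by apply/funext => x; exact: mevalM. Qed.

Lemma evfZ c P : evf (c *: P) = c *: evf P.
Proof. by apply/funext => x; exact: mevalZ. Qed.

Lemma evf_sum (J : Type) (s : seq J) (Q : pred J) (f : J -> {mpoly K[m]}) :
  evf (\sum_(j <- s | Q j) f j) = \sum_(j <- s | Q j) evf (f j).
Proof.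
elim/big_rec2: _ => [|j y1 y2 _ <-]; last exact: evfD.
by apply/funext => x; exact: meval0.
Qed.

Lemma Rk_evf k s : Rk v k s -> exists2 P : {mpoly K[m]}, P \is k.-homog & s = evf P.
Proof.
move: s; apply: lspan_sub; last first.
  by move=> _ [a ak ->]; exists 'X_[a]; rewrite ?evfX// dhomogX; apply/eqP.
split; first by exists 0; [exact: dhomog0|apply/funext => x; rewrite /evf meval0].
move=> c _ _ [P hP ->] [Q hQ ->]; exists (c *: P + Q); last by rewrite evfD evfZ.
by apply: rpredD => //; exact: rpredZ.
Qed.

Lemma evf_Rk k P : P \is k.-homog -> Rk v k (evf P).
Proof.
move=> /dhomogP hP; rewrite [P]mpolyE evf_sum big_seq_cond.
apply: subspace_sum; first exact: subspace_Rk.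
move=> a; rewrite andbT => /hP /= ak; rewrite evfZ evfX -ak.
by apply: subspaceZ; [exact: subspace_Rk|exact: Rk_mon].
Qed.

End Evaluation.

Section GradedModel.
Context (K : closedFieldType) (T : Type) {m : nat} (v : 'I_m -> (T -> K^o)).
Context (L : fieldType) (iota : {rmorphism K -> L}) (om : 'I_m -> L).

(* The functions [v] generate a graded algebra which is an integral domain,
   embedded in the field [L] by [v j |-> om j]. *)
Definition graded_model :=
  (forall P, mmap iota om P = 0 <-> evf v P = 0) /\
  (forall P d, mmap iota om P = 0 -> mmap iota om (pihomog mdeg d P) = 0).

Hypothesis hom : graded_model.

(** Powers of one element of degree one place independent copies of a graded piece in different
    degrees. Counting them turns a bound of order [n.+1] on the cone into one of order [n] on the
    piece. *)
Lemma graded_indep k q (I : finType) (s : I -> {mpoly K[m]}) j0 : om j0 != 0 ->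
  (forall i, s i \is k.-homog) ->
  (forall c : I -> K, \sum_i c i *: evf v (s i) = 0 -> forall i, c i = 0) ->
  forall c : 'I_q * I -> K,
    \sum_t iota (c t) * (om j0 ^+ t.1 * mmap iota om (s t.2)) = 0 -> forall t, c t = 0.
Proof.
move=> z0 hs ind c h [i0 a0].
pose P : {mpoly K[m]} := \sum_(i < q) \sum_b c (i, b) *: ('X_j0 ^+ i * s b).
have phiE i b : mmap iota om (c (i, b) *: ('X_j0 ^+ i * s b)) =
    iota (c (i, b)) * (om j0 ^+ i * mmap iota om (s b)).
  by rewrite mmapZ rmorphM rmorphXn /= !mmapX mmap1U.
have P0 : mmap iota om P = 0.
  rewrite -h rmorph_sum; under eq_bigr => i _.
    rewrite rmorph_sum; under eq_bigr => b _ do rewrite /= phiE.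
    over.
  by rewrite pair_bigA; apply: eq_bigr => -[].
have hX i b : 'X_j0 ^+ i * s b \is (i + k).-homog.
  apply: dhomogM (hs b); rewrite mpolyXn dhomogX; apply/eqP.
  by rewrite -[LHS]/(mdeg _) mdegMn mdeg1 mul1n.
have := hom.2 P (i0 + k)%N P0.
have -> : pihomog mdeg (i0 + k) P = 'X_j0 ^+ i0 * \sum_b c (i0, b) *: s b.
  rewrite /P raddf_sum.
  rewrite (bigD1 i0)//= [X in _ + X]big1 ?addr0 => [|i ii0].
    by rewrite raddf_sum mulr_sumr; apply: eq_bigr => b _; rewrite /= linearZ /= pihomog_dE// scalerAr.
  rewrite raddf_sum big1// => b _; rewrite /= linearZ /= (@pihomog_ne0 _ _ _ (i + k)%N) ?scaler0//.
  by rewrite eqn_add2r val_eqE.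
rewrite rmorphM rmorphXn /= mmapX mmap1U => /eqP; rewrite mulf_eq0 expf_eq0 (negbTE z0) andbF /=.
move=> /eqP /hom.1 e; apply: (ind (fun b => c (i0, b))).
by rewrite -[RHS]e evf_sum; apply: eq_bigr => b _; rewrite evfZ.
Qed.

End GradedModel.

Section Geometry.
Context (K : closedFieldType) (N : nat) (X : set 'rV[K]_N.+1) {m : nat} (r : nat).
Context (qf : 'I_m -> {mpoly K[N.+1]}) (v : 'I_m -> (X -> K^o)).
Hypotheses (r_gt0 : (0 < r)%N) (qf_form : forall j, qf j \is r.-homog)
  (vE : forall j, v j = fun x : X => (qf j).@[val x ord0]).

Lemma homog_scale n d (p : {mpoly K[n]}) (u : 'I_n -> K) t : p \is d.-homog ->
  p.@[fun i => t * u i] = t ^+ d * p.@[u].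
Proof.
move=> hp; rewrite -horner_line_poly (_ : line_poly u p = p.@[u] *: 'X^d).
  by rewrite hornerZ hornerXn mulrC.
apply/polyP => e; rewrite coef_line_poly coefZ coefXn.
have [->|ed] := eqVneq e d; first by rewrite mulr1 pihomog_dE.
by rewrite (@pihomog_ne0 _ _ _ d) 1?eq_sym// meval0 mulr0.
Qed.

Lemma homog_msize n d (p : {mpoly K[n]}) : p \is d.-homog -> (msize p <= d.+1)%N.
Proof.
move=> /dhomogP hp; rewrite msizeE; apply/bigmax_leqP_seq => a ap _.
by rewrite (hp a ap).
Qed.

Lemma homog_subst k (P : {mpoly K[m]}) : P \is k.-homog ->
  mmap (@mpolyC N.+1 K) qf P \is (r * k).-homog.
Proof.
move=> /dhomogP hP; rewrite /mmap big_seq; apply: rpred_sum => a /hP ak.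
rewrite mul_mpolyC; apply: rpredZ; have {ak} -> : k = mdeg a by [].
rewrite mdegE big_distrr.
apply: (big_ind2 (fun (p : {mpoly K[N.+1]}) d => p \is d.-homog)).
- exact: dhomog1.
- by move=> p d p' d' hp hp'; exact: dhomogM.
- by move=> j _; exact: dhomogMn.
Qed.

Lemma evf_pull P x : evf v P x = (mmap (@mpolyC N.+1 K) qf P).@[val x ord0].
Proof. by rewrite meval_mmap; apply: meval_eq => j; rewrite vE. Qed.

Lemma geometric_model (L : fieldType) (iota : {rmorphism K -> L}) g : variety X ->
  (forall p : {mpoly K[N.+1]}, mmap iota g p = 0 <-> vanish X p) ->
  graded_model v iota (fun j => mmap iota g (qf j)).
Proof.
move=> vX hk.
have evP P : mmap iota (fun j => mmap iota g (qf j)) P = 0 <-> evf v P = 0.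
  rewrite -mmap_mmap hk; split=> [h|h u Xu].
    by apply/funext => x; rewrite evf_pull; apply: h; exact: set_valP.
  by rewrite -(evf_pull P (SigSub (mem_set Xu))) h.
split=> // P d /evP hP; apply/evP/funext => x; rewrite /evf -coef_line_poly.
rewrite (_ : line_poly _ P = 0) ?coef0//; apply: poly_vanish_neq0 => s s0.
(* Scaling a point by [t] multiplies every [v j] by [t ^+ r], so an [r]-th root realises the factor
   [s]. *)
have [t tr] : exists t, t ^+ r = s.
  have /closed_rootP[t] : size ('X^r - s%:P) != 1%N by rewrite size_XnsubC// eqSS -lt0n.
  by rewrite rootE !hornerE subr_eq0 => /eqP; exists t.
have t0 : t != 0 by apply: contraTneq s0 => t0; rewrite -tr t0 expr0n gtn_eqF// eqxx.
have Xtx : X (t *: val x) by apply: proj_closed_scale vX.1 t0 _; exact: set_valP.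
have := congr1 (fun f => f (SigSub (mem_set Xtx))) hP; rewrite /evf horner_line_poly => h.
rewrite -[RHS]h; apply: meval_eq => j; rewrite !vE -tr -homog_scale//.
by apply: meval_eq => i; rewrite !mxE.
Qed.

Lemma hilbert_bound n j0 : variety X -> has_dimension X n -> v j0 != 0 ->
  exists C, forall k B (e : 'I_B -> (X -> K^o)), rel_basis (Rk v k) [set 0] e ->
    (B <= C * k.+1 ^ n)%N.
Proof.
move=> vX dX z0; have [L [iota [g hk]]] := coordinate_field vX.
have hom := geometric_model vX hk; set om := fun j => _ in hom.
have om0 : om j0 != 0.
  have := hom.1 'X_j0; rewrite mmapX mmap1U evfX monU => h.
  by apply: contra_neq z0 => /h.
have [d [x [x_span x_ind x_int]]] := noether_normalization iota g.
have dn := noether_dim vX dX hk x_span x_ind x_int.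
have [C hC] := count_bound x_int.
exists (C * (2 * r).+1 ^ n.+1)%N => k B e be.
have [Be _] := be; have /choice[s hs] : forall i, exists P, P \is k.-homog /\ e i = evf v P.
  by move=> i; have [P hP eP] := Rk_evf (Be i); exists P.
have ind (c : 'I_B -> K) : \sum_i c i *: evf v (s i) = 0 -> forall i, c i = 0.
  move=> h; apply: (rel_basis_indep (subspace_Rk v k) (subspace_set0 _) be).
  by rewrite /= -[RHS]h; apply: eq_bigr => i _; rewrite (hs i).2.
have gind := graded_indep hom (q := k.+1) om0 (fun i => (hs i).1) ind.
(* Each of the two factors of a product has degree at most [r * k] in the coordinates. *)
have := hC (2 * r * k)%N _ _ gind; rewrite card_prod !card_ord => hB.
have {hB} : (k.+1 * B <= C * (2 * r * k).+1 ^ d)%N.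
  apply: hB => -[i b] /=; exists (qf j0 ^+ i * mmap (@mpolyC N.+1 K) qf (s b)).
    have hh : qf j0 ^+ i * mmap (@mpolyC N.+1 K) qf (s b) \is (r * i + r * k).-homog.
      by apply: dhomogM; [exact: dhomogMn|exact: homog_subst (hs b).1].
    apply: leq_trans (homog_msize hh) _; rewrite ltnS -mulnA mul2n -addnn leq_add2r.
    by rewrite leq_mul2l -ltnS ltn_ord orbT.
  by rewrite rmorphM rmorphXn /= mmap_mmap.
move=> hB; have : (k.+1 * B <= k.+1 * (C * (2 * r).+1 ^ n.+1 * k.+1 ^ n))%N.
  apply: leq_trans hB _; apply: (@leq_trans (C * ((2 * r).+1 * k.+1) ^ n.+1)%N).
    rewrite leq_mul2l; apply/orP; right; apply: (@leq_trans (((2 * r).+1 * k.+1) ^ d)%N).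
      have le : ((2 * r * k).+1 <= (2 * r).+1 * k.+1)%N by rewrite mulSn mulnS; lia.
      by case: (d) => // d'; rewrite leq_exp2r.
    by rewrite leq_pexp2l// muln_gt0.
  by rewrite expnMn [(k.+1 ^ n.+1)%N]expnS; apply: eq_leq; ring.
by rewrite leq_pmul2l.
Qed.

End Geometry.

(** * Positivity of the norm *)

Lemma stdw_span (R : realDomainType) (K : fieldType) (T : Type) m (v : 'I_m -> (T -> K^o))
    (lam : 'I_m -> R) a :
  lspan [set s | exists b, [/\ stdw v lam b, mdeg b = mdeg a, wdeg lam b <= wdeg lam a & s = mon v b]]
    (mon v a).
Proof.
have [u hu e] : sumset (lspan [set s | exists b, [/\ stdw v lam b, mdeg a == mdeg b,
    (b == a) || ltw lam b a & s = mon v b]]) [set 0] (mon v a).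
  apply: (@std_span K T m v (ltw lam) (fun a b => mdeg a == mdeg b) (fun=> [set 0])
    (ltw_irr lam) (@ltw_trans _ _ lam)) => //.
  - by move=> b c; rewrite eq_sym.
  - by move=> b c d /eqP-> /eqP->.
  - by move=> b c /eqP.
  - by move=> b; exact: subspace_set0.
  - by move=> b c _ s.
have -> : mon v a = u by apply/eqP; rewrite -subr_eq0; apply/eqP.
move: u hu {e}; apply: lspan_mono => _ [b [sb /eqP ab ba ->]].
exists b; split => //; by move: ba => /predU1P[->//|/ltw_wdeg].
Qed.

Lemma pihomog_sumZ (K : fieldType) n d (I : Type) (s : seq I) (c : I -> K) (p : I -> {mpoly K[n]}) :
  pihomog mdeg d (\sum_(i <- s) c i *: p i) = \sum_(i <- s) c i *: pihomog mdeg d (p i).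
Proof. by rewrite linear_sum; apply: eq_bigr => i _; rewrite linearZ. Qed.

(** * An affine chart of the Rees algebra of a two-valued weight *)

Section Chart.
Context (K : closedFieldType) (T : Type) {m : nat} (v : 'I_m -> (T -> K^o)).
Context (L : fieldType) (iota : {rmorphism K -> L}) (om : 'I_m -> L).
Local Notation E := (T -> K^o).
Hypothesis hom : graded_model v iota om.
Context (V : pred 'I_m) (j0 : 'I_m).

Definition multiples e : set E :=
  lspan [set s | exists j b, [/\ V j, mdeg b = e & s = v j * mon v b]].

Hypothesis nonnil : forall e, ~ multiples e (v j0 ^+ e.+1).

(** Only the distinction between least and larger weights is retained; [count_high] compares the
    original weight with this one. *)
Definition lam01 (j : 'I_m) : int := if V j then 0 else 1.
Definition nv (a : 'X_{1..m}) : nat := \sum_j (if V j then 0%N else a j).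

Lemma wdeg01 a : wdeg lam01 a = (nv a)%:Z.
Proof.
rewrite /wdeg /nv -natz natr_sum; apply: eq_bigr => j _; rewrite /lam01.
by case: ifP => _; rewrite ?mul0rn.
Qed.

Lemma nv_le a : (nv a <= mdeg a)%N.
Proof. by rewrite mdegE; apply: leq_sum => j _; case: ifP. Qed.

Lemma nvD a b : nv (a + b)%MM = (nv a + nv b)%N.
Proof. by rewrite /nv -big_split; apply: eq_bigr => j _ /=; rewrite mnmDE; case: ifP. Qed.

Lemma multiples_mon a : (nv a < mdeg a)%N -> multiples (mdeg a).-1 (mon v a).
Proof.
move=> lt; have [j /andP[Vj aj]] : exists j, V j && (0 < a j)%N.
  apply/existsP; apply: contraTT lt; rewrite negb_exists -leqNgt mdegE => /forallP h.
  by apply: leq_sum => j _; have := h j; case: (V j) => //=; rewrite -leqNgt leqn0 => /eqP ->.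
have aE : (a = U_(j) + (a - U_(j)))%MM by rewrite addmC submK// lep1mP -lt0n.
apply: sub_lspan; exists j, (a - U_(j))%MM; split => //; last by rewrite {1}aE monD monU.
by rewrite {2}aE mdegD mdeg1.
Qed.

Lemma j0_notinV : V j0 = false.
Proof.
apply/negP => Vj0; apply: (@nonnil 0); apply: sub_lspan; exists j0, 0%MM.
by rewrite mdeg0 mon0 mulr1 expr1.
Qed.

Lemma om_neq0 j : v j != 0 -> om j != 0.
Proof.
apply: contra_neq => oj; have := hom.1 'X_j; rewrite mmapX mmap1U evfX monU oj => h.
by apply/h.
Qed.

Lemma omj0 : om j0 != 0.
Proof.
apply: om_neq0; apply/eqP => v0; apply: (@nonnil 0).
by rewrite v0 expr1; exact: subspace0 (subspace_lspan _).
Qed.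

Lemma mmap1_add n (h : 'I_n -> L) a b : mmap1 h (a + b)%MM = mmap1 h a * mmap1 h b.
Proof. by rewrite /mmap1 -big_split; apply: eq_bigr => i _ /=; rewrite mnmDE exprD. Qed.

Let u := (om j0)^-1.
Let u0 : u != 0. Proof. by rewrite invr_eq0 omj0. Qed.

(** In the Rees algebra of [lam01], putting [v j0 t = 1] turns [t] into [u], keeps the generators of
    weight zero and divides those of weight one by [v j0]. The locus [u = 0] is then an open part of
    the central fibre. *)
Definition chart (i : 'I_m.+1) : L :=
  if unlift ord0 i is Some j then (if V j then om j else om j * u) else u.

Definition tl (b : 'X_{1..m.+1}) : 'X_{1..m} := [multinom b (lift ord0 j) | j < m].
Definition cons0 i (c : 'X_{1..m}) : 'X_{1..m.+1} :=
  [multinom if unlift ord0 k is Some j then c j else i | k < m.+1].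

Lemma chart_mon b : mmap1 chart b = mmap1 om (tl b) * u ^+ (nv (tl b) + b ord0).
Proof.
rewrite /mmap1 big_ord_recl /chart unlift_none exprD mulrA [LHS]mulrC; congr (_ * _).
rewrite /nv -prodrXr -big_split; apply: eq_bigr => j _ /=.
by rewrite liftK mnmE; case: ifP => _; rewrite ?expr0 ?mulr1// exprMn.
Qed.

Lemma tl_cons0 i c : tl (cons0 i c) = c.
Proof. by apply/mnmP => j; rewrite !mnmE liftK. Qed.

Lemma mdeg_tl b : mdeg b = (b ord0 + mdeg (tl b))%N.
Proof. by rewrite !mdegE big_ord_recl; congr (_ + _)%N; apply: eq_bigr => j _; rewrite mnmE. Qed.

Lemma chart_cons0 i c : mmap iota chart 'X_[cons0 i c] = mmap1 om c * u ^+ (nv c + i).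
Proof. by rewrite mmapX chart_mon tl_cons0 mnmE unlift_none. Qed.

Lemma mdeg_cons0 i c : mdeg (cons0 i c) = (i + mdeg c)%N.
Proof. by rewrite mdeg_tl tl_cons0 mnmE unlift_none. Qed.

Lemma in_subalg_u : in_subalg iota chart u.
Proof. by exists 'X_[cons0 1 0%MM]; rewrite chart_cons0 /nv big1 ?mmap11 ?mul1r// => j _; rewrite mnm0E if_same. Qed.

(* If [1 / u] were in the algebra, then clearing denominators in degree one
   would make [v j0] nilpotent modulo [V]. *)
Lemma chart_nonunit : ~ in_subalg iota chart u^-1.
Proof.
rewrite invrK => -[p pE].
pose s b := (nv (tl b) + b ord0)%N.
pose S := \max_(b <- msupp p) s b.
have sS b : b \in msupp p -> (s b <= S)%N by move=> bp; exact: (leq_bigmax_seq _ bp).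
pose M (b : 'X_{1..m.+1}) := (tl b + U_(j0) *+ (S - s b))%MM.
pose P : {mpoly K[m]} := 'X_[(U_(j0) *+ S.+1)%MM] - \sum_(b <- msupp p) p@_b *: 'X_[M b].
have phiX a : mmap1 om (U_(j0) *+ a)%MM = om j0 ^+ a by rewrite -(mmapX om iota) -mpolyXn rmorphXn /= mmapX mmap1U.
have P0 : mmap iota om P = 0.
  rewrite rmorphB rmorph_sum /= mmapX phiX.
  apply/eqP; rewrite subr_eq0 exprSr {2}pE; apply/eqP.
  rewrite [X in _ * X]/mmap mulr_sumr.
  rewrite !big_seq; apply: eq_bigr => b bp; rewrite /= mmapZ mmapX chart_mon -/(s b) /M mmap1_add phiX.
  have <- : om j0 ^+ S * u ^+ s b = om j0 ^+ (S - s b).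
    by rewrite -{1}(subnK (sS b bp)) exprD -mulrA -exprMn mulfV ?expr1n ?mulr1// omj0.
  by rewrite mulrCA [om j0 ^+ S * (_ * _)]mulrCA.
have := hom.2 P S.+1 P0 => /hom.1.
have -> : pihomog mdeg S.+1 P = 'X_[(U_(j0) *+ S.+1)%MM] -
    \sum_(b <- msupp p) p@_b *: pihomog mdeg S.+1 'X_[M b].
  rewrite /P pihomogB pihomog_sumZ pihomog_dE//.
  by rewrite dhomogX -[X in X == _]/(mdeg _) mdegMn mdeg1 mul1n.
rewrite -scaleN1r evfD evfZ evfX scaleN1r => /eqP; rewrite subr_eq0 evf_sum => /eqP h.
apply: (@nonnil S).
have -> : v j0 ^+ S.+1 = mon v (U_(j0) *+ S.+1)%MM.
  by rewrite -[LHS]mulr1; elim: (S.+1) => [|e IH]; rewrite ?mulm0n ?mon0 ?mulr1// mulmS monD monU -IH exprS !mulr1.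
rewrite h big_seq; apply: subspace_sum; first exact: subspace_lspan.
move=> b bp; rewrite pihomogX -[X in X == _]/(mdeg _).
case: eqP => [bS|_]; last first.
  have -> : evf v (p@_b *: 0) = 0 by apply/funext => x; rewrite scaler0; exact: meval0.
  exact: subspace0 (subspace_lspan _).
rewrite evfZ evfX; apply: subspaceZ; first exact: subspace_lspan.
have := @multiples_mon (M b); rewrite bS /=; apply.
move: bS (sS b bp); rewrite /M nvD mdegD mdegMn mdeg1 mul1n /s.
have -> a : nv (U_(j0) *+ a)%MM = a.
  rewrite /nv (bigD1 j0)//= j0_notinV mulmnE mnm1E eqxx mul1n big1 ?addn0// => j /negbTE j0j.
  by rewrite mulmnE mnm1E eq_sym j0j mul0n if_same.
by lia.
Qed.


(** Multiplying [R_q] by [q.+1] powers of [om j0], and by [u ^+ (2 * q)] to land in the chart, gives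
    at least the order of [q ^ n.+1] independent elements of degree at most [3 * q]; an algebra
    integral over [d.+1] elements has room for [O(q ^ d.+1)]. *)
Lemma chart_dim n C1 k0 d (x : 'I_d.+1 -> L) : (forall i, integral_gen iota x (chart i)) ->
  (forall q B (e : 'I_B -> E), (k0 <= q)%N -> rel_basis (Rk v q) [set 0] e -> (q ^ n <= C1 * B)%N) ->
  (n <= d)%N.
Proof.
move=> x_int hilb; have [C hC] := count_bound x_int.
(* If [d < n], the bound [(3 * q).+1 <= 4 * q] leads to [q.+1 <= C1 * C * 4 ^ d.+1], which this
   choice excludes. *)
pose q := (k0 + C1 * C * 4 ^ d.+1).+1.
have [e be] := std_Rk_basis v lam01 q; set B := size _ in e be.
have hB := hilb q B e (leqW (leq_addr _ _)) be.
have [Be _] := be; have /choice[s hs] : forall i, exists P, P \is q.-homog /\ e i = evf v P.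
  by move=> i; have [P hP eP] := Rk_evf (Be i); exists P.
have ind (c : 'I_B -> K) : \sum_i c i *: evf v (s i) = 0 -> forall i, c i = 0.
  move=> h; apply: (rel_basis_indep (subspace_Rk v q) (subspace_set0 _) be).
  by rewrite /= -[RHS]h; apply: eq_bigr => i _; rewrite (hs i).2.
have gind := graded_indep hom (q := q.+1) omj0 (fun i => (hs i).1) ind.
pose y (t : 'I_q.+1 * 'I_B) := u ^+ (2 * q) * (om j0 ^+ t.1 * mmap iota om (s t.2)).
have yind c : \sum_t iota (c t) * y t = 0 -> forall t, c t = 0.
  move=> h; apply: gind; apply: (mulfI (expf_neq0 (2 * q) u0)); rewrite mulr0 -[RHS]h mulr_sumr.
  by apply: eq_bigr => t _; rewrite /y mulrCA.
have {hC} := hC (3 * q)%N _ y yind; rewrite card_prod !card_ord => hCB.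
have {hCB} hCB : (q.+1 * B <= C * (3 * q).+1 ^ d.+1)%N.
  apply: hCB => -[i b]; have /dhomogP sh := (hs b).1.
  exists (\sum_(a <- msupp (s b)) (s b)@_a *: 'X_[cons0 (2 * q - i - nv a) a]).
    rewrite big_seq; apply: (big_ind (fun p => (msize p <= _)%N)) => [|p p' hp hp'|a ab].
    - by rewrite msize0.
    - by apply: leq_trans (msizeD_le _ _) _; rewrite geq_max hp.
    apply: leq_trans (msizeZ_le _ _) _; rewrite mmeasureX ltnS -[X in (X <= _)%N]/(mdeg _) mdeg_cons0.
    have aq : mdeg a = q := sh a ab.
    by rewrite aq; move: (nv a) => na; lia.
  rewrite /y /= rmorph_sum [X in _ * (_ * X)]/mmap !mulr_sumr !big_seq.
  apply: eq_bigr => a ab; rewrite /= mmapZ chart_cons0.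
  have aq : mdeg a = q := sh a ab.
  have ai : (nv a + (2 * q - i - nv a) = 2 * q - i)%N.
    by have := nv_le a; rewrite aq; have := ltn_ord i; lia.
  have iq : (i <= 2 * q)%N by have := ltn_ord i; lia.
  rewrite ai; have -> : u ^+ (2 * q - i) = u ^+ (2 * q) * om j0 ^+ i.
    by rewrite -{2}(subnK iq) exprD -mulrA -exprMn mulVf ?omj0// expr1n mulr1.
  by rewrite [RHS]mulrA [RHS]mulrC -mulrA.
rewrite leqNgt; apply/negP => dn.
have : (q ^ d.+1 * q.+1 <= q ^ d.+1 * (C1 * C * 4 ^ d.+1))%N.
  apply: (@leq_trans (C1 * (q.+1 * B))%N).
    rewrite mulnC mulnCA leq_mul2l (leq_trans _ hB) ?orbT// leq_pexp2l//.
  apply: leq_trans (leq_mul (leqnn C1) hCB) _.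
  rewrite -!mulnA [(q ^ d.+1 * _)%N]mulnC -mulnA -!mulnA !leq_mul2l -expnMn leq_exp2r//.
  by rewrite (_ : (3 * q).+1 <= 4 * q)%N ?orbT// /q; lia.
by rewrite leq_pmul2l ?expn_gt0// /q; lia.
Qed.

(** The [d] elements independent modulo [u] have [t.+1 ^ d] monomials with exponents at most [t],
    hence of degree at most [q]. Homogenised to degree [2 * q] by [v j0], they are combinations of
    standard monomials; those below the top weight become multiples of [u], and the others have at
    least [q] factors outside [V]. *)
Lemma chart_count n C1 k0 :
  (forall q B (e : 'I_B -> E), (k0 <= q)%N -> rel_basis (Rk v q) [set 0] e -> (q ^ n <= C1 * B)%N) ->
  exists2 d, (n <= d)%N & forall q t, (d * t <= q)%N ->
    (t.+1 ^ d <= count (fun b => `[< stdw v lam01 b >] && (q <= nv b)%N) (mons (2 * q)))%N.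
Proof.
move=> hilb.
have [d [x [y [x_ind x_int y_span y_mod]]]] := principal_ideal_dim in_subalg_u u0 chart_nonunit.
exists d; first exact: chart_dim x_int hilb.
move=> q t tq; rewrite -size_filter.
pose Bq := [seq b <- mons (2 * q) | `[< stdw v lam01 b >] && (q <= nv b)%N]; rewrite -/Bq.
pose W : set L := [set z | exists (a : 'I_(size Bq) -> K) w, in_subalg iota chart w /\
  z = \sum_b iota (a b) * (mmap1 om (nth 0%MM Bq b) * u ^+ nv (nth 0%MM Bq b)) + u * w].
have W0 : W 0.
  exists (fun=> 0), 0; split; first exact: (in_subalg_nat _ _ 0).
  by rewrite mulr0 addr0 big1// => b _; rewrite rmorph0 mul0r.
have WD c z z' : W z -> W z' -> W (iota c * z + z').
  move=> [a [w [Aw ->]]] [a' [w' [Aw' ->]]]; exists (fun b => c * a b + a' b), (iota c * w + w').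
  split; first by apply: in_subalgD => //; apply: in_subalgM => //; exact: in_subalg_const.
  under [in RHS]eq_bigr do rewrite rmorphD rmorphM /= mulrDl -mulrA.
  by rewrite big_split -mulr_sumr /= !mulrDr addrACA; congr (_ + (_ + _)); rewrite mulrCA.
have W_u w : in_subalg iota chart w -> W (u * w).
  move=> Aw; exists (fun=> 0), w; split => //.
  by rewrite big1 ?add0r// => b _; rewrite rmorph0 mul0r.
have Amon i c : in_subalg iota chart (mmap1 om c * u ^+ (nv c + i)).
  by rewrite -chart_cons0; exists 'X_[cons0 i c].
have Wmon e : (mdeg e <= q)%N -> W (mmap1 chart e).
  rewrite chart_mon mdeg_tl; case: (e ord0) => [|i] eq; last first.
    by rewrite addnS exprS mulrCA; apply: W_u; exact: Amon.
  set c := tl e in eq *; rewrite addn0; rewrite add0n in eq.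
  (* Each added factor [v j0] raises [nv] by one because [j0] is outside [V], and at least [q] of
     them are added since [mdeg c <= q]. *)
  pose s := (nv c + (2 * q - mdeg c))%N.
  pose c' := (c + U_(j0) *+ (2 * q - mdeg c))%MM.
  have nvU a : nv (U_(j0) *+ a)%MM = a.
    rewrite /nv (bigD1 j0)//= j0_notinV mulmnE mnm1E eqxx mul1n big1 ?addn0// => j /negbTE j0j.
    by rewrite mulmnE mnm1E eq_sym j0j mul0n if_same.
  have nvc' : nv c' = s by rewrite nvD nvU.
  have dc' : mdeg c' = (2 * q)%N by rewrite mdegD mdegMn mdeg1 mul1n subnKC//; lia.
  have sq : (q <= s)%N by rewrite /s; lia.
  have -> : mmap1 om c * u ^+ nv c = mmap1 om c' * u ^+ s.
    rewrite /c' mmap1_add /s exprD; rewrite -(mmapX om iota (U_(j0) *+ _)%MM) -mpolyXn rmorphXn /= mmapX mmap1U.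
    have key (A B C D : L) : C * D = 1 -> A * B = A * C * (B * D) by move=> CD; rewrite mulrACA CD mulr1.
    by apply: key; rewrite -exprMn mulfV ?expr1n// omj0.
  have [p [a [w [hw cE]]]] := stdw_span v lam01 c'.
  have /choice[b hb] := hw.
  have omE : mmap1 om c' = \sum_j iota (a j) * mmap1 om (b j).
    pose P : {mpoly K[m]} := 'X_[c'] - \sum_j a j *: 'X_[b j].
    have : mmap iota om P = 0.
      apply/hom.1; rewrite /P -scaleN1r evfD evfZ scaleN1r evfX evf_sum cE.
      apply/eqP; rewrite subr_eq0; apply/eqP; apply: eq_bigr => j _.
      by rewrite evfZ evfX; have [_ _ _ ->] := hb j.
    rewrite rmorphB rmorph_sum /= mmapX => /eqP; rewrite subr_eq0 => /eqP ->.
    by apply: eq_bigr => j _; rewrite /= mmapZ mmapX.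
  rewrite omE mulr_suml; apply: big_ind => // [z z' Wz Wz'|j _].
    by rewrite -[z]mul1r -(rmorph1 iota); exact: WD.
  rewrite -mulrA -[X in W X]addr0; apply: WD => //.
  have [bstd bdeg ble _] := hb j; move: ble; rewrite !wdeg01 nvc' lez_nat leq_eqVlt => /predU1P[bs|bs].
    have bB : b j \in Bq.
      by rewrite mem_filter mem_mons bdeg dc' eqxx bs sq andbT andbT; exact/asboolP.
    have ib : (index (b j) Bq < size Bq)%N by rewrite index_mem.
    exists (fun i => (i == Ordinal ib)%:R), 0; split; first exact: (in_subalg_nat _ _ 0).
    rewrite mulr0 addr0 (bigD1 (Ordinal ib))//= eqxx rmorph1 mul1r nth_index// bs big1 ?addr0//.
    by move=> i /negbTE ->; rewrite rmorph0 mul0r.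
  have -> : mmap1 om (b j) * u ^+ s = u * (mmap1 om (b j) * u ^+ (nv (b j) + (s - nv (b j)).-1)).
    rewrite mulrCA -exprS; congr (_ * _ ^+ _); lia.
  by apply: W_u; exact: Amon.
have y_poly (b : 'X_{1..d}) : (mdeg b <= q)%N -> W (mmap iota y 'X_[b]).
  move=> bq; have /choice[cy yE] := y_span.
  pose h j : {mpoly K[m.+1]} := \sum_i cy j i *: 'X_i.
  have hh j : h j \is 1.-homog.
    by apply: rpred_sum => i _; apply: rpredZ; rewrite dhomogX; apply/eqP; exact: mdeg1.
  have -> : mmap iota y 'X_[b] = mmap iota chart (mmap (@mpolyC m.+1 K) h 'X_[b]).
    rewrite mmap_mmap; congr (mmap _ _ _); apply/funext => j.
    by rewrite /h rmorph_sum yE; apply: eq_bigr => i _; rewrite /= mmapZ mmapX mmap1U.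
  have /dhomogP Gh : mmap (@mpolyC m.+1 K) h 'X_[b] \is (1 * mdeg b).-homog.
    by apply: homog_subst => //; rewrite dhomogX.
  rewrite [mmap iota chart _]/mmap big_seq; apply: big_ind => // [z z' Wz Wz'|a ab].
    by rewrite -[z]mul1r -(rmorph1 iota); exact: WD.
  rewrite -[X in W X]addr0; apply: WD => //; apply: Wmon.
  have : mdeg a = (1 * mdeg b)%N := Gh a ab.
  by rewrite mul1n => ->.
pose J : finType := {ffun 'I_d -> 'I_t.+1}.
have -> : (t.+1 ^ d = #|J|)%N by rewrite card_ffun !card_ord.
rewrite leqNgt; apply/negP => lt.
pose mo (f : J) : 'X_{1..d} := [multinom (f i : nat) | i < d].
have mo_inj : injective mo.
  move=> f f' /mnmP e; apply/ffunP => i; apply: val_inj; have := e i; by rewrite !mnmE.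
have mo_deg f : (mdeg (mo f) <= q)%N.
  apply: leq_trans tq; rewrite mdegE -[X in (_ <= X * _)%N]card_ord -sum_nat_const.
  by apply: leq_sum => i _; rewrite mnmE -ltnS ltn_ord.
have /choice[a /choice[w hw]] : forall f : J, exists a : 'I_(size Bq) -> K, exists w, in_subalg iota chart w /\
  mmap iota y 'X_[mo f] = \sum_b iota (a b) * (mmap1 om (nth 0%MM Bq b) * u ^+ nv (nth 0%MM Bq b)) + u * w.
  by move=> f; exact: y_poly (mo_deg f).
have [s [i si] hs] := @kernel_row K #|J| (size Bq) (\matrix_(i, b) a (@enum_val J J i) b) lt.
pose P : {mpoly K[d]} := \sum_i s i *: 'X_[mo (@enum_val J J i)].
have P0 : P = 0.
  apply: (y_mod P (\sum_i iota (s i) * w (@enum_val J J i))).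
    by apply: in_subalg_sum => k _; apply: in_subalgM; [exact: in_subalg_const|case: (hw (@enum_val J J k))].
  rewrite rmorph_sum mulr_sumr.
  transitivity (\sum_k (iota (s k) * (\sum_b iota (a (@enum_val J J k) b) *
       (mmap1 om (nth 0%MM Bq b) * u ^+ nv (nth 0%MM Bq b))) + u * (iota (s k) * w (@enum_val J J k)))).
    by apply: eq_bigr => k _; rewrite /= mmapZ (hw _).2 mulrDr; congr (_ + _); rewrite mulrCA.
  rewrite big_split /= [X in X + _](_ : _ = 0) ?add0r//.
  under eq_bigr do rewrite mulr_sumr.
  rewrite exchange_big big1// => b _ /=; under eq_bigr do rewrite mulrA.
  rewrite -mulr_suml (_ : \sum_(_ < _) _ = 0) ?mul0r//.
  apply: etrans (rmorph0 iota); rewrite -(hs b) rmorph_sum; apply: eq_bigr => k _; by rewrite mxE rmorphM.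
move/eqP: si; apply; have := congr1 (mcoeff (mo (@enum_val J J i))) P0.
rewrite mcoeff0 raddf_sum (bigD1 i)//= mcoeffZ mcoeffX eqxx mulr1 big1 ?addr0// => k ki.
rewrite mcoeffZ mcoeffX; case: eqP => [/mo_inj/enum_val_inj e|]; last by rewrite mulr0.
by rewrite e eqxx in ki.
Qed.

End Chart.

Lemma count_sum_le (R : numDomainType) (s : seq R) (p : pred R) (f : R -> R) b :
  (forall x, p x -> b <= f x) -> (forall x, x \in s -> 0 <= f x) ->
  (count p s)%:R * b <= \sum_(x <- s) f x.
Proof.
move=> hb hf; rewrite (bigID p)/= -[leLHS]addr0 lerD//; last first.
  by rewrite big_seq_cond; apply: sumr_ge0 => x /andP[/hf].
rewrite -sum1_count natr_sum mulr_suml; apply: ler_sum => x px.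
by rewrite mul1r; exact: hb.
Qed.

(** * A lower bound for the variance of the spectrum *)

Section Variance.
Context (R : archiRealFieldType) (K : closedFieldType) (T : Type) {m : nat}.
Context (v : 'I_m -> (T -> K^o)) (L : fieldType) (iota : {rmorphism K -> L}) (om : 'I_m -> L).
Local Notation E := (T -> K^o).
Hypothesis hom : graded_model v iota om.
Context (lam : 'I_m -> R) (j1 : 'I_m).
Hypotheses (lam_min : forall j, lam j1 <= lam j) (v_neq0 : v j1 != 0).
Let V : pred 'I_m := fun j => lam j == lam j1.

Lemma gap : exists2 del, 0 < del & forall j, ~~ V j -> lam j1 + del <= lam j.
Proof.
have [del d0 h] : exists2 del, 0 < del & forall j, j \in enum 'I_m -> ~~ V j -> lam j1 + del <= lam j.
  elim: (enum 'I_m) => [|j s [del d0 h]]; first by exists 1.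
  have [Vj|nVj] := boolP (V j).
    by exists del => // i; rewrite inE => /predU1P[->|/h//]; rewrite Vj.
  have lt : 0 < lam j - lam j1 by rewrite subr_gt0 lt_neqAle eq_sym nVj lam_min.
  exists (Num.min del (lam j - lam j1)); first by rewrite lt_min d0.
  move=> i; rewrite inE => /predU1P[-> _|/h hi /hi le].
    by rewrite -lerBrDl ge_min lexx orbT.
  by apply: le_trans le; rewrite lerD2l ge_min lexx.
by exists del => // j; apply: h; rewrite mem_enum.
Qed.

Lemma wdeg_lower del a : (forall j, ~~ V j -> lam j1 + del <= lam j) ->
  (mdeg a)%:R * lam j1 + (nv V a)%:R * del <= wdeg lam a.
Proof.
move=> h; rewrite mdegE /nv /wdeg !natr_sum !mulr_suml -big_split; apply: ler_sum => j _ /=.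
rewrite -[lam j *+ _]mulr_natl; case: ifP => [/eqP ->|/negbT/h hj].
  by rewrite mulr0n mul0r addr0.
by rewrite -mulrDr ler_wpM2l.
Qed.

Lemma wdeg_upper D a : (forall j, lam j <= lam j1 + D) ->
  wdeg lam a <= (mdeg a)%:R * (lam j1 + D).
Proof.
move=> h; rewrite mdegE /wdeg natr_sum mulr_suml; apply: ler_sum => j _.
by rewrite -[lam j *+ _]mulr_natl ler_wpM2l.
Qed.

(** Multiplication by [v j1 ^+ (k - t)] is injective and maps [R_t] into the part of [R_k] whose
    weight exceeds the minimum by at most [t%:R * D]. *)
Lemma count_low D t k B (e : 'I_B -> E) : (t <= k)%N -> (forall j, lam j <= lam j1 + D) ->
  rel_basis (Rk v t) [set 0] e ->
  (B <= count (fun x => (x <= k%:R * lam j1 + t%:R * D)%R) (spectrum v lam k))%N.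
Proof.
move=> tk hD be; have [f bf] := spectrumP v lam k (k%:R * lam j1 + t%:R * D).
have [Be _] := be.
apply: (indep_leq (u := fun i => v j1 ^+ (k - t) * e i) (w := f) (subspace_set0 _)).
- move=> c /= h; apply: (rel_basis_indep (subspace_Rk v t) (subspace_set0 _) be) => /=.
  have /choice[s hs] : forall i, exists P, P \is t.-homog /\ e i = evf v P.
    by move=> i; have [P hP eP] := Rk_evf (Be i); exists P.
  have eE : \sum_i c i *: e i = evf v (\sum_i c i *: s i).
    by rewrite evf_sum; apply: eq_bigr => i _; rewrite evfZ (hs i).2.
  have : evf v ('X_j1 ^+ (k - t) * \sum_i c i *: s i) = 0.
    rewrite evfM -eE; apply: etrans h; rewrite mulr_sumr.
    have -> : evf v ('X_j1 ^+ (k - t)) = v j1 ^+ (k - t).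
      by rewrite mpolyXn evfX; apply/funext => x; rewrite monE fct_expE (bigD1 j1)//= mulmnE mnm1E eqxx mul1n big1 ?mulr1// => j /negbTE jj; rewrite mulmnE mnm1E eq_sym jj.
    by apply: eq_bigr => i _; rewrite -fct_scalerAr.
  move=> /hom.1; rewrite rmorphM rmorphXn /= mmapX mmap1U => /eqP.
  have oj1 : om j1 != 0.
    apply: contra_neq v_neq0 => oj; have := hom.1 'X_j1; rewrite mmapX mmap1U evfX monU oj => hh.
    by apply/hh.
  by rewrite mulf_eq0 expf_eq0 (negbTE oj1) andbF /= => /eqP /hom.1; rewrite -eE.
- move=> i; have [bW bs] := bf; have [|c [hc _]] := bs (v j1 ^+ (k - t) * e i); last by exists c.
  rewrite -{1}(subnK tk) (_ : k%:R * _ + _ = (k - t)%:R * lam j1 + t%:R * (lam j1 + D)); last first.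
    by rewrite natrB//; ring.
  apply: Sk_mul.
    have -> : v j1 ^+ (k - t) = mon v (U_(j1) *+ (k - t))%MM.
      by apply/funext => x; rewrite monE fct_expE (bigD1 j1)//= mulmnE mnm1E eqxx mul1n big1 ?mulr1// => j /negbTE jj; rewrite mulmnE mnm1E eq_sym jj.
    have {1}-> : (k - t)%N = mdeg (U_(j1) *+ (k - t))%MM by rewrite mdegMn mdeg1 mul1n.
    apply: Sk_mon; rewrite /wdeg (bigD1 j1)//= mulmnE mnm1E eqxx mul1n big1 ?addr0 ?mulr_natl// => j /negbTE jj.
    by rewrite mulmnE mnm1E eq_sym jj.
  move: (Be i); apply: lspan_mono => _ [b bt ->]; exists b; split => //.
  by rewrite -bt; exact: wdeg_upper.
Qed.

(** A monomial of weight below the threshold has fewer than [q] factors outside [V], so the lower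
    part for [lam] lies in the one for [lam01]. Both filtrations exhaust the same space, so the
    complementary counts compare the other way. *)
Lemma count_high del q : (forall j, ~~ V j -> lam j1 + del <= lam j) -> 0 < del ->
  (count (fun b => `[< stdw v (lam01 V) b >] && (q <= nv V b)%N) (mons (2 * q)) <=
   count (fun x => ((2 * q)%:R * lam j1 + q%:R * del <= x)%R) (spectrum v lam (2 * q)))%N.
Proof.
move=> hd d0; set k := (2 * q)%N; set y := _ + _.
rewrite [X in (_ <= X)%N]count_map count_filter.
have [|e be] := @std_filter_basis _ _ _ _ v lam (fun a => wdeg lam a < y) k.
  by move=> a b _ _ lb /ltw_wdeg; move/le_lt_trans; apply.
have [|e' be'] := @std_filter_basis _ _ _ _ v (lam01 V) (fun a => (nv V a < q)%N) k.
  move=> a b _ _ lb /ltw_wdeg; rewrite !wdeg01 lez_nat => le; exact: leq_ltn_trans le lb.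
have le : (count (fun a => `[< stdw v lam a >] && (wdeg lam a < y)%R) (mons k) <=
    count (fun a => `[< stdw v (lam01 V) a >] && (nv V a < q)%N) (mons k))%N.
  have [Be _] := be; have [_ Be'] := be'.
  apply: (indep_leq (w := e') (subspace_set0 _) (rel_basis_indep (subspace_lspan _) (subspace_set0 _) be)).
  move=> i; have [|c [hc _]] := Be' (e i); last by exists c.
  move: (Be i); apply: lspan_mono => _ [b [bk by_ ->]]; exists b; split => //.
  rewrite ltnNge; apply/negP => qb; have := le_lt_trans (wdeg_lower b hd) by_.
  by rewrite /y bk ltrD2l ltr_pM2r// ltr_nat ltnNge qb.
have split_count (A p : pred 'X_{1..m}) : (count (fun a => A a && p a) (mons k) +
    count (fun a => A a && ~~ p a) (mons k) = size [seq a <- mons k | A a])%N.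
  rewrite -(count_predC p) !count_filter; congr (_ + _)%N; apply: eq_count => a /=; exact: andbC.
have [e1 b1] := std_Rk_basis v lam k; have [e2 b2] := std_Rk_basis v (lam01 V) k.
have := rel_basis_dim (subspace_Rk v k) (subspace_set0 _) b1 b2; rewrite !size_map.
rewrite -(split_count _ (fun a => wdeg lam a < y)) -(split_count _ (fun a => (nv V a < q)%N)) => sizeE.
rewrite [X in (X <= _)%N](_ : _ =
    count (fun a => `[< stdw v (lam01 V) a >] && ~~ (nv V a < q)%N) (mons k)); last first.
  by apply: eq_count => a; rewrite -leqNgt.
rewrite [X in (_ <= X)%N](_ : _ =
    count (fun a => `[< stdw v lam a >] && ~~ (wdeg lam a < y)%R) (mons k)); last first.
  by apply: eq_count => a /=; rewrite -leNgt andbC.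
by move: le sizeE; set A := count _ _; set B := count _ _; set C := count _ _; set D := count _ _; lia.
Qed.

(** A number of entries of order at least [t ^ n] lies near the minimum, and another such group lies
    far above it; no [mu] is close to both. *)
Theorem spectrum_variance n C1 k0 j0 :
  (forall q B (e : 'I_B -> E), (k0 <= q)%N -> rel_basis (Rk v q) [set 0] e -> (q ^ n <= C1 * B)%N) ->
  (forall e, ~ multiples v V e (v j0 ^+ e.+1)) ->
  exists k1 c, [/\ (0 < k1)%N, 0 < c & forall t mu, (k0 <= t)%N ->
    c * t%:R ^+ n.+2 <= \sum_(x <- spectrum v lam (k1 * t)) (x - mu) ^+ 2].
Proof.
move=> hilb nonnil; have [d nd hcount] := chart_count hom nonnil hilb.
have [del d0 hdel] := gap.
have [D D0 hD] : exists2 D, 0 <= D & forall j, lam j <= lam j1 + D.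
  exists (\sum_j (lam j - lam j1)) => [|j].
    by apply: sumr_ge0 => j _; rewrite subr_ge0.
  rewrite -lerBlDl (bigD1 j)//= lerDl; apply: sumr_ge0 => i _; by rewrite subr_ge0.
(* The term [d] makes room for the box of [chart_count]; the other bounds the spread [t%:R * D] of
   the low group by half of [del * q%:R]. *)
pose Q0 := (d + Num.bound (2 * D / del)).+1.
have DQ : 2 * D <= del * Q0%:R.
  have : 2 * D / del < (Num.bound (2 * D / del))%:R.
    by apply: archi_boundP; rewrite divr_ge0 ?mulr_ge0// ltW.
  rewrite ltr_pdivrMr// [X in _ < X]mulrC => lt; apply: (le_trans (ltW lt)).
  by rewrite ler_pM2l// ler_nat /Q0; lia.
exists (2 * Q0)%N, ((del * Q0%:R / 4) ^+ 2 / C1.+1%:R); split=> // [|t mu kt].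
  by rewrite divr_gt0// exprn_gt0// divr_gt0// mulr_gt0.
set q := (Q0 * t)%N; have -> : (2 * Q0 * t = 2 * q)%N by rewrite mulnA.
set k := (2 * q)%N; set s := spectrum _ _ _; set b := (del * q%:R / 4) ^+ 2.
have qE : q%:R = Q0%:R * t%:R :> R by rewrite natrM.
have tQ : t%:R * D <= del * q%:R / 2.
  have := ler_wpM2l (ler0n R t) DQ; rewrite qE; move: (t%:R : R) (Q0%:R : R) => tt QQ h; nra.
have key (p : pred R) : (t ^ n <= C1.+1 * count p s)%N -> (forall x, p x -> b <= (x - mu) ^+ 2) ->
    (del * Q0%:R / 4) ^+ 2 / C1.+1%:R * t%:R ^+ n.+2 <= \sum_(x <- s) (x - mu) ^+ 2.
  move=> hp hb; apply: le_trans (count_sum_le hb (fun x _ => sqr_ge0 _)).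
  have -> : (del * Q0%:R / 4) ^+ 2 / C1.+1%:R * t%:R ^+ n.+2 = t%:R ^+ n / C1.+1%:R * b.
    have tE : t%:R ^+ n.+2 = t%:R ^+ n * t%:R ^+ 2 :> R by rewrite -exprD addn2.
    rewrite /b qE tE; have : C1.+1%:R != 0 :> R by rewrite pnatr_eq0.
    move: (t%:R ^+ n : R) (t%:R : R) (Q0%:R : R) (C1.+1%:R : R) => x y z w w0; by field.
  rewrite ler_wpM2r ?sqr_ge0// ler_pdivrMr// -natrM -natrX ler_nat mulnC//.
have hb x : del * q%:R / 4 <= `|x - mu| -> b <= (x - mu) ^+ 2.
  move=> h; rewrite /b -[leRHS]real_normK ?num_real// ler_sqr ?nnegrE//.
  by rewrite divr_ge0// mulr_ge0// ltW.
(* The low group ends half way up to the start of the high one. A cut at three quarters leaves a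
   distance of at least a quarter of [del * q%:R] on either side. *)
have [mle|mlt] := lerP mu (k%:R * lam j1 + del * q%:R * 3 / 4).
  apply: (key (fun x => (k%:R * lam j1 + q%:R * del <= x)%R)) => [|x hx]; last first.
    by apply: hb; apply: le_trans (ler_norm _); lra.
  apply: (@leq_trans (count (fun b => `[< stdw v (lam01 V) b >] && (q <= nv V b)%N) (mons k))).
    apply: (@leq_trans (t.+1 ^ d)%N); last by apply: hcount; rewrite /q leq_mul2r /Q0; apply/orP; right; lia.
    apply: (@leq_trans (t.+1 ^ n)%N); last by rewrite leq_pexp2l.
    by case: (n) => // n'; rewrite leq_exp2r.
  by apply: leq_trans (count_high _ hdel d0) _; rewrite -/k -/s leq_pmull.
have [e be] := std_Rk_basis v lam t; have hB := hilb t _ e kt be.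
have tk : (t <= k)%N by rewrite /k /q mulnA leq_pmull// muln_gt0.
apply: (key (fun x => (x <= k%:R * lam j1 + t%:R * D)%R)) => [|x hx]; last first.
  by apply: hb; rewrite distrC; apply: le_trans (ler_norm _); lra.
apply: leq_trans hB _; apply: leq_mul => //.
exact: count_low tk hD be.
Qed.

End Variance.

Lemma H0_mul (K : closedFieldType) N (X : set 'rV[K]_N.+1) d d' s s' :
  H0 (X := X) d s -> H0 (X := X) d' s' -> H0 (X := X) (d + d')%N (s * s').
Proof.
move=> hs hs' p; have [e [a [b [ha hb bp hab]]]] := hs p.
have [e' [a' [b' [ha' hb' bp' hab']]]] := hs' p.
have evM (f g : {mpoly K[N.+1]}) (x : 'rV[K]_N.+1) : Form.ev (f * g : {mpoly K[N.+1]}) x = Form.ev f x * Form.ev g x.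
  exact: mevalM.
exists (e + e')%N, ((a : {mpoly K[N.+1]}) * a'), ((b : {mpoly K[N.+1]}) * b'); split.
- by rewrite addnACA; apply: dhomogM.
- exact: dhomogM.
- by rewrite evM mulf_neq0.
move=> q; rewrite !evM mulf_eq0 negb_or => /andP[bq bq'].
by rewrite -mulf_div -hab// -hab'.
Qed.

(** * The nilpotent case: integrality and almost triviality *)

Section Nilpotent.
Context (K : closedFieldType) (N : nat) (X : set 'rV[K]_N.+1) {m : nat} (r : nat).
Local Notation E := (X -> K^o).
Variables (F : int -> set E) (v : 'I_m -> E) (w : 'I_m -> int) (j1 : 'I_m).
Hypothesis FE : forall i, F i = lspan [set s | exists2 j, w j <= i & s = v j].
Hypothesis w_min : forall j, w j1 <= w j.
Hypothesis v_free : forall x, exists j, v j x != 0.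
Hypothesis H0E : forall k, (0 < k)%N -> H0 (r * k) = Rk v k.
Let V : pred 'I_m := fun j => w j == w j1.
Hypothesis nil : forall j, exists e, multiples v V e (v j ^+ e.+1).
Let c := w j1.

Let m_gt0 : (0 < m)%N. Proof. by case: m j1 => // -[]. Qed.

Lemma multiples_mul e l s s' : multiples v V e s -> Rk v l s' -> multiples v V (e + l) (s * s').
Proof.
apply: lspan_mul => _ _ [j [b [Vj be ->]]] [b' bl ->]; apply: sub_lspan.
by exists j, (b + b')%MM; rewrite mdegD be bl monD mulrA.
Qed.

(** By pigeonhole, a monomial of large degree contains some [v j ^+ (ee j).+1], which lies in the
    ideal generated by [V]. *)
Lemma eventually_multiples : exists2 e0, (0 < e0)%N & forall e s, (e0 <= e)%N ->
  Rk v e.+1 s -> multiples v V e s.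
Proof.
have /choice[ee he] := nil; exists (\sum_j ee j).+1 => // e s le.
apply: lspan_sub; first exact: subspace_lspan.
move=> _ [a ae ->]; have [j aj] : exists j, (ee j < a j)%N.
  apply/existsP; apply: contraTT le; rewrite negb_exists => /forallP h; rewrite -ltnNge ltnS.
  by apply: ltnW; rewrite -ae mdegE; apply: leq_sum => j _; rewrite leqNgt.
pose a' := (a - U_(j) *+ (ee j).+1)%MM.
have aE : (a = U_(j) *+ (ee j).+1 + a')%MM.
  rewrite /a' addmC submK//; apply/mnm_lepP => i; rewrite mulmnE mnm1E; case: eqP => [<-|_]; by rewrite ?mul1n.
have vE : mon v (U_(j) *+ (ee j).+1)%MM = v j ^+ (ee j).+1.
  by apply/funext => x; rewrite monE fct_expE (bigD1 j)//= mulmnE mnm1E eqxx mul1n big1 ?mulr1// => i /negbTE ji; rewrite mulmnE mnm1E eq_sym ji.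
have := multiples_mul (he j) (Rk_mon v a'); rewrite -vE -monD -aE.
suff -> : (ee j + mdeg a' = e)%N by [].
by have := ae; rewrite aE mdegD mdegMn mdeg1 mul1n addSn => -[].
Qed.

Let low k : set E := Sk v w k (c *+ k).

Lemma Rk_decomp e0 k : (forall e s, (e0 <= e)%N -> Rk v e.+1 s -> multiples v V e s) ->
  Rk v (k + e0) `<=` lspan [set s | exists f g, [/\ low k f, Rk v e0 g & s = f * g]].
Proof.
move=> he0; elim: k => [|k IH] s.
  move=> Rs; apply: sub_lspan; exists 1, s; rewrite mul1r; split => //.
  by have := @Sk_mon _ _ _ _ v w 0%MM 0; rewrite mon0 mdeg0 wdeg0; apply.
rewrite addSn => /he0; move=> /(_ (leq_addl _ _)).
apply: lspan_sub; first exact: subspace_lspan.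
move=> _ [j [b [Vj bk ->]]]; rewrite mulrC.
have := IH (mon v b); rewrite -bk => /(_ (Rk_mon v b)).
apply: lspan_mulr => _ [f [g [hf hg ->]]]; apply: sub_lspan.
exists (f * v j), g; split => //; last by rewrite mulrAC.
rewrite /low mulrS addrC -[k.+1]addn1; apply: Sk_mul => //.
have := @Sk_mon _ _ _ _ v w U_(j)%MM c; rewrite monU mdeg1 wdegU; apply.
by rewrite (eqP Vj).
Qed.

(** The property [H n q] means that [q] is homogeneous of degree [n * k], with the variable of
    degree [k] and coefficients in [low]; it passes through the Leibniz formula. *)
Lemma char_poly_low p k (P : 'M[{mpoly K[m]}]_p) : (forall i j, low k (evf v (P i j))) ->
  forall j, (j <= p)%N -> low ((p - j) * k) (evf v (char_poly P)`_j).
Proof.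
move=> hP; pose H n (q : {poly {mpoly K[m]}}) := forall j,
  ((j <= n)%N -> low ((n - j) * k) (evf v q`_j)) /\ ((n < j)%N -> q`_j = 0).
have evf0 : evf v 0 = 0 by apply/funext => x; exact: meval0.
have low0 l : low l 0 by exact: subspace0 (subspace_Sk _ _ _ _).
have evf1 : evf v 1 = 1 by apply/funext => x; exact: meval1.
have low1 : low 0 1 by have := @Sk_mon _ _ _ _ v w 0%MM 0; rewrite mon0 mdeg0 wdeg0 /low mulr0n; apply.
have HD n q q' : H n q -> H n q' -> H n (q + q').
  move=> h h' j; have [h1 h2] := h j; have [h1' h2'] := h' j; rewrite coefD; split=> nj.
    by rewrite evfD; apply: subspaceD; [exact: subspace_Sk|exact: h1|exact: h1'].
  by rewrite h2// h2'// addr0.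
have HN n q : H n q -> H n (- q).
  move=> h j; have [h1 h2] := h j; rewrite coefN; split=> nj; last by rewrite h2// oppr0.
  rewrite -scaleN1r evfZ; apply: subspaceZ; [exact: subspace_Sk|exact: h1].
have H0' n : H n 0 by move=> j; rewrite coef0; split=> // _; rewrite evf0.
have HM n n' q q' : H n q -> H n' q' -> H (n + n')%N (q * q').
  move=> h h' j; rewrite coefM; split=> nj.
    rewrite evf_sum; apply: subspace_sum => [|i _]; first exact: subspace_Sk.
    have ij : (i <= j)%N by rewrite -ltnS.
    have [h1 h2] := h i; have [h1' h2'] := h' (j - i)%N.
    have [ni|ni] := ltnP n i; first by rewrite h2// mul0r evf0.
    have [ni'|ni'] := ltnP n' (j - i)%N; first by rewrite h2'// mulr0 evf0.
    rewrite evfM; have := Sk_mul (h1 ni) (h1' ni'); rewrite -mulrnDr -mulnDl.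
    by rewrite (_ : (n - i + (n' - (j - i)))%N = (n + n' - j)%N)//; lia.
  rewrite big1// => i _; have [h1 h2] := h i; have [h1' h2'] := h' (j - i)%N.
  have [ni|ni] := ltnP n i; first by rewrite h2// mul0r.
  by rewrite h2' ?mulr0//; have := ltn_ord i; lia.
suff : H p (char_poly P) by move=> h j; have [] := h j.
rewrite /char_poly /determinant; apply: big_ind => [|q q' hq hq'|s _]; [exact: H0'|exact: HD|].
have Hprod (g : 'I_p -> 'I_p) : H p (\prod_i char_poly_mx P i (g i)).
  have [n [pn hn]] : exists n, p = n /\ H n (\prod_i char_poly_mx P i (g i)).
    exists (\sum_(i < p) 1)%N; split; first by rewrite sum1_card card_ord.
    apply: (big_ind2 (fun q n => H n q)) => [|q n q' n' hq hq'|i _].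
    - move=> j; rewrite coef1; case: j => [|j]; split=> //= _; by rewrite evf1 ?mulr0n.
    - exact: HM.
    rewrite !mxE; apply: HD.
      case: (_ == _); last exact: H0'.
      move=> j; rewrite mulr1n coefX; case: j => [|[|j]]; split=> //= _; rewrite ?evf0 ?evf1//.
    apply: HN => j; rewrite coefC; case: j => [|j]; split=> //= _; last by rewrite evf0.
    by rewrite mul1n.
  by rewrite -pn in hn.
rewrite -signr_odd; case: odd; rewrite ?expr0 ?mul1r ?expr1 ?mulN1r; [apply: HN|]; exact: Hprod.
Qed.

(** As [R_(k + e0)] is [low k] times [R_e0], multiplication by [s] on the monomials of degree [e0]
    has a matrix with entries in [low k], and [s] is a root of its characteristic polynomial. *)
Lemma sections_integral k s : H0 (r * k) s -> exists p (a : 'I_p -> E),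
  (forall j : 'I_p, low ((p - j) * k) (a j)) /\ s ^+ p + \sum_(j < p) a j * s ^+ j = 0.
Proof.
move=> hs; have [e0 e00 he0] := eventually_multiples.
pose p := size (@mons m e0); pose u (i : 'I_p) := mon v (nth 0%MM (mons e0) i).
have u_mem (i : 'I_p) : mdeg (nth 0%MM (@mons m e0) i) = e0.
  by apply/eqP; rewrite -mem_mons; exact: mem_nth.
pose comb : set E := [set f | exists M : 'I_p -> {mpoly K[m]}, (forall i, low k (evf v (M i))) /\
  f = \sum_i evf v (M i) * u i].
have comb_sub : is_subspace comb.
  split.
    exists (fun=> 0); have evf0 : evf v 0 = 0 by apply/funext => x; exact: meval0.
    split=> [i|]; first by rewrite evf0; exact: subspace0 (subspace_Sk _ _ _ _).
    by rewrite big1// => i _; rewrite evf0 mul0r.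
  move=> a f f' [M [hM ->]] [M' [hM' ->]]; exists (fun i => a *: M i + M' i); split=> [i|].
    rewrite evfD evfZ; apply: subspaceD; [exact: subspace_Sk| |exact: hM'].
    by apply: subspaceZ; [exact: subspace_Sk|exact: hM].
  rewrite scaler_sumr -big_split; apply: eq_bigr => i _ /=.
  by rewrite evfD evfZ mulrDl fct_scalerAl.
have Rcomb : Rk v (k + e0) `<=` comb.
  move=> f /(Rk_decomp he0); apply: lspan_sub => // _ [f1 [g [hf1 hg ->]]].
  have [P hP fE] : exists2 P : {mpoly K[m]}, P \is k.-homog & f1 = evf v P.
    exact/Rk_evf/(Sk_Rk hf1).
  move: hg; rewrite mulrC => hg.
  suff : lspan comb (g * f1) by apply: lspan_sub.
  apply: lspan_mulr hg => _ [b be ->]; apply: sub_lspan.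
  have bm : b \in mons e0 by rewrite mem_mons be eqxx.
  have ib : (index b (mons e0) < p)%N by rewrite index_mem.
  exists (fun i => if i == Ordinal ib then P else 0); split=> [i|].
    case: eqP => _; first by rewrite -fE.
    rewrite (_ : evf v 0 = 0); first exact: subspace0 (subspace_Sk _ _ _ _).
    by apply/funext => x; exact: meval0.
  rewrite (bigD1 (Ordinal ib))//= eqxx -fE /u nth_index// big1 ?addr0 1?mulrC// => i /negbTE ->.
  by rewrite (_ : evf v 0 = 0) ?mul0r//; apply/funext => x; exact: meval0.
have /choice[M hM] : forall i, exists M : 'I_p -> {mpoly K[m]}, (forall j, low k (evf v (M j))) /\
    s * u i = \sum_j evf v (M j) * u j.
  move=> i; apply: Rcomb; rewrite -H0E ?addn_gt0 ?e00 ?orbT// mulnDr; apply: H0_mul => //.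
  by rewrite H0E// -(u_mem i); exact: Rk_mon.
pose P : 'M[{mpoly K[m]}]_p := \matrix_(i, j) M i j.
have lowP i j : low k (evf v (P i j)) by rewrite mxE; exact: (hM i).1.
exists p, (fun j => evf v (char_poly P)`_j); split=> [j|].
  by apply: char_poly_low => //; exact: ltnW.
apply/funext => x; pose ev := meval (fun j => v j x : K).
(* The equation is checked at each point: some [v j ^+ e0] is nonzero at [x], which forces the
   determinant to vanish there. *)
have [i ui] : exists i, u i x != 0.
  have [j vj] := v_free x; have jm : (U_(j) *+ e0)%MM \in mons e0 by rewrite mem_mons mdegMn mdeg1 mul1n.
  have ij : (index (U_(j) *+ e0)%MM (mons e0) < p)%N by rewrite index_mem.
  exists (Ordinal ij); rewrite /u /= nth_index// monE.
  apply/prodf_neq0 => i _; rewrite mulmnE mnm1E; have [<-|_] := eqVneq j i; last by rewrite mul0n expr0 oner_neq0.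
  by rewrite expf_neq0.
have det0 : \det ((s x : K)%:M - map_mx ev P) = 0.
  set A := _ - _; have AU : A *m (\col_j (u j x : K)) = 0.
    apply/colP => l; rewrite mulmxBl mul_scalar_mx !mxE.
    have -> : (s x : K) * u l x = \sum_j (ev (M l j) : K) * u j x.
      have := congr1 (fun f => f x) (hM l).2; rewrite fct_sumE; exact.
    by rewrite -sumrB big1// => j _; rewrite !mxE subrr.
  have : \det A *: (\col_j (u j x : K)) = 0 by rewrite -mul_scalar_mx -mul_adj_mx -mulmxA AU mulmx0.
  by move=> /colP/(_ i); rewrite !mxE => /eqP; rewrite mulf_eq0 (negbTE ui) orbF => /eqP.
move: det0; rewrite -horner_char_poly -map_char_poly horner_coef.
have mon1 : map_poly ev (char_poly P) \is monic by apply: monic_map; exact: char_poly_monic.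
have sz : size (map_poly ev (char_poly P)) = p.+1 by rewrite map_char_poly size_char_poly.
have top : (map_poly ev (char_poly P))`_p = 1 by have := monicP mon1; rewrite lead_coefE sz.
rewrite sz big_ord_recr /= top mul1r => det0.
have -> : (s ^+ p + \sum_(j < p) evf v (char_poly P)`_j * s ^+ j) x =
    (s x : K) ^+ p + \sum_(j < p) (evf v (char_poly P)`_j x : K) * (s x : K) ^+ j.
  rewrite -fct_expE; congr (_ + _); rewrite fct_sumE; apply: eq_bigr => j _.
  by rewrite -fct_expE.
rewrite addrC -[RHS]det0; congr (_ + _); apply: eq_bigr => j _.
by rewrite coef_map.
Qed.

Lemma low_neg k i n : i < 0 -> (0 < n)%N -> Sk v w (n * k) ((i + c *+ k) *+ n) = [set 0].
Proof.
move=> i0 n0; apply/seteqP; split; last by move=> _ ->; exact: subspace0 (subspace_Sk _ _ _ _).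
apply: lspan_sub; first exact: subspace_set0.
move=> t [b [bk bw _]]; exfalso.
have : c *+ (n * k) <= wdeg w b.
  rewrite -bk mdegE -sumrMnr; apply: ler_sum => j _; exact: ler_wMn2r.
move=> /le_trans/(_ bw); rewrite mulrnDl -[c *+ k *+ n]mulrnA [(k * n)%N]mulnC lerDr.
by rewrite leNgt pmulrn_llt0// i0.
Qed.

(** The twist is the least weight [c] and [theta] is the identity. For [i >= 0] every section is
    integral; for [i < 0] the coefficients of an integral equation have weight below the minimum, so
    they vanish and the section is nilpotent, hence zero. *)
Theorem nilpotent_almost_trivial : almost_trivial r F.
Proof.
exists c, (fun _ s => s); split=> // k i.
have chi_low l y : chi F l y = Sk v w l y by rewrite (chiE m_gt0 FE).
suff -> : chi_normalization r F k (i + c *+ k) = trivial_piece r k i.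
  by split; [|move=> s t _ _|move=> s hs; exists s].
have H00 d : H0 (X := X) d 0.
  move=> p; exists 0%N, (0 : {mpoly K[N.+1]}), (1 : {mpoly K[N.+1]}); split=> [||| q _].
  - exact: dhomog0.
  - exact: dhomog1.
  - by rewrite /Form.ev meval1 oner_neq0.
  - by rewrite /Form.ev meval0 mul0r.
rewrite /trivial_piece; case: ifPn => i0; apply/seteqP; split=> s.
- by move=> [].
- move=> hs; split=> //; have [p [a [ha hp]]] := sections_integral hs.
  exists p, a; split => // j; rewrite chi_low; apply: Sk_le (ha j).
  by rewrite mulrnDl -[c *+ k *+ _]mulrnA [(k * _)%N]mulnC lerDr mulrn_wge0.
- move=> [_ [p [a [ha hp]]]]; have a0 j : a j = 0.
    have := ha j; rewrite chi_low low_neg ?subn_gt0// ltNge//.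
  move: hp; rewrite big1 ?addr0 => [sp|j _]; last by rewrite a0 mul0r.
  apply/funext => x; have := congr1 (fun f => f x) sp; rewrite /= fct_expE => /eqP.
  by rewrite expf_eq0 => /andP[_ /eqP].
move=> ->; split; first exact: H00.
exists 1%N, (fun=> 0); split=> [j|]; last by rewrite expr1 big_ord1 mul0r addr0.
exact: chi_zero.
Qed.

End Nilpotent.

Lemma positive_gap (R : realDomainType) (s : seq R) :
  exists2 e, 0 < e & forall x, x \in s -> 0 < x -> e <= x.
Proof.
elim: s => [|y s [e e0 h]]; first by exists 1.
have [y0|y0] := ltrP 0 y.
  exists (Num.min e y); first by rewrite lt_min e0.
  by move=> x; rewrite inE => /predU1P[->|/h hx /hx ex]; rewrite ge_min ?lexx ?orbT// ex.
exists e => // x; rewrite inE => /predU1P[->|/h//]; by rewrite ltNge y0.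
Qed.

(** * Moments of downsets and perturbation of weights *)

Section Moments.
Context (R : realFieldType) {m : nat}.
Implicit Types (D : set 'X_{1..m}) (lam : 'I_m -> R).

Definition dspec lam D k : seq R := [seq wdeg lam a | a <- mons k & `[< D a >]].
Definition mom0 D k : R := dsum D (fun=> 1) k.
Definition mom1 D j k : R := dsum D (fun a => (a j)%:R) k.
Definition mom2 D i j k : R := dsum D (fun a => (a i)%:R * (a j)%:R) k.

Lemma evpoly_mom0 D : downset D -> evpoly (mom0 D).
Proof. by move=> dD; exact: evpoly_dsum (polynomial_lt_const _). Qed.

Lemma evpoly_mom1 D j : downset D -> evpoly (mom1 D j).
Proof. by move=> dD; exact: evpoly_dsum (polynomial_lt_coord _ _). Qed.

Lemma evpoly_mom2 D i j : downset D -> evpoly (mom2 D i j).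
Proof. by move=> dD; exact: evpoly_dsum (polynomial_lt_coord2 _ _ _). Qed.

Lemma size_dspec lam D k : (size (dspec lam D k))%:R = mom0 D k.
Proof. by rewrite size_map -sum1_size natr_sum big_filter. Qed.

Lemma wdegE lam a : wdeg lam a = \sum_j lam j * (a j)%:R.
Proof. by apply: eq_bigr => j _; rewrite mulr_natr. Qed.

Lemma sum_dspec lam D k : \sum_(x <- dspec lam D k) x = \sum_j lam j * mom1 D j k.
Proof.
rewrite big_map big_filter; under eq_bigr do rewrite wdegE.
by rewrite exchange_big; apply: eq_bigr => j _ /=; rewrite /mom1 /dsum mulr_sumr.
Qed.

Lemma sum2_dspec lam D k :
  \sum_(x <- dspec lam D k) x ^+ 2 = \sum_i \sum_j lam i * lam j * mom2 D i j k.
Proof.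
rewrite big_map big_filter.
under eq_bigr => a _ do rewrite wdegE expr2 mulr_suml; rewrite exchange_big; apply: eq_bigr => i _ /=.
under eq_bigr => a _ do rewrite mulr_sumr; rewrite exchange_big; apply: eq_bigr => j _ /=.
by rewrite /mom2 /dsum mulr_sumr; apply: eq_bigr => a _; rewrite mulrACA.
Qed.

Lemma coord_le_mdeg (a : 'X_{1..m}) j : (a j <= mdeg a)%N.
Proof. by rewrite mdegE (bigD1 j)//= leq_addr. Qed.

Lemma mom1_le D j k : 0 <= mom1 D j k <= k%:R * mom0 D k.
Proof.
apply/andP; split; first by apply: sumr_ge0 => a _; exact: ler0n.
rewrite /mom1 /mom0 /dsum mulr_sumr big_seq_cond [leRHS]big_seq_cond; apply: ler_sum => a.
rewrite mem_mons => /andP[/eqP ak _]; by rewrite mulr1 ler_nat -ak coord_le_mdeg.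
Qed.

Lemma mom2_le D i j k : 0 <= mom2 D i j k <= k%:R ^+ 2 * mom0 D k.
Proof.
apply/andP; split; first by apply: sumr_ge0 => a _; exact: mulr_ge0.
rewrite /mom2 /mom0 /dsum mulr_sumr big_seq_cond [leRHS]big_seq_cond; apply: ler_sum => a; rewrite mem_mons => /andP[/eqP ak _].
by rewrite mulr1 expr2 ler_pM// ler_nat -ak coord_le_mdeg.
Qed.

Lemma wdeg_near lam0 k : exists2 e, 0 < e & forall lam, (forall j, `|lam j - lam0 j| < e) ->
  forall a b, mdeg a = k -> mdeg b = k -> wdeg lam0 a < wdeg lam0 b -> wdeg lam a < wdeg lam b.
Proof.
have [g g0 hg] := positive_gap [seq wdeg lam0 b - wdeg lam0 a | a <- mons k, b <- mons k].
(* Positive weight differences in degree [k] are at least [g]; this tolerance on [lam] moves each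
   weight by less than [g / 2]. *)
exists (g / (2 * k.+1%:R)); first by rewrite divr_gt0// mulr_gt0.
move=> lam hlam a b ak bk ab.
have d (c : 'X_{1..m}) : mdeg c = k -> `|wdeg lam c - wdeg lam0 c| < g / 2.
  move=> ck; rewrite !wdegE -sumrB; apply: le_lt_trans (ler_norm_sum _ _ _) _.
  apply: (@le_lt_trans _ _ (\sum_j (g / (2 * k.+1%:R)) * (c j)%:R)).
    apply: ler_sum => j _; rewrite -mulrBl normrM [X in _ * X]ger0_norm//.
    by rewrite ler_wpM2r// ltW.
  rewrite -mulr_sumr -natr_sum -mdegE ck invfM mulrA -mulrA gtr_pMr ?divr_gt0//.
  by rewrite mulrC ltr_pdivrMr// mul1r ltr_nat.
have : g <= wdeg lam0 b - wdeg lam0 a.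
  apply: hg; rewrite ?subr_gt0//; apply/allpairsP; exists (a, b).
  by rewrite !mem_mons ak bk !eqxx.
have := d a ak; have := d b bk; rewrite !ltr_norml => /andP[h1 h2] /andP[h3 h4] h5; lra.
Qed.

End Moments.

Lemma mnm_sub_deg m r (a : 'X_{1..m}) : (r <= mdeg a)%N ->
  exists2 b, mdeg b = r & (b <= a)%MM.
Proof.
elim: r => [|r IH] ra; first by exists 0%MM; [exact: mdeg0|apply/mnm_lepP => i; rewrite mnm0E].
have [b br /mnm_lepP ba] := IH (ltnW ra).
have [i bi] : exists i, (b i < a i)%N.
  apply/existsP; apply: contraTT ra; rewrite negb_exists => /forallP h; rewrite -ltnNge ltnS -br !mdegE.
  by apply: leq_sum => i _; rewrite leqNgt.
exists (b + U_(i))%MM; first by rewrite mdegD mdeg1 br addn1.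
apply/mnm_lepP => j; rewrite mnmDE mnm1E; case: eqP => [<-|_]; rewrite ?addn1 ?addn0//; exact: ba.
Qed.

Section Affine.
Context (K : fieldType) (T : Type) {m : nat} (v : 'I_m -> (T -> K^o)).

Lemma stdw_eq (R R' : realDomainType) (lam : 'I_m -> R) (lam' : 'I_m -> R') :
  (forall a b, mdeg a = mdeg b -> ltw lam a b = ltw lam' a b) -> stdw v lam = stdw v lam'.
Proof.
move=> h; apply/funext => a; rewrite /stdw /std; congr (~ (_ _)).
rewrite /lower !sumset0; congr lspan; apply/seteqP; split=> _ [b [/eqP ab ba ->]]; exists b; split => //.
- by apply/eqP.
- by rewrite -h.
- by apply/eqP.
- by rewrite h.
Qed.

Lemma wdeg_affine (R : realDomainType) (lam : 'I_m -> R) (w : 'I_m -> int) (al be : R) a :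
  (forall j, lam j = al * (w j)%:~R + be) -> wdeg lam a = al * (wdeg w a)%:~R + be * (mdeg a)%:R.
Proof.
move=> h; rewrite /wdeg mdegE natr_sum rmorph_sum !mulr_sumr -big_split.
apply: eq_bigr => j _ /=; rewrite h mulrnDl; congr (_ + _); last by rewrite mulr_natr.
by rewrite rmorphMn /= mulrnAr.
Qed.

Lemma spectrum_affine (R : realDomainType) (lam : 'I_m -> R) (w : 'I_m -> int) (al be : R) k :
  0 < al -> (forall j, lam j = al * (w j)%:~R + be) ->
  spectrum v lam k = [seq al * x%:~R + be * k%:R | x <- spectrum v w k].
Proof.
move=> al0 h; rewrite /spectrum -map_comp.
have -> : stdw v lam = stdw v w.
  apply: stdw_eq => a b ab; rewrite /ltw !(wdeg_affine _ h) ab ltrD2r ltr_pM2l// ltr_int.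
  by rewrite (inj_eq (addIr _)) (inj_eq (mulfI (lt0r_neq0 al0))) eqr_int.
apply/eq_in_map => a; rewrite mem_filter mem_mons => /andP[_ /eqP <-] /=.
exact: wdeg_affine.
Qed.

Lemma Sk_prodn (R : realDomainType) (lam : 'I_m -> R) l k (u : 'I_k -> (T -> K^o)) (y : 'I_k -> R) :
  (forall i, Sk v lam l (y i) (u i)) -> Sk v lam (l * k) (\sum_i y i) (\prod_i u i).
Proof.
elim: k u y => [|k IH] u y h; rewrite ?big_ord0 ?big_ord_recl.
  by have := @Sk_mon _ _ _ _ v lam 0%MM 0; rewrite mon0 mdeg0 wdeg0 muln0; apply.
by have := Sk_mul (h ord0) (IH _ _ (fun i => h (lift ord0 i))); rewrite mulnS.
Qed.

Lemma Sk_prod (R : realDomainType) (lam : 'I_m -> R) k (u : 'I_k -> (T -> K^o)) (y : 'I_k -> R) :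
  (forall i, Sk v lam 1 (y i) (u i)) -> Sk v lam k (\sum_i y i) (\prod_i u i).
Proof. by move=> /Sk_prodn; rewrite mul1n. Qed.

Lemma mon_split (R : realDomainType) (lam : 'I_m -> R) l k b : mdeg b = (l * k)%N ->
  exists bs : 'I_k -> 'X_{1..m}, [/\ forall i, mdeg (bs i) = l,
    mon v b = \prod_i mon v (bs i) & wdeg lam b = \sum_i wdeg lam (bs i)].
Proof.
elim: k b => [|k IH] b bk.
  have b0 : b = 0%MM by apply/eqP; rewrite -mdeg_eq0 bk muln0.
  by exists (fun=> 0%MM); split=> [[]||]//; rewrite b0 ?mon0 ?wdeg0 !big_ord0.
have [c cl cb] := @mnm_sub_deg _ l b (eq_ind_r (fun x => (l <= x)%N) (leq_pmulr l (ltn0Sn k)) bk).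
have bE : b = (c + (b - c))%MM by rewrite addmC submK.
have [|bs [h1 h2 h3]] := IH (b - c)%MM.
  by move: (congr1 mdeg bE); rewrite mdegD bk cl mulnS => /addnI.
have -> : mon v b = mon v c * mon v (b - c)%MM by rewrite {1}bE monD.
have -> : wdeg lam b = wdeg lam c + wdeg lam (b - c)%MM by rewrite {1}bE wdegD.
exists (fun i => if unlift ord0 i is Some i' then bs i' else c).
split=> [i||]; first by case: unliftP => [j _|_]; [exact: h1|exact: cl].
  rewrite big_ord_recl unlift_none h2; congr (_ * _).
  by apply: eq_bigr => i _; rewrite liftK.
rewrite big_ord_recl unlift_none h3; congr (_ + _).
by apply: eq_bigr => i _; rewrite liftK.
Qed.

Lemma mon_prod (R : realDomainType) (lam : 'I_m -> R) k b : mdeg b = k ->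
  exists j : 'I_k -> 'I_m, mon v b = \prod_i v (j i) /\ wdeg lam b = \sum_i lam (j i).
Proof.
move=> bk; have [|bs [h1 h2 h3]] := @mon_split _ lam 1 k b; first by rewrite mul1n.
have /choice[j hj] : forall i, exists j, bs i = U_(j)%MM.
  by move=> i; have /eqP/mdeg1P[j /eqP bj] := h1 i; exists j.
exists j; rewrite h2 h3; split; apply: eq_bigr => i _; by rewrite hj ?monU ?wdegU.
Qed.

Lemma Sk1 (R : realDomainType) (lam : 'I_m -> R) y :
  lspan [set s | exists2 j, lam j <= y & s = v j] `<=` Sk v lam 1 y.
Proof.
apply: lspan_mono => _ [j ly ->]; exists U_(j)%MM; by rewrite mdeg1 wdegU monU.
Qed.

(** In each degree, weights close enough to [lam0] keep its strict inequalities; so every downset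
    attained arbitrarily near [lam0] computes its spectrum. *)
Lemma spectrum_perm (R : realFieldType) (lam0 : 'I_m -> R) (D : set 'X_{1..m}) :
  (forall e, 0 < e -> exists lam, (forall j, `|lam j - lam0 j| < e) /\ stdw v lam = D) ->
  forall k, perm_eq (dspec lam0 D k) (spectrum v lam0 k).
Proof.
move=> h k; have [e e0 he] := wdeg_near lam0 k; have [lam [hl <-]] := h e e0.
by apply: spec_near_perm; exact: he.
Qed.

End Affine.

(** * Sections of powers of [L] as forms *)

Section Sections.
Context (K : closedFieldType) (N : nat) (X : set 'rV[K]_N.+1).
Hypothesis Xnorm : projectively_normal X.
Local Notation E := (X -> K^o).

Lemma H0E d : (0 < d)%N ->
  H0 (X := X) d = [set s | exists2 p : {mpoly K[N.+1]}, p \is d.-homog & s = (fun q : X => p.@[val q ord0])].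
Proof.
move=> d0; apply/seteqP; split=> s; first exact: Xnorm.
move=> [p hp ->] x; exists 0%N, p, (1 : {mpoly K[N.+1]}); split=> [//||| q _].
- exact: dhomog1.
- by rewrite /Form.ev meval1 oner_neq0.
- by rewrite /Form.ev meval1 divr1.
Qed.

Lemma subspace_H0 d : (0 < d)%N -> is_subspace (H0 (X := X) d).
Proof.
move=> d0; rewrite H0E//; split.
  by exists 0; [exact: dhomog0|apply/funext => x; rewrite meval0].
move=> c _ _ [p hp ->] [q hq ->]; exists (c *: p + q).
  by apply: rpredD => //; exact: rpredZ.
by apply/funext => x; rewrite mevalD mevalZ.
Qed.

Definition coordinate (i : 'I_N.+1) : E := fun x => val x ord0 i.

Lemma coord_H0 d : (0 < d)%N -> Rk coordinate d = H0 d.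
Proof.
move=> d0; rewrite H0E//; apply/seteqP; split=> s.
  by move=> /Rk_evf[p hp ->]; exists p.
by move=> [p hp ->]; exact: evf_Rk.
Qed.

Lemma H0_basis d : (0 < d)%N -> exists B (e : 'I_B -> E), rel_basis (H0 d) [set 0] e.
Proof.
move=> d0; have [e be] := std_Rk_basis coordinate (fun=> 0 : int) d.
by exists (size (spectrum coordinate (fun=> 0 : int) d)), e; rewrite -coord_H0.
Qed.

Section Basis.
Context (r m : nat) (v : 'I_m -> E).
Hypotheses (r_gt0 : (0 < r)%N) (bv : rel_basis (H0 r) [set 0] v).

Lemma basis_forms : exists qf : 'I_m -> {mpoly K[N.+1]}, (forall j, qf j \is r.-homog) /\
  forall j, v j = fun x : X => (qf j).@[val x ord0].
Proof.
have /choice[qf h] : forall j, exists q : {mpoly K[N.+1]}, q \is r.-homog /\ v j = fun x : X => q.@[val x ord0].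
  by move=> j; have := bv.1 j; rewrite H0E// => -[q hq vq]; exists q.
by exists qf; split=> j; have [] := h j.
Qed.

Lemma H0_lspan s : H0 r s -> Rk v 1 s.
Proof.
move=> hs; have [_ /(_ s hs)[c [/= /eqP sE _]]] := bv.
rewrite (_ : s = \sum_i c i *: v i); last by apply/eqP; rewrite -subr_eq0.
apply: subspace_sum; first exact: subspace_Rk.
move=> i _; apply: subspaceZ; first exact: subspace_Rk.
by have := Rk_mon v U_(i)%MM; rewrite monU mdeg1.
Qed.

(** Surjectivity of [Sym^k R_r -> R_(rk)]: a monomial of degree [r * k] in the coordinates is a
    product of [k] monomials of degree [r]. *)
Lemma Rk_H0 k : (0 < k)%N -> Rk v k = H0 (r * k).
Proof.
move=> k0; have rk : (0 < r * k)%N by rewrite muln_gt0 r_gt0.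
have [qf [hq vq]] := basis_forms.
apply/seteqP; split=> s.
  rewrite H0E// => /Rk_evf[P hP ->]; exists (mmap (@mpolyC N.+1 K) qf P); first exact: homog_subst.
  by apply/funext => x; rewrite (evf_pull vq).
rewrite -coord_H0//; move: s; apply: lspan_sub; first exact: subspace_Rk.
move=> _ [a ak ->]; elim: k {k0 rk} a ak => [|k IH] a.
  rewrite muln0 => /eqP; rewrite mdeg_eq0 => /eqP ->.
  by have := Rk_mon v 0%MM; rewrite !mon0 mdeg0.
rewrite mulnS => ak; have [b br ba] := @mnm_sub_deg _ r a (eq_ind_r (fun x => (r <= x)%N) (leq_addr _ _) ak).
have ab : mdeg (a - b)%MM = (r * k)%N.
  by have := ak; rewrite -{1}(submK ba) mdegD br addnC => /addnI.
rewrite -(submK ba) monD -[k.+1]addn1; apply: Rk_mul; first exact: IH.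
by apply: H0_lspan; rewrite -coord_H0// -br; exact: Rk_mon.
Qed.

Lemma basis_neq0 j : v j != 0.
Proof.
apply/eqP => vj0; have := rel_basis_indep (subspace_H0 r_gt0) (subspace_set0 _) bv.
move=> /(_ (fun i => (i == j)%:R)) h; have : (j == j)%:R = 0 :> K.
  apply: h; rewrite /= (bigD1 j)//= vj0 scaler0 add0r big1// => i /negbTE ->.
  by rewrite scale0r.
by rewrite eqxx => /eqP; rewrite oner_eq0.
Qed.

Lemma basis_nonvanishing x : proj_closed X -> exists j, v j x != 0.
Proof.
move=> cX; have x0 := proj_closed_neq0 cX (set_valP x).
have [i xi] : exists i, val x ord0 i != 0.
  apply/existsP; apply: contra_neqT x0 => /existsPn h; apply/rowP => i; rewrite mxE.
  by have := h i; rewrite negbK => /eqP.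
have hr : H0 r (coordinate i ^+ r : E).
  rewrite -coord_H0//; have := Rk_mon coordinate (U_(i) *+ r)%MM; rewrite mdegMn mdeg1 mul1n.
  suff -> : mon coordinate (U_(i) *+ r)%MM = coordinate i ^+ r by [].
  apply/funext => y; rewrite monE fct_expE (bigD1 i)//= mulmnE mnm1E eqxx mul1n big1 ?mulr1// => j /negbTE ji.
  by rewrite mulmnE mnm1E eq_sym ji.
have [_ /(_ _ hr)[c [/= /eqP sE _]]] := bv.
apply: contrapT => h; have vx j : v j x = 0 by apply: contrapT => /eqP vj; apply: h; exists j.
move: sE; rewrite subr_eq0 => /eqP /(congr1 (fun f => f x)); rewrite fct_sumE big1 => [|j _]; last first.
  by rewrite -[LHS]/(c j * v j x) vx mulr0.
by rewrite fct_expE /coordinate => /eqP; rewrite expf_eq0 (negbTE xi) andbF.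
Qed.

Lemma hilbert_upper n : variety X -> has_dimension X n -> (0 < m)%N ->
  exists C, forall k B (e : 'I_B -> E), rel_basis (Rk v k) [set 0] e -> (B <= C * k.+1 ^ n)%N.
Proof.
move=> vX dX m0; have [qf [hq vq]] := basis_forms.
exact: (hilbert_bound r_gt0 hq vq vX dX (basis_neq0 (Ordinal m0))).
Qed.

Lemma variance_or_nilpotent (R : archiRealFieldType) n C1 k0 (lam : 'I_m -> R) j1 : variety X ->
  (forall q B (e : 'I_B -> E), (k0 <= q)%N -> rel_basis (Rk v q) [set 0] e -> (q ^ n <= C1 * B)%N) ->
  (forall j, lam j1 <= lam j) ->
  (exists k1 c, [/\ (0 < k1)%N, 0 < c & forall t mu, (k0 <= t)%N ->
    c * t%:R ^+ n.+2 <= \sum_(x <- spectrum v lam (k1 * t)) (x - mu) ^+ 2]) \/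
  forall j, exists e, multiples v (fun j => lam j == lam j1) e (v j ^+ e.+1).
Proof.
move=> vX hilb lmin; have [h|/existsNP[j0 /forallNP h]] := pselect (forall j, exists e,
    multiples v (fun j => lam j == lam j1) e (v j ^+ e.+1)); [by right|left].
have [L [iota [g hk]]] := coordinate_field vX; have [qf [hq vq]] := basis_forms.
have hom := geometric_model r_gt0 hq vq vX hk.
exact: (spectrum_variance hom lmin (basis_neq0 j1) hilb h).
Qed.

End Basis.

(* A section vanishing at a point [x] cuts out a chain [{x} < X]. *)
Lemma dimension_gt0 n r (s s' : E) : variety X -> has_dimension X n -> (0 < r)%N ->
  H0 r s -> H0 r s' -> (forall c, s <> c *: s') -> s' <> 0 -> (0 < n)%N.
Proof.
move=> vX [_ dX] r0 hs hs' nc s'0.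
have [x sx] : exists x, s' x != 0.
  apply: contrapT => h; apply: s'0; apply/funext => x; apply: contrapT => /eqP sx.
  by apply: h; exists x.
pose xv := val x; have x0 := proj_closed_neq0 vX.1 (set_valP x).
pose P : set 'rV[K]_N.+1 := [set v | exists2 t, t != 0 & v = t *: xv].
have [i xi] : exists i, xv ord0 i != 0.
  apply/existsP; apply: contra_neqT x0 => /existsPn h; apply/rowP => i; rewrite mxE.
  by have := h i; rewrite negbK => /eqP.
have cP : proj_closed P.
  exists [set p | exists j, p = (xv ord0 j *: 'X_i - xv ord0 i *: 'X_j : {mpoly K[N.+1]})].
    move=> _ [j ->]; exists 1%N; apply: rpredB; apply: rpredZ; rewrite dhomogX; apply/eqP; exact: mdeg1.
  have evE j (u : 'rV[K]_N.+1) : Form.ev (xv ord0 j *: 'X_i - xv ord0 i *: 'X_j : {mpoly K[N.+1]}) u =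
      xv ord0 j * u ord0 i - xv ord0 i * u ord0 j.
    by rewrite /Form.ev mevalB !mevalZ !mevalXU.
  apply/seteqP; split=> [u [t t0 ->]|u [u0 hu]].
    split=> [|_ [j ->]]; first by rewrite scaler_eq0 negb_or t0.
    by rewrite evE !mxE; ring.
  exists (u ord0 i / xv ord0 i).
    apply: contra_neq u0 => /eqP; rewrite mulf_eq0 invr_eq0 (negbTE xi) orbF => /eqP ui.
    apply/rowP => j; rewrite mxE; have := hu _ (ex_intro _ j erefl); rewrite evE ui mulr0 sub0r.
    by move=> /eqP; rewrite oppr_eq0 mulf_eq0 (negbTE xi) => /eqP.
  apply/rowP => j; rewrite mxE; have := hu _ (ex_intro _ j erefl); rewrite evE => /eqP; rewrite subr_eq0 => /eqP h.
  have key (a b c : K) : c != 0 -> a * b = c * (b / c * a) by move=> c0; field.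
  by apply: (mulfI xi); rewrite -h; exact: key.
have xP : P xv by exists 1; rewrite ?oner_neq0 ?scale1r.
have vP : variety P.
  split=> //; split; first by exists xv.
  move=> A B cA cB PAB; have sub C : proj_closed C -> C xv -> P `<=` C.
    by move=> cC Cx _ [t t0 ->]; exact: proj_closed_scale.
  by have [Ax|Bx] := PAB _ xP; [left|right]; exact: sub.
have PX : P `<=` X by move=> _ [t t0 ->]; apply: proj_closed_scale vX.1 t0 _; exact: set_valP.
suff PnX : ~ X `<=` P.
  apply: (dX 1%N (fun i => if i is 0%N then P else X)); split=> [[|k] _|[|k]//= _].
  - by split.
  - by split.
move=> XP; apply: (nc (s x / s' x)); apply/funext => y.
have [t t0 yt] := XP _ (set_valP y).
move: hs hs'; rewrite !H0E// => -[p hp sE] [p' hp' sE'].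
have sc (q : {mpoly K[N.+1]}) : q \is r.-homog -> q.@[val y ord0] = t ^+ r * q.@[xv ord0].
  move=> hq; rewrite -(homog_scale _ t hq) yt; apply: meval_eq => j; by rewrite mxE.
have e1 : s y = t ^+ r * s x by rewrite sE sc.
have e2 : s' y = t ^+ r * s' x by rewrite sE' sc.
have -> : (s x / s' x *: s') y = s x / s' x * s' y by [].
by rewrite e1 e2 [in RHS]mulrCA divfK.
Qed.

End Sections.

End Algebra.
Import Algebra.

From mathcomp Require Import all_reals all_analysis.
Import numFieldNormedType.Exports.
Local Open Scope quotient_scope.
Local Open Scope classical_set_scope.
Local Open Scope ring_scope.

(** * Flags *)

Section FreeFamilies.
Context (K : fieldType) (E : lmodType K).
Implicit Types (W : set E) (s : seq E).

(** Coefficients are indexed by [nat] so that appending vectors does not change their type. *)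
Definition freeseq s := forall c : nat -> K, \sum_(i < size s) c i *: s`_i = 0 ->
  forall i, (i < size s)%N -> c i = 0.

Lemma freeseq_rcons s x : freeseq s -> ~ lspan [set` s] x -> freeseq (rcons s x).
Proof.
move=> fs nx c; rewrite size_rcons big_ord_recr /= nth_rcons ltnn eqxx.
under eq_bigr => i _ do rewrite nth_rcons ltn_ord.
move=> h; have cx : c (size s) = 0.
  apply: contrapT => /eqP c0; apply: nx.
  have -> : x = \sum_(i < size s) (- (c (size s))^-1 * c i) *: s`_i.
    under eq_bigr do rewrite -scalerA; rewrite -scaler_sumr.
    move: h => /eqP; rewrite addr_eq0 => /eqP ->; rewrite scalerN scaleNr opprK scalerA mulVf// scale1r//.
  apply: subspace_sum; first exact: subspace_lspan.
  move=> i _; apply: subspaceZ; first exact: subspace_lspan.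
  by apply: sub_lspan; rewrite /=; exact: mem_nth.
move: h; rewrite cx scale0r addr0 => /fs hs i; rewrite ltnS leq_eqVlt => /predU1P[->//|].
exact: hs.
Qed.

Lemma freeseq_extend W M s : is_subspace W ->
  (forall t, freeseq t -> [set` t] `<=` W -> (size t <= M)%N) ->
  freeseq s -> [set` s] `<=` W ->
  exists t, [/\ freeseq (s ++ t), [set` s ++ t] `<=` W & W `<=` lspan [set` s ++ t]].
Proof.
move=> hW bW; have [k] := ubnP (M - size s); elim: k s => // k IH s; rewrite ltnS => sk fs sW.
have [h|] := pselect (W `<=` lspan [set` s]); first by exists [::]; rewrite cats0.
move=> /existsNP[x /not_implyP[Wx nx]]; have fx := freeseq_rcons fs nx.
have xW : [set` rcons s x] `<=` W.
  by move=> y /=; rewrite mem_rcons inE => /predU1P[->//|]; exact: sW.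
have [||//|t] := IH (rcons s x); first 1 last.
- by [].
- by rewrite cat_rcons => -[]; exists (x :: t).
by have := bW _ fx xW; rewrite size_rcons; lia.
Qed.

Lemma freeseq_basis W s : freeseq s -> [set` s] `<=` W -> W `<=` lspan [set` s] ->
  rel_basis W [set 0] (fun i : 'I_(size s) => s`_i).
Proof.
move=> fs sW Ws; apply: rel_basisP.
- exact: subspace_set0.
- by move=> i; apply: sW; exact: mem_nth.
- suff h : lspan [set` s] `<=` [set x | exists c : 'I_(size s) -> K, [set 0] (x - \sum_i c i *: s`_i)].
    by move=> x /Ws /h.
  apply: lspan_sub.
    split; first by exists (fun=> 0); rewrite /= big1 ?subr0// => i _; rewrite scale0r.
    move=> c x1 x2 [a /= /eqP]; rewrite subr_eq0 => /eqP -> [b /= /eqP]; rewrite subr_eq0 => /eqP ->.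
    exists (fun i => c * a i + b i); apply/eqP; rewrite /= subr_eq0 scaler_sumr -big_split; apply/eqP.
    by apply: eq_bigr => i _; rewrite /= scalerA scalerDl.
  move=> y ys; have iy : (index y s < size s)%N by rewrite index_mem.
  exists (fun i => (i == Ordinal iy)%:R) => /=; rewrite (bigD1 (Ordinal iy))//= eqxx scale1r nth_index//.
  by rewrite big1 ?addr0 ?subrr// => i /negbTE ->; rewrite scale0r.
move=> c /= h i; have := fs (fun k => if insub k is Some j then c j else 0).
move=> /(_ _ i (ltn_ord i)); rewrite valK; apply.
by rewrite -[RHS]h; apply: eq_bigr => j _; rewrite valK.
Qed.

End FreeFamilies.

Section Flags.
Context (R : realType) (K : fieldType) (E : lmodType K) (V : set E).
Implicit Type f : wflag R V.

Lemma steps_size f : (2 <= size (steps f))%N.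
Proof. by have [[]] := wflagP f. Qed.

Lemma steps_subspace f i : (i < size (steps f))%N -> is_subspace (nth set0 (steps f) i).
Proof. by move=> h; have [_ /(_ i h)[_ ? ?] _ _ _] := wflagP f. Qed.

Lemma steps_sub f i : (i < size (steps f))%N -> nth set0 (steps f) i `<=` V.
Proof. by move=> h; have [_ /(_ i h)[]] := wflagP f. Qed.

Lemma steps_le f i j : (i <= j)%N -> (j < size (steps f))%N ->
  nth set0 (steps f) i `<=` nth set0 (steps f) j.
Proof.
move=> ij; rewrite -(subnK ij); elim: (j - i)%N => [_|d IH dj]; first exact: subset_refl.
move=> x /(IH (ltnW dj)); have [_ _ [/(_ _ dj)[h _] _] _ _] := wflagP f; exact: h.
Qed.

Lemma steps_last f : nth set0 (steps f) (size (steps f)).-1 = V.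
Proof.
have [[_ sz] _ [_ e] _ _] := wflagP f; rewrite -[RHS]e nth_last.
by case: (steps f) sz.
Qed.

Lemma wts_le f i j : (i <= j)%N -> (j < size (steps f))%N -> (wts f)`_i <= (wts f)`_j.
Proof.
have [[sw _] _ _ sorted_w _] := wflagP f; rewrite leq_eqVlt => /predU1P[->//|ij] js.
apply: ltW; apply: (sorted_ltn_nth lt_trans 0 sorted_w) => //; rewrite inE sw//.
exact: ltn_trans js.
Qed.

Lemma adapted_basis f B (e : 'I_B -> E) : is_subspace V -> rel_basis V [set 0] e ->
  exists m (v : 'I_m -> E), rel_basis V [set 0] v /\ adapted v f.
Proof.
move=> hV be; have bV t : freeseq t -> [set` t] `<=` V -> (size t <= B)%N.
  move=> ft tV; apply: (@indep_leq _ _ [set 0] _ _ (fun i : 'I_(size t) => t`_i) e).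
  - exact: subspace_set0.
  - move=> c /= h i; have := ft (fun k => if insub k is Some j then c j else 0).
    move=> /(_ _ i (ltn_ord i)); rewrite valK; apply.
    by rewrite -[RHS]h; apply: eq_bigr => j _; rewrite valK.
  - move=> i; have [_ /(_ t`_i)[|c [hc _]]] := be; first by apply: tV; exact: mem_nth.
    by exists c.
(* The basis grows along the flag, so each step is spanned by an initial segment of it. *)
suff [s [fs sV hs]] : exists s, [/\ freeseq s, [set` s] `<=` nth set0 (steps f) (size (steps f)).-1 &
    forall i, (i <= (size (steps f)).-1)%N -> exists n, nth set0 (steps f) i = lspan [set` take n s]].
  have sz := steps_size f.
  exists (size s), (fun i => s`_i); split.
    apply: freeseq_basis => //; first by rewrite -(steps_last f).
    have [n VE] := hs _ (leqnn _); rewrite -(steps_last f) VE.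
    by apply: lspan_mono => x /= /mem_take.
  move=> i hi; have [|n ->] := hs i; first by rewrite -ltnS prednK// (ltn_trans _ sz).
  exists [set j : 'I_(size s) | (j < n)%N]%SET; congr (lspan _); apply/seteqP; split=> x /=.
    move=> /(nthP 0)[j]; rewrite size_take_min leq_min => /andP[jn js] <-.
    by exists (Ordinal js); rewrite /= ?inE// nth_take.
  move=> [j] /=; rewrite inE => jn <-; rewrite -(nth_take 0 jn); apply: mem_nth.
  by rewrite size_take_min leq_min jn ltn_ord.
have : ((size (steps f)).-1 < size (steps f))%N by rewrite prednK// (ltn_trans _ (steps_size f)).
elim: (size (steps f)).-1 => [|p IH] ps.
  have [|||t [ft tW Wt]] := @freeseq_extend _ _ (nth set0 (steps f) 0) B [::] (steps_subspace ps).
  - by move=> t ft tW; apply: bV => //; apply: subset_trans tW _; exact: steps_sub.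
  - by [].
  - by [].
  exists t; split=> // i; rewrite leqn0 => /eqP ->; exists (size t); rewrite take_size.
  by apply/seteqP; split=> //; apply: lspan_sub => //; exact: steps_subspace.
have [s [fs sW hs]] := IH (ltnW ps).
have sW' : [set` s] `<=` nth set0 (steps f) p.+1 by apply: subset_trans sW _; exact: steps_le.
have [|t [ft tW Wt]] := @freeseq_extend _ _ (nth set0 (steps f) p.+1) B s (steps_subspace ps) _ fs sW'.
  by move=> t ft tW; apply: bV => //; apply: subset_trans tW _; exact: steps_sub.
exists (s ++ t); split=> // i; rewrite leq_eqVlt => /predU1P[->|]; last first.
  rewrite ltnS => /hs[n ->]; exists (minn n (size s)).
  have [ns|sn] := leqP n (size s); first by rewrite takel_cat.
  by rewrite take_size_cat// take_oversize// ltnW.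
exists (size (s ++ t)); rewrite take_size.
by apply/seteqP; split=> //; apply: lspan_sub => //; exact: steps_subspace.
Qed.

Lemma filt_adapted f m (v : 'I_m -> E) y : rel_basis V [set 0] v -> adapted v f ->
  filt f y = lspan [set s | exists2 j, weight_of f (v j) <= y & s = v j].
Proof.
move=> [Vv _] af; apply/seteqP; split=> [s [->|[i [hi wy hs]]]|].
- exact: subspace0 (subspace_lspan _).
- have [J stE] := af i hi; rewrite stE in hs; move: s hs; apply: lspan_mono => _ [j jJ <-].
  exists j => //; apply: le_trans wy; rewrite /weight_of.
  apply: wts_le => //; rewrite leqNgt; apply/negP => /(before_find set0)/asboolP; apply.
  by rewrite stE; apply: sub_lspan; exists j.
apply: lspan_sub.
  split; first by left.
  move=> c s s' hs hs'.
  have hZ t i : (i < size (steps f))%N -> nth set0 (steps f) i t -> nth set0 (steps f) i (c *: t).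
    by move=> hi; exact: subspaceZ (steps_subspace hi).
  case: hs hs' => [->|[i [hi wi si]]] [->|[i' [hi' wi' si']]].
  - by left; rewrite scaler0 addr0.
  - by right; exists i'; rewrite scaler0 add0r.
  - by right; exists i; rewrite addr0; split => //; exact: hZ.
  - right; have [ii|ii] := leqP i i'.
      by exists i'; split=> //; apply: (steps_subspace hi').2 => //; exact: steps_le ii hi' _ si.
    by exists i; split=> //; apply: (steps_subspace hi).2 => //; exact: steps_le (ltnW ii) hi _ si'.
move=> _ [j wj ->]; right.
have hf : has (fun F : set E => `[< F (v j) >]) (steps f).
  apply/(has_nthP set0); exists (size (steps f)).-1.
    by rewrite prednK// (ltn_trans _ (steps_size f)).
  by apply/asboolP; rewrite steps_last; exact: Vv.
exists (find (fun F : set E => `[< F (v j) >]) (steps f)); split; first by rewrite -has_find.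
  exact: wj.
by apply/asboolP; exact: (nth_find set0 hf).
Qed.

End Flags.

(** * Asymptotic invariants of spectra *)

Section SpectralSequences.
Context (R : realType).
Implicit Types (s : nat -> seq R) (u : nat -> R) (P : {poly R}).

Lemma poly_ofE u P : (\forall k \near \oo, u k = P.[k%:R]) -> poly_of u = P.
Proof.
move=> uP; rewrite /poly_of; case: xgetP => [Q _ uQ|/(_ P)//].
have : \forall k \near \oo, (Q - P).[k%:R] = 0.
  by apply: filterS2 uP uQ => k e1 e2; rewrite hornerD hornerN -e1 -e2 subrr.
move=> [n0 _ h]; apply/eqP; rewrite -subr_eq0; apply/negPn/negP => QP0.
have := @max_poly_roots _ (Q - P) [seq (n0 + i)%:R | i <- iota 0 (size (Q - P))] QP0.
rewrite size_map size_iota ltnn => /(_ _ _) h'; have : false; last by []; apply: h'.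
  by apply/allP => _ /mapP[i _ ->]; rewrite rootE h//= leq_addr.
by rewrite map_inj_uniq ?iota_uniq// => i j /eqP; rewrite eqr_nat eqn_add2l => /eqP.
Qed.

Lemma poly_of_near u u' : (\forall k \near \oo, u k = u' k) -> poly_of u = poly_of u'.
Proof.
move=> uu; rewrite /poly_of; congr (xget _ _); apply/seteqP; split=> P hP;
  by apply: filterS2 uu hP => k -> .
Qed.

Lemma lim_near u u' : (\forall k \near \oo, u k = u' k) -> lim (u @ \oo) = lim (u' @ \oo).
Proof.
move=> uu; congr (lim _); apply/funext => A; apply/propext; split=> hA;
  by apply: filterS2 uu hA => k /= ->.
Qed.

(** The polynomial [P(c X)] with its coefficients made explicit; it records the passage from [L] to
    a power of [L]. *)
Definition dilate_poly c P : {poly R} := \poly_(i < size P) (c ^+ i * P`_i).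

Lemma horner_dilate_poly c P x : (dilate_poly c P).[x] = P.[c * x].
Proof.
rewrite horner_poly horner_coef; apply: eq_bigr => i _.
by rewrite exprMn mulrAC mulrC mulrA.
Qed.

Lemma coef_dilate_poly c P i : (dilate_poly c P)`_i = c ^+ i * P`_i.
Proof.
by rewrite coef_poly; case: ltnP => // h; rewrite nth_default ?mulr0.
Qed.

Lemma cvg_dilate (k0 : nat) : (0 < k0)%N -> (fun k => (k0 * k)%N) @ \oo --> \oo.
Proof.
move=> k00 A [N _ hN]; exists N => // k /= Nk; apply: hN => /=.
by apply: leq_trans Nk _; rewrite leq_pmull.
Qed.

Lemma cvg_poly P d : (size P <= d.+1)%N -> (fun k => P.[k%:R] / k%:R ^+ d) @ \oo --> P`_d.
Proof.
elim/poly_ind: P d => [|P c IH] d sP.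
  rewrite coef0; apply: cvg_near_cst; near=> k; by rewrite horner0 mul0r.
have inv0 : (fun k => (k%:R : R)^-1) @ \oo --> (0 : R).
  have := @cvg_harmonic R; rewrite -(cvg_shiftS (fun k => (k%:R : R)^-1)); exact.
case: d sP => [|d] sP.
  have P0 : P = 0.
    apply/eqP; rewrite -size_poly_eq0 -leqn0; move: sP; rewrite size_MXaddC.
    by case: ifP => [/andP[/eqP -> _]|_]; rewrite ?size_poly0// ltnS.
  apply: cvg_near_cst; near=> k.
  by rewrite P0 mul0r add0r hornerC expr0 divr1 coefC.
rewrite coefD coefMX coefC /= addr0.
have sP' : (size P <= d.+1)%N.
  by move: sP; rewrite size_MXaddC; case: ifP => [/andP[/eqP -> _]|_]; rewrite ?size_poly0.
have e : \forall k \near \oo, P.[k%:R] / k%:R ^+ d + c * (k%:R^-1) ^+ d.+1 = (P * 'X + c%:P).[k%:R] / k%:R ^+ d.+1.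
  near=> k; have k0 : k%:R != 0 :> R by rewrite pnatr_eq0 -lt0n; near: k; exact: nbhs_infty_gt.
  rewrite !hornerE exprVn mulrDl; congr (_ + _).
  by rewrite [in RHS]exprS invfM mulrA mulfK.
apply: cvg_trans (near_eq_cvg e) _.
rewrite -[P`_d]addr0; apply: cvgD; first exact: IH.
rewrite -(mulr0 c) -[X in c * X](_ : 0 ^+ d.+1 = 0 :> R); last by rewrite expr0n.
apply: cvgM; first exact: cvg_cst.
exact: (cvg_comp _ _ inv0 (@exprn_continuous R d.+1 0)).
Unshelve. all: by end_near. Qed.


Lemma size_le_growth P d C : (\forall k \near \oo, `|P.[k%:R]| <= C * k.+1%:R ^+ d) -> (size P <= d.+1)%N.
Proof.
move=> hP; rewrite leqNgt; apply/negP => dP; pose e := (size P).-1.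
have eP : size P = e.+1 by rewrite prednK// (leq_trans _ dP).
have P0 : P`_e != 0.
  by rewrite -[P`_e]/(lead_coef P) lead_coef_eq0 -size_poly_gt0 eP.
pose Q := C *: ('X + 1) ^+ d : {poly R}.
have sQ : (size Q <= d.+1)%N.
  apply: leq_trans (size_scale_leq _ _) _; apply: leq_trans (size_poly_exp_leq _ _) _.
  by rewrite -[1]/(1%:P) size_XaddC /= mul1n.
have de : (d < e)%N by rewrite -ltnS -eP.
have cP : (fun k => `|P.[k%:R] / k%:R ^+ e|) @ \oo --> `|P`_e|.
  by apply: cvg_norm; apply: cvg_poly; rewrite eP.
have cQ : (fun k => Q.[k%:R] / k%:R ^+ e) @ \oo --> Q`_e.
  by apply: cvg_poly; apply: leq_trans sQ _; exact: ltnW.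
have Qe : Q`_e = 0 by rewrite nth_default// (leq_trans sQ).
have : `|P`_e| <= Q`_e.
  apply: (ler_cvg_to cP cQ); apply: filterS hP => k hk.
  rewrite normrM [X in _ * X]ger0_norm ?invr_ge0 ?exprn_ge0// ler_wpM2r ?invr_ge0 ?exprn_ge0//.
  by rewrite /Q !hornerE /= natr1.
by rewrite Qe normr_le0 (negbTE P0).
Qed.

Definition seq_h s k : R := (size (s k))%:R.
Definition seq_w s k : R := \sum_(x <- s k) x.
Definition seq_q s k : R := \sum_(x <- s k) x ^+ 2.
Definition seq_var s k : R := \sum_(x <- s k) (x - seq_w s k / seq_h s k) ^+ 2.

Definition seq_L2 n r s : R :=
  Num.sqrt (lim ((fun k => seq_var s k / (k * r)%:R ^+ n.+2) @ \oo)).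

Definition seq_DF n r s : R :=
  let a0 := (poly_of (seq_h s))`_n in
  let a1 := (poly_of (seq_h s))`_n.-1 in
  let b0 := (poly_of (seq_w s))`_n.+1 in
  let b1 := (poly_of (seq_w s))`_n in
  (seq_L2 n r s)^-1 * ((a1 * b0 - a0 * b1) / a0 ^+ 2).

Definition has_polys n s h w q :=
  [/\ \forall k \near \oo, seq_h s k = h.[k%:R], \forall k \near \oo, seq_w s k = w.[k%:R],
      \forall k \near \oo, seq_q s k = q.[k%:R],
      [/\ (size h <= n.+1)%N, (size w <= n.+2)%N & (size q <= n.+3)%N] & h`_n != 0].

(** The coefficient of [k ^+ n.+2] in the growth of the variance [q - w ^+ 2 / h]. *)
Definition norm2 n h w q : R := q`_n.+2 - w`_n.+1 ^+ 2 / h`_n.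
Definition dfnum n h w : R := (h`_n.-1 * w`_n.+1 - h`_n * w`_n) / h`_n ^+ 2.

Lemma seq_varE s k : seq_h s k != 0 -> seq_var s k = seq_q s k - seq_w s k ^+ 2 / seq_h s k.
Proof.
move=> h0; rewrite /seq_var; set mu := _ / _.
have -> : \sum_(x <- s k) (x - mu) ^+ 2 = seq_q s k - 2 * mu * seq_w s k + mu ^+ 2 * seq_h s k.
  have -> : seq_h s k = \sum_(x <- s k) 1 by rewrite /seq_h -sum1_size natr_sum.
  by rewrite /seq_q /seq_w !mulr_sumr -sumrB -big_split; apply: eq_bigr => x _ /=; ring.
rewrite /mu; move: (seq_q s k) (seq_w s k) (seq_h s k) h0 => a b c c0; by field.
Qed.

Lemma has_polys_cvg n r s h w q : (0 < r)%N -> has_polys n s h w q ->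
  (fun k => seq_var s k / (k * r)%:R ^+ n.+2) @ \oo --> norm2 n h w q / r%:R ^+ n.+2.
Proof.
move=> r0 [sh sw sq [szh szw szq] hn].
have r0' : r%:R != 0 :> R by rewrite pnatr_eq0 -lt0n.
have ch := cvg_poly szh; have cw := cvg_poly szw; have cq := cvg_poly szq.
have main : (fun k : nat => (q.[k%:R] / k%:R ^+ n.+2 - (w.[k%:R] / k%:R ^+ n.+1) * (w.[k%:R] / k%:R ^+ n.+1) *
    (h.[k%:R] / k%:R ^+ n)^-1) * (r%:R ^+ n.+2)^-1) @ \oo --> norm2 n h w q / r%:R ^+ n.+2.
  rewrite /norm2 expr2; apply: cvgM; last exact: cvg_cst.
  apply: cvgB => //; apply: cvgM; last exact: cvgV.
  exact: cvgM.
apply: cvg_trans main; apply: near_eq_cvg.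
have hk0 : \forall k \near \oo, h.[k%:R] / k%:R ^+ n != 0 :> R.
  exact: (cvgr_neq0 _ ch hn).
near=> k.
have k0 : k%:R != 0 :> R by rewrite pnatr_eq0 -lt0n; near: k; exact: nbhs_infty_gt.
have hk : h.[k%:R] != 0.
  have : h.[k%:R] / k%:R ^+ n != 0 by near: k.
  by rewrite mulf_eq0 negb_or => /andP[].
have e1 : seq_h s k = h.[k%:R] by near: k.
have e2 : seq_w s k = w.[k%:R] by near: k.
have e3 : seq_q s k = q.[k%:R] by near: k.
rewrite seq_varE ?e1// e2 e3 natrM exprMn.
have xE : (k%:R : R) ^+ n.+1 = k%:R ^+ n * k%:R by rewrite exprSr.
have xE2 : (k%:R : R) ^+ n.+2 = k%:R ^+ n * k%:R ^+ 2 by rewrite -exprD addn2.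
rewrite xE2 xE; have : (k%:R : R) ^+ n != 0 by rewrite expf_neq0.
have : (r%:R : R) ^+ n.+2 != 0 by rewrite expf_neq0.
move: (k%:R ^+ n : R) (r%:R ^+ n.+2 : R) (h.[k%:R]) (w.[k%:R]) (q.[k%:R]) (k%:R : R) hk k0.
by move=> x y hh ww qq kk hh0 kk0 y0 x0; field; rewrite hh0 x0 kk0 y0.
Unshelve. all: by end_near. Qed.

Lemma has_polys_L2 n r s h w q : (0 < r)%N -> has_polys n s h w q ->
  seq_L2 n r s = Num.sqrt (norm2 n h w q / r%:R ^+ n.+2).
Proof. by move=> r0 /(has_polys_cvg r0)/cvg_lim; rewrite /seq_L2 => ->. Qed.

Lemma has_polys_DF n r s h w q : has_polys n s h w q ->
  seq_DF n r s = (seq_L2 n r s)^-1 * dfnum n h w.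
Proof. by move=> [sh sw _ _ _]; rewrite /seq_DF (poly_ofE sh) (poly_ofE sw). Qed.

Lemma has_polys_transform n s s2 h w q k0 al be : (0 < k0)%N -> has_polys n s h w q ->
  (\forall k \near \oo, perm_eq (s2 k) [seq al * x + be * k%:R | x <- s (k0 * k)%N]) ->
  has_polys n s2 (dilate_poly k0%:R h) (al *: dilate_poly k0%:R w + be *: ('X * dilate_poly k0%:R h))
    (al ^+ 2 *: dilate_poly k0%:R q + (2 * al * be) *: ('X * dilate_poly k0%:R w)
      + be ^+ 2 *: ('X ^+ 2 * dilate_poly k0%:R h)).
Proof.
move=> k00 [sh sw sq [szh szw szq] hn] hs.
have szX (p : {poly R}) d i : (size p <= d)%N -> (size ('X^i * dilate_poly k0%:R p)%R <= d + i)%N.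
  move=> pd; rewrite mulrC; apply: leq_trans (size_polyMleq _ _) _; rewrite size_polyXn addnS /= leq_add2r.
  by apply: leq_trans pd; exact: size_poly.
have sub (P : nat -> Prop) : (\forall k \near \oo, P k) -> \forall k \near \oo, P (k0 * k)%N.
  by move=> hP; exact: (cvg_dilate k00 hP).
have {}sh := sub _ sh; have {}sw := sub _ sw; have {}sq := sub _ sq.
split.
- near=> k; rewrite horner_dilate_poly -natrM.
  have e : perm_eq (s2 k) [seq al * x + be * k%:R | x <- s (k0 * k)%N] by near: k.
  have <- : seq_h s (k0 * k) = h.[(k0 * k)%:R] by near: k.
  by rewrite /seq_h (perm_size e) size_map.
- near=> k; rewrite !hornerE !horner_dilate_poly -[k0%:R * k%:R]natrM.
  have e : perm_eq (s2 k) [seq al * x + be * k%:R | x <- s (k0 * k)%N] by near: k.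
  have <- : seq_h s (k0 * k) = h.[(k0 * k)%:R] by near: k.
  have <- : seq_w s (k0 * k) = w.[(k0 * k)%:R] by near: k.
  rewrite /seq_w (perm_big _ e) big_map big_split /= -mulr_sumr; congr (_ + _).
  rewrite /seq_h -sum1_size natr_sum !mulr_sumr; apply: eq_bigr => x _; by rewrite mulr1.
- near=> k; rewrite !hornerE !horner_dilate_poly -[k0%:R * k%:R]natrM.
  have e : perm_eq (s2 k) [seq al * x + be * k%:R | x <- s (k0 * k)%N] by near: k.
  have <- : seq_h s (k0 * k) = h.[(k0 * k)%:R] by near: k.
  have <- : seq_w s (k0 * k) = w.[(k0 * k)%:R] by near: k.
  have <- : seq_q s (k0 * k) = q.[(k0 * k)%:R] by near: k.
  have -> : seq_q s2 k = al ^+ 2 * seq_q s (k0 * k) + 2 * al * be * k%:R * seq_w s (k0 * k)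
      + (be * k%:R) ^+ 2 * seq_h s (k0 * k).
    have -> : seq_h s (k0 * k) = \sum_(x <- s (k0 * k)%N) 1 by rewrite /seq_h -sum1_size natr_sum.
    rewrite /seq_q (perm_big _ e) big_map /seq_w !mulr_sumr -!big_split.
    by apply: eq_bigr => x _ /=; ring.
  by rewrite /=; ring.
- split.
  + by apply: leq_trans szh; exact: size_poly.
  + apply: leq_trans (size_polyD _ _) _; rewrite geq_max; apply/andP; split.
      apply: leq_trans (size_scale_leq _ _) _; apply: leq_trans szw; exact: size_poly.
    by apply: leq_trans (size_scale_leq _ _) _; rewrite -[X in (_ <= X)%N]addn1; exact: (szX h n.+1 1%N).
  + apply: leq_trans (size_polyD _ _) _; rewrite geq_max; apply/andP; split; last first.
      by apply: leq_trans (size_scale_leq _ _) _; rewrite -[X in (_ <= X)%N](addn2 n.+1); exact: (szX h n.+1 2%N).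
    apply: leq_trans (size_polyD _ _) _; rewrite geq_max; apply/andP; split.
      apply: leq_trans (size_scale_leq _ _) _; apply: leq_trans szq; exact: size_poly.
    by apply: leq_trans (size_scale_leq _ _) _; rewrite -[X in (_ <= X)%N]addn1; exact: (szX w n.+2 1%N).
- by rewrite coef_dilate_poly mulf_neq0// expf_neq0// pnatr_eq0 -lt0n.
Unshelve. all: by end_near. Qed.

(** One statement covers rescaled and shifted weights, equivalent flags and the maps [iota]. The
    shift [be] cancels in the variance and in the numerator of [df]; the latter uses [0 < n], as
    [n.-1] is truncated at zero. *)
Lemma seq_transform n r s s2 h w q k0 al be : (0 < n)%N -> (0 < r)%N -> (0 < k0)%N -> al != 0 ->
  has_polys n s h w q ->
  (\forall k \near \oo, perm_eq (s2 k) [seq al * x + be * k%:R | x <- s (k0 * k)%N]) ->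
  seq_L2 n (r * k0) s2 = `|al| * seq_L2 n r s /\
  seq_DF n (r * k0) s2 = al / `|al| * seq_DF n r s.
Proof.
case: n => // n _ r0 k00 al0 hs ss; have hs2 := has_polys_transform k00 hs ss.
have hn : h`_n.+1 != 0 by case: hs.
have k0' : k0%:R != 0 :> R by rewrite pnatr_eq0 -lt0n.
have r0' : r%:R != 0 :> R by rewrite pnatr_eq0 -lt0n.
have kn : (k0%:R : R) ^+ n != 0 by rewrite expf_neq0.
have kE1 : (k0%:R : R) ^+ n.+1 = k0%:R ^+ n * k0%:R by rewrite exprSr.
have kE2 : (k0%:R : R) ^+ n.+2 = k0%:R ^+ n * k0%:R ^+ 2 by rewrite -exprD addn2.
have kE3 : (k0%:R : R) ^+ n.+3 = k0%:R ^+ n * k0%:R ^+ 3 by rewrite -exprD addn3.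
have L2E : seq_L2 n.+1 (r * k0) s2 = `|al| * seq_L2 n.+1 r s.
  rewrite (has_polys_L2 _ hs2) ?muln_gt0 ?r0// (has_polys_L2 r0 hs).
  rewrite -sqrtr_sqr -sqrtrM ?sqr_ge0//; congr Num.sqrt; rewrite /norm2.
  rewrite !coefD !coefZ !coefXM !coefXnM /= !coef_dilate_poly !subSS subn0 natrM exprMn kE3 kE2 kE1.
  have : (r%:R : R) ^+ n.+3 != 0 by rewrite expf_neq0.
  move: (r%:R ^+ n.+3 : R) (k0%:R ^+ n : R) (k0%:R : R) kn k0' => y x k x0 kk0 y0.
  by field; rewrite kk0 x0 y0 hn.
split=> //; rewrite (has_polys_DF _ hs2) (has_polys_DF _ hs) L2E /dfnum /=.
rewrite !coefD !coefZ !coefXM /= !coef_dilate_poly kE2 kE1 invfM.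
have [L0|L0] := eqVneq (seq_L2 n.+1 r s) 0; first by rewrite L0 invr0 !(mul0r, mulr0).
have a0 : `|al| != 0 by rewrite normr_eq0.
move: (seq_L2 n.+1 r s) (`|al|) (k0%:R ^+ n : R) (k0%:R : R) kn k0' L0 a0 => L a x k x0 kk0 L0 a0.
by field; rewrite kk0 x0 hn L0 a0.
Qed.

End SpectralSequences.

(** * From flags to traces on the central fibre *)

Section FlagSpectra.
Context (R : realType) (K : closedFieldType) (N : nat) (X : set 'rV[K]_N.+1).
Local Notation E := (X -> K^o).

Lemma sym_filt_Sk (G : R -> set E) m (v : 'I_m -> E) (lam : 'I_m -> R) k x :
  (forall y, G y = lspan [set s | exists2 j, lam j <= y & s = v j]) ->
  sym_filt G k x = Sk v lam k x.
Proof.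
move=> GE; apply/seteqP; split.
  apply: lspan_sub; first exact: subspace_Sk.
  move=> _ [u [y [hu hy ->]]]; apply: (Sk_le hy); apply: Sk_prod => i.
  by apply: Sk1; rewrite -GE.
apply: lspan_mono => _ [b [bk bx ->]]; have [j [j1 j2]] := mon_prod v lam bk.
exists (fun i => v (j i)), (fun i => lam (j i)); split; [|by rewrite -j2|exact: j1].
by move=> i; rewrite GE; apply: sub_lspan; exists (j i).
Qed.

Lemma fsbig_count (s : seq int) (phi : int -> R) :
  \sum_(i \in [set: int]) (count_mem i s)%:R * phi i = \sum_(x <- s) phi x.
Proof.
rewrite -(@fsbig_widen _ _ _ _ [set` undup s])//; last first.
  move=> i /= [_ /negP]; rewrite mem_undup => /count_memPn ->; by rewrite mul0r.
rewrite -fsbig_seq ?undup_uniq//.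
transitivity (\sum_(i <- undup s) iterop (count_mem i s) +%R (phi i) 0).
  apply: eq_bigr => i _; rewrite mulr_natl; case: (count_mem i s) => // n.
by rewrite big_undup_iterop_count.
Qed.

Lemma trace_sum (F : int -> set E) m (v : 'I_m -> E) (w : 'I_m -> int) : (0 < m)%N ->
  (forall i, F i = lspan [set s | exists2 j, w j <= i & s = v j]) ->
  exists k0, forall k, (k0 <= k)%N -> forall phi : R -> R,
    trace_fun F phi k = \sum_(x <- [seq - (x%:~R : R) | x <- spectrum v w k]) phi x.
Proof.
move=> m0 FE; have [k0 h] := mult0_large m0 FE; exists k0 => k kk phi.
rewrite big_map -(fsbig_count (spectrum v w k) (fun i => phi (- i%:~R))).
apply: eq_fsbigr => i _; rewrite h//; congr (_%:R * _).
rewrite /spectrum [RHS]count_map [RHS]count_filter; apply: eq_count => a /=; exact: andbC.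
Qed.

Lemma trace_seq n r (F : int -> set E) (s : nat -> seq R) :
  (exists k0, forall k, (k0 <= k)%N -> forall phi : R -> R,
    trace_fun F phi k = \sum_(x <- s k) phi x) ->
  L2norm R n r F = seq_L2 n r s /\ DF_normalized R n r F = seq_DF n r s.
Proof.
move=> [k0 h].
have hE : \forall k \near \oo, hfun R F k = seq_h s k.
  by exists k0 => // k /= kk; rewrite /hfun h// /seq_h -sum1_size natr_sum.
have wE : \forall k \near \oo, wfun R F k = seq_w s k by exists k0 => // k /= kk; rewrite /wfun h.
have vE : \forall k \near \oo, tr_sq R F k = seq_var s k.
  near=> k; rewrite /tr_sq.
  have -> : hfun R F k = seq_h s k by near: k.
  have -> : wfun R F k = seq_w s k by near: k.
  by rewrite h//; near: k; exists k0.
have LE : L2norm R n r F = seq_L2 n r s.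
  by rewrite /L2norm /seq_L2; congr Num.sqrt; apply: lim_near; apply: filterS vE => k ->.
by split=> //; rewrite /DF_normalized /seq_DF LE (poly_of_near hE) (poly_of_near wE).
Unshelve. all: by end_near. Qed.

Section Flag.
Context (r m : nat) (f : wflag R (H0 (X := X) r)) (v : 'I_m -> E).
Hypotheses (bv : rel_basis (H0 r) [set 0] v) (af : adapted v f).
Let lam j : R := weight_of f (v j).

Lemma weight_of_mem j : lam j \in wts f.
Proof.
have hf : has (fun F : set E => `[< F (v j) >]) (steps f).
  apply/(has_nthP set0); exists (size (steps f)).-1.
    by rewrite prednK// (ltn_trans _ (steps_size f)).
  by apply/asboolP; rewrite steps_last; exact: bv.1.
apply: mem_nth; have [[-> _] _ _ _ _] := wflagP f; by rewrite -has_find.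
Qed.

Lemma integral_data F : integral_rep f F -> exists a b (w : 'I_m -> int),
  [/\ 0 < a, forall j, lam j = a * (w j)%:~R + b &
      forall i, F i = lspan [set s | exists2 j, w j <= i & s = v j]].
Proof.
move=> [a [b [a0 hx hF]]]; have /choice[w hw] : forall j, exists z : int, lam j = a * z%:~R + b.
  by move=> j; apply: hx; exact: weight_of_mem.
exists a, b, w; split=> // i; rewrite hF (filt_adapted _ bv af); congr lspan.
apply/seteqP; split=> _ [j hj ->]; exists j => //; move: hj; rewrite -/(lam j) hw lerD2r ler_pM2l// ler_int//.
Qed.

Lemma sym_filt_flag k x : sym_filt (filt f) k x = Sk v lam k x.
Proof. by apply: sym_filt_Sk => y; exact: filt_adapted. Qed.

Lemma basis_size_gt1 : (1 < m)%N.
Proof.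
have sz := steps_size f; have [_ _ [hlt _] _ _] := wflagP f.
have H1 := hlt 1%N sz; have H0 := hlt 0%N (ltn_trans (ltnSn 0) sz).
have [J1 E1] := af sz; have [J0 E0] := af (ltn_trans (ltnSn 0) sz).
have [j jJ] : exists j, j \in J0.
  apply/existsP; apply: contraPT H0 => /existsPn h [_ ]; apply => /=; rewrite E0.
  by apply: lspan_sub; [exact: subspace_set0|move=> s [j /= jJ _]; have := h j; rewrite jJ].
have [i /andP[iJ1 iJ0]] : exists i, (i \in J1) && (i \notin J0).
  apply/existsP; apply: contraPT H1 => /existsPn h [_ ]; apply => /=; rewrite E0 E1.
  apply: lspan_mono => _ [i /= iJ <-]; exists i => //=.
  by have := h i; rewrite iJ /= negbK.
case: m v bv af J1 E1 J0 E0 j jJ i iJ1 iJ0 => [|[|//]] v' bv' af' J1 E1 J0 E0 j jJ i iJ1 iJ0; first by case: j {jJ}.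
by move: jJ iJ0; rewrite (ord1 i) (ord1 j) => ->.
Qed.

End Flag.
End FlagSpectra.

Lemma evpoly_near (R : realType) (u : nat -> R) : evpoly u ->
  \forall k \near \oo, u k = (poly_of u).[k%:R].
Proof.
move=> [P [k0 h]]; have uP : \forall k \near \oo, u k = P.[k%:R] by exists k0.
by rewrite (poly_ofE uP).
Qed.

Section MomentPolynomials.
Context (R : realType) {m : nat}.
Implicit Types (D : set (mpoly.multinom m)) (lam : 'I_m -> R).

Definition hpoly D : {poly R} := poly_of (mom0 R D).
Definition wpoly lam D : {poly R} := \sum_j lam j *: poly_of (mom1 R D j).
Definition q2poly lam D : {poly R} := \sum_i \sum_j (lam i * lam j) *: poly_of (mom2 R D i j).

Lemma near_forall_ord p (P : 'I_p -> nat -> Prop) :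
  (forall j, \forall k \near \oo, P j k) -> \forall k \near \oo, forall j, P j k.
Proof. by move=> h; apply: filter_forall. Qed.

Lemma has_polys_dspec n lam D C : downset D ->
  (forall k, mom0 R D k <= C * k.+1%:R ^+ n) -> (hpoly D)`_n != 0 ->
  has_polys n (dspec lam D) (hpoly D) (wpoly lam D) (q2poly lam D).
Proof.
move=> dD hC hn.
have m0_ge k : 0 <= mom0 R D k by apply: sumr_ge0.
have e0 := evpoly_near (evpoly_mom0 R dD).
have e1 := near_forall_ord (fun j => evpoly_near (evpoly_mom1 R j dD)).
have e2 := near_forall_ord (fun i => near_forall_ord (fun j => evpoly_near (evpoly_mom2 R i j dD))).
(* A moment of order [d] is at most [k%:R ^+ d] times the count, since the exponents of a monomial
   of degree [k] are at most [k]; this bounds the degree of its polynomial. *)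
have grow u d : evpoly u -> (forall k, 0 <= u k <= k%:R ^+ d * mom0 R D k) -> (size (poly_of u) <= (n + d).+1)%N.
  move=> /evpoly_near eu hu; apply: (@size_le_growth _ _ _ C); apply: filterS eu => k <-.
  have /andP[u0 uk] := hu k; rewrite ger0_norm//; apply: (le_trans uk).
  rewrite exprD mulrA [leRHS]mulrC ler_pM// ?exprn_ge0// lerXn2r ?nnegrE// ler_nat//.
split=> //.
- by apply: filterS e0 => k <-; rewrite /seq_h size_dspec.
- apply: filterS e1 => k ek; rewrite /seq_w sum_dspec /wpoly horner_sum.
  by apply: eq_bigr => j _; rewrite hornerZ ek.
- apply: filterS e2 => k ek; rewrite /seq_q sum2_dspec /q2poly horner_sum.
  apply: eq_bigr => i _; rewrite horner_sum; apply: eq_bigr => j _; by rewrite hornerZ ek.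
split.
- have := grow _ 0%N (evpoly_mom0 R dD); rewrite addn0; apply => k.
  by rewrite expr0 mul1r m0_ge lexx.
- apply: leq_trans (size_sum _ _ _) _; apply/bigmax_leqP => j _.
  apply: leq_trans (size_scale_leq _ _) _; 
  have := grow _ 1%N (evpoly_mom1 R j dD); rewrite addn1; apply => k; rewrite expr1; exact: mom1_le.
- apply: leq_trans (size_sum _ _ _) _; apply/bigmax_leqP => i _.
  apply: leq_trans (size_sum _ _ _) _; apply/bigmax_leqP => j _.
  apply: leq_trans (size_scale_leq _ _) _; 
  have := grow _ 2%N (evpoly_mom2 R i j dD); rewrite addn2; apply => k; exact: mom2_le.
Qed.

(** The polynomials are forced by the sequence of lists, so two downsets that give the same lists at
    [lam] give the same formulas there. *)
Lemma wpolyE n lam D h w q : has_polys n (dspec lam D) h w q -> downset D ->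
  [/\ h = hpoly D, w = wpoly lam D & q = q2poly lam D].
Proof.
move=> [sh sw sq _ _] dD; have e0 := evpoly_near (evpoly_mom0 R dD).
have e1 := near_forall_ord (fun j => evpoly_near (evpoly_mom1 R j dD)).
have e2 := near_forall_ord (fun i => near_forall_ord (fun j => evpoly_near (evpoly_mom2 R i j dD))).
split.
- by rewrite -(poly_ofE sh); apply: poly_ofE; apply: filterS e0 => k <-; rewrite /seq_h size_dspec.
- rewrite -(poly_ofE sw); apply: poly_ofE.
  apply: filterS e1 => k ek; rewrite /seq_w sum_dspec /wpoly horner_sum.
  by apply: eq_bigr => j _; rewrite hornerZ ek.
- rewrite -(poly_ofE sq); apply: poly_ofE.
  apply: filterS e2 => k ek; rewrite /seq_q sum2_dspec /q2poly horner_sum.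
  apply: eq_bigr => i _; rewrite horner_sum; apply: eq_bigr => j _; by rewrite hornerZ ek.
Qed.

End MomentPolynomials.

Lemma continuous_sum (R : realType) (T : topologicalType) p (F : 'I_p -> T -> R) (x : T) :
  (forall i, {for x, continuous (F i)}) -> {for x, continuous (fun y => \sum_i F i y)}.
Proof.
elim: p F => [|p IH] F hF.
  rewrite (_ : (fun y => _) = fun=> 0); first exact: cst_continuous.
  by apply/funext => y; rewrite big_ord0.
rewrite (_ : (fun y => _) = fun y => F ord0 y + \sum_i F (lift ord0 i) y); last first.
  by apply/funext => y; rewrite big_ord_recl.
by apply: continuousD => //; exact: IH.
Qed.

(* A function given by continuous formulas [G D] on finitely many pieces is
   continuous when it agrees at [x] with every formula whose piece adheres to
   [x]. *)
Lemma continuous_pieces (T U : topologicalType) (J : choiceType) (lab : T -> J) (G : J -> T -> U) (x : T) :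
  finite_set (range lab) -> (forall D, {for x, continuous (G D)}) ->
  (forall D, closure [set y | lab y = D] x -> G D x = G (lab x) x) ->
  {for x, continuous (fun y => G (lab y) y)}.
Proof.
move=> fin cG hG A hA.
suff : \forall y \near x, forall D, range lab D -> lab y = D -> A (G D y).
  by apply: filterS => y; apply => //; exists y.
have /finite_seqP[s ->] := fin.
have near_s : \forall y \near x, forall D, D \in s -> lab y = D -> A (G D y).
  elim: s => [|D s IH]; first by apply: nearW.
  have hD : \forall y \near x, lab y = D -> A (G D y).
    have [cl|ncl] := pselect (closure [set y | lab y = D] x).
      have AD : nbhs (G D x) A by rewrite hG.
      have h : nbhs x (G D @^-1` A) := cG D A AD.
      by apply: filterS h => y Ay _; exact: Ay.
    move: ncl => /existsNP[B /not_implyP[xB nB]]; apply: filterS xB => y By yD.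
    by case: nB; exists y.
  by apply: filterS2 hD IH => y h1 h2 D'; rewrite inE => /predU1P[->|/h2].
by apply: filterS near_s => y h D /h.
Qed.

(** * The Hilbert polynomial and nonvanishing of the norm *)

Section FlagNorm.
Context (R : realType) (K : closedFieldType) (N n : nat) (X : set 'rV[K]_N.+1).
Hypotheses (X_variety : variety X) (X_dim : has_dimension X n) (Xnorm : projectively_normal X).
Local Notation E := (X -> K^o).

(** The Hilbert polynomial of [X], computed with the standard monomials of the coordinates for the
    zero weight. *)
Definition hilb : {poly R} := hpoly R (stdw (@coordinate K N X) (fun=> 0 : R)).

Section Basis.
Context (r m : nat) (v : 'I_m -> E).
Hypotheses (r_gt0 : (0 < r)%N) (bv : rel_basis (H0 r) [set 0] v) (m_gt0 : (0 < m)%N).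
Hypothesis hilb0 : hilb`_n != 0.
Implicit Types lam : 'I_m -> R.

Lemma hpoly_basis lam : hpoly R (stdw v lam) = dilate_poly r%:R hilb.
Proof.
apply: poly_ofE; have h := cvg_dilate r_gt0 (evpoly_near (evpoly_mom0 R (@stdw_downset R K _ _ (@coordinate K N X) (fun=> 0)))).
near=> k.
rewrite horner_dilate_poly -natrM /hilb /hpoly.
have k0 : (0 < k)%N by near: k; exact: nbhs_infty_gt.
transitivity (mom0 R (stdw (@coordinate K N X) (fun=> 0 : R)) (r * k)); last by near: k.
rewrite -!(size_dspec (fun=> 0)) !size_map.
have [e be] := std_Rk_basis v lam k; have [e' be'] := std_Rk_basis (@coordinate K N X) (fun=> 0 : R) (r * k)%N.
move: be be'; rewrite (Rk_H0 Xnorm r_gt0 bv k0) (coord_H0 Xnorm) ?muln_gt0 ?r_gt0// => be be'.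
have := rel_basis_dim (subspace_H0 Xnorm _) (subspace_set0 _) be be'; rewrite !size_map => -> //.
by rewrite muln_gt0 r_gt0.
Unshelve. all: by end_near. Qed.

Lemma hpoly_neq0 lam : (hpoly R (stdw v lam))`_n != 0.
Proof. by rewrite hpoly_basis coef_dilate_poly mulf_neq0// expf_neq0// pnatr_eq0 -lt0n. Qed.

Lemma mom0_size lam k : mom0 R (stdw v lam) k = (size (spectrum v lam k))%:R.
Proof. by rewrite -(size_dspec lam). Qed.

Lemma mom0_growth : exists C, forall lam k, mom0 R (stdw v lam) k <= C * k.+1%:R ^+ n.
Proof.
have [C hC] := hilbert_upper Xnorm r_gt0 bv X_variety X_dim m_gt0.
exists C%:R => lam k; have [e be] := std_Rk_basis v lam k.
by rewrite mom0_size -natrX -natrM ler_nat; exact: hC be.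
Qed.

Lemma has_polys_spectrum lam : has_polys n (spectrum v lam) (hpoly R (stdw v lam))
  (wpoly lam (stdw v lam)) (q2poly lam (stdw v lam)).
Proof.
have [C hC] := mom0_growth.
exact: has_polys_dspec (@stdw_downset R K _ _ v lam) (hC lam) (hpoly_neq0 lam).
Qed.

(** The coefficient [a0] is the limit of [dim (Rk v q) / q ^ n], so it is positive and [a0 / 2] is
    an eventual lower bound; [C1] is an integer above [2 / a0]. *)
Lemma hilbert_lower : exists C1 k0, forall q B (e : 'I_B -> E), (k0 <= q)%N ->
  rel_basis (Rk v q) [set 0] e -> (q ^ n <= C1 * B)%N.
Proof.
pose lam : 'I_m -> R := fun=> 0.
have [sh _ _ [szh _ _] hn] := has_polys_spectrum lam; have ch := cvg_poly szh.
set a0 := _`_n in ch hn.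
have a0_gt0 : 0 < a0.
  rewrite lt0r hn /=; apply: (cvgr_to_ge ch); apply: filterS sh => k <-.
  by rewrite divr_ge0// ?exprn_ge0// ler0n.
have hge : \forall k \near \oo, a0 / 2 <= (hpoly R (stdw v lam)).[k%:R] / k%:R ^+ n.
  by apply: (cvgr_ge _ ch); rewrite ltr_pdivrMr// ltr_pMr// ltr1n.
have [k0 _ hk0] := filterI hge (filterI sh (nbhs_infty_gt 0)).
exists (Num.bound (2 / a0)), k0 => q B e kq be; have [h1 [h2 q0]] := hk0 q kq.
have [e' be'] := std_Rk_basis v lam q.
have BE := rel_basis_dim (subspace_Rk v q) (subspace_set0 _) be be'.
move: h1; rewrite /= -h2 /seq_h -BE => h1.
have qn : 0 < (q%:R : R) ^+ n by rewrite exprn_gt0// ltr0n.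
rewrite -(ler_nat R) natrX natrM; move: h1; rewrite ler_pdivlMr// => h1.
have : 2 / a0 < (Num.bound (2 / a0))%:R by apply: archi_boundP; rewrite divr_ge0// ltW.
rewrite ltr_pdivrMr// => h3.
have B0 : 0 <= (B%:R : R) by [].
move: (q%:R ^+ n : R) (B%:R : R) ((Num.bound (2 / a0))%:R : R) a0_gt0 h1 h3 qn B0 (ler0n R (Num.bound (2 / a0))) => Q b M.
by clear; move: a0 => a a0 h1 h3 Q0 b0 M0; nra.
Qed.

(** The variance is bounded below only along multiples of [k1], which suffices because the limit
    defining the norm exists. *)
Lemma norm_neq0 lam j1 : (forall j, lam j1 <= lam j) ->
  (forall j, exists e, multiples v (fun j => lam j == lam j1) e (v j ^+ e.+1)) \/
  seq_L2 n r (spectrum v lam) != 0.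
Proof.
move=> lmin; have [C1 [k0 hl]] := hilbert_lower.
have [[k1 [c [k10 c0 hc]]]|] := variance_or_nilpotent Xnorm r_gt0 bv X_variety hl lmin; [right|by left].
have hp := has_polys_spectrum lam; rewrite (has_polys_L2 r_gt0 hp).
have cv := has_polys_cvg (ltn0Sn 0) hp.
have cv1 := cvg_comp _ _ (cvg_dilate k10) cv.
set N2 := norm2 _ _ _ _ in cv1 *; rewrite expr1n divr1 in cv1.
have : c / k1%:R ^+ n.+2 <= N2.
  apply: (cvgr_to_ge cv1); near=> k => /=; rewrite muln1.
  have k0k : (0 < k)%N by near: k; exact: nbhs_infty_gt.
  have kk : ((k1 * k)%:R : R) ^+ n.+2 = k1%:R ^+ n.+2 * k%:R ^+ n.+2 by rewrite natrM exprMn.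
  have p1 : 0 < (k1%:R : R) ^+ n.+2 by rewrite exprn_gt0// ltr0n.
  have p2 : 0 < (k%:R : R) ^+ n.+2 by rewrite exprn_gt0// ltr0n.
  have hk : c * k%:R ^+ n.+2 <= seq_var (spectrum v lam) (k1 * k).
    by apply: hc; near: k; exact: nbhs_infty_ge.
  rewrite kk; move: (k1%:R ^+ n.+2 : R) (k%:R ^+ n.+2 : R) (seq_var _ _) p1 p2 hk => A B W p1 p2 hk.
  rewrite ler_pdivlMr ?mulr_gt0//; have -> : c / A * (A * B) = c * B by rewrite mulrA divfK// gt_eqF.
  exact: hk.
move=> hN; have N0 : 0 < N2 by apply: lt_le_trans hN; rewrite divr_gt0// exprn_gt0// ltr0n.
by rewrite gt_eqF// sqrtr_gt0 divr_gt0// exprn_gt0// ltr0n.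
Unshelve. all: by end_near. Qed.

End Basis.
End FlagNorm.

Section SeqPerm.
Context (R : realType).
Implicit Types s : nat -> seq R.

Lemma seq_perm s s' : (forall k, perm_eq (s k) (s' k)) ->
  [/\ seq_h s = seq_h s', seq_w s = seq_w s', seq_q s = seq_q s' & seq_var s = seq_var s'].
Proof.
move=> ss; have hE : seq_h s = seq_h s' by apply/funext => k; rewrite /seq_h (perm_size (ss k)).
have wE : seq_w s = seq_w s' by apply/funext => k; exact: perm_big.
split=> //; apply/funext => k; first exact: perm_big.
by rewrite /seq_var hE wE; exact: perm_big.
Qed.

Lemma seq_perm_values n r s s' : (forall k, perm_eq (s k) (s' k)) ->
  seq_L2 n r s = seq_L2 n r s' /\ seq_DF n r s = seq_DF n r s'.
Proof.
by move=> /seq_perm[hE wE _ vE]; rewrite /seq_DF /seq_L2 hE wE vE.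
Qed.

Lemma has_polys_perm n s s' h w q : (forall k, perm_eq (s k) (s' k)) ->
  has_polys n s h w q -> has_polys n s' h w q.
Proof. by move=> /seq_perm[hE wE qE _]; rewrite /has_polys hE wE qE. Qed.

End SeqPerm.

(** * Values at points of the buildings and their invariance *)

Section Points.
Context (R : realType) (K : closedFieldType) (N n : nat) (X : set 'rV[K]_N.+1).
Hypotheses (X_variety : variety X) (X_dim : has_dimension X n) (Xnorm : projectively_normal X).
Local Notation E := (X -> K^o).
Local Notation flag r := (wflag R (H0 (X := X) r)).

Lemma flag_basis r (f : flag r) : (0 < r)%N ->
  exists m (v : 'I_m -> E), [/\ rel_basis (H0 r) [set 0] v, adapted v f & (1 < m)%N].
Proof.
move=> r0; have [B [e be]] := H0_basis Xnorm r0.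
have [m [v [bv af]]] := adapted_basis f (subspace_H0 Xnorm r0) be.
by exists m, v; split=> //; exact: basis_size_gt1 bv af.
Qed.

(** A flag has at least two steps, hence there are two independent sections of [r L];
    [seq_transform] relies on the positivity. *)
Lemma dim_gt0 r (f : flag r) : (0 < r)%N -> (0 < n)%N.
Proof.
move=> r0; have [m [v [bv _ m1]]] := flag_basis f r0.
have ind := rel_basis_indep (subspace_H0 Xnorm r0) (subspace_set0 _) bv.
pose i0 := Ordinal (ltnW m1); pose i1 := Ordinal m1.
apply: (dimension_gt0 Xnorm X_variety X_dim r0 (bv.1 i0) (bv.1 i1)) => [c e|v0].
  have : (i0 == i0)%:R - c * (i0 == i1)%:R = 0 :> K.
    apply: (ind (fun i => (i == i0)%:R - c * (i == i1)%:R)); rewrite /=.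
    have d (a : K) i' : \sum_i (a * (i == i')%:R) *: v i = a *: v i'.
      by rewrite (bigD1 i')//= eqxx mulr1 big1 ?addr0// => i /negbTE ->; rewrite mulr0 scale0r.
    under eq_bigr do rewrite scalerBl -[X in X *: _]mul1r.
    by rewrite sumrB !d scale1r e subrr.
  by rewrite eqxx mulr0 subr0 => /eqP; rewrite oner_eq0.
by have := basis_neq0 Xnorm r0 bv i1; rewrite v0 eqxx.
Qed.

Section Rep.
Context (r m : nat) (f : flag r) (v : 'I_m -> E).
Hypotheses (r_gt0 : (0 < r)%N) (bv : rel_basis (H0 r) [set 0] v) (af : adapted v f).
Let lam j : R := weight_of f (v j).
Let m_gt0 : (0 < m)%N. Proof. exact: ltnW (basis_size_gt1 bv af). Qed.

Lemma rep_hilb0 F : integral_rep f F -> (hilb R X)`_n = 0 -> DF_normalized R n r F = 0.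
Proof.
move=> /(integral_data bv af)[a [b [w [a0 lw FE]]]] hn.
have [k0 ht] := trace_sum R m_gt0 FE.
have [_ ->] := trace_seq n r (ex_intro _ k0 ht).
rewrite /seq_DF (_ : poly_of _ = dilate_poly r%:R (hilb R X)).
  by rewrite !coef_dilate_poly hn mulr0 expr0n /= invr0 !mulr0.
rewrite -(hpoly_basis Xnorm r_gt0 bv lam); congr poly_of; apply/funext => k.
by rewrite mom0_size (spectrum_affine v k a0 lw) size_map /seq_h size_map.
Qed.

Hypothesis hilb0 : (hilb R X)`_n != 0.

Lemma rep_values F : integral_rep f F ->
  DF_normalized R n r F = - seq_DF n r (spectrum v lam).
Proof.
move=> /(integral_data bv af)[a [b [w [a0 lw FE]]]].
have [k0 ht] := trace_sum R m_gt0 FE; have [_ ->] := trace_seq n r (ex_intro _ k0 ht).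
have hp := has_polys_spectrum X_variety X_dim Xnorm r_gt0 bv m_gt0 hilb0 lam.
have a0' : a != 0 by rewrite gt_eqF.
have al0 : - a^-1 != 0 by rewrite oppr_eq0 invr_eq0.
(* The factor [- a^-1] undoes the scaling of the weights by [a] and turns weight [x] into the
   eigenvalue [- x]; the shift [b] leaves [b / a] per degree. *)
have [|_] := @seq_transform R n r _ (fun k => [seq - (x%:~R : R) | x <- spectrum v w k]) _ _ _ 1 (- a^-1) (b / a)
  (dim_gt0 f r_gt0) r_gt0 isT al0 hp.
  apply: nearW => k; rewrite mul1n (spectrum_affine v k a0 lw); move: (spectrum v w k) => s.
  rewrite -map_comp (_ : [seq - _ | x <- s] = map ((fun x => - a^-1 * x + b / a * k%:R) \o (fun x : int => a * x%:~R + b * k%:R)) s)//.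
  by apply: eq_map => x /=; field.
rewrite muln1 => ->; rewrite normrN ger0_norm ?invr_ge0 1?ltW//.
by rewrite mulNr divff ?invr_eq0// mulN1r.
Qed.

Lemma rep_norm_neq0 F : integral_rep f F -> ~ almost_trivial r F -> seq_L2 n r (spectrum v lam) != 0.
Proof.
move=> /(integral_data bv af)[a [b [w [a0 lw FE]]]] nt.
have [j1 _ lmin] : exists2 j1, true & forall j, lam j1 <= lam j.
  by case: (arg_minP lam (isT : xpredT (Ordinal m_gt0))) => j _ h; exists j => // i; exact: h.
have [nil|//] := norm_neq0 X_variety X_dim Xnorm r_gt0 bv m_gt0 hilb0 lmin.
case: nt; apply: (@nilpotent_almost_trivial K N X m r F v w j1 FE) => [j|x|k k0|j].
- by have := lmin j; rewrite /lam !lw lerD2r ler_pM2l// ler_int.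
- refine (basis_nonvanishing Xnorm r_gt0 bv x X_variety.1).
- by rewrite (Rk_H0 Xnorm r_gt0 bv).
have [e he] := nil j; exists e.
rewrite (_ : (fun j => w j == w j1) = (fun j => lam j == lam j1))//.
apply/funext => i; rewrite /lam !lw (inj_eq (addIr _)) (inj_eq (mulfI (lt0r_neq0 a0))) eqr_int//.
Qed.

End Rep.

(** Spectra of a flag, characterised by its induced filtrations so that no adapted basis is
    chosen. *)
Definition fspec r (f : flag r) (s : nat -> seq R) :=
  forall k, is_spec (fun x => sym_filt (filt f) k x) (s k).

Definition df_in r (O : set R) (f : flag r) :=
  exists s, [/\ fspec f s, seq_L2 n r s != 0 & O (- seq_DF n r s)].

Lemma fspec_adapted r (f : flag r) m (v : 'I_m -> E) : rel_basis (H0 r) [set 0] v -> adapted v f ->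
  fspec f (spectrum v (fun j => weight_of f (v j))).
Proof.
move=> bv af k x; rewrite (sym_filt_flag bv af); exact: spectrumP.
Qed.

Lemma df_inE r O (f : flag r) s : (0 < r)%N -> fspec f s ->
  df_in O f <-> seq_L2 n r s != 0 /\ O (- seq_DF n r s).
Proof.
move=> r0 hs; split=> [[s' [hs' L0 OD]]|[L0 OD]]; last by exists s.
have [m [v [bv af _]]] := flag_basis f r0.
have [|<- <-] := @seq_perm_values R n r s' s; last by [].
move=> k; apply: (@spec_perm _ _ _ (fun x => sym_filt (filt f) k x)) => //.
by move=> x; rewrite (sym_filt_flag bv af); exact: subspace_Sk.
Qed.

Hypothesis hilb0 : (hilb R X)`_n != 0.

Lemma df_in_transform r k0 r' O (f : flag r) (g : flag r') (al be : R) : (0 < r)%N -> (0 < k0)%N ->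
  r' = (r * k0)%N -> 0 < al ->
  (forall k x, sym_filt (filt g) k x = sym_filt (filt f) (k0 * k) ((x - be * k%:R) / al)) ->
  df_in O f <-> df_in O g.
Proof.
move=> r0 k00 rr al0 fg; have [m [v [bv af m1]]] := flag_basis f r0.
pose s := spectrum v (fun j => weight_of f (v j)).
pose s2 k := [seq al * x + be * k%:R | x <- s (k0 * k)%N].
have fs : fspec f s := fspec_adapted bv af.
have gs : fspec g s2.
  move=> k x; rewrite fg; have := fs (k0 * k)%N ((x - be * k%:R) / al).
  rewrite (_ : count _ (s2 k) = count (fun y => y <= (x - be * k%:R) / al) (s (k0 * k)%N)); first by [].
  by rewrite /s2; move: (s _) => t; rewrite count_map; apply: eq_count => y /=; rewrite ler_pdivlMr// lerBrDr mulrC.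
have r0' : (0 < r')%N by rewrite rr muln_gt0 r0.
rewrite (df_inE O r0 fs) (df_inE O r0' gs) rr.
have hp := has_polys_spectrum X_variety X_dim Xnorm r0 bv (ltnW m1) hilb0 (fun j => weight_of f (v j)).
have [|-> ->] := @seq_transform R n r s s2 _ _ _ k0 al be (dim_gt0 f r0) r0 k00 (lt0r_neq0 al0) hp.
  exact: nearW.
have e1 : al / al = 1 by apply: divff; exact: lt0r_neq0.
rewrite gtr0_norm// e1 mul1r mulf_eq0 (gt_eqF al0) /=; exact: iff_refl.
Qed.

Lemma df_in_equiv r O (f g : flag r) : (0 < r)%N -> wflag_equiv f g -> df_in O f <-> df_in O g.
Proof.
move=> r0 /asboolP[sfg [c c0 wg]].
have [m [v [bv af m1]]] := flag_basis f r0.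
have ag : adapted v g by rewrite /adapted -sfg.
have gw j : weight_of g (v j) = c * weight_of f (v j).
  rewrite /weight_of -sfg wg (nth_map 0)//.
  have [[-> _] _ _ _ _] := wflagP f; rewrite -has_find.
  apply/(has_nthP set0); exists (size (steps f)).-1.
    by rewrite prednK// (ltn_trans _ (steps_size f)).
  by apply/asboolP; rewrite steps_last; exact: bv.1.
apply: (@df_in_transform r 1 r O f g c 0) => //; first by rewrite muln1.
move=> k x; rewrite (sym_filt_flag bv ag) (sym_filt_flag bv af) mul1n mul0r subr0 /Sk.

have wc b : wdeg (fun j => weight_of g (v j)) b = wdeg (fun j => weight_of f (v j)) b * c.
  by rewrite /wdeg mulr_suml; apply: eq_bigr => i _; rewrite gw -mulrnAr mulrC.
congr lspan; apply/seteqP; split=> _ [b [bk bx ->]]; exists b; split=> //; move: bx; by rewrite ler_pdivlMr// wc.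
Qed.

(** What [g] induces in degree [k] is what [f] induces in degree [k0 * k], shifted by [c] once for
    each of the [k] factors. *)
Lemma df_in_iota r r' k0 c O (f : flag r) (g : flag r') : (0 < r)%N -> (0 < k0)%N -> r' = (r * k0)%N ->
  (forall z, filt g z = sym_filt (filt f) k0 (z + c)) -> df_in O f <-> df_in O g.
Proof.
move=> r0 k00 rr hg; have [m [v [bv af m1]]] := flag_basis f r0.
apply: (@df_in_transform r k0 r' O f g 1 (- c)) => // k x.
pose lam j : R := weight_of f (v j).
have gE z : filt g z = Sk v lam k0 (z + c) by rewrite hg (sym_filt_flag bv af).
rewrite (sym_filt_flag bv af) divr1 mulNr opprK; apply/seteqP; split.
  apply: lspan_sub; first exact: subspace_Sk.
  move=> _ [u [y [hu hy ->]]].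
  have := @Sk_prodn K _ m v R lam k0 k u (fun i => y i + c) (fun i => eq_ind _ (fun S : set E => S (u i)) (hu i) _ (gE (y i))).
  by apply: Sk_le; rewrite big_split sumr_const card_ord /= lerD// mulr_natr.
apply: lspan_mono => _ [b [bk bx ->]]; have [bs [h1 h2 h3]] := mon_split v lam bk.
exists (fun i => mon v (bs i)), (fun i => wdeg lam (bs i) - c); split=> // [i|].
  by rewrite gE subrK -(h1 i); exact: Sk_mon.
by rewrite sumrB sumr_const card_ord -h3 lerBlDr -mulr_natr.
Qed.

End Points.

(** * Continuity *)

Section BuildingClasses.
Context (R : realType) (K : fieldType) (E : lmodType K) (V : set E).
Implicit Types f g : wflag R V.

Lemma bclass_eqP f g : bclass f = bclass g -> wflag_equiv f g.
Proof. by move=> /eqmodP. Qed.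

Lemma repr_bclass f : wflag_equiv (repr (bclass f)) f.
Proof. by apply: bclass_eqP; rewrite /bclass reprK. Qed.

Lemma rational_denominator (s : seq R) : (forall x, x \in s -> exists q : rat, x = ratr q) ->
  exists2 d : int, 0 < d & forall x, x \in s -> exists z : int, x * d%:~R = z%:~R.
Proof.
elim: s => [|x s IH] hs; first by exists 1.
have [q xq] := hs x (mem_head _ _).
have [|d d0 hd] := IH; first by move=> y ys; apply: hs; rewrite inE ys orbT.
exists (denq q * d) => [|y]; first by rewrite mulr_gt0.
rewrite inE => /predU1P[->|/hd[z hz]].
  exists (numq q * d); rewrite xq /ratr !intrM mulrA divfK//.
  by rewrite intr_eq0 denq_eq0.
by exists (denq q * z); rewrite !intrM mulrCA hz.
Qed.

(** The scale [c0 / d] combines a common denominator [d] of the rational weights with the factor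
    [c0] leading to the chosen representative. *)
Lemma integral_rep_exists (c : building R V) : rational_points c -> exists F, integral_rep (repr c) F.
Proof.
move=> [f0 cE rat0]; have : wflag_equiv f0 (repr c) by apply: bclass_eqP; rewrite -cE /bclass reprK.
move=> /asboolP[_ [c0 c00 wE]]; have [d d0 hd] := rational_denominator rat0.
have dR : 0 < d%:~R :> R by rewrite ltr0z.
exists (fun i => filt (repr c) (c0 / d%:~R * i%:~R + 0)), (c0 / d%:~R), 0; split=> [|y|//].
  by rewrite divr_gt0.
rewrite wE => /mapP[x /hd[z hz] ->]; exists z; rewrite -hz addr0; field.
by rewrite gt_eqF.
Qed.

End BuildingClasses.

Section Continuity.
Context (R : realType) (K : closedFieldType) (N n : nat) (X : set 'rV[K]_N.+1).
Hypotheses (X_variety : variety X) (X_dim : has_dimension X n) (Xnorm : projectively_normal X).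
Hypothesis hilb0 : (hilb R X)`_n != 0.
Local Notation E := (X -> K^o).

Section Apartment.
Context (r m : nat) (v : 'I_m -> E).
Hypotheses (r_gt0 : (0 < r)%N) (bv : rel_basis (H0 r) [set 0] v) (m_gt0 : (0 < m)%N).
Local Notation entries := (fun (y : 'rV[R]_m) (j : 'I_m) => y ord0 j).

Lemma coef_wpoly_continuous D i (x : 'rV[R]_m) :
  {for x, continuous (fun y => (wpoly (entries y) D)`_i)}.
Proof.
rewrite (_ : (fun y => _) = fun y : 'rV[R]_m => \sum_j y ord0 j * (poly_of (mom1 R D j))`_i); last first.
  by apply/funext => y; rewrite /wpoly coef_sum; apply: eq_bigr => j _; rewrite coefZ.
by apply: continuous_sum => j; apply: continuousM; [exact: coord_continuous|exact: cst_continuous].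
Qed.

Lemma coef_q2poly_continuous D i (x : 'rV[R]_m) :
  {for x, continuous (fun y => (q2poly (entries y) D)`_i)}.
Proof.
rewrite (_ : (fun y => _) = fun y : 'rV[R]_m =>
    \sum_j \sum_l (y ord0 j * y ord0 l) * (poly_of (mom2 R D j l))`_i); last first.
  apply/funext => y; rewrite /q2poly coef_sum; apply: eq_bigr => j _.
  by rewrite coef_sum; apply: eq_bigr => l _; rewrite coefZ.
apply: continuous_sum => j; apply: continuous_sum => l.
apply: continuousM; last exact: cst_continuous.
by apply: continuousM; exact: coord_continuous.
Qed.

Lemma continuous_apartment (U : topologicalType) (Phi : {poly R} -> {poly R} -> {poly R} -> U) (x : 'rV[R]_m) :
  (forall D, {for x, continuous (fun y => Phi (hpoly R D) (wpoly (entries y) D) (q2poly (entries y) D))}) ->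
  {for x, continuous (fun y => Phi (hpoly R (stdw v (entries y)))
    (wpoly (entries y) (stdw v (entries y))) (q2poly (entries y) (stdw v (entries y))))}.
Proof.
move=> cP; apply: (@continuous_pieces _ _ _ (fun y => stdw v (entries y))
  (fun D y => Phi (hpoly R D) (wpoly (entries y) D) (q2poly (entries y) D))) => [|//|D cl].
  by apply: sub_finite_set (@finite_stdw R _ _ _ v) => _ [y _ <-]; exists (entries y).
have near_x e : 0 < e -> exists lam, (forall j, `|lam j - x ord0 j| < e) /\ stdw v lam = D.
  move=> e0; have [y [yD [_ yb]]] := cl _ (nbhsx_ballx x e e0).
  exists (entries y); split=> // j.
  by have := yb ord0 j; rewrite -ball_normE /= distrC.
have dD : downset D.
  by have [lam [_ <-]] := near_x 1 ltr01; exact: (@stdw_downset R K _ _ v lam).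
have hp := has_polys_spectrum X_variety X_dim Xnorm r_gt0 bv m_gt0 hilb0 (entries x).
have hp' : has_polys n (dspec (entries x) D) (hpoly R (stdw v (entries x)))
    (wpoly (entries x) (stdw v (entries x))) (q2poly (entries x) (stdw v (entries x))).
  by apply: has_polys_perm hp => k; rewrite perm_sym; exact: (spectrum_perm near_x).
by have [-> -> ->] := wpolyE hp' dD.
Qed.

Lemma seq_L2_continuous (x : 'rV[R]_m) : {for x, continuous (fun y => seq_L2 n r (spectrum v (entries y)))}.
Proof.
have hp lam := has_polys_spectrum X_variety X_dim Xnorm r_gt0 bv m_gt0 hilb0 lam.
have -> : (fun y => seq_L2 n r (spectrum v (entries y))) = (fun y => Num.sqrt
  (norm2 n (hpoly R (stdw v (entries y))) (wpoly (entries y) (stdw v (entries y)))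
   (q2poly (entries y) (stdw v (entries y))) / r%:R ^+ n.+2)).
  by apply/funext => y; exact: has_polys_L2 (hp (entries y)).
apply: (@continuous_apartment _ (fun h w q => Num.sqrt (norm2 n h w q / r%:R ^+ n.+2))) => D.
apply: (@continuous_comp _ _ _ (fun y => norm2 n (hpoly R D) (wpoly (entries y) D) (q2poly (entries y) D) / r%:R ^+ n.+2) Num.sqrt);
  last exact: sqrt_continuous.
rewrite /norm2; apply: continuousM; last exact: cst_continuous.
apply: continuousB; first exact: coef_q2poly_continuous.
apply: continuousM; last exact: cst_continuous.
apply: (@continuous_comp _ _ _ (fun y => (wpoly (entries y) D)`_n.+1) (fun z => z ^+ 2));
  [exact: coef_wpoly_continuous|exact: exprn_continuous].
Qed.

Lemma seq_DF_continuous (x : 'rV[R]_m) : seq_L2 n r (spectrum v (entries x)) != 0 ->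
  {for x, continuous (fun y => seq_DF n r (spectrum v (entries y)))}.
Proof.
move=> L0; have hp lam := has_polys_spectrum X_variety X_dim Xnorm r_gt0 bv m_gt0 hilb0 lam.
have -> : (fun y => seq_DF n r (spectrum v (entries y))) = (fun y => (seq_L2 n r (spectrum v (entries y)))^-1 *
    dfnum n (hpoly R (stdw v (entries y))) (wpoly (entries y) (stdw v (entries y)))).
  by apply/funext => y; exact: has_polys_DF (hp (entries y)).
apply: continuousM; first by apply: continuousV => //; exact: seq_L2_continuous.
apply: (@continuous_apartment _ (fun h w _ => dfnum n h w)) => D; rewrite /dfnum.
apply: continuousM; last exact: cst_continuous.
apply: continuousB; (apply: continuousM; [exact: cst_continuous|exact: coef_wpoly_continuous]).
Qed.

Lemma open_apartment (O : set R) : open O -> open [set y : 'rV[R]_m |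
  seq_L2 n r (spectrum v (entries y)) != 0 /\ O (- seq_DF n r (spectrum v (entries y)))].
Proof.
move=> oO; rewrite openE => y [L0 Oy]; rewrite /interior.
have L0' : nbhs (seq_L2 n r (spectrum v (entries y))) [set t | t != 0].
  by apply: open_nbhs_nbhs; split=> //; exact: open_neq.
have h1 : nbhs y ((fun z => seq_L2 n r (spectrum v (entries z))) @^-1` [set t | t != 0]).
  exact: (seq_L2_continuous (x := y) L0').
have cN : {for y, continuous (fun z => - seq_DF n r (spectrum v (entries z)))}.
  by apply: continuousN; exact: seq_DF_continuous.
have AO : nbhs (- seq_DF n r (spectrum v (entries y))) O by apply: open_nbhs_nbhs.
have h2 : nbhs y ((fun z => - seq_DF n r (spectrum v (entries z))) @^-1` O) := cN O AO.
by apply: filterS2 h1 h2.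
Qed.

End Apartment.

Lemma df_in_bclass r O (f : wflag R (H0 (X := X) r)) : (0 < r)%N ->
  df_in n O (repr (bclass f)) <-> df_in n O f.
Proof. by move=> r0; apply: df_in_equiv => //; exact: repr_bclass. Qed.

Lemma df_in_open r O : (0 < r)%N -> open O ->
  simplicial_open (fun cl : building R (H0 (X := X) r) => df_in n O (repr cl)).
Proof.
move=> r0 oO m v bv; have [m0|m0] := ltnP 0 m; last first.
  exists set0 => [|f af]; first exact: open0.
  by have := basis_size_gt1 bv af; rewrite ltnNge (leq_trans m0).
exists [set y : 'rV[R]_m | seq_L2 n r (spectrum v (fun j => y ord0 j)) != 0 /\
   O (- seq_DF n r (spectrum v (fun j => y ord0 j)))]; first exact: open_apartment.
move=> f af; have e1 := df_in_bclass O f r0.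
have e2 : df_in n O f <-> _ := df_inE n Xnorm O r0 (fspec_adapted bv af).
rewrite /= (_ : (fun j => (\row_j0 weight_of f (v j0)) ord0 j) = fun j => weight_of f (v j)).
  by split=> [/e1/e2|/e2/e1].
by apply/funext => j; rewrite mxE.
Qed.

Definition sum_df_in (O : set R) (y : Delta_sum R X) : Prop := df_in n O (repr (val (projT2 y))).

Lemma sum_df_in_iota O x y : iota_graph x y -> sum_df_in O x <-> sum_df_in O y.
Proof.
move=> [k [k0 yk [f [g [c [fx gy h]]]]]]; rewrite /sum_df_in -fx -gy.
have e1 := df_in_bclass O f (valP (projT1 x)); have e2 := df_in_bclass O g (valP (projT1 y)).
have e3 : df_in n O f <-> df_in n O g.
  by apply: (@df_in_iota _ _ _ _ _ _ _ _ _ _ _ k c) => //; exact: valP.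
by split=> [/e1/e3/e2|/e2/e3/e1].
Qed.

Lemma sum_df_in_equiv O x y : Delta_equiv x y -> sum_df_in O x <-> sum_df_in O y.
Proof.
move=> /asboolP; elim=> [a b|//|a b _ h|a b c _ h1 _ h2]; first exact: sum_df_in_iota.
  by split=> /h.
by split=> [/h1/h2|/h2/h1].
Qed.

Lemma sum_df_in_open O : open O -> open [set y | sum_df_in O y].
Proof.
move=> oO; apply/sigT_openP => r.
have oU : open (fun cl : building R (H0 (X := X) (val r)) => df_in n O (repr cl)).
  exact: (df_in_open (valP r) oO).
have c : continuous (set_val : rbuilding R (H0 (X := X) (val r)) -> building R (H0 (X := X) (val r))).
  exact: initial_continuous.
exact: (open_comp (fun y _ => c y) oU).
Qed.

(** An open set of the whole limit when [O] is open: [df] maps it into [O], and it contains every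
    point of value in [O] that is not almost trivial. *)
Definition infty_df_in O : set (Delta_infty R X) :=
  [set x | sum_df_in O (repr (x : {eq_quot @Delta_equiv R K N X}))].

Lemma infty_df_in_open O : open O -> open (infty_df_in O).
Proof.
move=> oO; rewrite /open /= /quotient_open.
rewrite (_ : _ @^-1` _ = [set y | sum_df_in O y]); first exact: sum_df_in_open.
apply/seteqP; split=> y; rewrite /infty_df_in /=.
  by apply: (sum_df_in_equiv O _).1; apply/eqmodP; rewrite reprK.
by apply: (sum_df_in_equiv O _).2; apply/eqmodP; rewrite reprK.
Qed.

Lemma tc_integral_rep (x : Delta_infty R X) :
  integral_rep (repr (val (projT2 (repr (x : {eq_quot @Delta_equiv R K N X}))))) (tc_filtration x).
Proof.
apply: (@xgetPex _ (fun=> set0) (integral_rep _)); apply: integral_rep_exists.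
exact: set_valP.
Qed.

Lemma infty_df_in_df O x : infty_df_in O x -> O (df R X n x).
Proof.
set y : Delta_sum R X := repr (x : {eq_quot @Delta_equiv R K N X}).
have r0 : (0 < tc_exponent x)%N := valP (projT1 y).
have [m [v [bv af m1]]] := flag_basis Xnorm (repr (val (projT2 y))) r0.
move=> h; rewrite /df (rep_values X_variety X_dim Xnorm r0 bv af hilb0 (tc_integral_rep x)).
by have [] := (df_inE n Xnorm O r0 (fspec_adapted bv af)).1 h.
Qed.

Lemma df_infty_df_in O x : non_almost_trivial R X x -> O (df R X n x) -> infty_df_in O x.
Proof.
set y : Delta_sum R X := repr (x : {eq_quot @Delta_equiv R K N X}).
have r0 : (0 < tc_exponent x)%N := valP (projT1 y).
have [m [v [bv af m1]]] := flag_basis Xnorm (repr (val (projT2 y))) r0.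
rewrite /df (rep_values X_variety X_dim Xnorm r0 bv af hilb0 (tc_integral_rep x)) => nt h.
apply: (df_inE n Xnorm O r0 (fspec_adapted bv af)).2; split=> //.
exact: (rep_norm_neq0 X_variety X_dim Xnorm r0 bv af hilb0 (tc_integral_rep x) nt).
Qed.

End Continuity.

Theorem theorem1p1 (R : realType) (K : closedFieldType)
    (charK : [pchar K] =i pred0)
    (N n : nat) (X : set 'rV[K]_N.+1)
    (X_variety : variety X) (X_dim : has_dimension X n)
    (X_normal : normal_variety X) (L_projnormal : projectively_normal X) :
  {within non_almost_trivial R X, continuous (df R X n)}.
Proof.
have [h0|h0] := eqVneq (hilb R X)`_n 0.
  have -> : df R X n = fun=> 0.
    apply/funext => x; set y : Delta_sum R X := repr (x : {eq_quot @Delta_equiv R K N X}).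
    have r0 : (0 < tc_exponent x)%N := valP (projT1 y).
    have [m [v [bv af m1]]] := flag_basis L_projnormal (repr (val (projT2 y))) r0.
    exact: (rep_hilb0 L_projnormal r0 bv af (tc_integral_rep x) h0).
  by move=> x; exact: cst_continuous.
apply: continuous_in_subspaceT => x /set_mem xT O'; rewrite nbhsE; case=> O [oO Ox] OO'.
apply: (@filterS _ _ _ (infty_df_in n O)).
  by move=> y /(infty_df_in_df X_variety X_dim L_projnormal h0); exact: OO'.
apply: open_nbhs_nbhs; split; first exact: infty_df_in_open.
exact: df_infty_df_in.
Qed.
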